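(* As $\ell\to\infty$ through the positive integers, $\mathrm{Det}\,\Delta_{H_3/\Gamma_\ell}\to 0$.
   Context: Zeta-regularized determinant: for a closed (connected) Riemannian manifold $\mathbf{M}$ of dimension $n$ with nonnegative Laplacian $\Delta_{\mathbf{M}}$ on functions, the spectral zeta-function is $\zeta_{\mathbf{M}}(s)=\sum_{\lambda\ne 0} m_\lambda\lambda^{-s}$ (sum over distinct non-zero eigenvalues, $m_\lambda$ = multiplicity), convergent for $\mathrm{Re}(s)>n/2$; it continues meromorphically to $\mathbb{C}$ and is holomorphic at $s=0$. Set $\mathrm{Det}\,\Delta_{\mathbf{M}}=e^{-\zeta_{\mathbf{M}}'(0)}$. Three-dimensional Heisenberg manifold: $H_3$ is the Lie group of matrices $\begin{pmatrix}1&x&z\\0&1&y\\0&0&1\end{pmatrix}$, $x,y,z\in\mathbb{R}$, with the left invariant Riemannian metric for which $X_1=\begin{pmatrix}0&1&0\\0&0&0\\0&0&0\end{pmatrix}$, $Y_1=\begin{pmatrix}0&0&0\\0&0&1\\0&0&0\end{pmatrix}$, $Z=\begin{pmatrix}0&0&1\\0&0&0\\0&0&0\end{pmatrix}$ is an orthonormal basis of the Lie algebra. For a positive integer $\ell$, $\Gamma_\ell=\left\{\begin{pmatrix}1&m&k/(2\ell)\\0&1&n\\0&0&1\end{pmatrix}: m,n,k\in\mathbb{Z}\right\}$, and $H_3/\Gamma_\ell$ denotes the quotient of $H_3$ by the action of $\Gamma_\ell$ by left translations, with the induced metric. *)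

(* Defs.v *)
From HB Require Import structures.
From mathcomp Require Import all_boot all_order all_algebra finmap complex.
From mathcomp Require Import all_classical all_reals all_analysis.
From mathcomp Require Import summability.

Set Implicit Arguments.
Unset Strict Implicit.
Unset Printing Implicit Defensive.

Import Order.TTheory GRing.Theory Num.Theory.
Import numFieldNormedType.Exports.

Local Open Scope classical_set_scope.
Local Open Scope ring_scope.
Local Open Scope complex_scope.

(* R[i] with its usual topology, as a normed space over itself. *)
#[non_forgetful_inheritance]
HB.instance Definition _ (R : realType) := NormedModule.copy R[i] R[i]^o.

Section ComplexAnalysis.
Variable R : realType.
Implicit Types (f g : R[i] -> R[i]) (a s : R[i]).

Definition cexp s : R[i] :=
  let: x +i* y := s in (expR x * cos y) +i* (expR x * sin y).

(* x ^ s for a positive real x *)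
Definition cpow (x : R) s : R[i] := cexp (s * (ln x)%:C).

Definition holomorphic_at f a := \forall z \near a, derivable f z 1.

Definition meromorphic_at f a := exists (k : nat) (g : R[i] -> R[i]),
  holomorphic_at g a /\ \forall z \near a^', (z - a) ^+ k * f z = g z.

(* unconditional (equivalently, absolute) convergence: the limit is taken along
   the finite subsets of the index type, directed by inclusion *)
Definition has_sum (I : choiceType) (D : set I) (F : I -> R[i]) (S : R[i]) :=
  partial_sum (fun i => if i \in D then F i else 0) @ totally --> S.

End ComplexAnalysis.

Section ZetaDeterminant.
Variables (R : realType) (V : lmodType R).

Definition has_dim (E : set V) (m : nat) := exists b : 'I_m -> V,
  (forall c : 'I_m -> R, \sum_i c i *: b i = 0 -> forall i, c i = 0) /\
  E = [set v | exists c : 'I_m -> R, v = \sum_i c i *: b i].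

Definition dim (E : set V) : nat := xget 0%N [set m | has_dim E m].

(* In what follows an operator is given by its eigenspaces:
   [eig lambda] is the set of solutions v of [Delta v = lambda v]. *)
Variable eig : R -> set V.

Definition eigenvalues : set R :=
  [set lambda | exists2 v, eig lambda v & v <> 0].

(* [Z] is the meromorphic continuation to the complex plane of the spectral
   zeta-function, on a manifold of dimension [n]; it is only determined up to
   its values at isolated points, among which 0 does not occur. *)
Definition spectral_zeta (n : nat) (Z : R[i] -> R[i]) :=
  [/\ forall s : R[i], n%:R / 2 < complex.Re s ->
        has_sum [set lambda | eigenvalues lambda /\ lambda <> 0]
          (fun lambda => (dim (eig lambda))%:R * cpow lambda (- s)) (Z s),
      forall a, meromorphic_at Z a
    & holomorphic_at Z 0].

(* The value 1 is a placeholder for the case (excluded for a closed Riemannian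
   manifold) in which the zeta-function has no such continuation. *)
Definition zeta_det (n : nat) : R[i] :=
  xget 1 [set d | exists2 Z, spectral_zeta n Z & d = cexp (- derive1 Z 0)].

End ZetaDeterminant.

Section Euclidean.
Variables (R : realType) (n : nat).
Implicit Types f : 'rV[R]_n.+1 -> R.

Definition partial (i : 'I_n.+1) f : 'rV[R]_n.+1 -> R :=
  fun p => 'D_(delta_mx 0 i) f p.

Definition smooth f := forall (s : seq 'I_n.+1) p,
  {for p, continuous (foldr partial f s)} /\
  forall i, derivable (foldr partial f s) p (delta_mx 0 i).

(* The nonnegative Laplace-Beltrami operator, in a global chart, of the
   Riemannian metric with Gram matrix [g] in the coordinate frame. *)
Definition laplacian (g : 'rV[R]_n.+1 -> 'M[R]_n.+1) f : 'rV[R]_n.+1 -> R :=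
  let vol q := Num.sqrt (\det (g q)) in
  fun p => - (vol p)^-1 *
    \sum_i partial i
      (fun q => vol q * \sum_j invmx (g q) i j * partial j f q) p.

End Euclidean.

Section Heisenberg.
Variable R : realType.

Definition mx3 (s : seq (seq R)) : 'M[R]_3 :=
  \matrix_(i < 3, j < 3) (nth [::] s i)`_j.

Definition heis (x y z : R) : 'M[R]_3 :=
  mx3 [:: [:: 1; x; z];
          [:: 0; 1; y];
          [:: 0; 0; 1]].

(* the global chart (x, y, z) of H_3, as a map from row vectors *)
Definition heis_pt (p : 'rV[R]_3) : 'M[R]_3 := heis (p 0 0) (p 0 1) (p 0 2).

(* the coordinates in this chart of a tangent vector, given as a matrix *)
Definition tangent_coord (A : 'M[R]_3) : 'rV[R]_3 :=
  \row_j [:: A 0 1; A 1 2; A 0 2]`_j.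

Definition X1 : 'M[R]_3 := mx3 [:: [:: 0; 1; 0]; [:: 0; 0; 0]; [:: 0; 0; 0]].
Definition Y1 : 'M[R]_3 := mx3 [:: [:: 0; 0; 0]; [:: 0; 0; 1]; [:: 0; 0; 0]].
Definition Z1 : 'M[R]_3 := mx3 [:: [:: 0; 0; 1]; [:: 0; 0; 0]; [:: 0; 0; 0]].

(* Row i holds the coordinates at p of the left invariant vector field
   extending the i-th of X1, Y1, Z1: its value at the matrix A is A *m X1, etc. *)
Definition heis_frame (p : 'rV[R]_3) : 'M[R]_3 :=
  \matrix_(i < 3) tangent_coord (heis_pt p *m nth 0 [:: X1; Y1; Z1] i).

(* The metric g for which that frame F is orthonormal, F *m g *m F^T = 1. *)
Definition heis_metric (p : 'rV[R]_3) : 'M[R]_3 :=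
  invmx (heis_frame p) *m (invmx (heis_frame p))^T.

Definition heis_lattice (l : nat) : set 'M[R]_3 :=
  [set A | exists m n k : int, A = heis m%:~R n%:~R (k%:~R / (2 * l%:R))].

(* Functions on the quotient are functions on H_3 that are invariant under left
   translations by the lattice; smoothness and the Laplacian are local, hence
   computed on H_3. Functions are real-valued: the Laplacian is a real operator
   with real eigenvalues, so multiplicities over the reals and over the complex
   numbers agree. *)
Definition heis_eigenspace (l : nat) (lambda : R) : set ('rV[R]_3 -> R) :=
  [set f | [/\ smooth f,
      forall A p q, heis_lattice l A -> heis_pt q = A *m heis_pt p -> f q = f p
    & forall p, laplacian heis_metric f p = lambda * f p]].

Definition heis_det (l : nat) : R[i] := zeta_det (heis_eigenspace l) 3.

End Heisenberg.

(* Main.v *)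
(** Fourier analysis in the central variable splits the spectrum of the manifold
    in two.  The functions independent of [z] live on a flat torus and have the
    eigenvalues [4 pi^2 (m^2 + n^2)], whatever [l] is.  The central frequency
    [k <> 0] reduces the Laplacian to harmonic oscillators: with [c = 2 pi l] the
    eigenvalue [4 c |k| (c |k| + j + 1/2)], [j >= 0], occurs for each of [2 l |k|]
    theta functions.  Hence
    [zeta_l(s) = T(s) + 4 l sum_(k >= 1, j >= 0) k (4 c k (c k + j + 1/2))^(-s)],
    where [T] does not depend on [l].  A midpoint Euler-Maclaurin summation over [j]
    turns the double sum into multiples of [c^(1 - 2 s - r) zeta_Riemann(2 s + r - 2)]
    and a small remainder.  As [zeta_Riemann(-2) = 0], the derivative of the double sum
    at [s = 0] is [- 2 c zeta_Riemann'(-2) + O(1/c)], where [zeta_Riemann'(-2) < 0]: so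
    [zeta_l'(0)] grows like a positive multiple of [l^2], and [Det = exp(- zeta_l'(0))]
    tends to [0]. *)

Require Import Defs.
From mathcomp Require Import all_boot all_order all_algebra finmap complex.
From mathcomp Require Import all_classical all_reals all_analysis.
From mathcomp Require Import summability ring lra zify.

Set Implicit Arguments.
Unset Strict Implicit.
Unset Printing Implicit Defensive.

Import Order.TTheory GRing.Theory Num.Theory.
Import numFieldNormedType.Exports.

Local Open Scope classical_set_scope.
Local Open Scope ring_scope.

(** * Unconditional sums *)

(** The determinant is defined by choosing a continuation, so its value is known only once any two
    continuations are shown to have the same derivative at 0. This is the purpose of the identity
    theorem for meromorphic functions, derived from Goursat's theorem and from the uniqueness of
    Fourier coefficients in an exponential coordinate. Riemann's zeta function and [T] are continued
    by Euler's transformation of alternating series: order [N] reaches a half-plane that grows with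
    [N], and the half-planes are glued. The same transformation at order 4 yields the two facts used
    at -2, the sign of the derivative coming down to [3^9 < 2^16]. Completeness of the list of
    eigenvalues rests on the lattice: a Fourier coefficient of an eigenfunction in [(y, z)] is a
    function of [x] that solves the oscillator equation, and invariance makes it bounded, hence a
    multiple of a Hermite function. Multiplicities are counted by functionals biorthogonal to the
    explicit eigenfunctions within each eigenspace. *)

Section UnconditionalSums.
Variable R : realType.

Definition summ (I : choiceType) (F : I -> R) :=
  exists M, forall A : {fset I}, \sum_(i <- A) `|F i| <= M.

Definition is_sum (I : choiceType) (F : I -> R) (S : R) :=
  forall e, 0 < e -> exists A : {fset I}, forall B : {fset I}, (A `<=` B)%fset ->
    `|\sum_(i <- B) F i - S| <= e.

(** Index types are arbitrary, so that integers, pairs and the spectrum itself are summed over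
    directly. The value 0 is the default for a family without a sum. *)
Definition rsum (I : choiceType) (F : I -> R) : R := xget 0 [set S | is_sum F S].

Section OneIndex.
Variable I : choiceType.
Implicit Types (F G : I -> R) (A B : {fset I}).

Lemma is_sum_unique F S T : is_sum F S -> is_sum F T -> S = T.
Proof.
move=> FS FT; apply/eqP; rewrite -subr_eq0 -normr_le0.
apply/ler_addgt0Pl => e e0; rewrite addr0.
have e2 : 0 < e / 2 by rewrite divr_gt0.
have [A hA] := FS _ e2; have [B hB] := FT _ e2.
have h1 := hA _ (fsubsetUl A B); have h2 := hB _ (fsubsetUr A B).
set X := \sum_(_ <- _) _ in h1 h2.
have -> : S - T = (X - T) - (X - S) by ring.
by rewrite (le_trans (ler_normB _ _))// (splitr e) lerD.
Qed.

Lemma is_sum_rsum F S : is_sum F S -> rsum F = S.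
Proof.
by move=> FS; apply: (is_sum_unique _ FS); rewrite /rsum; apply: xgetPex; exists S.
Qed.

Lemma is_sumD F G S T : is_sum F S -> is_sum G T ->
  is_sum (fun i => F i + G i) (S + T).
Proof.
move=> FS GT e e0; have e2 : 0 < e / 2 by rewrite divr_gt0.
have [A hA] := FS _ e2; have [B hB] := GT _ e2.
exists (A `|` B)%fset => C; rewrite fsubUset => /andP[AC BC].
rewrite big_split/= opprD addrACA (le_trans (ler_normD _ _))// (splitr e).
by rewrite lerD ?hA ?hB.
Qed.

Lemma is_sumZ c F S : is_sum F S -> is_sum (fun i => c * F i) (c * S).
Proof.
move=> FS e e0; have e2 : 0 < e / (1 + `|c|) by rewrite divr_gt0// ltr_pwDl.
have [A hA] := FS _ e2; exists A => B /hA h.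
rewrite -mulr_sumr -mulrBr normrM (le_trans (ler_wpM2l _ h))//.
by rewrite mulrCA ler_piMr ?(ltW e0)// ler_pdivrMr ?ltr_pwDl// mul1r lerDr.
Qed.

Lemma is_sum_fin F A : (forall i, i \notin A -> F i = 0) ->
  is_sum F (\sum_(i <- A) F i).
Proof.
move=> F0 e e0; exists A => B AB.
suff -> : \sum_(i <- B) F i = \sum_(i <- A) F i by rewrite subrr normr0 ltW.
rewrite [RHS](big_fset_incl _ AB)// => i _; exact: F0.
Qed.

Lemma ler_sum_fsub F A B : (forall i, 0 <= F i) -> (A `<=` B)%fset ->
  \sum_(i <- A) F i <= \sum_(i <- B) F i.
Proof.
move=> F0 AB; rewrite [leRHS](bigID (fun i => i \in A))/=.
rewrite (big_fset_condE _ B (fun i => i \in A)) (_ : [fset i in B | i \in A]%fset = A).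
  by rewrite lerDl sumr_ge0.
apply/fsetP => i; rewrite !inE/=.
by case: (boolP (i \in A)) => [/(fsubsetP AB) ->|]; rewrite ?andbF.
Qed.

Lemma summ_is_sum_ge0 F : (forall i, 0 <= F i) -> summ F -> exists S, is_sum F S.
Proof.
move=> F0 [M hM].
pose E : set R := [set \sum_(i <- A) F i | A in [set: {fset I}]].
have E0 : has_sup E.
  split; first by exists (\sum_(i <- fset0) F i); exists fset0.
  exists M => _ [A _ <-]; apply: le_trans (hM A).
  by apply: ler_sum => i _; rewrite ger0_norm.
exists (sup E) => e e0.
have [_ [A _ <-] hA] := sup_adherent e0 E0.
exists A => B AB; rewrite ler_norml; apply/andP; split; last first.
  rewrite lerBlDr; apply: le_trans (_ : sup E <= _); last by rewrite lerDr ltW.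
  by apply: ub_le_sup; [exact: E0.2|exists B].
rewrite lerBrDr addrC; apply: le_trans (ltW hA) _; exact: ler_sum_fsub.
Qed.

Lemma summ_le F G : (forall i, `|F i| <= G i) -> summ G -> summ F.
Proof.
move=> FG [M hM]; exists M => A; apply: le_trans (hM A).
by apply: ler_sum => i _; rewrite (le_trans (FG i))// ler_norm.
Qed.

Lemma summ_norm F : summ F -> summ (fun i => `|F i|).
Proof. by move=> [M h]; exists M => A; under eq_bigr do rewrite normr_id. Qed.

Lemma summD F G : summ F -> summ G -> summ (fun i => F i + G i).
Proof.
move=> [M hM] [N hN]; exists (M + N) => A; apply: le_trans (lerD (hM A) (hN A)).
by rewrite -big_split/=; apply: ler_sum => i _; exact: ler_normD.
Qed.

Lemma summZ c F : summ F -> summ (fun i => c * F i).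
Proof.
move=> [M hM]; exists (`|c| * M) => A.
under eq_bigr do rewrite normrM.
by rewrite -mulr_sumr ler_wpM2l.
Qed.

Lemma summN F : summ F -> summ (fun i => - F i).
Proof. by move=> [M hM]; exists M => A; under eq_bigr do rewrite normrN. Qed.

Lemma summB F G : summ F -> summ G -> summ (fun i => F i - G i).
Proof. by move=> hF /summN; exact: summD. Qed.

Lemma summ_is_sum F : summ F -> is_sum F (rsum F).
Proof.
move=> hF; rewrite /rsum; apply: xgetPex.
have [|S hS] := @summ_is_sum_ge0 (fun i => `|F i|) _ (summ_norm hF); first by [].
(* [F] is the difference of the nonnegative families [F + |F|] and [|F|]. *)
have [||T hT] := @summ_is_sum_ge0 (fun i => F i + `|F i|).
- by move=> i; rewrite -lerBlDr sub0r lerNnormlW.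
- exact: summD hF (summ_norm hF).
exists (T + -1 * S); have := is_sumD hT (is_sumZ (-1) hS).
by congr is_sum; apply/funext => i; ring.
Qed.

Lemma summ_fin F A : (forall i, i \notin A -> F i = 0) -> summ F.
Proof.
move=> F0; exists (\sum_(i <- A) `|F i|) => B.
apply: le_trans (ler_sum_fsub _ (fsubsetUl B A)) _ => //.
rewrite le_eqVlt [X in _ == X](big_fset_incl _ (fsubsetUr B A)) ?eqxx// => i _ iA.
by rewrite F0// normr0.
Qed.

Lemma rsum_fin F A : (forall i, i \notin A -> F i = 0) -> rsum F = \sum_(i <- A) F i.
Proof. by move=> F0; apply: is_sum_rsum; exact: is_sum_fin. Qed.

Lemma rsum0 : rsum (fun _ : I => 0) = 0.
Proof. by rewrite (@rsum_fin _ fset0) ?big_seq_fset0. Qed.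

Lemma rsum1 F j : (forall i, i != j -> F i = 0) -> rsum F = F j.
Proof.
move=> F0; rewrite (@rsum_fin _ [fset j]%fset) ?big_seq_fset1// => i.
by rewrite inE; exact: F0.
Qed.

Lemma rsumD F G : summ F -> summ G -> rsum (fun i => F i + G i) = rsum F + rsum G.
Proof. by move=> hF hG; apply: is_sum_rsum; apply: is_sumD; exact: summ_is_sum. Qed.

Lemma rsumZ c F : summ F -> rsum (fun i => c * F i) = c * rsum F.
Proof. by move=> hF; apply: is_sum_rsum; apply: is_sumZ; exact: summ_is_sum. Qed.

Lemma rsumN F : summ F -> rsum (fun i => - F i) = - rsum F.
Proof.
move=> hF; rewrite -mulN1r -rsumZ//; congr rsum.
by apply/funext => i; rewrite mulN1r.
Qed.

Lemma rsumB F G : summ F -> summ G -> rsum (fun i => F i - G i) = rsum F - rsum G.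
Proof. by move=> hF hG; rewrite (rsumD hF (summN hG)) rsumN. Qed.

Lemma rsum_le F M : summ F -> (forall A, \sum_(i <- A) F i <= M) -> rsum F <= M.
Proof.
move=> /summ_is_sum hF hM; apply/ler_addgt0Pl => e e0.
have [A /(_ _ (fsubset_refl _))] := hF _ e0.
rewrite ler_norml => /andP[h _]; have := hM A; lra.
Qed.

Lemma rsum_ge F A : (forall i, 0 <= F i) -> summ F -> \sum_(i <- A) F i <= rsum F.
Proof.
move=> F0 /summ_is_sum hF; apply/ler_addgt0Pl => e e0.
have [B /(_ _ (fsubsetUr A B))] := hF _ e0.
rewrite ler_norml => /andP[_ h].
by have := ler_sum_fsub F0 (fsubsetUl A B); lra.
Qed.

Lemma rsum_ge0 F : (forall i, 0 <= F i) -> summ F -> 0 <= rsum F.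
Proof. by move=> F0 hF; have := rsum_ge fset0 F0 hF; rewrite big_seq_fset0. Qed.

Lemma ler_rsum F G : summ F -> summ G -> (forall i, F i <= G i) -> rsum F <= rsum G.
Proof.
move=> hF hG FG; rewrite -subr_ge0 -rsumB//; apply: rsum_ge0; last exact: summB.
by move=> i; rewrite subr_ge0.
Qed.

Lemma ler_norm_rsum F : summ F -> `|rsum F| <= rsum (fun i => `|F i|).
Proof.
move=> hF; have hN := summ_norm hF.
rewrite ler_norml -rsumN//; apply/andP; split; apply: ler_rsum => //.
- exact: summN.
- by move=> i; rewrite lerNl -normrN ler_norm.
- by move=> i; exact: ler_norm.
Qed.

Lemma ler_norm_rsum_bound F M : (forall A, \sum_(i <- A) `|F i| <= M) -> `|rsum F| <= M.
Proof.
move=> hM; have hF : summ F by exists M.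
by apply: le_trans (ler_norm_rsum hF) _; apply: rsum_le => //; exact: summ_norm.
Qed.

Lemma ler_norm_rsum_le F G : (forall i, `|F i| <= G i) -> summ G -> `|rsum F| <= rsum G.
Proof.
move=> FG hG; have hF := summ_le FG hG.
by apply: le_trans (ler_norm_rsum hF) _; apply: ler_rsum => //; exact: summ_norm.
Qed.

Lemma summ_tail G e : (forall i, 0 <= G i) -> summ G -> 0 < e ->
  exists A, forall B, \sum_(i <- B | i \notin A) G i <= e.
Proof.
move=> G0 /summ_is_sum hG e0; have e2 : 0 < e / 2 by rewrite divr_gt0.
have [A hA] := hG _ e2; exists A => B.
have := hA _ (fsubset_refl A); have := hA _ (fsubsetUl A B).
rewrite (bigID (fun i => i \in A))/= (big_fset_condE _ (A `|` B)%fset (fun i => i \in A)) (big_fset_condE _ (A `|` B)%fset (fun i => i \notin A)) (big_fset_condE _ B (fun i => i \notin A)).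
rewrite (_ : [fset i in (A `|` B)%fset | i \in A]%fset = A); last first.
  by apply/fsetP => i; rewrite !inE/=; case: (i \in A); rewrite ?andbF.
rewrite (_ : [fset i in (A `|` B)%fset | i \notin A]%fset = [fset i in B | i \notin A]%fset); last first.
  by apply/fsetP => i; rewrite !inE/=; case: (i \in A); rewrite ?andbF.
rewrite !ler_norml => /andP[_ h1] /andP[h2 _]; lra.
Qed.

(** The set [A] depends on the majorant [G] alone, so it serves every dominated [F] at once. *)
Lemma rsum_tail G e : (forall i, 0 <= G i) -> summ G -> 0 < e ->
  exists A : {fset I}, forall F, (forall i, `|F i| <= G i) ->
    (forall i, i \in A -> F i = 0) -> `|rsum F| <= e.
Proof.
move=> G0 hG e0; have [A hA] := summ_tail G0 hG e0; exists A => F FG F0.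
apply: ler_norm_rsum_bound => B; apply: le_trans (hA B).
rewrite (bigID (fun i => i \in A))/= big1 ?add0r; first exact: ler_sum.
by move=> i /F0 ->; rewrite normr0.
Qed.

(** A finite set [A] captures all but [e / 2] of the sum of the majorant [2 G] of the differences;
    on [A] only a finite sum has to converge. This is dominated convergence, along any filter. *)
Lemma cvg_rsum (T : Type) (FF : set_system T) {FFf : ProperFilter FF}
    (F : T -> I -> R) (L G : I -> R) :
  summ G -> (\forall h \near FF, forall i, `|F h i| <= G i) ->
  (forall i, F h i @[h --> FF] --> L i) ->
  rsum (F h) @[h --> FF] --> rsum L.
Proof.
move=> hG FG FL.
have LG i : `|L i| <= G i.
  apply: (@cvgr_to_le _ FF _ _ (fun h => `|F h i|)); first exact: cvg_norm.
  by apply: filterS FG => h; apply.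
have G0 i : 0 <= G i by apply: le_trans (LG i).
apply/cvgrPdist_le => e e0; have e3 : 0 < e / 2 by rewrite divr_gt0.
have hG2 := summZ 2 hG.
have [|A hA] := @rsum_tail (fun i => 2 * G i) _ _ hG2 e3.
  by move=> i; rewrite mulr_ge0.
have cA : \sum_(i <- A) `|L i - F h i| @[h --> FF] --> \sum_(i <- A) (0 : R).
  elim: (enum_fset A) => [|i s IH].
    by rewrite big_nil; under eq_fun do rewrite big_nil; exact: cvg_cst.
  rewrite big_cons; under eq_fun do rewrite big_cons.
  apply: cvgD => //; rewrite -(normr0 R) -(subrr (L i)).
  by apply: cvg_norm; apply: cvgB => //; exact: cvg_cst.
rewrite big1_eq in cA.
move/cvgrPdist_le : cA => /(_ _ e3); apply: filterS2 FG => h hFG hA'.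
have hF : summ (F h) by exact: summ_le hG.
have hL : summ L by exact: summ_le hG.
rewrite -rsumB//.
pose D i := L i - F h i.
have -> : rsum (fun i => L i - F h i) =
  rsum (fun i => if i \in A then D i else 0) + rsum (fun i => if i \in A then 0 else D i).
  have DG i : `|D i| <= 2 * G i.
    by rewrite (le_trans (ler_normB _ _))// mulr_natl mulr2n lerD.
  rewrite -rsumD.
  - by congr rsum; apply/funext => i; case: ifP; rewrite ?addr0 ?add0r.
  - apply: (summ_le _ hG2) => i; case: ifP => // _; rewrite normr0.
    by rewrite mulr_ge0.
  - apply: (summ_le _ hG2) => i; case: ifP => // _; rewrite normr0.
    by rewrite mulr_ge0.
rewrite (splitr e) (le_trans (ler_normD _ _))// lerD//.
  rewrite (@rsum_fin _ A); last by move=> i /negPf ->.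
  rewrite big_seq_cond (eq_bigr D); last by move=> i /andP[->].
  rewrite -big_seq_cond; apply: le_trans (ler_norm_sum _ _ _) _.
  by move: hA'; rewrite sub0r normrN; apply: le_trans; exact: ler_norm.
apply: hA => i; last by move=> ->.
case: ifP => _; first by rewrite normr0 mulr_ge0.
by rewrite (le_trans (ler_normB _ _))// mulr_natl mulr2n lerD.
Qed.

Lemma rsum_sum (J : eqType) (s : seq J) (F : J -> I -> R) : (forall j, j \in s -> summ (F j)) ->
  summ (fun i => \sum_(j <- s) F j i) /\
  rsum (fun i => \sum_(j <- s) F j i) = \sum_(j <- s) rsum (F j).
Proof.
elim: s => [|j s IH] hF.
  rewrite big_nil; under eq_fun do rewrite big_nil.
  by rewrite rsum0; split => //; apply: (@summ_fin _ fset0).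
have [h1 h2] := IH (fun k ks => hF k (@mem_behead _ (j :: s) k ks)).
have h3 := hF j (mem_head _ _).
rewrite big_cons; under [X in summ X]eq_fun do rewrite big_cons.
under [X in rsum X]eq_fun do rewrite big_cons.
by split; [exact: summD|rewrite rsumD// h2].
Qed.

End OneIndex.

Section Fibres.
Variables (K I : choiceType) (p : K -> I).
Implicit Type F : K -> R.

(** The restriction to a fibre is an extension by zero, so it stays a family on the same index
    type. *)
Definition fibre F i k : R := if p k == i then F k else 0.

Lemma summ_fibre F i : summ F -> summ (fibre F i).
Proof.
move=> hF; apply: (summ_le _ (summ_norm hF)) => k; rewrite /fibre.
by case: ifP => //; rewrite normr0.
Qed.

Lemma sum_fibre F (B : {fset I}) k :
  \sum_(i <- B) fibre F i k = if p k \in B then F k else 0.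
Proof.
rewrite /fibre; case: ifPn => pB.
  rewrite (big_fsetD1 _ pB)/= eqxx big_seq big1 ?addr0// => i.
  by rewrite !inE => /andP[/negPf]; rewrite eq_sym => ->.
rewrite big_seq big1// => i iB; case: eqP => // pk.
by rewrite pk iB in pB.
Qed.

Lemma summ_rsum_fibre F : summ F -> summ (fun i => rsum (fibre F i)).
Proof.
move=> hF; exists (rsum (fun k => `|F k|)) => B.
have hN := summ_norm hF.
apply: (@le_trans _ _ (\sum_(i <- B) rsum (fibre (fun k => `|F k|) i))).
  apply: ler_sum => i _; apply: ler_norm_rsum_le; last exact: summ_fibre.
  by move=> k; rewrite /fibre; case: ifP => //; rewrite normr0.
have [_ <-] := @rsum_sum _ _ (enum_fset B) _ (fun i _ => summ_fibre i hN).
apply: ler_rsum => //.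
  by have [] := @rsum_sum _ _ (enum_fset B) _ (fun i _ => summ_fibre i hN).
by move=> k; rewrite sum_fibre; case: ifP.
Qed.

(** Any finite set of fibres that covers [A] carries the whole sum up to the tail outside [A]. *)
Lemma rsum_fibres F : summ F -> rsum F = rsum (fun i => rsum (fibre F i)).
Proof.
move=> hF; apply/esym/is_sum_rsum => e e0.
have hN := summ_norm hF.
have [|A hA] := rsum_tail _ hN e0; first by [].
exists [fset p k | k in A]%fset => B AB.
have [h1 <-] := @rsum_sum _ _ (enum_fset B) _ (fun i _ => summ_fibre i hF).
rewrite -rsumB//; apply: hA => k; rewrite sum_fibre.
  case: ifP => _; first by rewrite subrr normr0.
  by rewrite sub0r normrN.
move=> kA; rewrite ifT ?subrr//.
by apply: (fsubsetP AB); exact: in_imfset.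
Qed.

End Fibres.

Lemma summ_inj (I J : choiceType) (h : I -> J) (F : J -> R) :
  injective h -> summ F -> summ (F \o h).
Proof.
move=> hinj [M hM]; exists M => A; apply: le_trans (hM [fset h i | i in A]%fset).
by rewrite big_imfset//= => i j _ _; exact: hinj.
Qed.

Lemma rsum_inj (I J : choiceType) (h : I -> J) (F : J -> R) :
  injective h -> summ F -> (forall j, F j != 0 -> exists i, h i = j) ->
  rsum (F \o h) = rsum F.
Proof.
move=> hinj hF hsurj.
rewrite (rsum_fibres h (summ_inj hinj hF)); congr rsum; apply/funext => j.
case: (pselect (exists i, h i = j)) => [[i hij]|nj].
  rewrite (@rsum1 _ _ i) /fibre/= ?hij ?eqxx// => i' ii'.
  case: eqP => // hi'; move: ii'; rewrite (_ : i' = i) ?eqxx//.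
  by apply: hinj; rewrite hi'.
case: (eqVneq (F j) 0) => [->|/hsurj//].
rewrite (_ : fibre _ _ _ = (fun=> 0)) ?rsum0//.
by apply/funext => i; rewrite /fibre; case: eqP => // hij; case: nj; exists i.
Qed.

(** A finite set [C] is compared with its preimage [A], computed with the partial inverse [g] of
    [h]; outside the image the terms vanish. *)
Lemma summ_image (I J : choiceType) (h : I -> J) (F : J -> R) :
  injective h -> summ (F \o h) -> (forall j, F j != 0 -> exists i, h i = j) -> summ F.
Proof.
move=> hinj [M hM] hs; exists M => C.
pose g j := if pselect (exists i, h i = j) is left e then Some (projT1 (cid e)) else None.
pose A := seq_fset tt (pmap g C).
apply: le_trans (hM A).
have <- : \sum_(j <- [fset h i | i in A]%fset) `|F j| = \sum_(i <- A) `|(F \o h) i|.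
  by rewrite big_imfset//= => i j _ _; exact: hinj.
apply: le_trans (ler_sum_fsub _ (fsubsetUl C [fset h i | i in A]%fset)) _ => //.
rewrite le_eqVlt [X in _ == X](big_fset_incl _ (fsubsetUr C _)) ?eqxx// => j jC jA.
apply/eqP; rewrite normr_eq0; apply/negP => /negP/hs Fj.
have jC' : j \in C.
  by move: jC jA; rewrite inE => /orP[//|->].
move/negP : jA; apply; apply/imfsetP => /=; exists (projT1 (cid Fj)); last by case: cid.
rewrite seq_fsetE mem_pmap; apply/mapP; exists j => //.
by rewrite /g; case: pselect => // e; congr Some; congr projT1; congr cid; exact: Prop_irrelevance.
Qed.

Lemma summ_bij (I J : choiceType) (h : I -> J) (F : J -> R) :
  bijective h -> summ (F \o h) -> summ F.
Proof.
move=> hb hF; apply: summ_image hF _; first exact: bij_inj.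
by case: hb => g _ gh j _; exists (g j).
Qed.

Lemma rsum_bij (I J : choiceType) (h : I -> J) (F : J -> R) :
  bijective h -> summ F -> rsum (F \o h) = rsum F.
Proof.
move=> hb hF; apply: rsum_inj => //; first exact: bij_inj.
by case: hb => g _ gh j _; exists (g j).
Qed.

Section Pairs.
Variables (I J : choiceType).

Lemma summ_pair (F : I * J -> R) i : summ F -> summ (fun j => F (i, j)).
Proof. by move=> hF; apply: (@summ_inj _ _ (pair i)) => // j j' [->]. Qed.

Lemma rsum_pair_fibre (F : I * J -> R) i : summ F ->
  rsum (fibre fst F i) = rsum (fun j => F (i, j)).
Proof.
move=> hF; rewrite -(@rsum_inj _ _ (pair i) (fibre fst F i)).
- by congr rsum; apply/funext => j; rewrite /= /fibre/= eqxx.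
- by move=> j j' [->].
- exact: summ_fibre.
- move=> [i' j]; rewrite /fibre/=; case: (eqVneq i' i) => [-> _|_]; first by exists j.
  by rewrite eqxx.
Qed.

Lemma rsum_pair (F : I * J -> R) : summ F ->
  rsum F = rsum (fun i => rsum (fun j => F (i, j))).
Proof.
move=> hF; rewrite (rsum_fibres fst hF); congr rsum.
by apply/funext => i; rewrite rsum_pair_fibre.
Qed.

Lemma summ_rsum_pair (F : I * J -> R) : summ F ->
  summ (fun i => rsum (fun j => F (i, j))).
Proof.
move=> hF; have := summ_rsum_fibre fst hF.
by congr summ; apply/funext => i; rewrite rsum_pair_fibre.
Qed.

Lemma summ_mul (a : I -> R) (b : J -> R) : summ a -> summ b ->
  summ (fun k => a k.1 * b k.2).
Proof.
move=> [M hM] [N hN]; exists (M * N) => C.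
pose A := [fset k.1 | k in C]%fset; pose B := [fset k.2 | k in C]%fset.
pose AB := [fset ((i, j) : I * J) | i in [fset i in A | xpredT i],
                      j in [fset j in B | xpredT j]]%fset.
have CAB : (C `<=` AB)%fset.
  apply/fsubsetP => -[i j] kC; apply/imfset2P; exists i.
    by rewrite !inE andbT; apply/imfsetP; exists (i, j).
  by exists j => //; rewrite !inE andbT; apply/imfsetP; exists (i, j).
apply: le_trans (ler_sum_fsub _ CAB) _ => //.
have := pair_big_dep_cond (GRing.add : Monoid.com_law (0 : R)) A (fun=> B) xpredT (fun=> xpredT)
  (fun i j => `|a i * b j|).
rewrite -/AB => <-/=.
have -> : \sum_(i <- A) \sum_(j <- B) `|a i * b j| =
    (\sum_(i <- A) `|a i|) * (\sum_(j <- B) `|b j|).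
  rewrite mulr_suml; apply: eq_bigr => i _; rewrite mulr_sumr.
  by apply: eq_bigr => j _; rewrite normrM.
by rewrite ler_pM// sumr_ge0.
Qed.

End Pairs.

Lemma rsum_sumtype (I J : choiceType) (F : I + J -> R) :
  summ F -> rsum F = rsum (F \o inl) + rsum (F \o inr).
Proof.
move=> hF.
pose p (k : I + J) : bool := if k is inl _ then true else false.
rewrite (rsum_fibres p hF) (@rsum_fin _ _ [fset true; false]%fset); last first.
  by case; rewrite !inE.
rewrite big_fsetU1 ?inE//= big_seq_fset1; congr (_ + _).
  rewrite -(@rsum_inj _ _ inl) => //; [by move=> ? ? []|exact: summ_fibre|].
  by case=> [i _|j]; [exists i|rewrite /fibre/= eqxx].
rewrite -(@rsum_inj _ _ inr) => //; [by move=> ? ? []|exact: summ_fibre|].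
by case=> [i|j _]; [rewrite /fibre/= eqxx|exists j].
Qed.

Lemma summ_sumtype (I J : choiceType) (F : I + J -> R) :
  summ (F \o inl) -> summ (F \o inr) -> summ F.
Proof.
move=> hl hr.
have -> : F = (fun k => (if k is inl _ then F k else 0) + (if k is inr _ then F k else 0)).
  by apply/funext; case=> k; rewrite ?addr0 ?add0r.
apply: summD; [apply: (@summ_image _ _ inl)|apply: (@summ_image _ _ inr)] => //.
- by move=> ? ? [].
- by case=> i; rewrite ?eqxx//; exists i.
- by move=> ? ? [].
- by case=> i; rewrite ?eqxx//; exists i.
Qed.

End UnconditionalSums.

(** * Integrals of continuous functions *)

Section RealCalculus.
Variable R : realType.
Implicit Types (f g F G dF dG : R -> R) (x y a b c h M r : R).

Lemma is_deriveP f (x d : R) :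
  is_derive x 1 f d <-> h^-1 * (f (x + h) - f x) @[h --> 0^'] --> d.
Proof.
have E : (fun h : R => h^-1 *: ((f \o shift x) (h *: (1:R)) - f x)) = (fun h : R => h^-1 * (f (x + h) - f x)).
  by apply/funext => h /=; rewrite [_%:A]mulr1 (addrC h x).
split=> [[df <-]|h]; first by move: df; rewrite /derive /derivable E.
split; first by rewrite /derivable E; apply/cvg_ex; exists d.
by rewrite /derive E; apply: cvg_lim.
Qed.

Lemma is_derive_ext f g (x d : R) : f =1 g -> is_derive x 1 f d -> is_derive x 1 g d.
Proof. by move=> /funext ->. Qed.

Lemma is_derive_continuous f (df : R -> R) : (forall x, is_derive x 1 f (df x)) -> continuous f.
Proof.
move=> h x; apply: differentiable_continuous; apply/derivable1_diffP.
by have [] := h x.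
Qed.

Lemma mvt f (df : R -> R) a b : a <= b -> (forall x, is_derive x 1 f (df x)) ->
  exists2 c, a <= c <= b & f b - f a = df c * (b - a).
Proof.
move=> ab h; have [c] := MVT_segment ab (fun x _ => h x)
  (continuous_subspaceT (is_derive_continuous h)).
by rewrite in_itv/= => cab e; exists c.
Qed.

Lemma mvt_local f (df : R -> R) a b : a <= b -> (forall x, a <= x <= b -> is_derive x 1 f (df x)) ->
  exists2 c, a <= c <= b & f b - f a = df c * (b - a).
Proof.
move=> ab h; have [x||c] := @MVT_segment _ f df _ _ ab.
- by rewrite in_itv/= => /andP[/ltW ? /ltW ?]; apply: h; apply/andP.
- apply: derivable_within_continuous => x; rewrite in_itv/= => /h; by case.
- by rewrite in_itv/= => cab e; exists c.
Qed.

Lemma ler_mvt f (df : R -> R) a b M : a <= b -> (forall x, a <= x <= b -> is_derive x 1 f (df x)) ->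
  (forall x, a <= x <= b -> `|df x| <= M) -> `|f b - f a| <= M * (b - a).
Proof.
move=> ab h hM; have [c cab ->] := mvt_local ab h.
by rewrite normrM [X in _ * X]ger0_norm ?subr_ge0// ler_wpM2r ?subr_ge0// hM.
Qed.

Lemma eq_derive_sub f g (df : R -> R) a b : (forall x, is_derive x 1 f (df x)) ->
  (forall x, is_derive x 1 g (df x)) -> f b - f a = g b - g a.
Proof.
move=> hf hg.
suff: (f - g) b = (f - g) a by rewrite /= !fctE; lra.
apply: is_derive_0_is_cst => x.
have := is_deriveB (hf x) (hg x); by rewrite subrr.
Qed.

Section Continuity.
Variable T : topologicalType.
Implicit Types u v : T -> R.

Lemma contD u v : continuous u -> continuous v -> continuous (fun t => u t + v t).
Proof. by move=> cu cv x; apply: cvgD; [exact: cu|exact: cv]. Qed.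

Lemma contN u : continuous u -> continuous (fun t => - u t).
Proof. by move=> cu x; apply: cvgN; exact: cu. Qed.

Lemma contB u v : continuous u -> continuous v -> continuous (fun t => u t - v t).
Proof. by move=> cu cv; apply: contD => //; exact: contN. Qed.

Lemma contM u v : continuous u -> continuous v -> continuous (fun t => u t * v t).
Proof. by move=> cu cv x; apply: cvgM; [exact: cu|exact: cv]. Qed.

Lemma contZ c u : continuous u -> continuous (fun t => c * u t).
Proof. by move=> cu; apply: contM => // x; exact: cvg_cst. Qed.

Lemma cont_cst c : continuous (fun _ : T => c).
Proof. by move=> x; exact: cvg_cst. Qed.

Lemma cont_comp f u : continuous f -> continuous u -> continuous (fun t => f (u t)).
Proof. by move=> cf cu x; apply: continuous_comp; [exact: cu|exact: cf]. Qed.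
End Continuity.

Section DerivRules.
Variables (f g : R -> R) (x a b : R).

Lemma drvD : is_derive x 1 f a -> is_derive x 1 g b -> is_derive x 1 (fun t => f t + g t) (a + b).
Proof. by move=> hf hg; exact: is_deriveD. Qed.

Lemma drvN : is_derive x 1 f a -> is_derive x 1 (fun t => - f t) (- a).
Proof. by move=> hf; exact: is_deriveN. Qed.

Lemma drvB : is_derive x 1 f a -> is_derive x 1 g b -> is_derive x 1 (fun t => f t - g t) (a - b).
Proof. by move=> hf hg; exact: is_deriveB. Qed.

Lemma drvZ c : is_derive x 1 f a -> is_derive x 1 (fun t => c * f t) (c * a).
Proof. by move=> hf; exact: is_deriveZ. Qed.

Lemma drvM : is_derive x 1 f a -> is_derive x 1 g b ->
  is_derive x 1 (fun t => f t * g t) (a * g x + f x * b).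
Proof.
move=> hf hg; have := is_deriveM hf hg.
by congr is_derive; rewrite /GRing.scale/=; ring.
Qed.

Lemma drv_cst c : is_derive x 1 (fun _ : R => c) 0.
Proof. exact: is_derive_cst. Qed.

Lemma drv_id : is_derive x 1 (fun t : R => t) 1.
Proof. exact: is_derive_id. Qed.

Lemma drv_eq : is_derive x 1 f a -> a = b -> is_derive x 1 f b.
Proof. by move=> ? <-. Qed.
End DerivRules.

Lemma drv_comp f g x a b : is_derive (g x) 1 f a -> is_derive x 1 g b ->
  is_derive x 1 (fun t => f (g t)) (a * b).
Proof. by move=> hf hg; exact: is_derive1_comp. Qed.

(** Integrals are differences of a chosen primitive, which makes orientation, additivity and
    translation algebraic. The default [fun=> 0] is met only by functions without a primitive. *)
Definition antideriv f : R -> R := xget (fun=> 0) [set F | forall x, is_derive x 1 F (f x)].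
Definition integ f (a b : R) : R := antideriv f b - antideriv f a.

Lemma integ_eq F f a b : (forall x, is_derive x 1 F (f x)) -> integ f a b = F b - F a.
Proof.
move=> h; apply: (@eq_derive_sub _ _ f) => //.
by rewrite /antideriv; apply: (@xgetPex _ (fun=> 0) [set F | forall x, is_derive x 1 F (f x)]); exists F.
Qed.

Lemma ftc_right f a : continuous f ->
  forall x, a < x -> is_derive x 1 (fun x => \int[lebesgue_measure]_(t in `[a, x]) f t) (f x).
Proof.
move=> cf x ax.
have [||d e] := @continuous_FTC1_closed _ f a x (x + 1) _ _ ax (cf x).
- by rewrite ltrDl.
- apply: continuous_compact_integrable; first exact: segment_compact.
  exact: continuous_subspaceT.
exact: DeriveDef d (etrans (esym (derive1E _ _)) e).
Qed.

(** The Lebesgue integral from [a] is differentiable only to the right of [a], so the base point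
    [- |x| - 1] moves with [x]. Subtracting the integral up to 0 makes the value independent of the
    base point, and near a given [x] the base may be frozen. *)
Lemma antideriv_ex f : continuous f -> exists F, forall x, is_derive x 1 F (f x).
Proof.
move=> cf.
pose G a x := \int[lebesgue_measure]_(t in `[a, x]) f t.
pose H a x := G a x - G a 0.
have HH a b x : a < 0 -> b < 0 -> a < x -> b < x -> H a x = H b x.
  move=> a0 b0 ax bx.
  have D y : Num.max a b < y -> is_derive y 1 (G a - G b) 0.
    rewrite gt_max => /andP[ay yb].
    by have := is_deriveB (ftc_right cf ay) (ftc_right cf yb); rewrite subrr.
  suff: (G a - G b) x = (G a - G b) 0 by rewrite /H !fctE; lra.
  case: (leP x 0) => x0.
    have [y /andP[y1 _]|c _] := @mvt_local (G a - G b) (fun=> 0) x 0 x0.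
      by apply: D; rewrite gt_max; apply/andP; split; lra.
    by rewrite mul0r => /eqP; rewrite subr_eq0 => /eqP.
  have [y /andP[y1 _]|c _] := @mvt_local (G a - G b) (fun=> 0) 0 x (ltW x0).
    by apply: D; rewrite gt_max; apply/andP; split; lra.
  by rewrite mul0r => /eqP; rewrite subr_eq0 => /eqP.
exists (fun x => H (- `|x| - 1) x) => x.
have xn := normr_ge0 x; have xm := ler_norm (- x); rewrite normrN in xm.
have d : is_derive x 1 (H (- `|x| - 2)) (f x).
  have -> : f x = f x - 0 by rewrite subr0.
  apply: is_deriveB; apply: ftc_right => //; lra.
apply: near_eq_is_derive d.
have : \forall y \near x, `|x - y| < 1.
  by move: (@cvgr_dist_lt _ _ R _ (nbhs_filter x) id x cvg_id 1 ltr01).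
apply: filterS => y xy; apply: HH; try lra.
- by have := normr_ge0 y; lra.
- have h : `|x| - 1 <= y \/ true by right.
  have := ler_norm (x - y); lra.
- by have := ler_norm (- y); rewrite normrN; lra.
Qed.

Lemma antiderivP f : continuous f -> forall x, is_derive x 1 (antideriv f) (f x).
Proof.
by move=> /antideriv_ex; exact: (@xgetPex _ (fun=> 0) [set F | forall x, is_derive x 1 F (f x)]).
Qed.

Lemma eq_integ f g a b : f =1 g -> integ f a b = integ g a b.
Proof. by move=> /funext ->. Qed.

Lemma integD f g a b : continuous f -> continuous g ->
  integ (fun t => f t + g t) a b = integ f a b + integ g a b.
Proof.
move=> cf cg; rewrite [LHS](_ : _ = (antideriv f b + antideriv g b) - (antideriv f a + antideriv g a)); last first.
  by apply: (@integ_eq (fun t => antideriv f t + antideriv g t)) => x; apply: drvD; exact: antiderivP.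
by rewrite /integ; ring.
Qed.

Lemma integZ c f a b : continuous f -> integ (fun t => c * f t) a b = c * integ f a b.
Proof.
move=> cf; rewrite /integ mulrBr; apply: (@integ_eq (fun t => c * antideriv f t)) => x.
by apply: drvZ; exact: antiderivP.
Qed.

Lemma integN f a b : continuous f -> integ (fun t => - f t) a b = - integ f a b.
Proof.
by move=> cf; rewrite -mulN1r -integZ//; apply: eq_integ => t; rewrite mulN1r.
Qed.

Lemma integB f g a b : continuous f -> continuous g ->
  integ (fun t => f t - g t) a b = integ f a b - integ g a b.
Proof.
move=> cf cg; rewrite integD ?integN//; exact: contN.
Qed.

Lemma integ_chasles f b a c : integ f a b + integ f b c = integ f a c.
Proof. by rewrite /integ; ring. Qed.

Lemma integ_ge f a b m : a <= b -> continuous f -> (forall x, a <= x <= b -> m <= f x) ->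
  m * (b - a) <= integ f a b.
Proof.
move=> ab /antiderivP h hm; rewrite /integ; have [c cab ->] := mvt ab h.
by rewrite ler_wpM2r ?subr_ge0// hm.
Qed.

Lemma integ_norm f a b M : a <= b -> continuous f -> (forall x, a <= x <= b -> `|f x| <= M) ->
  `|integ f a b| <= M * (b - a).
Proof.
move=> ab /antiderivP h hm; rewrite /integ; have [c cab ->] := mvt ab h.
by rewrite normrM [X in _ * X]ger0_norm ?subr_ge0// ler_wpM2r ?subr_ge0// hm.
Qed.

Lemma drv_shift f d c x : is_derive (x + c) 1 f d ->
  is_derive x 1 (fun t => f (t + c)) d.
Proof.
move=> /is_deriveP h; apply/is_deriveP; move: h.
by under eq_fun do rewrite addrAC.
Qed.

Lemma integ_shift f c a b : continuous f ->
  integ (fun t => f (t + c)) a b = integ f (a + c) (b + c).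
Proof.
move=> /antiderivP h; apply: (@integ_eq (fun t => antideriv f (t + c))) => x; exact: drv_shift.
Qed.

Lemma integ_period f a : continuous f -> (forall x, f (x + 1) = f x) ->
  integ f a (a + 1) = integ f 0 1.
Proof.
move=> cf fp; have h := integ_shift 1 0 a cf.
rewrite (@eq_integ _ f) ?add0r in h => [|x]; last by rewrite fp.
have := integ_chasles f 1 0 (a + 1); have := integ_chasles f a 0 (a + 1); rewrite h; lra.
Qed.

Section Termwise.
Variable I : choiceType.

(** The mean value theorem bounds every difference quotient by [M i], so [cvg_rsum] applies as the
    increment tends to 0. *)
Lemma rsum_is_derive (F f : I -> R -> R) (M : I -> R) (x r : R) : 0 < r ->
  (forall i y, `|y - x| <= r -> is_derive y 1 (F i) (f i y)) ->
  (forall y, `|y - x| <= r -> summ (F ^~ y)) ->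
  summ M -> (forall i y, `|y - x| <= r -> `|f i y| <= M i) ->
  is_derive x 1 (fun y => rsum (F ^~ y)) (rsum (f ^~ x)).
Proof.
move=> r0 hF hS hM hf; apply/is_deriveP.
have near_r : \forall h \near (0 : R)^', `|h| <= r.
  apply: dnbhs0_le; exact: r0.
have := @cvg_rsum R I R (0 : R)^' _ (fun h i => h^-1 * (F i (x + h) - F i x)) (f ^~ x) M hM.
have E : \forall h \near (0 : R)^', rsum (fun i => h^-1 * (F i (x + h) - F i x)) =
   h^-1 * (rsum (F^~ (x + h)) - rsum (F ^~ x)).
  apply: filterS near_r => h hr.
  rewrite rsumZ; last apply: summB.
  - rewrite rsumB//; apply: hS; first by rewrite addrC addKr.
    by rewrite subrr normr0 ltW.
  - by apply: hS; rewrite addrC addKr.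
  - by apply: hS; rewrite subrr normr0 ltW.
move=> H; apply: cvg_trans; last apply: H.
- by apply: near_eq_cvg; exact: E.
- near=> h => i.
  have hr : `|h| <= r by near: h.
  have h0 : h != 0 by near: h; exact: nbhs_dnbhs_neq.
  rewrite normrM normfV ler_pdivrMl ?normr_gt0// mulrC.
  case: (leP 0 h) => hh.
    have xh : x <= x + h by rewrite lerDl.
    rewrite [in X in _ <= _ * X](_ : h = x + h - x); last by ring.
    rewrite [X in _ <= _ * X]ger0_norm ?subr_ge0//.
    rewrite ger0_norm in hr => //.
    apply: (@ler_mvt _ (f i)) => // y yx; [apply: hF|apply: hf]; rewrite ler_norml; lra.
  have xh : x + h <= x by rewrite gerDl ltW.
  rewrite distrC [in X in _ <= _ * X](_ : h = - (x - (x + h))); last by ring.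
  rewrite normrN [X in _ <= _ * X]ger0_norm ?subr_ge0//.
  rewrite ltr0_norm in hr => //.
  apply: (@ler_mvt _ (f i)) => // y yx; [apply: hF|apply: hf]; rewrite ler_norml; lra.
- by move=> i; apply/is_deriveP; apply: hF; rewrite subrr normr0 ltW.
Unshelve. all: by end_near. Qed.

Lemma rsum_continuous (T : topologicalType) (f : I -> T -> R) (M : I -> R) (x : T) :
  (forall i, {for x, continuous (f i)}) -> summ M ->
  (\forall z \near x, forall i : I, `|f i z| <= M i) ->
  {for x, continuous (fun z => rsum (fun i => f i z))}.
Proof.
move=> cf hM hf; by apply: (@cvg_rsum R I T (nbhs x) _ (fun z i => f i z) (f ^~ x) M).
Qed.

Lemma integ_rsum (f : I -> R -> R) (M : I -> R) a b :
  (forall i, continuous (f i)) -> summ M -> (forall i t, `|f i t| <= M i) ->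
  integ (fun t => rsum (f ^~ t)) a b = rsum (fun i => integ (f i) a b).
Proof.
move=> cf hM hf.
pose F i t := antideriv (f i) t - antideriv (f i) a.
have hF i (t : R) : is_derive t 1 (F i) (f i t).
  by apply: drv_eq (drvB (antiderivP (cf i) t) (drv_cst t (antideriv (f i) a))) _; rewrite subr0.
have Fb i t : `|F i t| <= `|t - a| * M i.
  case: (leP a t) => hat.
    rewrite (@ger0_norm _ (t - a)) ?subr_ge0// mulrC.
    exact: (ler_mvt hat (fun y _ => antiderivP (cf i) y) (fun y _ => hf i y)).
  rewrite distrC (@ltr0_norm _ (t - a)) ?subr_lt0// opprB mulrC.
  exact: (ler_mvt (ltW hat) (fun y _ => antiderivP (cf i) y) (fun y _ => hf i y)).
have sF t : summ (F ^~ t) by apply: (summ_le (Fb^~ t)); exact: summZ.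
have -> : integ (fun t => rsum (f ^~ t)) a b = rsum (F ^~ b) - rsum (F ^~ a).
  by apply: (@integ_eq (fun t => rsum (F ^~ t))) => x; apply: (@rsum_is_derive _ _ M _ 1).
by rewrite -rsumB//; congr rsum; apply/funext => i; rewrite /integ /F; ring.
Qed.

End Termwise.

(** Compactness of [[a, b]] makes the continuity in the parameter uniform in [t]. *)
Lemma tube (T : topologicalType) (g : T * R -> R) (p : T) (a b e : R) :
  continuous g -> 0 < e ->
  \forall q \near p, forall t, a <= t <= b -> `|g (q, t) - g (p, t)| <= e.
Proof.
move=> cg e0; have := @segment_compact R a b => /compact_near_coveringP.
move=> /(_ T (nbhs p) (fun q t => `|g (q, t) - g (p, t)| <= e) _) H.
have e2 : 0 < e / 2 by rewrite divr_gt0.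
apply: filterS (H _) => [q hq t tab|]; first by apply: hq; rewrite /= in_itv.
move=> t _.
have /cvgrPdist_le /(_ _ e2) h := cg (p, t).
have h1 : \forall u \near t & q \near p, `|g (p, t) - g (q, u)| <= e / 2.
  by case: h => -[/= U V] [/= hU hV] UV; exists (V, U) => //= -[v u] [/= ? ?]; exact: (UV (u, v)).
have h2 : \forall u \near t & q \near p, `|g (p, t) - g (p, u)| <= e / 2.
  case: h => -[/= U V] [/= hU hV] UV; exists (V, setT) => //=; first by split=> //; exact: filterT.
  move=> -[v u] [/= Vv _]; apply: (UV (p, v)); split => //=; exact: nbhs_singleton.
apply: filterS2 h1 h2 => -[u q] /= h1 h2.
have -> : g (q, u) - g (p, u) = (g (p, t) - g (p, u)) - (g (p, t) - g (q, u)) by ring.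
by rewrite (splitr e) (le_trans (ler_normB _ _))// lerD.
Qed.

Lemma continuous_slice (T : topologicalType) (g : T * R -> R) (p : T) :
  continuous g -> continuous (fun t => g (p, t)).
Proof.
move=> cg t; apply: (@continuous_comp _ _ _ (fun t => (p, t)) g); last exact: cg.
by apply: (@cvg_pair _ _ _ _ (nbhs p) (nbhs t)) => //=; exact: cvg_cst.
Qed.

Lemma continuous_integ (T : topologicalType) (g : T * R -> R) (a b : R) : a <= b ->
  continuous g -> continuous (fun p => integ (fun t => g (p, t)) a b).
Proof.
move=> ab cg p; apply/cvgrPdist_le => e e0.
have e1 : 0 < e / (b - a + 1) by rewrite divr_gt0//; lra.
have := tube p a b cg e1; apply: filterS => q hq.
rewrite -integB; try exact: continuous_slice.
apply: (@le_trans _ _ (e / (b - a + 1) * (b - a))).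
  apply: integ_norm => //; last by move=> t /hq; rewrite distrC.
  by apply: contB; exact: continuous_slice.
rewrite mulrAC ler_pdivrMr; last by lra.
by rewrite ler_wpM2l// ?(ltW e0)//; lra.
Qed.

(** By the mean value theorem the difference quotient at [t] is [dg (c, t)] with [c] close to [x],
    and [tube] makes the error small uniformly in [t]. *)
Lemma is_derive_integ (g dg : R * R -> R) (a b x : R) : a <= b ->
  (forall x t, is_derive x 1 (fun x => g (x, t)) (dg (x, t))) ->
  continuous g -> continuous dg ->
  is_derive x 1 (fun x => integ (fun t => g (x, t)) a b) (integ (fun t => dg (x, t)) a b).
Proof.
move=> ab hd cg cdg; apply/is_deriveP/cvgrPdist_le => e e0.
have e1 : 0 < e / (b - a + 1) by rewrite divr_gt0//; lra.
have /nbhs_ballP[r r0 hr] := tube x a b cdg e1.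
near=> h.
have hh : `|h| < r by near: h; apply: dnbhs0_lt.
have h0 : h != 0 by near: h; exact: nbhs_dnbhs_neq.
have cs := fun y => continuous_slice (p := y) cg.
rewrite -integB// -integZ; last exact: contB.
have cq : continuous (fun t => h^-1 * (g (x + h, t) - g (x, t))).
  by apply: contZ; exact: contB.
rewrite -integB//; last exact: continuous_slice.
apply: (@le_trans _ _ (e / (b - a + 1) * (b - a))); last first.
  rewrite mulrAC ler_pdivrMr; last by lra.
  by rewrite ler_wpM2l// ?(ltW e0)//; lra.
apply: integ_norm => //.
  by apply: contB => //; exact: continuous_slice.
move=> t tab.
have key c : `|c - x| <= `|h| -> `|dg (x, t) - dg (c, t)| <= e / (b - a + 1).
  move=> cx; rewrite distrC; apply: (hr c) tab.
  by rewrite /ball/= distrC; exact: le_lt_trans hh.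
suff [c cx ->] : exists2 c, `|c - x| <= `|h| & h^-1 * (g (x + h, t) - g (x, t)) = dg (c, t).
  exact: key.
case: (leP 0 h) => hp.
  have [|c cx E] := @mvt (fun y => g (y, t)) (fun y => dg (y, t)) x (x + h) _ (hd^~ t).
    by rewrite lerDl.
  exists c; first by rewrite !ger0_norm//; lra.
  by rewrite E (addrC x) addrK mulrC mulfK.
have [|c cx E] := @mvt (fun y => g (y, t)) (fun y => dg (y, t)) (x + h) x _ (hd^~ t).
  by rewrite gerDl ltW.
exists c; first by rewrite (ltr0_norm hp) ler_norml; lra.
by rewrite -[X in _ * X]opprB E (_ : x - (x + h) = - h) ?mulrN ?opprK 1?mulrC ?mulfK//; ring.
Unshelve. all: by end_near. Qed.

End RealCalculus.

(** * Uniqueness of Fourier coefficients *)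

Section FourierUniqueness.
Variable R : realType.
Implicit Types (f g : R -> R).

Lemma cos_int (n : int) (x : R) : cos (x + 2 * pi * n%:~R) = cos x.
Proof.
have P (m : nat) (y : R) : cos (y + 2 * pi * m%:R) = cos y.
  elim: m y => [|m IH] y; first by rewrite mulr0 addr0.
  by rewrite -natr1 (_ : _ + _ = y + 2 * pi * m%:R + pi *+ 2) ?cosD2pi ?IH//; ring.
case: n => m; first by rewrite -pmulrn P.
have := P m.+1 (x - 2 * pi * m.+1%:R); rewrite addrNK => ->.
by rewrite NegzE mulrNz -pmulrn mulrN.
Qed.

Lemma sin_int (n : int) (x : R) : sin (x + 2 * pi * n%:~R) = sin x.
Proof.
have E y : sin y = cos (y - pi / 2).
  by rewrite -cosN opprB cosB cos_pihalf sin_pihalf mul0r mul1r add0r.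
by rewrite !E addrAC cos_int.
Qed.

Lemma eq_cont (T : topologicalType) (u v : T -> R) :
  u =1 v -> continuous u -> continuous v.
Proof. by move=> /funext ->. Qed.

Lemma cont_cos_lin (a b : R) : continuous (fun t => cos (a * t + b)).
Proof.
apply: cont_comp; first exact: continuous_cos.
by apply: contD; [apply: contZ => x; exact: cvg_id|exact: cont_cst].
Qed.

(** Multiplication by [cos (2 pi (t - x0))] only shifts the frequency by one and changes the phase,
    so the hypothesis, which covers all frequencies and phases, is inherited. *)
Lemma fourier_kernel f (x0 : R) (d : R) n (k : int) (p : R) : continuous f ->
  (forall (k : int) p, integ (fun t => f t * cos (2 * pi * k%:~R * t + p)) 0 1 = 0) ->
  integ (fun t => f t * (1 + cos (2 * pi * (t - x0)) - d) ^+ n * cos (2 * pi * k%:~R * t + p)) 0 1 = 0.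
Proof.
move=> cf h; elim: n k p => [|n IH] k p.
  by under [X in integ X]eq_fun do rewrite expr0 mulr1; exact: h.
have cK m : continuous (fun t => f t * (1 + cos (2 * pi * (t - x0)) - d) ^+ m).
  apply: contM => //; apply: (@cont_comp _ _ (fun x => x ^+ m)).
    exact: exprn_continuous.
  apply: contB; last exact: cont_cst.
  apply: contD; first exact: cont_cst.
  by apply: eq_cont (@cont_cos_lin (2 * pi) (- (2 * pi * x0))) => t; rewrite mulrBr.
pose c := 1 - d.
pose K t := f t * (1 + cos (2 * pi * (t - x0)) - d) ^+ n.
rewrite (@eq_integ _ _ (fun t => c * (K t * cos (2 * pi * k%:~R * t + p)) +
    (2^-1 * (K t * cos (2 * pi * (k + 1)%:~R * t + (p - 2 * pi * x0))) +
     2^-1 * (K t * cos (2 * pi * (k - 1)%:~R * t + (p + 2 * pi * x0)))))).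
  have cKc a b : continuous (fun t => K t * cos (a * t + b)).
    by apply: contM => //; [exact: cK|exact: cont_cos_lin].
  rewrite !(integD, integZ) ?IH ?mulr0 ?addr0//; try exact: contZ.
  by apply: contD; exact: contZ.
move=> t; rewrite /K /c exprS.
set A := cos (2 * pi * (t - x0)); set X := _ ^+ n; set F := f t.
rewrite (_ : 2 * pi * (k + 1)%:~R * t + (p - 2 * pi * x0) =
  (2 * pi * k%:~R * t + p) + 2 * pi * (t - x0)); last by rewrite intrD; ring.
rewrite (_ : 2 * pi * (k - 1)%:~R * t + (p + 2 * pi * x0) =
  (2 * pi * k%:~R * t + p) - 2 * pi * (t - x0)); last by rewrite intrB; ring.
rewrite (cosD (_ + p)) (cosB (_ + p)) -/A; by field.
Qed.

Lemma expr_unbounded (q M : R) : 1 < q -> exists n, M < q ^+ n.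
Proof.
move=> q1; have [n hn] : exists n : nat, M / (q - 1) < n%:R.
  by exists (Num.truncn (M / (q - 1))).+1; exact: truncnS_gt.
exists n; apply: (@lt_le_trans _ _ (1 + n%:R * (q - 1))).
  by move: hn; rewrite ltr_pdivrMr; lra.
elim: n {hn} => [|n IH]; first by rewrite mul0r addr0 expr0.
rewrite exprS -natr1; have : 0 <= n%:R :> R by [].
move=> n0; have : 0 <= n%:R * (q - 1) * (q - 1) by rewrite !mulr_ge0//; lra.
have : q * (1 + n%:R * (q - 1)) <= q * q ^+ n by rewrite ler_wpM2l//; lra.
lra.
Qed.

(* The trigonometric polynomials [(1 + cos (2 pi (t - x0)) - cos (2 pi d)) ^ n]
   concentrate near [x0]. *)
Lemma fourier_unique_pos f (x0 : R) : continuous f -> (forall x, f (x + 1) = f x) ->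
  (forall (k : int) p, integ (fun t => f t * cos (2 * pi * k%:~R * t + p)) 0 1 = 0) ->
  ~ 0 < f x0.
Proof.
move=> cf fp h fx0.
have [d d0 [d4 hd]] : exists2 d, 0 < d & d <= 4^-1 /\
    forall t, x0 - d <= t <= x0 + d -> f x0 / 2 <= f t.
  have e0 : 0 < f x0 / 2 by rewrite divr_gt0.
  have /cvgrPdist_le /(_ _ e0) /nbhs_ballP[r /= r0 hr] := cf x0.
  exists (Num.min (r / 2) 4^-1); first by rewrite lt_min divr_gt0//= invr_gt0.
  split; first by rewrite ge_min lexx orbT.
  move=> t ht; have := hr t; rewrite /ball/= ler_distl.
  have m : Num.min (r / 2) 4^-1 <= r / 2 by rewrite ge_min lexx.
  move=> H; have /H : `|x0 - t| < r by rewrite distrC ltr_distl; lra.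
  by lra.
have pi0 := pi_gt0 R.
(* On the period around [x0], [p] is at least [q > 1] within [d / 2], at least 1 within [d], and of
   modulus at most 1 elsewhere. *)
pose p t := 1 + cos (2 * pi * (t - x0)) - cos (2 * pi * d).
pose q := p (x0 + d / 2).
have cosdec a b : 0 <= a -> a <= b -> b <= 2^-1 -> cos (2 * pi * b) <= cos (2 * pi * a) :> R.
  move=> a0 ab b2; have [->//|ne] := eqVneq a b; apply/ltW.
  have pp : 0 <= pi * a by rewrite mulr_ge0// ltW.
  have h1 : pi * a <= pi * b by rewrite ler_wpM2l// ltW.
  have h2 : pi * b <= pi * 2^-1 by rewrite ler_wpM2l// ltW.
  have h3 : pi * a < pi * b by rewrite ltr_pM2l// lt_neqAle ne.
  by rewrite ltr_cos ?in_itv/=; [lra|lra..].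
have cosE t : cos (2 * pi * (t - x0)) = cos (2 * pi * `|t - x0|).
  case: (leP 0 (t - x0)) => h0; first by rewrite ger0_norm.
  by rewrite ltr0_norm// mulrN cosN.
have q1 : 1 < q.
  rewrite /q /p (_ : x0 + d / 2 - x0 = d / 2); last by lra.
  rewrite -[ltLHS]addr0 -addrA ltrD2l subr_gt0.
  have h1 : 0 < pi * d by rewrite mulr_gt0.
  have h2 : pi * d <= pi * 4^-1 by rewrite ler_wpM2l// ltW.
  by rewrite ltr_cos ?in_itv/=; lra.
have p1 t : `|t - x0| <= d -> 1 <= p t.
  move=> ht; rewrite /p cosE -addrA lerDl subr_ge0; apply: cosdec => //; lra.
have pq t : `|t - x0| <= d / 2 -> q <= p t.
  move=> ht; rewrite /q /p (_ : x0 + d / 2 - x0 = d / 2); last by lra.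
  by rewrite lerD2r lerD2l cosE; apply: cosdec => //; lra.
have plo t : d <= `|t - x0| -> `|t - x0| <= 2^-1 -> `|p t| <= 1.
  move=> h1 h2; rewrite /p ler_norml cosE.
  have := cosdec _ _ (ltW d0) h1 h2.
  have := cos_geN1 (2 * pi * `|t - x0|).
  have h3 : cos (2 * pi * d) <= 1 by exact: cos_le1.
  have h4 : 0 <= cos (2 * pi * d).
    apply: cos_ge0_pihalf.
    have h1' : 0 < pi * d by rewrite mulr_gt0.
    have h2' : pi * d <= pi * 4^-1 by rewrite ler_wpM2l// ltW.
    lra.
  lra.
have [M hM] : exists M, forall t, x0 - 2^-1 <= t <= x0 + 2^-1 -> `|f t| <= M.
  have lex : x0 - 2^-1 <= x0 + 2^-1 by lra.
  have cn : {within `[x0 - 2^-1, x0 + 2^-1], continuous (fun t => `|f t|)}.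
    apply: continuous_subspaceT; apply: (@cont_comp R R (fun x => `|x|)) => //.
    exact: norm_continuous.
  have [c _ hc] := EVT_max lex cn.
  by exists (`|f c|) => t ht; apply: hc; rewrite in_itv.
(* For this [n] the points within [d / 2] of [x0] contribute more than [M] to an integral that is
   zero, while the points at distance at least [d] cannot take away more than [M (1 - 2 d)]. *)
have [n hn] := expr_unbounded (M / (f x0 / 2 * d)) q1.
have := @fourier_kernel f x0 (cos (2 * pi * d)) n 0 0 cf h.
pose K t := f t * p t ^+ n.
rewrite (@eq_integ _ _ K); last first.
  by move=> t; rewrite mulr0 mul0r addr0 cos0 mulr1 /K /p.
have cp : continuous p.
  apply: contB; last exact: cont_cst.
  apply: contD; first exact: cont_cst.
  by apply: eq_cont (@cont_cos_lin (2 * pi) (- (2 * pi * x0))) => t; rewrite mulrBr.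
have cK : continuous K.
  by apply: contM => //; apply: (@cont_comp _ _ (fun x => x ^+ n)) => //; exact: exprn_continuous.
have Kp t : K (t + 1) = K t.
  rewrite /K /p fp (_ : 2 * pi * (t + 1 - x0) = 2 * pi * (t - x0) + 2 * pi * 1%:~R).
    by rewrite cos_int.
  by ring.
rewrite -(integ_period (x0 - 2^-1) cK Kp) (_ : x0 - 2^-1 + 1 = x0 + 2^-1); last by field.
have M0 : 0 <= M by apply: le_trans (hM x0 _) => //; lra.
have hout a b : a <= b -> (forall t, a <= t <= b -> d <= `|t - x0| <= 2^-1) -> - M * (b - a) <= integ K a b.
  move=> ab hab; apply: integ_ge => // t tab; rewrite /K.
  have /andP[h1 h2] := hab _ tab.
  have := ler_norm (- (f t * p t ^+ n)); rewrite normrN normrM normrX.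
  have : `|f t| * `|p t| ^+ n <= M * 1.
    have f1 : `|f t| <= M by apply: hM; move: h2; rewrite ler_norml; lra.
    have f2 : `|p t| ^+ n <= 1 by rewrite exprn_ile1// plo.
    have f3 : 0 <= `|p t| ^+ n by exact: exprn_ge0.
    exact: ler_pM.
  lra.
have hin a b : a <= b -> x0 - d <= a -> b <= x0 + d -> 0 <= integ K a b.
  move=> ab h1 h2; have : 0 * (b - a) <= integ K a b; last by rewrite mul0r.
  apply: integ_ge => // t tab; rewrite /K mulr_ge0//.
    have := hd t; lra.
  by rewrite exprn_ge0// (le_trans ler01)// p1// ler_norml; lra.
have hmid : (f x0 / 2) * q ^+ n * (x0 + d / 2 - (x0 - d / 2)) <= integ K (x0 - d / 2) (x0 + d / 2).
  apply: integ_ge => // [|t tab]; first lra.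
  rewrite /K ler_pM//; [lra|by rewrite exprn_ge0//; lra|by apply: hd; lra|].
  rewrite lerXn2r ?nnegrE; [|lra| |]; last by apply: pq; rewrite ler_norml; lra.
    by [].
  by rewrite (le_trans ler01)// p1// ler_norml; lra.
rewrite -(integ_chasles K (x0 - d)) -(integ_chasles K (x0 - d / 2) (x0 - d)).
rewrite -(integ_chasles K (x0 + d / 2) (x0 - d / 2)) -(integ_chasles K (x0 + d) (x0 + d / 2)).
have i1 : - M * (x0 - d - (x0 - 2^-1)) <= integ K (x0 - 2^-1) (x0 - d).
  by apply: hout => [|t ht]; [lra|rewrite ler0_norm; lra].
have i2 : - M * (x0 + 2^-1 - (x0 + d)) <= integ K (x0 + d) (x0 + 2^-1).
  by apply: hout => [|t ht]; [lra|rewrite ger0_norm; lra].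
have i3 : 0 <= integ K (x0 - d) (x0 - d / 2) by apply: hin; lra.
have i4 : 0 <= integ K (x0 + d / 2) (x0 + d) by apply: hin; lra.
move: hmid hn; rewrite (_ : x0 + d / 2 - (x0 - d / 2) = d); last by field.
rewrite ltr_pdivrMr; last by rewrite mulr_gt0// divr_gt0.
have : 0 <= M * d by rewrite mulr_ge0// ltW.
set Q := q ^+ n; set X := integ K _ _; lra.
Qed.

Lemma fourier_unique f : continuous f -> (forall x, f (x + 1) = f x) ->
  (forall (k : int) p, integ (fun t => f t * cos (2 * pi * k%:~R * t + p)) 0 1 = 0) ->
  forall x, f x = 0.
Proof.
move=> cf fp h x; apply/eqP; rewrite eq_le leNgt; apply/andP; split.
  by apply/negP; exact: fourier_unique_pos.
rewrite leNgt -oppr_gt0; apply/negP; apply: (@fourier_unique_pos (fun t => - f t)) => //.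
- exact: contN.
- by move=> t; rewrite fp.
- move=> k p; rewrite (@eq_integ _ _ (fun t => - (f t * cos (2 * pi * k%:~R * t + p)))).
    rewrite integN ?h ?oppr0//; apply: contM => //; exact: cont_cos_lin.
  by move=> t; rewrite mulNr.
Qed.

End FourierUniqueness.

(** * Complex analysis *)

Section ComplexCalculus.
Variable R : realType.
Local Notation C := R[i].
Local Notation Re := (@complex.Re R).
Local Notation Im := (@complex.Im R).
Implicit Types (f g : C -> C) (z w d : C).
Local Open Scope complex_scope.

(** The norm of [R[i]] takes its values in [R[i]]; its real part brings the estimates back to the
    ordered field [R]. *)
Definition cmod z : R := Re `|z|.

Lemma cmodE z : `|z| = (cmod z)%:C.
Proof. by rewrite /cmod normc_def. Qed.

Lemma cmod_sqrt z : cmod z = Num.sqrt (Re z ^+ 2 + Im z ^+ 2).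
Proof. by rewrite /cmod normc_def. Qed.

Lemma cmod_ge0 z : 0 <= cmod z.
Proof. by rewrite cmod_sqrt sqrtr_ge0. Qed.

Lemma cmodM z w : cmod (z * w) = cmod z * cmod w.
Proof. by apply: (@complexI R); rewrite rmorphM/= -!cmodE normrM. Qed.

Lemma cmodN z : cmod (- z) = cmod z.
Proof. by apply: (@complexI R); rewrite -!cmodE normrN. Qed.

Lemma cmodV z : cmod z^-1 = (cmod z)^-1.
Proof. by apply: (@complexI R); rewrite fmorphV/= -!cmodE normfV. Qed.

Lemma cmodX z n : cmod (z ^+ n) = cmod z ^+ n.
Proof. by apply: (@complexI R); rewrite rmorphXn/= -!cmodE normrX. Qed.

Lemma cmodD z w : cmod (z + w) <= cmod z + cmod w.
Proof. by rewrite -lecR rmorphD/= -!cmodE ler_normD. Qed.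

Lemma cmodB z w : cmod (z - w) <= cmod z + cmod w.
Proof. by rewrite -(cmodN w) cmodD. Qed.

Lemma cmodBC z w : cmod (z - w) = cmod (w - z).
Proof. by rewrite -cmodN opprB. Qed.

Lemma cmod0 : cmod 0 = 0.
Proof. by apply: (@complexI R); rewrite -cmodE normr0. Qed.

Lemma cmod1 : cmod 1 = 1.
Proof. by apply: (@complexI R); rewrite -cmodE normr1. Qed.

Lemma cmod_eq0 z : (cmod z == 0) = (z == 0).
Proof. by rewrite -[RHS]normr_eq0 cmodE (inj_eq (@complexI R) _ 0). Qed.

Lemma cmod_gt0 z : (0 < cmod z) = (z != 0).
Proof. by rewrite lt_neqAle cmod_ge0 andbT eq_sym cmod_eq0. Qed.

Lemma cmodR (x : R) : cmod x%:C = `|x|.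
Proof. by rewrite cmod_sqrt/= expr0n addr0 sqrtr_sqr. Qed.

Lemma cmod_nat n : cmod n%:R = n%:R.
Proof.
by rewrite -(rmorph_nat (@real_complex R)) cmodR ger0_norm.
Qed.

Lemma Re_le_cmod z : `|Re z| <= cmod z.
Proof. by rewrite cmod_sqrt -sqrtr_sqr ler_wsqrtr// lerDl sqr_ge0. Qed.

Lemma Im_le_cmod z : `|Im z| <= cmod z.
Proof. by rewrite cmod_sqrt -sqrtr_sqr ler_wsqrtr// lerDr sqr_ge0. Qed.

Lemma cmod_le_ReIm z : cmod z <= `|Re z| + `|Im z|.
Proof.
case: z => x y /=.
have -> : x +i* y = x%:C + 'i * y%:C by simpc.
rewrite (le_trans (cmodD _ _))// cmodM !cmodR.
have -> : cmod 'i = 1 by rewrite cmod_sqrt/= expr0n expr1n add0r sqrtr1.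
by rewrite mul1r.
Qed.

Lemma cReD z w : Re (z + w) = Re z + Re w. Proof. by case: z w => ? ? []. Qed.
Lemma cImD z w : Im (z + w) = Im z + Im w. Proof. by case: z w => ? ? []. Qed.
Lemma cReN z : Re (- z) = - Re z. Proof. by case: z. Qed.
Lemma cImN z : Im (- z) = - Im z. Proof. by case: z. Qed.
Lemma cReM z w : Re (z * w) = Re z * Re w - Im z * Im w. Proof. by case: z w => ? ? []. Qed.
Lemma cImM z w : Im (z * w) = Re z * Im w + Im z * Re w. Proof. by case: z w => ? ? []. Qed.

Definition cReIm := (cReD, cImD, cReN, cImN, cReM, cImM).

Lemma complex_eqP z w : Re z = Re w -> Im z = Im w -> z = w.
Proof. by case: z w => ? ? [? ?] /= -> ->. Qed.

Lemma posC (e : C) : 0 < e -> e = (Re e)%:C /\ 0 < Re e.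
Proof. by rewrite ltcE/= => /andP[/eqP h0 h]; split => //; case: e h0 h => a b /= ->. Qed.

Lemma nbhsCP (P : C -> Prop) z :
  (\forall w \near z, P w) <-> exists2 r : R, 0 < r & forall w, cmod (w - z) < r -> P w.
Proof.
split=> [/nbhs_ballP[e /posC[-> e0] h]|[r r0 h]].
  exists (Re e) => // w wz; apply: h.
  by rewrite -ball_normE/ball_/= cmodE ltcR cmodBC.
apply/nbhs_ballP; exists r%:C; first by rewrite /= ltcR.
by move=> w; rewrite -ball_normE/ball_/= cmodE ltcR cmodBC; exact: h.
Qed.

Lemma dnbhsCP (P : C -> Prop) z :
  (\forall w \near z^', P w) <->
  exists2 r : R, 0 < r & forall w, w != z -> cmod (w - z) < r -> P w.
Proof.
split=> [/nbhsCP[r r0 h]|[r r0 h]].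
  by exists r => // w wz /h; apply.
by apply/nbhsCP; exists r => // w wr wz; exact: h.
Qed.

Lemma cvgCP (T : Type) (F : set_system T) {FF : Filter F} (f : T -> C) (l : C) :
  (f x @[x --> F] --> l) <-> forall e : R, 0 < e -> \forall x \near F, cmod (f x - l) <= e.
Proof.
split=> [/cvgrPdist_le h e e0|h].
  have := h e%:C; rewrite ltcR => /(_ e0); apply: filterS => x.
  by rewrite cmodE lecR cmodBC.
apply/cvgrPdist_le => e /posC[-> e0]; have := h _ e0; apply: filterS => x.
by rewrite cmodE lecR cmodBC.
Qed.

(** This quotient-free form includes [h = 0], so that a composition can be treated even when the
    inner increment vanishes. *)
Lemma cderP f z d : is_derive z (1 : C) f d <->
  forall e : R, 0 < e -> exists2 r : R, 0 < r &
    forall h, cmod h < r -> cmod (f (z + h) - f z - d * h) <= e * cmod h.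
Proof.
pose q (h : C) := h^-1 *: ((f \o shift z) (h *: (1 : C)) - f z).
have qE h : q h = h^-1 * (f (z + h) - f z).
  by rewrite /q/= [_%:A]mulr1 (addrC h z).
have key : (q h @[h --> (0 : C)^'] --> d) <-> forall e : R, 0 < e -> exists2 r : R, 0 < r &
    forall h, cmod h < r -> cmod (f (z + h) - f z - d * h) <= e * cmod h.
  split=> [/cvgCP H e /H/dnbhsCP[r r0 h]|H].
    exists r => // w wr; have [->|w0] := eqVneq w 0.
      by rewrite addr0 subrr mulr0 subr0 cmod0 mulr0.
    have := h w w0; rewrite subr0 => /(_ wr); rewrite qE.
    have -> : w^-1 * (f (z + w) - f z) - d = w^-1 * (f (z + w) - f z - d * w) by field.
    by rewrite cmodM cmodV ler_pdivrMl ?cmod_gt0// (mulrC e).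
  apply/cvgCP => e /H[r r0 h]; apply/dnbhsCP; exists r => // w w0; rewrite subr0 => /h.
  rewrite qE => hw.
  have -> : w^-1 * (f (z + w) - f z) - d = w^-1 * (f (z + w) - f z - d * w) by field.
  by rewrite cmodM cmodV ler_pdivrMl ?cmod_gt0// (mulrC (cmod w)).
rewrite -key; split=> [[df <-]|h]; first exact: df.
split; first by apply/cvg_ex; exists d.
by apply: cvg_lim h.
Qed.

Lemma cderD f g z a b : is_derive z (1 : C) f a -> is_derive z (1 : C) g b ->
  is_derive z (1 : C) (fun t => f t + g t) (a + b).
Proof. by move=> hf hg; exact: is_deriveD. Qed.

Lemma cderN f z a : is_derive z (1 : C) f a -> is_derive z (1 : C) (fun t => - f t) (- a).
Proof. by move=> hf; exact: is_deriveN. Qed.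

Lemma cderB f g z a b : is_derive z (1 : C) f a -> is_derive z (1 : C) g b ->
  is_derive z (1 : C) (fun t => f t - g t) (a - b).
Proof. by move=> hf hg; exact: is_deriveB. Qed.

Lemma cderM f g z a b : is_derive z (1 : C) f a -> is_derive z (1 : C) g b ->
  is_derive z (1 : C) (fun t => f t * g t) (a * g z + f z * b).
Proof.
move=> hf hg; have := is_deriveM hf hg.
by congr is_derive; rewrite /GRing.scale/=; ring.
Qed.

Lemma cder_cst z (c : C) : is_derive z (1 : C) (fun _ : C => c) 0.
Proof. exact: is_derive_cst. Qed.

Lemma cder_id z : is_derive z (1 : C) (fun t : C => t) 1.
Proof. exact: is_derive_id. Qed.

Lemma cderZ f z a (c : C) : is_derive z (1 : C) f a -> is_derive z (1 : C) (fun t => c * f t) (c * a).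
Proof.
by move=> hf; have := cderM (cder_cst z c) hf; rewrite mul0r add0r.
Qed.

Lemma cder_eq f z a b : is_derive z (1 : C) f a -> a = b -> is_derive z (1 : C) f b.
Proof. by move=> ? <-. Qed.

Lemma cder_cont f z a : is_derive z (1 : C) f a ->
  forall e : R, 0 < e -> exists2 r : R, 0 < r & forall h, cmod h < r -> cmod (f (z + h) - f z) <= e.
Proof.
move=> /cderP H e e0; have [r r0 h] := H 1 ltr01.
have k0 : 0 < cmod a + 1 by rewrite ltr_wpDl ?cmod_ge0.
exists (Num.min r (e / (cmod a + 1))); first by rewrite lt_min r0 divr_gt0.
move=> u; rewrite lt_min => /andP[/h h1 h2].
rewrite (_ : f (z + u) - f z = (f (z + u) - f z - a * u) + a * u); last by ring.
apply: le_trans (cmodD _ _) _; rewrite cmodM.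
move: h2; rewrite ltr_pdivlMr// => h2; lra.
Qed.

Lemma cder_comp f g z a b : is_derive (g z) (1 : C) f a -> is_derive z (1 : C) g b ->
  is_derive z (1 : C) (fun t => f (g t)) (a * b).
Proof.
move=> hf hg; have cg := cder_cont hg.
apply/cderP => e e0; move/cderP in hf; move/cderP in hg.
have ka : 0 < cmod a + 1 by rewrite ltr_wpDl ?cmod_ge0.
have kb : 0 < cmod b + 1 by rewrite ltr_wpDl ?cmod_ge0.
have e1 : 0 < e / 2 / (cmod b + 1) by rewrite !divr_gt0.
have e2 : 0 < Num.min 1 (e / 2 / (cmod a + 1)) by rewrite lt_min ltr01 !divr_gt0.
have [r1 r10 h1] := hf _ e1; have [r2 r20 h2] := hg _ e2.
have r12 : 0 < r1 / 2 by rewrite divr_gt0.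
have [r3 r30 h3] := cg _ r12.
exists (Num.min r2 r3); first by rewrite lt_min r20.
move=> u; rewrite lt_min => /andP[u2 u3].
set k := g (z + u) - g z.
have -> : g (z + u) = g z + k by rewrite /k; ring.
have kr : cmod k < r1 by apply: le_lt_trans (h3 _ u3) _; lra.
have hk := h2 _ u2; rewrite -/k in hk.
have m1 : Num.min 1 (e / 2 / (cmod a + 1)) <= 1 by rewrite ge_min lexx.
have m2 : Num.min 1 (e / 2 / (cmod a + 1)) <= e / 2 / (cmod a + 1) by rewrite ge_min lexx orbT.
have u0 := cmod_ge0 u.
have hk1 : cmod (k - b * u) <= cmod u by apply: le_trans hk _; rewrite ler_piMl.
have hk2 : cmod (k - b * u) <= e / 2 / (cmod a + 1) * cmod u by apply: le_trans hk _; rewrite ler_wpM2r.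
have kb' : cmod k <= (cmod b + 1) * cmod u.
  rewrite (_ : k = (k - b * u) + b * u); last by ring.
  apply: le_trans (cmodD _ _) _; rewrite cmodM; lra.
have := h1 _ kr; set X := f (g z + k) - f (g z) => hX.
rewrite (_ : X - a * b * u = (X - a * k) + a * (k - b * u)); last by ring.
apply: le_trans (cmodD _ _) _; rewrite cmodM.
have q1 : cmod (X - a * k) <= e / 2 * cmod u.
  apply: le_trans hX _.
  apply: (@le_trans _ _ (e / 2 / (cmod b + 1) * ((cmod b + 1) * cmod u))).
    by rewrite ler_wpM2l// ltW.
  by rewrite mulrA divfK// gt_eqF.
have q2 : cmod a * cmod (k - b * u) <= e / 2 * cmod u.
  apply: (@le_trans _ _ ((cmod a + 1) * (e / 2 / (cmod a + 1) * cmod u))).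
    by apply: ler_pM; rewrite ?cmod_ge0// lerDl.
  by rewrite mulrA [_ * (e / 2 / _)]mulrC divfK// gt_eqF.
lra.
Qed.

Lemma cder_inv w : w != 0 -> is_derive w (1 : C) (fun t : C => t^-1) (- w ^- 2).
Proof.
move=> w0; apply/cderP => e e0; have cw : 0 < cmod w by rewrite cmod_gt0.
exists (Num.min (cmod w / 2) (e * cmod w ^+ 3 / 2)).
  by rewrite lt_min !divr_gt0// mulr_gt0// exprn_gt0.
move=> h; rewrite lt_min => /andP[h1 h2].
have wh : cmod w / 2 <= cmod (w + h).
  have := cmodB (w + h) h; rewrite addrK; lra.
have wh0 : w + h != 0 by rewrite -cmod_gt0; lra.
rewrite (_ : _ - _ = h * (h / (w ^+ 2 * (w + h)))); last by field; rewrite w0 wh0.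
rewrite cmodM mulrC ler_wpM2r ?cmod_ge0// cmodM cmodV cmodM cmodX.
rewrite ler_pdivrMr; last by rewrite mulr_gt0 ?exprn_gt0//; lra.
apply: le_trans (ltW h2) _.
rewrite (_ : e * cmod w ^+ 3 / 2 = e * (cmod w ^+ 2 * (cmod w / 2))); last by ring.
by rewrite ler_wpM2l ?(ltW e0)// ler_wpM2l// exprn_ge0// ltW.
Qed.

Lemma cderV f z a : f z != 0 -> is_derive z (1 : C) f a ->
  is_derive z (1 : C) (fun t => (f t)^-1) (- a / f z ^+ 2).
Proof.
move=> fz hf; apply: cder_eq (cder_comp (cder_inv fz) hf) _.
by rewrite mulNr mulrC mulNr.
Qed.

Lemma cexpD z w : cexp (z + w) = cexp z * cexp w.
Proof.
case: z w => a b [c d]; rewrite /cexp/= expRD cosD sinD.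
by apply: complex_eqP => /=; ring.
Qed.

Lemma cexp0 : cexp (0 : C) = 1.
Proof. by rewrite /cexp/= expR0 cos0 sin0 mulr1 mulr0. Qed.

Lemma cmod_cexp z : cmod (cexp z) = expR (Re z).
Proof.
case: z => a b /=; rewrite cmod_sqrt/=.
rewrite (_ : _ + _ = expR a ^+ 2 * (cos b ^+ 2 + sin b ^+ 2)); last by ring.
by rewrite cos2Dsin2 mulr1 sqrtr_sqr ger0_norm// expR_ge0.
Qed.

Lemma cexp_neq0 z : cexp z != 0.
Proof. by rewrite -cmod_gt0 cmod_cexp expR_gt0. Qed.

Lemma cexpN z : cexp (- z) = (cexp z)^-1.
Proof.
apply: (mulIf (cexp_neq0 z)); rewrite -cexpD addNr cexp0 mulVf//; exact: cexp_neq0.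
Qed.

Lemma derive_eps (f : R -> R) (x d e : R) : is_derive x 1 f d -> 0 < e ->
  exists2 r, 0 < r & forall h, `|h| < r -> `|f (x + h) - f x - d * h| <= e * `|h|.
Proof.
move=> /is_deriveP/cvgrPdist_le h /h.
rewrite /dnbhs/= => /nbhs_ballP[r r0 hr]; exists r => // u ur.
have [->|u0] := eqVneq u 0; first by rewrite addr0 subrr mulr0 subr0 normr0 mulr0.
have := hr u; rewrite /ball/= sub0r normrN => /(_ ur u0).
rewrite distrC (_ : _ - d = u^-1 * (f (x + u) - f x - d * u)); last by field.
by rewrite normrM normfV ler_pdivrMl ?normr_gt0// (mulrC e).
Qed.

(** Multiplicativity reduces the claim to the origin, where the first-order expansions of [expR],
    [cos] and [sin] are combined; the share [e / 8] given to each leaves room for the cross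
    terms. *)
Lemma cder_cexp z : is_derive z (1 : C) (@cexp R) (cexp z).
Proof.
suff H : forall e : R, 0 < e -> exists2 r : R, 0 < r &
    forall h, cmod h < r -> cmod (cexp h - 1 - h) <= e * cmod h.
  apply/cderP => e e0.
  have ez : 0 < e / expR (Re z) by rewrite divr_gt0// expR_gt0.
  have [r r0 h] := H _ ez; exists r => // u ur.
  rewrite cexpD (_ : _ - _ = cexp z * (cexp u - 1 - u)); last by ring.
  rewrite cmodM cmod_cexp -ler_pdivlMl ?expR_gt0// mulrA.
  by apply: le_trans (h _ ur) _; rewrite [X in _ <= X * _]mulrC.
move=> e e0.
have e8 : 0 < Num.min 1 (e / 8) by rewrite lt_min ltr01 divr_gt0.
have [r1 r10 h1] := derive_eps (is_derive_expR (0 : R)) e8.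
have [r2 r20 h2] := derive_eps (is_derive_cos (0 : R)) e8.
have [r3 r30 h3] := derive_eps (is_derive_sin (0 : R)) e8.
set e' := Num.min 1 _ in e8 h1 h2 h3.
have e'1 : e' <= 1 by rewrite /e' ge_min lexx.
have e'2 : e' <= e / 8 by rewrite /e' ge_min lexx orbT.
exists (Num.min (Num.min r1 r2) (Num.min r3 (Num.min (1/2) (e / 8)))).
  by rewrite !lt_min r10 r20 r30/= !divr_gt0.
move=> [a b]; rewrite !lt_min => /andP[/andP[u1 u2] /andP[u3 /andP[u4 u5]]].
set u := a +i* b in u1 u2 u3 u4 u5 *.
have au := Re_le_cmod u; have bu := Im_le_cmod u; rewrite /= in au bu.
have := h1 a (le_lt_trans au u1); have := h2 b (le_lt_trans bu u2).
have := h3 b (le_lt_trans bu u3).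
rewrite !add0r expR0 cos0 sin0 oppr0 mul0r !subr0 !mul1r ?addr0 => k3 k2 k1.
have cu := cmod_ge0 u.
have m1 : e' * `|a| <= e' * cmod u by rewrite ler_wpM2l// ltW.
have m2 : e' * `|b| <= e' * cmod u by rewrite ler_wpM2l// ltW.
have m3 : e' * cmod u <= e / 8 * cmod u by rewrite ler_wpM2r.
have m4 : e' * cmod u <= cmod u by rewrite ler_piMl.
have E1 : `|expR a - 1| <= 2 * cmod u.
  rewrite (_ : expR a - 1 = (expR a - 1 - a) + a); last by ring.
  apply: le_trans (ler_normD _ _) _; lra.
have E2 : expR a <= 2.
  move: E1; rewrite ler_norml; lra.
have ea := expR_ge0 a.
apply: le_trans (cmod_le_ReIm _) _; rewrite !cReIm/= oppr0 ?addr0 ?subr0.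
rewrite (_ : expR a * cos b - 1 - a = (expR a - 1 - a) + expR a * (cos b - 1)); last by ring.
rewrite (_ : expR a * sin b - b = expR a * (sin b - b) + (expR a - 1) * b); last by ring.
apply: le_trans (lerD (ler_normD _ _) (ler_normD _ _)) _.
rewrite !normrM (ger0_norm ea).
have p1 : expR a * `|cos b - 1| <= 2 * (e / 8 * cmod u) by apply: ler_pM => //; lra.
have p2 : expR a * `|sin b - b| <= 2 * (e / 8 * cmod u) by apply: ler_pM => //; lra.
have p3 : `|expR a - 1| * `|b| <= 2 * (e / 8) * cmod u.
  by apply: ler_pM => //; lra.
have eu : 0 <= e * cmod u by rewrite mulr_ge0// ltW.
lra.
Qed.

End ComplexCalculus.

(** * Contour integrals along rectangles *)

Section Goursat.
Variable R : realType.
Local Notation C := R[i].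
Local Notation Re := (@complex.Re R).
Local Notation Im := (@complex.Im R).
Implicit Types (G : C -> C) (u v : R -> C).
Local Open Scope complex_scope.

Definition ci : C := 0 +i* 1.

Definition ccont G := forall z (e : R), 0 < e ->
  exists2 r : R, 0 < r & forall w, cmod (w - z) < r -> cmod (G w - G z) <= e.

Definition rcont u := continuous (fun t => Re (u t)) /\ continuous (fun t => Im (u t)).

Definition cinteg u (a b : R) : C := integ (fun t => Re (u t)) a b +i* integ (fun t => Im (u t)) a b.

Lemma rcont_ext u v : u =1 v -> rcont u -> rcont v.
Proof. by move=> /funext ->. Qed.

Lemma eq_cinteg u v a b : u =1 v -> cinteg u a b = cinteg v a b.
Proof. by move=> /funext ->. Qed.

Lemma rcontD u v : rcont u -> rcont v -> rcont (fun t => u t + v t).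
Proof.
move=> [u1 u2] [v1 v2]; split.
  by apply: eq_cont (contD u1 v1) => t; rewrite cReD.
by apply: eq_cont (contD u2 v2) => t; rewrite cImD.
Qed.

Lemma rcontM u v : rcont u -> rcont v -> rcont (fun t => u t * v t).
Proof.
move=> [u1 u2] [v1 v2]; split.
  by apply: eq_cont (contB (contM u1 v1) (contM u2 v2)) => t; rewrite cReM.
by apply: eq_cont (contD (contM u1 v2) (contM u2 v1)) => t; rewrite cImM.
Qed.

Lemma rcont_cst (c : C) : rcont (fun=> c).
Proof. by split; exact: cont_cst. Qed.

Lemma rcontB u v : rcont u -> rcont v -> rcont (fun t => u t - v t).
Proof.
move=> hu hv; apply: rcont_ext (rcontD hu (rcontM (rcont_cst (-1)) hv)) => t.
by rewrite mulN1r.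
Qed.

Lemma cintegD u v a b : rcont u -> rcont v -> cinteg (fun t => u t + v t) a b = cinteg u a b + cinteg v a b.
Proof.
move=> [u1 u2] [v1 v2]; apply: complex_eqP; rewrite ?cReD ?cImD/= -integD//; apply: eq_integ => t.
  by rewrite cReD.
by rewrite cImD.
Qed.

Lemma cintegZ (c : C) u a b : rcont u -> cinteg (fun t => c * u t) a b = c * cinteg u a b.
Proof.
move=> [u1 u2]; apply: complex_eqP; rewrite ?cReM ?cImM/=.
  rewrite -!integZ// -integB; try exact: contZ.
  by apply: eq_integ => t; rewrite cReM.
rewrite -!integZ// -integD; try exact: contZ.
by apply: eq_integ => t; rewrite cImM.
Qed.

Lemma cintegB u v a b : rcont u -> rcont v -> cinteg (fun t => u t - v t) a b = cinteg u a b - cinteg v a b.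
Proof.
move=> hu hv; rewrite -mulN1r -cintegZ// -cintegD//; last first.
  by apply: rcontM => //; exact: rcont_cst.
by apply: eq_cinteg => t; rewrite mulN1r.
Qed.

Lemma cinteg_chasles u c a b : cinteg u a c + cinteg u c b = cinteg u a b.
Proof. by apply: complex_eqP; rewrite ?cReD ?cImD/= integ_chasles. Qed.

(** The factor 2 comes from bounding real and imaginary parts separately; it enters the constants of
    [boundary_norm] and [cauchy_est]. *)
Lemma cinteg_norm u a b M : a <= b -> rcont u -> (forall t, a <= t <= b -> cmod (u t) <= M) ->
  cmod (cinteg u a b) <= 2 * M * (b - a).
Proof.
move=> ab [u1 u2] h; apply: le_trans (cmod_le_ReIm _) _ => /=.
have h1 : `|integ (fun t => Re (u t)) a b| <= M * (b - a).
  by apply: integ_norm => // t /h; exact: le_trans (Re_le_cmod _).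
have h2 : `|integ (fun t => Im (u t)) a b| <= M * (b - a).
  by apply: integ_norm => // t /h; exact: le_trans (Im_le_cmod _).
lra.
Qed.

Lemma cinteg_cst (c : C) a b : cinteg (fun=> c) a b = c * (b - a)%:C.
Proof.
have E (k : R) : integ (fun=> k) a b = k * (b - a).
  rewrite mulrBr; apply: (@integ_eq _ (fun t => k * t)) => t.
  by apply: drv_eq (drvZ k (drv_id t)) _; rewrite mulr1.
by apply: complex_eqP; rewrite ?cReM ?cImM/= !E; ring.
Qed.

Lemma cinteg_id a b : cinteg (fun t => t%:C) a b = ((b ^+ 2 - a ^+ 2) / 2)%:C.
Proof.
apply: complex_eqP => /=; last first.
  by rewrite (_ : integ _ _ _ = Im (cinteg (fun=> 0) a b))// cinteg_cst mul0r.
rewrite mulrBl; apply: (@integ_eq _ (fun t => t ^+ 2 / 2)) => t.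
apply: is_derive_ext (_ : is_derive t 1 (fun t => 2^-1 * (t * t)) _).
  by move=> s; rewrite mulrC expr2.
by apply: drv_eq (drvZ _ (drvM (drv_id t) (drv_id t))) _; by field.
Qed.

Lemma rcont_line G (p q : C) : ccont G -> rcont (fun t => G (p + q * t%:C)).
Proof.
move=> cG.
have H (x : R) (e : R) : 0 < e -> \forall y \near x, cmod (G (p + q * y%:C) - G (p + q * x%:C)) <= e.
  move=> e0; have [r r0 h] := cG (p + q * x%:C) _ e0.
  have k0 : 0 < r / (cmod q + 1) by rewrite divr_gt0// ltr_wpDl ?cmod_ge0.
  apply/nbhs_ballP; exists (r / (cmod q + 1)) => // y; rewrite /ball/= distrC => hy.
  apply: h; rewrite (_ : _ - _ = q * (y - x)%:C); last by rewrite rmorphB/=; ring.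
  move: hy; rewrite cmodM cmodR ltr_pdivlMr ?ltr_wpDl ?cmod_ge0// => hy.
  have := normr_ge0 (y - x); have := cmod_ge0 q; set A := `|_|; set B := cmod q => ? ?.
  by apply: le_lt_trans hy; rewrite mulrC ler_wpM2l// lerDl.
split=> x; apply/cvgrPdist_le => e e0; apply: filterS (H x e e0) => y; rewrite distrC.
  by apply: le_trans; rewrite -cReN -cReD; exact: Re_le_cmod.
by apply: le_trans; rewrite -cImN -cImD; exact: Im_le_cmod.
Qed.

Definition hseg G (y a b : R) := cinteg (fun t => G (ci * y%:C + 1 * t%:C)) a b.
Definition vseg G (x a b : R) := cinteg (fun t => G (x%:C + ci * t%:C)) a b.

(** The contour integral along the rectangle of lower left corner [(x, y)], counterclockwise; the
    factor [ci] is the velocity on the vertical sides. *)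
Definition boundary G (x y w h : R) : C :=
  hseg G y x (x + w) - hseg G (y + h) x (x + w)
  + ci * (vseg G (x + w) y (y + h) - vseg G x y (y + h)).

Lemma boundary_quad G x y w h :
  boundary G x y (w *+ 2) (h *+ 2) =
  boundary G x y w h + boundary G (x + w) y w h + boundary G x (y + h) w h + boundary G (x + w) (y + h) w h.
Proof.
rewrite /boundary !mulr2n !addrA /hseg /vseg.
rewrite -!(cinteg_chasles _ (x + w) x (x + w + w)) -!(cinteg_chasles _ (y + h) y (y + h + h)).
ring.
Qed.

Lemma boundaryB G H x y w h : ccont G -> ccont H ->
  boundary (fun z => G z - H z) x y w h = boundary G x y w h - boundary H x y w h.
Proof.
move=> cG cH; rewrite /boundary /hseg /vseg !cintegB; try exact: rcont_line.
ring.
Qed.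

Lemma boundary_affine (p q : C) x y w h : boundary (fun z => p + q * z) x y w h = 0.
Proof.
have cid : rcont (fun t : R => t%:C).
  have cI : ccont (fun z => z) by move=> z e e0; exists e => // u /ltW.
  by apply: rcont_ext (rcont_line 0 1 cI) => t; rewrite add0r mul1r.
have E (r s : C) a b : cinteg (fun t => p + q * (r + s * t%:C)) a b =
    (p + q * r) * (b - a)%:C + q * s * ((b ^+ 2 - a ^+ 2) / 2)%:C.
  rewrite -cinteg_cst -cinteg_id -cintegZ// -cintegD; last first.
  - by apply: rcontM => //; exact: rcont_cst.
  - exact: rcont_cst.
  by apply: eq_cinteg => t; ring.
rewrite /boundary /hseg /vseg !E.
rewrite !(rmorphB, rmorphD, rmorphM, rmorphXn, fmorphV)/=; ring.
Qed.

End Goursat.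

(** * Goursat's theorem on rectangles and its periodic form *)

Section Cauchy.
Variable R : realType.
Local Notation C := R[i].
Local Notation Re := (@complex.Re R).
Local Notation Im := (@complex.Im R).
Implicit Types (f g G : C -> C) (u v : R -> C).
Local Open Scope complex_scope.

Lemma nested_intervals (a W : nat -> R) : (forall n, 0 <= W n) ->
  (forall n, a n <= a n.+1) -> (forall n, a n.+1 + W n.+1 <= a n + W n) ->
  exists c, forall n, a n <= c <= a n + W n.
Proof.
move=> W0 a1 a2.
have am m n : (m <= n)%N -> a m <= a n.
  by move=> /subnK <-; elim: (n - m)%N => // k IH; rewrite addSn (le_trans IH).
have bm m n : (m <= n)%N -> a n + W n <= a m + W m.
  by move=> /subnK <-; elim: (n - m)%N => // k IH; rewrite addSn (le_trans (a2 _)).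
have ab m n : a m <= a n + W n.
  case: (leqP m n) => [mn|/ltnW nm]; first by rewrite (le_trans (am _ _ mn))// lerDl.
  by rewrite (le_trans _ (bm _ _ nm))// lerDl.
have ne : range a !=set0 by exists (a 0%N), 0%N.
exists (sup (range a)) => n; apply/andP; split.
  by apply: ub_le_sup; [exists (a 0%N + W 0%N) => _ [m _ <-]|exists n].
by apply: ge_sup => // _ [m _ <-].
Qed.

Lemma boundary_norm G x y w h M : ccont G -> 0 <= w -> 0 <= h ->
  (forall z, x <= Re z <= x + w -> y <= Im z <= y + h -> cmod (G z) <= M) ->
  cmod (boundary G x y w h) <= 4 * M * (w + h).
Proof.
move=> cG w0 h0 hM.
have xw : x <= x + w by rewrite lerDl.
have yh : y <= y + h by rewrite lerDl.
have hs y' : y <= y' <= y + h -> cmod (hseg G y' x (x + w)) <= 2 * M * w.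
  move=> hy; rewrite -[X in _ * X](addKr x) [X in _ * X]addrC.
  apply: cinteg_norm => //; first exact: rcont_line.
  by move=> t tx; apply: hM; rewrite !cReIm/=; move: tx hy; lra.
have vs x' : x <= x' <= x + w -> cmod (vseg G x' y (y + h)) <= 2 * M * h.
  move=> hx; rewrite -[X in _ * X](addKr y) [X in _ * X]addrC.
  apply: cinteg_norm => //; first exact: rcont_line.
  by move=> t ty; apply: hM; rewrite !cReIm/=; move: ty hx; lra.
have := hs y; have := hs (y + h); have := vs x; have := vs (x + w).
rewrite !lexx xw yh => /(_ erefl) a1 /(_ erefl) a2 /(_ erefl) a3 /(_ erefl) a4.
apply: le_trans (cmodD _ _) _; rewrite cmodM.
have -> : cmod (ci R) = 1 by rewrite cmod_sqrt/= expr0n expr1n add0r sqrtr1.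
rewrite mul1r.
apply: le_trans (lerD (cmodB _ _) (cmodB _ _)) _; lra.
Qed.

Lemma ccont_affine (p q : C) : ccont (fun z => p + q * z).
Proof.
move=> z e e0; have k0 : 0 < cmod q + 1 by rewrite ltr_wpDl ?cmod_ge0.
exists (e / (cmod q + 1)); first by rewrite divr_gt0.
move=> w; rewrite ltr_pdivlMr// => hw.
rewrite (_ : _ - _ = q * (w - z)); last by ring.
rewrite cmodM mulrC; apply: le_trans (ltW hw); rewrite ler_wpM2l ?cmod_ge0//.
by rewrite lerDl.
Qed.

Lemma ccontD f g : ccont f -> ccont g -> ccont (fun z => f z + g z).
Proof.
move=> cf cg z e e0; have e2 : 0 < e / 2 by rewrite divr_gt0.
have [r1 r10 h1] := cf z _ e2; have [r2 r20 h2] := cg z _ e2.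
exists (Num.min r1 r2); first by rewrite lt_min r10.
move=> w; rewrite lt_min => /andP[/h1 a1 /h2 a2].
rewrite (_ : _ - _ = (f w - f z) + (g w - g z)); last by ring.
by rewrite (splitr e) (le_trans (cmodD _ _))// lerD.
Qed.

Lemma ccontM f g : ccont f -> ccont g -> ccont (fun z => f z * g z).
Proof.
move=> cf cg z e e0.
have ka : 0 < cmod (f z) + 1 by rewrite ltr_wpDl ?cmod_ge0.
have kb : 0 < cmod (g z) + 1 by rewrite ltr_wpDl ?cmod_ge0.
have e1 : 0 < Num.min 1 (e / 2 / (cmod (g z) + 1)) by rewrite lt_min ltr01 !divr_gt0.
have e2 : 0 < e / 2 / (cmod (f z) + 1) by rewrite !divr_gt0.
have [r1 r10 h1] := cf z _ e1; have [r2 r20 h2] := cg z _ e2.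
have [r3 r30 h3] := cg z _ ltr01.
exists (Num.min r1 (Num.min r2 r3)); first by rewrite !lt_min r10 r20.
move=> w; rewrite !lt_min => /andP[/h1 a1 /andP[/h2 a2 /h3 a3]].
rewrite (_ : _ - _ = (f w - f z) * g w + f z * (g w - g z)); last by ring.
apply: le_trans (cmodD _ _) _; rewrite !cmodM.
have gw : cmod (g w) <= cmod (g z) + 1.
  rewrite (_ : g w = g z + (g w - g z)); last by ring.
  apply: le_trans (cmodD _ _) _; lra.
have m2 : Num.min 1 (e / 2 / (cmod (g z) + 1)) <= e / 2 / (cmod (g z) + 1) by rewrite ge_min lexx orbT.
have b1 : cmod (f w - f z) * cmod (g w) <= e / 2.
  rewrite -[leRHS](@divfK _ (cmod (g z) + 1)) ?gt_eqF// ler_pM ?cmod_ge0//.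
  exact: le_trans a1 m2.
have b2 : cmod (f z) * cmod (g w - g z) <= e / 2.
  rewrite mulrC -[leRHS](@divfK _ (cmod (f z) + 1)) ?gt_eqF// ler_pM ?cmod_ge0//.
  by rewrite lerDl.
lra.
Qed.

Lemma ccont_comp f g : (forall z (e : R), 0 < e -> exists2 r : R, 0 < r &
    forall h, cmod h < r -> cmod (f (g z + h) - f (g z)) <= e) ->
  ccont g -> ccont (fun z => f (g z)).
Proof.
move=> cf cg z e e0; have [r r0 h] := cf z _ e0.
have r2 : 0 < r / 2 by rewrite divr_gt0.
have [s s0 hs] := cg z _ r2; exists s => // w /hs hw.
by rewrite (_ : g w = g z + (g w - g z)); [apply: h; lra|ring].
Qed.

Lemma ccont_der f df : (forall z, is_derive z (1 : C) f (df z)) -> ccont f.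
Proof.
move=> hf z e e0; have [r r0 h] := cder_cont (hf z) e0; exists r => // w wr.
by have := h (w - z) wr; rewrite (addrC z) subrK.
Qed.

(** By bisection, some quarter keeps at least a quarter of the integral. At the common point [c] of
    the nested rectangles the affine part of [G] integrates to 0, and the rest is at most a small
    constant times the square of the size, which decreases like [4 ^- n]. *)
Theorem goursat G x y w h : ccont G -> 0 <= w -> 0 <= h ->
  (forall z, x <= Re z <= x + w -> y <= Im z <= y + h -> derivable G z (1 : C)) ->
  boundary G x y w h = 0.
Proof.
move=> cG w0 h0 dG.
pose W n := w / 2 ^+ n; pose H n := h / 2 ^+ n.
have p2 n : 0 < 2 ^+ n :> R by rewrite exprn_gt0.
have WS n : W n = W n.+1 *+ 2.
  by rewrite /W exprS mulr2n; field; rewrite gt_eqF.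
have HS n : H n = H n.+1 *+ 2.
  by rewrite /H exprS mulr2n; field; rewrite gt_eqF.
have W0 n : 0 <= W n by rewrite divr_ge0// ltW.
have H0 n : 0 <= H n by rewrite divr_ge0// ltW.
pose B n (p : R * R) := boundary G p.1 p.2 (W n) (H n).
pose P (k : nat * (R * R)) (q : R * R) :=
  [/\ k.2.1 <= q.1, q.1 + W k.1.+1 <= k.2.1 + W k.1,
      k.2.2 <= q.2, q.2 + H k.1.+1 <= k.2.2 + H k.1
    & cmod (B k.1 k.2) <= 4 * cmod (B k.1.+1 q)].
have [nx hnx] : {nx & forall k, P k (nx k)}.
  apply: choice => -[n [a b]]; rewrite /P/=.
  have := W0 n.+1; have := H0 n.+1.
  have : cmod (B n (a, b)) <= cmod (B n.+1 (a, b)) + cmod (B n.+1 (a + W n.+1, b))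
     + cmod (B n.+1 (a, b + H n.+1)) + cmod (B n.+1 (a + W n.+1, b + H n.+1)).
    rewrite /B/= WS HS boundary_quad.
    rewrite (le_trans (cmodD _ _))// lerD2r (le_trans (cmodD _ _))// lerD2r.
    exact: cmodD.
  rewrite (WS n) (HS n) !mulr2n.
  set b1 := cmod (B n.+1 (a, b)); set b2 := cmod (B n.+1 (a + _, b)).
  set b3 := cmod (B n.+1 (a, b + _)); set b4 := cmod (B n.+1 (a + _, b + _)).
  set b0 := cmod (B n _); set A1 := W n.+1; set A2 := H n.+1 => hb H1 H2.
  have [c1|c1] := leP b0 (4 * b1); first by exists (a, b); split=> //=; lra.
  have [c2|c2] := leP b0 (4 * b2); first by exists (a + A1, b); split=> //=; lra.
  have [c3|c3] := leP b0 (4 * b3); first by exists (a, b + A2); split=> //=; lra.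
  by exists (a + A1, b + A2); split=> //=; lra.
pose s := fix s n := if n is m.+1 then nx (m, s m) else (x, y).
have hs n : P (n, s n) (s n.+1) by exact: hnx.
have hB n : cmod (B 0%N (x, y)) <= 4 ^+ n * cmod (B n (s n)).
  elim: n => [|n IH]; first by rewrite expr0 mul1r.
  apply: le_trans IH _; rewrite exprSr -mulrA ler_wpM2l ?exprn_ge0//.
  by have [] := hs n.
have [|n|n|cx hcx] := @nested_intervals (fun n => (s n).1) W => //; try by have [] := hs n.
have [|n|n|cy hcy] := @nested_intervals (fun n => (s n).2) H => //; try by have [] := hs n.
have B0 : B 0%N (x, y) = boundary G x y w h by rewrite /B /W /H !expr0 !divr1.
have dc : derivable G (cx +i* cy) (1 : C).
  apply: dG => /=; [have := hcx 0%N|have := hcy 0%N].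
    by rewrite /= /W expr0 divr1.
  by rewrite /= /H expr0 divr1.
set c := cx +i* cy in dc; have {}dc := DeriveDef dc erefl.
move/cderP : dc; set d := 'D_1 G c => dc.
apply/eqP; rewrite -cmod_eq0 eq_le cmod_ge0 andbT -B0.
apply/ler_addgt0Pl => e e0; rewrite addr0.
have S0 : 0 < 4 * (w + h + 1) ^+ 2 by rewrite mulr_gt0// exprn_gt0//; lra.
have e1 : 0 < e / (4 * (w + h + 1) ^+ 2) by rewrite divr_gt0.
have [r r0 hr] := dc _ e1.
have [n hn] := expr_unbounded ((w + h) / r) (ltr1n R 2).
set e' := e / _ in e1 hr.
have Sn : W n + H n < r.
  by rewrite /W /H -mulrDl ltr_pdivrMr// mulrC -ltr_pdivrMr.
apply: le_trans (hB n) _.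
(* The first-order expansion of [G] at [c]; its boundary integral is 0 by [boundary_affine]. *)
pose L z := (G c - d * c) + d * z.
have cL : ccont L by exact: ccont_affine.
have -> : B n (s n) = boundary (fun z => G z - L z) (s n).1 (s n).2 (W n) (H n).
  by rewrite boundaryB// boundary_affine subr0.
have cGL : ccont (fun z => G z - L z).
  move=> z e2 e20; have c1 : ccont (fun z => -1 * L z).
    by apply: ccontM => //; have := ccont_affine (-1) 0; congr ccont; apply/funext => t; rewrite mul0r addr0.
  have [k k0 hk] := ccontD cG c1 z e20; exists k => // t /hk.
  by rewrite !mulN1r.
have := @boundary_norm _ (s n).1 (s n).2 (W n) (H n) (e' * (W n + H n)) cGL (W0 n) (H0 n).
have hb z : (s n).1 <= Re z <= (s n).1 + W n -> (s n).2 <= Im z <= (s n).2 + H n ->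
     cmod (G z - L z) <= e' * (W n + H n).
  move=> z1 z2; have zc : cmod (z - c) <= W n + H n.
    apply: le_trans (cmod_le_ReIm _) _; rewrite !cReIm/= lerD//.
      by have := hcx n; rewrite /= ler_norml; lra.
    by have := hcy n; rewrite /= ler_norml; lra.
  have := hr (z - c) (le_lt_trans zc Sn).
  rewrite (addrC c) subrK (_ : G z - G c - _ = G z - L z); last by rewrite /L; ring.
  by move/le_trans; apply; rewrite ler_wpM2l// ltW.
move=> /(_ hb) hb'.
apply: le_trans (ler_wpM2l _ hb') _; first by rewrite exprn_ge0.
rewrite (_ : 4 ^+ n * _ = e' * (4 * (w + h) ^+ 2)); last first.
  rewrite /W /H (_ : 4 = 2 ^+ 2 :> R); last by ring.
  by rewrite -exprM mulnC exprM; field; rewrite gt_eqF.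
apply: (@le_trans _ _ (e' * (4 * (w + h + 1) ^+ 2))); last first.
  by rewrite /e' divfK// gt_eqF.
rewrite ler_wpM2l ?(ltW e1)// ler_wpM2l// lerXn2r ?nnegrE; lra.
Qed.

(** The two horizontal sides of the rectangle of height 1 cancel by periodicity, so Goursat's
    theorem compares the vertical ones. *)
Lemma vseg_strip G X x1 x2 : ccont G -> (forall z, Re z < X -> derivable G z (1 : C)) ->
  (forall z, G (z + ci R) = G z) -> x1 <= x2 -> x2 < X ->
  vseg G x1 0 1 = vseg G x2 0 1.
Proof.
move=> cG dG pG x12 x2X.
have := @goursat G x1 0 (x2 - x1) 1 cG.
rewrite subr_ge0 x12 => /(_ erefl ler01 _).
rewrite /boundary add0r (addrC x1) subrK.
have -> : hseg G 1 x1 x2 = hseg G 0 x1 x2.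
  by apply: eq_cinteg => t; rewrite -(pG (ci R * 0%:C + _)); congr G; rewrite mulr0 mulr1; ring.
rewrite subrr add0r => H.
have /eqP : ci R * (vseg G x2 0 1 - vseg G x1 0 1) = 0.
  by apply: H => z /andP[_ zx] _; apply: dG; exact: le_lt_trans x2X.
rewrite mulf_eq0 subr_eq0 => /orP[|/eqP->//].
by rewrite -cmod_eq0 cmod_sqrt/= expr0n expr1n add0r sqrtr1 oner_eq0.
Qed.

End Cauchy.

(** * The identity theorem and the Cauchy estimate on discs *)

Section DiscTheory.
Variable R : realType.
Local Notation C := R[i].
Local Notation Re := (@complex.Re R).
Local Notation Im := (@complex.Im R).
Implicit Types (f g G : C -> C) (u v : R -> C).
Local Open Scope complex_scope.

Lemma cexp_ci (t : R) : cexp (ci R * t%:C) = cos t +i* sin t.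
Proof.
rewrite (_ : ci R * t%:C = 0 +i* t); last by apply: complex_eqP; rewrite /ci ?cReM ?cImM/=; ring.
by rewrite /cexp expR0 !mul1r.
Qed.

Lemma rcont_real (f : R -> R) : continuous f -> rcont (fun t => (f t)%:C).
Proof. by move=> cf; split => //=; exact: cont_cst. Qed.

Lemma cfourier_unique u : rcont u -> (forall t, u (t + 1) = u t) ->
  (forall n : int, cinteg (fun t => u t * cexp (ci R * (2 * pi * n%:~R * t)%:C)) 0 1 = 0) ->
  forall t, u t = 0.
Proof.
move=> cu pu h.
have ce (n : int) : rcont (fun t => cexp (ci R * (2 * pi * n%:~R * t)%:C)).
  apply: rcont_ext (_ : rcont (fun t => (cos (2 * pi * n%:~R * t + 0))%:C +
     ci R * (sin (2 * pi * n%:~R * t + 0))%:C)).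
    move=> t; rewrite cexp_ci addr0.
    by apply: complex_eqP; rewrite /ci !cReIm/=; ring.
  apply: rcontD; first by apply: rcont_real; exact: cont_cos_lin.
  apply: rcontM; first exact: rcont_cst.
  apply: rcont_real; apply: eq_cont (@cont_cos_lin R (2 * pi * n%:~R) (- (pi / 2))) => t.
  by rewrite addr0 cosB cos_pihalf sin_pihalf mulr0 mulr1 add0r.
have H (k : int) (p : R) : cinteg (fun t => u t * (cos (2 * pi * k%:~R * t + p))%:C) 0 1 = 0.
  rewrite (@eq_cinteg _ _ (fun t => cexp (ci R * p%:C) / 2 * (u t * cexp (ci R * (2 * pi * k%:~R * t)%:C))
     + cexp (ci R * (- p)%:C) / 2 * (u t * cexp (ci R * (2 * pi * (- k)%:~R * t)%:C)))).
    have c1 n := rcontM cu (ce n).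
    rewrite cintegD ?cintegZ ?h ?mulr0 ?addr0//; apply: rcontM => //; exact: rcont_cst.
  move=> t; rewrite !cexp_ci mulrNz !mulrN mulNr !cosN !sinN cosD.
  by apply: complex_eqP; rewrite !cReIm/=; field.
have Z : forall k p, integ (fun t => Re (u t) * cos (2 * pi * k%:~R * t + p)) 0 1 = 0 /\
    integ (fun t => Im (u t) * cos (2 * pi * k%:~R * t + p)) 0 1 = 0.
  move=> k p; have [e1 e2] : Re (cinteg (fun t => u t * (cos (2 * pi * k%:~R * t + p))%:C) 0 1) = 0 /\
     Im (cinteg (fun t => u t * (cos (2 * pi * k%:~R * t + p))%:C) 0 1) = 0 by rewrite H.
  split; [rewrite -[RHS]e1|rewrite -[RHS]e2]; apply: eq_integ => t; rewrite !cReIm/=; ring.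
move=> t; case: cu => c1 c2; apply: complex_eqP => /=.
  apply: (fourier_unique c1); first by move=> x; rewrite pu.
  by move=> k p; case: (Z k p).
apply: (fourier_unique c2); first by move=> x; rewrite pu.
by move=> k p; case: (Z k p).
Qed.

(** The map [w -> exp(2 pi w)] has period [ci] and unwinds a punctured disc into a half-plane.
    Clamping the real part at [X] makes it continuous on the plane with values in the closed disc of
    radius [exp(2 pi X)], so that compositions satisfy the global condition [ccont]. *)
Definition clampX (X : R) (w : C) : C := Num.min (Re w) X +i* Im w.
Definition expX (X : R) (w : C) : C := cexp ((2 * pi)%:C * clampX X w).

Lemma ccont_expX X : ccont (expX X).
Proof.
apply: (@ccont_comp _ (@cexp R) (fun w => (2 * pi)%:C * clampX X w)).
  by move=> z e e0; have [r r0 h] := cder_cont (cder_cexp ((2 * pi)%:C * clampX X z)) e0; exists r.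
apply: (@ccont_comp _ (fun w => (2 * pi)%:C * w) (clampX X)).
  move=> z e e0; have [r r0 h] := @ccont_affine R 0 (2 * pi)%:C (clampX X z) _ e0.
  exists r => // k kr; have := h (clampX X z + k); rewrite !add0r; apply.
  by rewrite addrC addKr.
move=> z e e0; exists (e / 2); first by rewrite divr_gt0.
move=> w hw; apply: le_trans (cmod_le_ReIm _) _; rewrite !cReIm/=.
have h1 := Re_le_cmod (w - z); have h2 := Im_le_cmod (w - z); rewrite !cReIm in h1 h2.
suff : `|Num.min (Re w) X - Num.min (Re z) X| <= `|Re w - Re z| by lra.
rewrite ler_norml.
case: (leP (Re w) X) => a; case: (leP (Re z) X) => b; have := ler_norm (Re w - Re z);
  have := ler_norm (- (Re w - Re z)); rewrite normrN; lra.
Qed.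

Lemma expX_lt X w : Re w < X -> expX X w = cexp ((2 * pi)%:C * w).
Proof.
move=> h; rewrite /expX /clampX min_l ?ltW//; congr (cexp (_ * _)).
by case: w h.
Qed.

Lemma cmod_expX X w : cmod (expX X w) = expR (2 * pi * Num.min (Re w) X).
Proof. by rewrite /expX cmod_cexp cReM/= mul0r subr0. Qed.

Lemma cmod_expX_le X w : cmod (expX X w) <= expR (2 * pi * X).
Proof.
rewrite cmod_expX ler_expR ler_wpM2l//; first by rewrite mulr_ge0// pi_ge0.
by rewrite ge_min lexx orbT.
Qed.

Lemma expX_neq0 X w : expX X w != 0.
Proof. exact: cexp_neq0. Qed.

Lemma cexp_period (n : int) z : cexp (z + (2 * pi * n%:~R)%:C * ci R) = cexp z.
Proof.
rewrite cexpD (mulrC _ (ci R)) cexp_ci.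
have -> : cos (2 * pi * n%:~R) = 1 :> R by rewrite -[2 * _ * _]add0r cos_int cos0.
have -> : sin (2 * pi * n%:~R) = 0 :> R by rewrite -[2 * _ * _]add0r sin_int sin0.
by apply: complex_eqP; rewrite !cReIm/=; ring.
Qed.

Lemma expX_period X w : expX X (w + ci R) = expX X w.
Proof.
rewrite /expX -[RHS](cexp_period 1); congr cexp; rewrite /clampX.
by apply: complex_eqP; rewrite /ci !cReIm/= ?addr0; ring.
Qed.

Lemma derivable_near f g z : (exists2 r : R, 0 < r & forall w, cmod (w - z) < r -> f w = g w) ->
  derivable f z (1 : C) -> derivable g z (1 : C).
Proof.
move=> h df; have d := near_eq_is_derive (_ : \near z, f z = g z) (DeriveDef df erefl).
by case: d => //; apply/nbhsCP.
Qed.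

Lemma expX_derivable X w : Re w < X -> derivable (expX X) w (1 : C).
Proof.
move=> h; apply: (@derivable_near (fun w => cexp ((2 * pi)%:C * w))).
  exists (X - Re w); first by rewrite subr_gt0.
  move=> z hz; rewrite expX_lt//; have := Re_le_cmod (z - w); rewrite !cReIm.
  have := ler_norm (Re z - Re w); lra.
by have [] := cder_comp (cder_cexp ((2 * pi)%:C * w)) (cderZ (2 * pi)%:C (cder_id w)).
Qed.

Lemma polar z : z != 0 -> exists t : R, z = (cmod z)%:C * cexp (ci R * (2 * pi * t)%:C).
Proof.
move=> z0; have c0 : 0 < cmod z by rewrite cmod_gt0.
have pi0 := pi_gt0 R.
pose a := Re z / cmod z; pose b := Im z / cmod z.
have ab : a ^+ 2 + b ^+ 2 = 1.
  rewrite /a /b !expr_div_n -mulrDl.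
  have -> : Re z ^+ 2 + Im z ^+ 2 = cmod z ^+ 2.
    by rewrite cmod_sqrt sqr_sqrtr// addr_ge0// sqr_ge0.
  by rewrite divff// gt_eqF// exprn_gt0.
have a1 : -1 <= a <= 1.
  by rewrite -ler_norml -(@expr_le1 _ 2)// real_normK ?num_real// -ab lerDl sqr_ge0.
have hs : sin (acos a) ^+ 2 = b ^+ 2.
  rewrite sin2cos2 acosK ?in_itv//= -ab; ring.
have [t ht ht'] : exists2 t, cos t = a & sin t = b.
  have : (sin (acos a) - b) * (sin (acos a) + b) = 0.
    by rewrite -subr_sqr hs subrr.
  move/eqP; rewrite mulf_eq0 => /orP[|]; rewrite ?subr_eq0 ?addr_eq0 => /eqP h.
    by exists (acos a); [rewrite acosK ?in_itv|].
  by exists (- acos a); [rewrite cosN acosK ?in_itv|rewrite sinN h opprK].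
exists (t / (2 * pi)); rewrite (_ : 2 * pi * (t / (2 * pi)) = t); last by rewrite mulrC divfK// gt_eqF// mulr_gt0.
rewrite cexp_ci ht ht' /a /b.
apply: complex_eqP; rewrite !cReIm/=; field; rewrite gt_eqF//.
Qed.

(* In the coordinate [z = b + exp (2 pi w)] the integrals of [g] times a character
   over the periods [Re w = x] do not depend on [x], hence vanish as they do for
   small [x]; Fourier uniqueness concludes. *)
Lemma disc_identity g b (r r1 : R) : 0 < r1 ->
  (forall z, cmod (z - b) < r -> derivable g z (1 : C)) ->
  (forall z, cmod (z - b) < r1 -> g z = 0) -> forall z, cmod (z - b) < r -> g z = 0.
Proof.
move=> r10 dg g0 z zr.
have [|rz] := ltP (cmod (z - b)) r1; first exact: g0.
set rho := cmod (z - b) in zr rz; have rho0 : 0 < rho by lra.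
have pi0 := pi_gt0 R; have p2 : 0 < 2 * pi :> R by rewrite mulr_gt0.
(* A radius strictly between [rho] and [r]: the clamped exponential stays where [g] is
   differentiable, and the circle through [z] stays below the clamp. *)
pose rho' := (rho + r) / 2; have rho'0 : 0 < rho' by rewrite /rho'; lra.
pose X := ln rho' / (2 * pi).
have eX : expR (2 * pi * X) = rho' by rewrite /X mulrC divfK ?gt_eqF// lnK.
pose U w := g (b + expX X w).
have inr w : cmod (expX X w) < r.
  by apply: le_lt_trans (cmod_expX_le _ _) _; rewrite eX /rho'; lra.
have cU : ccont U.
  apply: (@ccont_comp _ (fun t => g (b + t)) (expX X)); last exact: ccont_expX.
  move=> w e e0.
  have dw : derivable g (b + expX X w) (1 : C) by apply: dg; rewrite addrC addKr.
  have [k k0 hk] := cder_cont (DeriveDef dw erefl) e0; exists k => // h.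
  by rewrite addrA; exact: hk.
pose E (n : int) (w : C) := cexp ((- (2 * pi * n%:~R))%:C * w).
have dE n w : is_derive w (1 : C) (E n) (cexp ((- (2 * pi * n%:~R))%:C * w) * ((- (2 * pi * n%:~R))%:C * 1)).
  exact: cder_comp (cder_cexp _) (cderZ _ (cder_id w)).
have cE n : ccont (E n) by apply: ccont_der => w; exact: dE.
pose G n w := U w * E n w.
have cG n : ccont (G n) by exact: ccontM.
have dG n w : Re w < X -> derivable (G n) w (1 : C).
  move=> hw.
  have d1 := DeriveDef (expX_derivable hw) erefl.
  have d2 := cderD (cder_cst w b) d1.
  have d3 : derivable g (b + expX X w) (1 : C) by apply: dg; rewrite addrC addKr.
  have d4 := @cder_comp _ g (fun t => b + expX X t) w _ _ (DeriveDef d3 erefl) d2.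
  by have [] := cderM d4 (dE n w).
have pG n w : G n (w + ci R) = G n w.
  rewrite /G /U expX_period /E mulrDr (_ : (- (2 * pi * n%:~R))%:C = (2 * pi * (- n)%:~R)%:C).
    by rewrite cexp_period.
  by rewrite mulrNz mulrN.
have key n x : x < X -> vseg (G n) x 0 1 = 0.
  (* At the abscissa [x'] the circle has radius at most [r1 / 2], so [g] vanishes on it. *)
  move=> xX; pose x' := Num.min x (ln (r1 / 2) / (2 * pi)).
  have x'x : x' <= x by rewrite ge_min lexx.
  have x'2 : x' <= ln (r1 / 2) / (2 * pi) by rewrite ge_min lexx orbT.
  rewrite -(@vseg_strip _ _ X x' x (cG n) (dG n) (pG n) x'x xX).
  rewrite /vseg (@eq_cinteg _ _ (fun=> 0)) ?cinteg_cst ?mul0r// => t.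
  rewrite /G /U g0 ?mul0r// addrC addKr cmod_expX.
  apply: (@le_lt_trans _ _ (expR (2 * pi * x'))).
    rewrite ler_expR ler_wpM2l ?(ltW p2)//.
    by rewrite ge_min; apply/orP; left; rewrite !cReIm/=; lra.
  apply: (@le_lt_trans _ _ (r1 / 2)); last by lra.
  rewrite -[leRHS](@lnK _ (r1 / 2)) ?posrE ?divr_gt0// ler_expR.
  by rewrite mulrC -ler_pdivlMr.
pose x := ln rho / (2 * pi).
have xX : x < X by rewrite /x /X ltr_pM2r ?invr_gt0// ltr_ln ?posrE// /rho'; lra.
have U0 : forall t, U (x%:C + ci R * t%:C) = 0.
  apply: cfourier_unique.
  - exact: rcont_line.
  - move=> t; rewrite /U -[in RHS]expX_period; congr (g (b + expX X _)).
    by rewrite rmorphD/= rmorph1; ring.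
  - move=> n; have := key (- n) x xX; rewrite /vseg.
    rewrite (@eq_cinteg _ _ (fun t => cexp ((2 * pi * n%:~R * x)%:C) *
       (U (x%:C + ci R * t%:C) * cexp (ci R * (2 * pi * n%:~R * t)%:C)))).
      rewrite cintegZ; last first.
        apply: rcontM; first exact: rcont_line.
        apply: rcont_ext (@rcont_line _ (E (- n)) 0 (ci R) (cE (- n))) => t.
        rewrite /E mulrNz mulrN opprK; congr cexp.
        by apply: complex_eqP; rewrite /ci !cReIm/=; ring.
      by move/eqP; rewrite mulf_eq0 (negPf (cexp_neq0 _)) => /eqP.
    move=> t; rewrite /G /E mulrCA -cexpD; congr (_ * cexp _).
    rewrite mulrNz; apply: complex_eqP; rewrite /ci !cReIm/=; ring.
have zb0 : z - b != 0 by rewrite -cmod_gt0.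
have [t ht] := polar zb0; rewrite -/rho in ht.
rewrite -(U0 t) /U; congr g; rewrite expX_lt; last by rewrite !cReIm/=; lra.
rewrite -[LHS](subrK b) addrC; congr (_ + _); rewrite ht.
rewrite (_ : (2 * pi)%:C * _ = (2 * pi * x)%:C + ci R * (2 * pi * t)%:C).
  rewrite cexpD; congr (_ * _); rewrite /x mulrC divfK ?gt_eqF//.
  by apply: complex_eqP; rewrite /= ?cos0 ?sin0 ?mulr1 ?mulr0// lnK.
by apply: complex_eqP; rewrite /ci !cReIm/=; ring.
Qed.

(** The quotient [(f (c + t) - f c) / t], in the coordinate [t = exp(2 pi w)], has the same mean
    over all circles of radius below [r / 2]. These means tend to [d] as the radius tends to 0, and
    on the circle of radius [r / 4] the quotient is at most [2 M / (r / 4)], which [cinteg_norm]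
    doubles. *)
Lemma cauchy_est f c (r M : R) d : 0 < r ->
  (forall z, cmod (z - c) < r -> derivable f z (1 : C)) ->
  (forall z, cmod (z - c) < r -> cmod (f z) <= M) ->
  is_derive c (1 : C) f d -> cmod d <= 16 * M / r.
Proof.
move=> r0 df fM dfc.
have pi0 := pi_gt0 R; have p2 : 0 < 2 * pi :> R by rewrite mulr_gt0.
pose X := ln (r / 2) / (2 * pi).
have r2 : 0 < r / 2 by rewrite divr_gt0.
have eX : expR (2 * pi * X) = r / 2 by rewrite /X mulrC divfK ?gt_eqF// lnK.
have inr w : cmod (expX X w) < r.
  by apply: le_lt_trans (cmod_expX_le _ _) _; rewrite eX; lra.
pose q t := (f (c + t) - f c) / t.
have dq t : t != 0 -> cmod t < r -> derivable q t (1 : C).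
  move=> t0 tr.
  have d3 : derivable f (c + t) (1 : C) by apply: df; rewrite addrC addKr.
  have d4 := cder_comp (DeriveDef d3 erefl) (cderD (cder_cst t c) (cder_id t)).
  by have [] := cderM (cderB d4 (cder_cst t (f c))) (cder_inv t0).
pose G w := q (expX X w).
have cG : ccont G.
  apply: (@ccont_comp _ q (expX X)); last exact: ccont_expX.
  move=> w e e0; have [k k0 hk] := cder_cont (DeriveDef (dq _ (expX_neq0 X w) (inr w)) erefl) e0.
  by exists k.
have dG w : Re w < X -> derivable G w (1 : C).
  move=> hw.
  have d1 := DeriveDef (expX_derivable hw) erefl.
  by have [] := cder_comp (DeriveDef (dq _ (expX_neq0 X w) (inr w)) erefl) d1.
have pG w : G (w + ci R) = G w by rewrite /G expX_period.
pose x := ln (r / 4) / (2 * pi).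
have r4 : 0 < r / 4 by rewrite divr_gt0.
have xX : x < X by rewrite /x /X ltr_pM2r ?invr_gt0// ltr_ln ?posrE//; lra.
have ex : expR (2 * pi * x) = r / 4 by rewrite /x mulrC divfK ?gt_eqF// lnK.
have -> : d = vseg G x 0 1.
  apply/eqP; rewrite -subr_eq0 -cmod_eq0 eq_le cmod_ge0 andbT.
  apply/ler_addgt0Pl => e e0; rewrite addr0.
  have e2 : 0 < e / 2 by rewrite divr_gt0.
  have [k k0 hk] := (cderP _ _ _).1 dfc _ e2.
  pose x' := Num.min x (ln (k / 2) / (2 * pi)).
  have x'x : x' <= x by rewrite ge_min lexx.
  have x'2 : x' <= ln (k / 2) / (2 * pi) by rewrite ge_min lexx orbT.
  rewrite -(@vseg_strip _ _ X x' x cG dG pG x'x xX).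
  have -> : d = cinteg (fun=> d) 0 1 by rewrite cinteg_cst subr0 mulr1.
  rewrite /vseg -cintegB; [|exact: rcont_cst|exact: rcont_line].
  rewrite (_ : e = 2 * (e / 2) * (1 - 0)); last by field.
  apply: cinteg_norm => //.
    by apply: rcontB; [exact: rcont_cst|exact: rcont_line].
  move=> t _; rewrite cmodBC.
  set w := x'%:C + ci R * t%:C; have := expX_neq0 X w.
  have hE : cmod (expX X w) < k.
    rewrite cmod_expX; apply: (@le_lt_trans _ _ (expR (2 * pi * x'))).
      rewrite ler_expR ler_wpM2l ?(ltW p2)//.
      by rewrite ge_min; apply/orP; left; rewrite /w !cReIm/=; lra.
    apply: (@le_lt_trans _ _ (k / 2)); last by lra.
    rewrite -[leRHS](@lnK _ (k / 2)) ?posrE ?divr_gt0// ler_expR.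
    by rewrite mulrC -ler_pdivlMr.
  have := hk _ hE; rewrite /G /q; set s := expX X w => hs s0.
  have -> : (f (c + s) - f c) / s - d = (f (c + s) - f c - d * s) / s by field.
  by rewrite cmodM cmodV ler_pdivrMr ?cmod_gt0.
rewrite (_ : 16 * M / r = 2 * (8 * M / r) * (1 - 0)); last by field; rewrite gt_eqF.
apply: cinteg_norm => //; first exact: rcont_line.
move=> t _; set w := _ + _.
have hw : cmod (expX X w) = r / 4.
  rewrite cmod_expX min_l; first by rewrite -ex /w !cReIm/=; congr (expR _); ring.
  by rewrite /w !cReIm/=; lra.
rewrite /G /q cmodM cmodV hw ler_pdivrMr//.
rewrite (_ : 8 * M / r * (r / 4) = M + M); last by field; rewrite gt_eqF.
by apply: le_trans (cmodB _ _) _; rewrite lerD ?fM// ?subrr ?cmod0// addrC addKr.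
Qed.

Lemma derive_of_eps (f : R -> R) (x d : R) :
  (forall e, 0 < e -> exists2 r, 0 < r & forall h, `|h| < r -> `|f (x + h) - f x - d * h| <= e * `|h|) ->
  is_derive x 1 f d.
Proof.
move=> H; apply/is_deriveP/cvgrPdist_le => e /H[r r0 h].
apply/nbhs_ballP; exists r => // u; rewrite /ball/= sub0r normrN => ur u0.
rewrite distrC (_ : _ - d = u^-1 * (f (x + u) - f x - d * u)); last by field.
by rewrite normrM normfV ler_pdivrMl ?normr_gt0// (mulrC `|u|) h.
Qed.

Lemma cder_line f z h (t : R) d : is_derive (z + t%:C * h) (1 : C) f d ->
  is_derive t 1 (fun s => Re (f (z + s%:C * h))) (Re (d * h)) /\
  is_derive t 1 (fun s => Im (f (z + s%:C * h))) (Im (d * h)).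
Proof.
move=> /cderP H.
have K (e : R) : 0 < e -> exists2 r, 0 < r & forall k : R, `|k| < r ->
    cmod (f (z + (t + k)%:C * h) - f (z + t%:C * h) - d * h * k%:C) <= e * `|k|.
  move=> e0; have k0 : 0 < cmod h + 1 by rewrite ltr_wpDl ?cmod_ge0.
  have e1 : 0 < e / (cmod h + 1) by rewrite divr_gt0.
  have [r r0 hr] := H _ e1; exists (r / (cmod h + 1)); first by rewrite divr_gt0.
  move=> k; rewrite ltr_pdivlMr// => kr.
  have := hr (k%:C * h); rewrite cmodM cmodR.
  have n0 := normr_ge0 k; have c0 := cmod_ge0 h.
  have lek : `|k| * cmod h <= `|k| * (cmod h + 1) by rewrite ler_wpM2l// lerDl.
  move=> /(_ (le_lt_trans lek kr)).
  rewrite (_ : z + t%:C * h + k%:C * h = z + (t + k)%:C * h); last by rewrite rmorphD/=; ring.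
  rewrite (_ : d * (k%:C * h) = d * h * k%:C); last by ring.
  move/le_trans; apply; rewrite mulrAC ler_pdivrMr// -mulrA ler_wpM2l// ltW//.
by split; apply: derive_of_eps => e /K[r r0 hr]; exists r => // k /hr;
  apply: le_trans; [have := Re_le_cmod (f (z + (t + k)%:C * h) - f (z + t%:C * h) - d * h * k%:C)
   |have := Im_le_cmod (f (z + (t + k)%:C * h) - f (z + t%:C * h) - d * h * k%:C)];
  rewrite !cReIm/= !mulr0 ?subr0 ?addr0 ?add0r.
Qed.

Lemma cmvt f (df : C -> C) z h (M : R) :
  (forall t : R, 0 <= t <= 1 -> is_derive (z + t%:C * h) (1 : C) f (df (z + t%:C * h))) ->
  (forall t : R, 0 <= t <= 1 -> cmod (df (z + t%:C * h)) <= M) ->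
  cmod (f (z + h) - f z) <= 2 * M * cmod h.
Proof.
move=> hd hM.
have B (t : R) : 0 <= t <= 1 -> cmod (df (z + t%:C * h) * h) <= M * cmod h.
  by move=> t01; rewrite cmodM ler_wpM2r ?cmod_ge0// hM.
have d1 := @ler_mvt R (fun s => Re (f (z + s%:C * h))) (fun t => Re (df (z + t%:C * h) * h)) 0 1
  (M * cmod h) ler01 (fun t ht => (cder_line (hd t ht)).1)
  (fun t ht => le_trans (Re_le_cmod _) (B t ht)).
have d2 := @ler_mvt R (fun s => Im (f (z + s%:C * h))) (fun t => Im (df (z + t%:C * h) * h)) 0 1
  (M * cmod h) ler01 (fun t ht => (cder_line (hd t ht)).2)
  (fun t ht => le_trans (Im_le_cmod _) (B t ht)).
apply: le_trans (cmod_le_ReIm _) _; rewrite !cReIm/=.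
move: d1 d2; rewrite mul1r mul0r addr0 subr0; lra.
Qed.

End DiscTheory.

(** * Series and meromorphic functions *)

Section Series.
Variable R : realType.
Local Notation C := R[i].
Local Notation Re := (@complex.Re R).
Local Notation Im := (@complex.Im R).
Local Open Scope complex_scope.

Section OneIndex.
Variable I : choiceType.
Implicit Types (F G : I -> C).

Definition csumm F := summ (fun i => cmod (F i)).
Definition csum F : C := rsum (fun i => Re (F i)) +i* rsum (fun i => Im (F i)).

Lemma csumm_le F (M : I -> R) : (forall i, cmod (F i) <= M i) -> summ M -> csumm F.
Proof. by move=> h; apply: summ_le => i; rewrite ger0_norm ?cmod_ge0. Qed.

Lemma csummRe F : csumm F -> summ (fun i => Re (F i)).
Proof. by apply: summ_le => i; exact: Re_le_cmod. Qed.

Lemma csummIm F : csumm F -> summ (fun i => Im (F i)).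
Proof. by apply: summ_le => i; exact: Im_le_cmod. Qed.

Lemma csummD F G : csumm F -> csumm G -> csumm (fun i => F i + G i).
Proof. by move=> hF hG; apply: csumm_le (summD hF hG) => i; exact: cmodD. Qed.

Lemma csummZ c F : csumm F -> csumm (fun i => c * F i).
Proof. by move=> hF; apply: csumm_le (summZ (cmod c) hF) => i; rewrite cmodM. Qed.

Lemma csumD F G : csumm F -> csumm G -> csum (fun i => F i + G i) = csum F + csum G.
Proof.
move=> hF hG; apply: complex_eqP; rewrite !cReIm/= -rsumD//.
- by congr rsum; apply/funext => i; rewrite cReD.
- exact: csummRe.
- exact: csummRe.
- by congr rsum; apply/funext => i; rewrite cImD.
- exact: csummIm.
- exact: csummIm.
Qed.

Lemma csumZ c F : csumm F -> csum (fun i => c * F i) = c * csum F.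
Proof.
move=> hF; have h1 := csummRe hF; have h2 := csummIm hF.
apply: complex_eqP; rewrite !cReIm/= -!rsumZ//.
  rewrite -rsumB; [|exact: summZ|exact: summZ].
  by congr rsum; apply/funext => i; rewrite cReM.
rewrite -rsumD; [|exact: summZ|exact: summZ].
by congr rsum; apply/funext => i; rewrite cImM.
Qed.

Lemma csumB F G : csumm F -> csumm G -> csum (fun i => F i - G i) = csum F - csum G.
Proof.
move=> hF hG; rewrite -mulN1r -csumZ// -csumD//; last exact: csummZ.
by congr csum; apply/funext => i; rewrite mulN1r.
Qed.

Lemma csum_norm F (M : I -> R) : (forall i, cmod (F i) <= M i) -> summ M ->
  cmod (csum F) <= 2 * rsum M.
Proof.
move=> h hM; apply: le_trans (cmod_le_ReIm _) _ => /=.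
rewrite mulr2n mulrDl mul1r lerD//; apply: ler_norm_rsum_le => // i.
  exact: le_trans (Re_le_cmod _) (h i).
exact: le_trans (Im_le_cmod _) (h i).
Qed.

Lemma eq_csum F G : F =1 G -> csum F = csum G.
Proof. by move=> /funext ->. Qed.

Lemma csum0 : csum (fun _ => 0) = 0.
Proof. by apply: complex_eqP; rewrite /= rsum0. Qed.

Lemma csum_fin F (A : {fset I}) : (forall i, i \notin A -> F i = 0) ->
  csum F = \sum_(i <- A) F i.
Proof.
move=> F0; apply: complex_eqP => /=.
  rewrite (@rsum_fin _ _ _ A); last by move=> i /F0 ->.
  by elim: (enum_fset A) => [|i s IH]; rewrite ?big_nil// !big_cons cReD IH.
rewrite (@rsum_fin _ _ _ A); last by move=> i /F0 ->.
by elim: (enum_fset A) => [|i s IH]; rewrite ?big_nil// !big_cons cImD IH.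
Qed.

Lemma cder_limP (f : C -> C) z d : is_derive z (1 : C) f d <->
  h^-1 * (f (z + h) - f z) @[h --> (0 : C)^'] --> d.
Proof.
have E : (fun h : C => h^-1 *: ((f \o shift z) (h *: (1 : C)) - f z)) =
  (fun h : C => h^-1 * (f (z + h) - f z)).
  by apply/funext => h /=; rewrite [_%:A]mulr1 (addrC h z).
split=> [[df <-]|h]; first by move: df; rewrite /derive /derivable E.
split; first by rewrite /derivable E; apply/cvg_ex; exists d.
by rewrite /derive E; apply: cvg_lim.
Qed.

(** Only the functions are dominated, as in Weierstrass' theorem: on the half disc the Cauchy
    estimate bounds the derivatives by [32 / r] times [M i], hence the difference quotients by
    [64 / r] times [M i], and dominated convergence applies. *)
Lemma csum_derive (F dF : I -> C -> C) a (r : R) (M : I -> R) : 0 < r ->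
  (forall i z, cmod (z - a) < r -> is_derive z (1 : C) (F i) (dF i z)) ->
  (forall i z, cmod (z - a) < r -> cmod (F i z) <= M i) -> summ M ->
  is_derive a (1 : C) (fun z => csum (F ^~ z)) (csum (dF ^~ a)).
Proof.
move=> r0 hd hM sM; have r2 : 0 < r / 2 by rewrite divr_gt0.
have dM i z : cmod (z - a) < r / 2 -> cmod (dF i z) <= 32 / r * M i.
  move=> hz; rewrite (_ : _ * _ = 16 * M i / (r / 2)); last by field; rewrite gt_eqF.
  have sub w : cmod (w - z) < r / 2 -> cmod (w - a) < r.
    move=> hw; rewrite (_ : w - a = (w - z) + (z - a)); last by ring.
    by apply: le_lt_trans (cmodD _ _) _; lra.
  apply: (@cauchy_est _ (F i) z) => //.
  - by move=> w /sub /hd -/(_ i)[].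
  - by move=> w /sub /hM -/(_ i).
  - by apply: hd; lra.
have qM i h : h != 0 -> cmod h < r / 2 -> cmod (h^-1 * (F i (a + h) - F i a)) <= 64 / r * M i.
  move=> h0 hr; rewrite cmodM cmodV ler_pdivrMl ?cmod_gt0// mulrC.
  rewrite (_ : 64 / r * M i = 2 * (32 / r * M i)); last by ring.
  have th (t : R) : 0 <= t <= 1 -> cmod (t%:C * h) < r / 2.
    move=> /andP[t0 t1]; rewrite cmodM cmodR ger0_norm//.
    by apply: le_lt_trans hr; rewrite ler_piMl ?cmod_ge0.
  apply: (@cmvt _ (F i) (dF i)) => t /th ht.
    by apply: hd; rewrite addrC addKr; lra.
  by apply: dM; rewrite addrC addKr.
have nr : \forall h \near (0 : C)^', h != 0 /\ cmod h < r / 2.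
  by apply/dnbhsCP; exists (r / 2) => // w w0; rewrite subr0.
have a0 : cmod (a - a) < r by rewrite subrr cmod0.
have qd i : h^-1 * (F i (a + h) - F i a) @[h --> (0 : C)^'] --> dF i a.
  by apply/cder_limP; exact: hd.
have sF z : cmod (z - a) < r -> csumm (F ^~ z).
  by move=> hz; apply: csumm_le sM => i; exact: hM.
apply/cder_limP; apply/(cvgCP _ _) => e e0.
have e2 : 0 < e / 2 by rewrite divr_gt0.
have cR := @cvg_rsum R I C (0 : C)^' _ (fun h i => Re (h^-1 * (F i (a + h) - F i a)))
  (fun i => Re (dF i a)) (fun i => 64 / r * M i) (summZ _ sM).
have cI := @cvg_rsum R I C (0 : C)^' _ (fun h i => Im (h^-1 * (F i (a + h) - F i a)))
  (fun i => Im (dF i a)) (fun i => 64 / r * M i) (summZ _ sM).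
have {}cR : rsum (fun i => Re (h^-1 * (F i (a + h) - F i a))) @[h --> (0 : C)^'] -->
    rsum (fun i => Re (dF i a)).
  apply: cR.
    by apply: filterS nr => h [h0 hr] i; apply: le_trans (Re_le_cmod _) _; exact: qM.
  move=> i; apply/cvgrPdist_le => e1 e10; have /cvgCP /(_ _ e10) := qd i.
  apply: filterS => h; apply: le_trans; rewrite cmodBC -cReN -cReD; exact: Re_le_cmod.
have {}cI : rsum (fun i => Im (h^-1 * (F i (a + h) - F i a))) @[h --> (0 : C)^'] -->
    rsum (fun i => Im (dF i a)).
  apply: cI.
    by apply: filterS nr => h [h0 hr] i; apply: le_trans (Im_le_cmod _) _; exact: qM.
  move=> i; apply/cvgrPdist_le => e1 e10; have /cvgCP /(_ _ e10) := qd i.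
  apply: filterS => h; apply: le_trans; rewrite cmodBC -cImN -cImD; exact: Im_le_cmod.
move/cvgrPdist_le : cR => /(_ _ e2); move/cvgrPdist_le : cI => /(_ _ e2).
apply: filterS3 nr => h [h0 hr] hI hR.
have s2 := sF a a0.
have s1 : csumm (F ^~ (a + h)) by apply: sF; rewrite addrC addKr; lra.
rewrite -(csumB s1 s2) -csumZ; last by apply: csumm_le (summD s1 s2) => i; exact: cmodB.
apply: le_trans (cmod_le_ReIm _) _; rewrite !cReIm/= (splitr e) lerD// distrC//.
Qed.

End OneIndex.

Lemma csum_bij (I J : choiceType) (h : I -> J) (F : J -> C) :
  bijective h -> csumm F -> csum (F \o h) = csum F.
Proof.
move=> hb hF; apply: complex_eqP => /=.
  by rewrite -(rsum_bij hb (csummRe hF)).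
by rewrite -(rsum_bij hb (csummIm hF)).
Qed.

Lemma csum_inj (I J : choiceType) (h : I -> J) (F : J -> C) :
  injective h -> csumm F -> (forall j, F j != 0 -> exists i, h i = j) ->
  csum (F \o h) = csum F.
Proof.
move=> hi hF hs; apply: complex_eqP => /=.
  rewrite -(rsum_inj hi (csummRe hF))// => j Fj; apply: hs.
  by apply: contraNneq Fj => ->.
rewrite -(rsum_inj hi (csummIm hF))// => j Fj; apply: hs.
by apply: contraNneq Fj => ->.
Qed.

Lemma csum_pair (I J : choiceType) (F : I * J -> C) : csumm F ->
  csum F = csum (fun i => csum (fun j => F (i, j))).
Proof.
move=> hF; apply: complex_eqP => /=; rewrite rsum_pair//.
  exact: csummRe.
exact: csummIm.
Qed.

Lemma csumm_pair (I J : choiceType) (F : I * J -> C) i : csumm F ->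
  csumm (fun j => F (i, j)).
Proof. by move=> hF; exact: summ_pair i hF. Qed.

Lemma csumm_csum_pair (I J : choiceType) (F : I * J -> C) : csumm F ->
  csumm (fun i => csum (fun j => F (i, j))).
Proof.
move=> hF; have := summZ 2 (summ_rsum_pair hF); apply: csumm_le => i.
by apply: csum_norm => //; exact: summ_pair i hF.
Qed.

Lemma csum_fibres (K I : choiceType) (p : K -> I) (F : K -> C) : csumm F ->
  csum F = csum (fun i => csum (fun k => if p k == i then F k else 0)).
Proof.
move=> hF; apply: complex_eqP => /=.
  rewrite (rsum_fibres p (csummRe hF)); congr rsum; apply/funext => i; congr rsum.
  by apply/funext => k; rewrite /fibre; case: ifP.
rewrite (rsum_fibres p (csummIm hF)); congr rsum; apply/funext => i; congr rsum.
by apply/funext => k; rewrite /fibre; case: ifP.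
Qed.

Lemma csum_sumtype (I J : choiceType) (F : I + J -> C) : csumm F ->
  csum F = csum (F \o inl) + csum (F \o inr).
Proof.
move=> hF; apply: complex_eqP; rewrite !cReIm/= rsum_sumtype//.
  exact: csummRe.
exact: csummIm.
Qed.

End Series.

(** * Meromorphic functions and the identity theorem along a horizontal segment *)

Section Meromorphic.
Variable R : realType.
Local Notation C := R[i].
Local Notation Re := (@complex.Re R).
Local Notation Im := (@complex.Im R).
Local Open Scope complex_scope.
Implicit Types (f g h : C -> C) (a z w : C).

Lemma holP f a : holomorphic_at f a <->
  exists2 r : R, 0 < r & forall z, cmod (z - a) < r -> derivable f z (1 : C).
Proof. exact: nbhsCP. Qed.

Definition mero f a := exists (k : nat) (g : C -> C), exists2 r : R, 0 < r &
  (forall z, cmod (z - a) < r -> derivable g z (1 : C)) /\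
  (forall z, z != a -> cmod (z - a) < r -> (z - a) ^+ k * f z = g z).

Lemma meroP f a : meromorphic_at f a <-> mero f a.
Proof.
split=> [[k [g [/holP[r r0 h1] /dnbhsCP[s s0 h2]]]]|[k [g [r r0 [h1 h2]]]]].
  exists k, g, (Num.min r s); first by rewrite lt_min r0.
  by split=> z; rewrite lt_min; [move=> /andP[/h1]|move=> za /andP[_ /h2]; exact].
by exists k, g; split; [apply/holP; exists r|apply/dnbhsCP; exists r].
Qed.

Lemma mero_ext f g a : (exists2 r : R, 0 < r & forall z, z != a -> cmod (z - a) < r -> f z = g z) ->
  mero f a -> mero g a.
Proof.
move=> [s s0 hs] [k [u [r r0 [h1 h2]]]]; exists k, u, (Num.min r s).
  by rewrite lt_min r0.
split=> z; rewrite ?lt_min; first by move=> /andP[/h1].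
by move=> za /andP[zr zs]; rewrite -hs// h2.
Qed.

Lemma mero_hol f a : (exists2 r : R, 0 < r & forall z, cmod (z - a) < r -> derivable f z (1 : C)) ->
  mero f a.
Proof. by move=> [r r0 h]; exists 0%N, f, r => //; split=> // z _ _; rewrite expr0 mul1r. Qed.

Lemma cderX a z k : exists d, is_derive z (1 : C) (fun w => (w - a) ^+ k) d.
Proof.
elim: k => [|k [d hd]].
  by exists 0; under eq_fun do rewrite expr0; exact: cder_cst.
have := cderM (cderB (cder_id z) (cder_cst z a)) hd.
move=> hk; eexists; have -> : (fun w => (w - a) ^+ k.+1) = (fun w => (w - a) * (w - a) ^+ k).
  by apply/funext => w; rewrite exprS.
exact: hk.
Qed.

Lemma meroM f g a : mero f a -> mero g a -> mero (fun z => f z * g z) a.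
Proof.
move=> [k [u [r r0 [h1 h2]]]] [l [v [s s0 [h3 h4]]]].
exists (k + l)%N, (fun z => u z * v z), (Num.min r s); first by rewrite lt_min r0.
split=> z; rewrite lt_min.
  move=> /andP[/h1 d1 /h3 d2].
  by have [] := cderM (DeriveDef d1 erefl) (DeriveDef d2 erefl).
by move=> za /andP[zr zs]; rewrite -h2// -h4// exprD; ring.
Qed.

Lemma meroD f g a : mero f a -> mero g a -> mero (fun z => f z + g z) a.
Proof.
move=> [k [u [r r0 [h1 h2]]]] [l [v [s s0 [h3 h4]]]].
exists (k + l)%N, (fun z => (z - a) ^+ l * u z + (z - a) ^+ k * v z), (Num.min r s).
  by rewrite lt_min r0.
split=> z; rewrite lt_min.
  move=> /andP[/h1 d1 /h3 d2].
  have [dk hk] := cderX a z k; have [dl hl] := cderX a z l.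
  by have [] := cderD (cderM hl (DeriveDef d1 erefl)) (cderM hk (DeriveDef d2 erefl)).
by move=> za /andP[zr zs]; rewrite -h2// -h4// exprD; ring.
Qed.

Lemma mero_cst (c : C) a : mero (fun=> c) a.
Proof.
by apply: mero_hol; exists 1 => // z _; have [] := cder_cst z c.
Qed.

Lemma meroZ (c : C) f a : mero f a -> mero (fun z => c * f z) a.
Proof. by move=> hf; apply: meroM => //; exact: mero_cst. Qed.

Lemma mero_sum (I : Type) (s : seq I) (F : I -> C -> C) a : (forall i, mero (F i) a) ->
  mero (fun z => \sum_(i <- s) F i z) a.
Proof.
move=> hF; elim: s => [|i s IH].
  by under eq_fun do rewrite big_nil; exact: mero_cst.
by under eq_fun do rewrite big_cons; exact: meroD.
Qed.

Lemma mero_comp_affine f (p q : C) a : p != 0 -> mero f (p * a + q) ->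
  mero (fun z => f (p * z + q)) a.
Proof.
move=> p0 [k [g [r r0 [h1 h2]]]].
have cp : 0 < cmod p by rewrite cmod_gt0.
exists k, (fun z => p ^- k * g (p * z + q)), (r / cmod p); first by rewrite divr_gt0.
have E z : p * z + q - (p * a + q) = p * (z - a) by ring.
split=> z.
  rewrite ltr_pdivlMr// => hz.
  have d1 : derivable g (p * z + q) (1 : C) by apply: h1; rewrite E cmodM mulrC.
  have d2 := cderD (cderZ p (cder_id z)) (cder_cst z q).
  have d3 := @cder_comp _ g (fun t => p * t + q) z _ _ (DeriveDef d1 erefl) d2.
  by have [] := cderZ (p ^- k) d3.
move=> za; rewrite ltr_pdivlMr// => hz; rewrite -h2.
- by rewrite E exprMn !mulrA mulVf ?mul1r// expf_neq0.
- by rewrite -subr_eq0 E mulf_neq0// subr_eq0.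
- by rewrite E cmodM mulrC.
Qed.

(** At a simple zero the pole is cleared by [(z - a) ^+ 2] instead of [z - a]: since [0^-1 = 0], the
    product [(z - a) ^+ 2 / f z] then already has its right value 0 at [a], and it is differentiable
    there with derivative [d^-1]. *)
Lemma mero_inv f a d : (exists2 r : R, 0 < r & forall z, cmod (z - a) < r -> derivable f z (1 : C)) ->
  is_derive a (1 : C) f d -> f a != 0 \/ d != 0 -> mero (fun z => (f z)^-1) a.
Proof.
move=> [r r0 hr] da.
have [fa|fa] := eqVneq (f a) 0; last first.
  move=> _; apply: mero_hol.
  have e0 : 0 < cmod (f a) / 2 by rewrite divr_gt0// cmod_gt0.
  have [s s0 hs] := cder_cont da e0.
  exists (Num.min r s); first by rewrite lt_min r0.
  move=> z; rewrite lt_min => /andP[/hr d1 /hs].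
  rewrite (addrC a) subrK => hz.
  have fz : f z != 0.
    apply: contraTneq hz => ->; rewrite sub0r cmodN -ltNge.
    by rewrite ltr_pdivrMr// ltr_pMr ?cmod_gt0// ltr1n.
  by have [] := cderV fz (DeriveDef d1 erefl).
case=> [//|d0].
have dc : 0 < cmod d by rewrite cmod_gt0.
have key (e : R) : 0 < e -> exists2 s : R, 0 < s & forall h : C, cmod h < s ->
    cmod (f (a + h) - d * h) <= e * cmod h.
  by move=> /((cderP _ _ _).1 da)[s s0 hs]; exists s => // h /hs; rewrite fa subr0.
have e0 : 0 < cmod d / 2 by rewrite divr_gt0.
have [s s0 hs] := key _ e0.
have low (h : C) : cmod h < s -> cmod d / 2 * cmod h <= cmod (f (a + h)).
  move=> /hs hh; have := cmodB (f (a + h)) (f (a + h) - d * h).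
  rewrite (_ : f (a + h) - _ = d * h); last by ring.
  by rewrite cmodM; lra.
exists 2%N, (fun z => (z - a) ^+ 2 * (f z)^-1), (Num.min r s); first by rewrite lt_min r0.
split=> // z; rewrite lt_min => /andP[zr zs].
have [->|za] := eqVneq z a; last first.
  have fz : f z != 0.
    rewrite -cmod_gt0; have := low (z - a) zs; rewrite (addrC a) subrK.
    by apply: lt_le_trans; rewrite mulr_gt0// cmod_gt0 subr_eq0.
  have [dk hk] := cderX a z 2.
  by have [] := cderM hk (cderV fz (DeriveDef (hr z zr) erefl)).
suff : is_derive a (1 : C) (fun z => (z - a) ^+ 2 * (f z)^-1) d^-1 by case.
apply/cderP => e e0'.
have e1 : 0 < e * (cmod d * (cmod d / 2)) by rewrite !mulr_gt0.
have [t t0 ht] := key _ e1.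
exists (Num.min s t); first by rewrite lt_min s0.
move=> h; rewrite lt_min => /andP[hs' ht'].
have [->|h0] := eqVneq h 0.
  by rewrite addr0 [X in cmod (X - _)]subrr mulr0 subr0 cmod0 mulr0.
have ch : 0 < cmod h by rewrite cmod_gt0.
have lo := low h hs'.
have fh : f (a + h) != 0 by rewrite -cmod_gt0; apply: lt_le_trans lo; rewrite mulr_gt0.
rewrite subrr expr0n/= mul0r subr0 (addrC a) addrK -(addrC a).
rewrite (_ : _ - _ = - (h * (f (a + h) - d * h) / (d * f (a + h)))); last first.
  by field; rewrite fh d0.
rewrite cmodN cmodM cmodV !cmodM mulrC.
rewrite ler_pdivrMl; last by rewrite mulr_gt0 ?cmod_gt0.
have := ht h ht' => hk.
apply: (@le_trans _ _ (cmod h * (e * (cmod d * (cmod d / 2)) * cmod h))).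
  by rewrite ler_wpM2l// ltW.
rewrite [leLHS](_ : _ = (e * cmod h * cmod d) * (cmod d / 2 * cmod h)); last by ring.
rewrite [leRHS](_ : _ = (e * cmod h * cmod d) * cmod (f (a + h))); last by ring.
by rewrite ler_wpM2l// !mulr_ge0// ltW.
Qed.

Definition zero_near f a := exists2 r : R, 0 < r & forall z, z != a -> cmod (z - a) < r -> f z = 0.

(** Vanishing is pushed to the left from [x1], and [t0] is the infimum of the abscissas reached.
    Clearing the pole at [t0] gives a function differentiable on a disc around it, to which
    [disc_identity] extends the vanishing known slightly to the right. *)
Lemma mero_identity h (x0 x1 y : R) : x0 <= x1 ->
  (forall t, x0 <= t <= x1 -> mero h (t +i* y)) -> zero_near h (x1 +i* y) ->
  forall t, x0 <= t <= x1 -> zero_near h (t +i* y).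
Proof.
move=> x01 hm h1.
pose S : set R := [set t | x0 <= t <= x1 /\ forall s, t <= s <= x1 -> zero_near h (s +i* y)].
have S1 : S x1.
  split; first by rewrite x01 lexx.
  by move=> s; rewrite -eq_le => /eqP <-.
have lbS : lbound S x0 by move=> t [/andP[]].
have iS : has_inf S by split; [exists x1|exists x0].
pose t0 := inf S.
have t00 : x0 <= t0 by apply: lb_le_inf => //; exists x1.
have t01 : t0 <= x1 by apply: ge_inf => //; exists x0.
have [|k [g [r r0 [dg hg]]]] := hm t0; first by rewrite t00.
have r8 : 0 < r / 8 by rewrite divr_gt0.
have [t St tr] := inf_adherent r8 iS.
have [/andP[tx0 tx1] ht] := St.
have t0t : t0 <= t by apply: ge_inf => //; exists x0.
rewrite -/t0 in tr.
have [|rho rho0 hrho] := ht t; first by rewrite lexx.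
(* The disc of radius [d] about the point [b] of abscissa [t + d] lies to the right of [t], inside
   the punctured disc where [h] vanishes; it also avoids [a], since [t0 <= t]. *)
pose d := Num.min (rho / 4) (r / 8).
have d0 : 0 < d by rewrite lt_min !divr_gt0.
have d1 : d <= rho / 4 by rewrite ge_min lexx.
have d2 : d <= r / 8 by rewrite ge_min lexx orbT.
set a := t0 +i* y in dg hg.
pose b : C := (t + d) +i* y.
have cR (u v : R) : cmod ((u +i* y) - (v +i* y)) = `|u - v|.
  by rewrite cmod_sqrt !cReIm/= subrr expr0n addr0 sqrtr_sqr.
have ba : cmod (b - a) <= r / 4.
  by rewrite cR ger0_norm; lra.
have gb z : cmod (z - b) < d -> g z = 0.
  move=> zb; have := Re_le_cmod (z - b); rewrite !cReIm/= ler_norml => hz.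
  have za : cmod (z - a) < r.
    rewrite (_ : z - a = (z - b) + (b - a)); last by ring.
    apply: le_lt_trans (cmodD _ _) _; lra.
  have zna : z != a.
    by apply/negP => /eqP E; have : Re z = t0 by [rewrite E]; lra.
  rewrite -hg// hrho ?mulr0//.
    by apply/negP => /eqP E; have : Re z = t by [rewrite E]; lra.
  rewrite (_ : z - _ = (z - b) + (b - (t +i* y))); last by ring.
  apply: le_lt_trans (cmodD _ _) _; rewrite cR.
  by rewrite (_ : t + d - t = d) ?ger0_norm; lra.
have ga z : cmod (z - a) < r / 4 -> g z = 0.
  move=> za; apply: (@disc_identity _ g b (r / 2) d) => //.
    move=> w wb; apply: dg; rewrite (_ : w - a = (w - b) + (b - a)); last by ring.
    apply: le_lt_trans (cmodD _ _) _; lra.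
  rewrite (_ : z - b = (z - a) - (b - a)); last by ring.
  apply: le_lt_trans (cmodB _ _) _; lra.
have ha z : z != a -> cmod (z - a) < r / 4 -> h z = 0.
  move=> zna za; have : (z - a) ^+ k * h z = 0 by rewrite hg ?ga//; lra.
  by move/eqP; rewrite mulf_eq0 expf_eq0 subr_eq0 (negPf zna) andbF => /eqP.
have loc s : `|s - t0| < r / 8 -> zero_near h (s +i* y).
  move=> hs; have [->|st] := eqVneq s t0.
    by exists (r / 4); [rewrite divr_gt0|exact: ha].
  have st0 : 0 < `|s - t0| by rewrite normr_gt0 subr_eq0.
  exists `|s - t0| => // z _ zs; apply: ha.
    by apply: contraTneq zs => ->; rewrite cR distrC ltxx.
  rewrite (_ : z - a = (z - (s +i* y)) + ((s +i* y) - a)); last by ring.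
  apply: le_lt_trans (cmodD _ _) _; rewrite cR; lra.
(* [m] is to the left of [t0] unless [t0 = x0], and the vanishing extends down to [m]; as [t0] is an
   infimum, [t0 = x0]. *)
pose m := Num.max x0 (t0 - r / 16).
have m1 : x0 <= m by rewrite le_max lexx.
have m2 : t0 - r / 16 <= m by rewrite le_max lexx orbT.
have mt0 : m <= t0 by rewrite ge_max t00/=; lra.
have Sm : S m.
  split; first by rewrite m1/=; lra.
  move=> s /andP[ms sx]; have [st|ts] := leP t s; first by apply: ht; rewrite st.
  by apply: loc; rewrite ltr_norml; lra.
have t0m : t0 <= m by apply: ge_inf => //; exists x0.
have E0 : t0 = x0.
  move: t0m; rewrite le_max => /orP[|]; lra.
move=> s /andP[s0 s1]; case: Sm => _; apply; rewrite s1 andbT.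
lra.
Qed.

Lemma zero_near_derive f d a : zero_near f a ->
  is_derive a (1 : C) f d -> d = 0.
Proof.
move=> [r r0 h] df.
have fa : f a = 0.
  apply/eqP; rewrite -cmod_eq0 eq_le cmod_ge0 andbT; apply/ler_addgt0Pl => e e0; rewrite addr0.
  have [s s0 hs] := cder_cont df e0.
  pose u : C := (Num.min r s / 2)%:C.
  have m0 : 0 < Num.min r s by rewrite lt_min r0.
  have cu : cmod u = Num.min r s / 2 by rewrite cmodR ger0_norm// divr_ge0// ltW.
  have mr : Num.min r s <= r by rewrite ge_min lexx.
  have ms : Num.min r s <= s by rewrite ge_min lexx orbT.
  have := hs u; rewrite h.
  - by rewrite sub0r cmodN; apply; rewrite cu; lra.
  - by rewrite -subr_eq0 addrC addKr -cmod_gt0 cu divr_gt0.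
  - by rewrite addrC addKr cu; lra.
have : is_derive a (1 : C) f 0.
  apply/cderP => e e0; exists r => // u ur; have [->|u0] := eqVneq u 0.
    by rewrite addr0 subrr mulr0 subr0 cmod0 mulr0.
  rewrite h ?fa ?subr0 ?mul0r ?subr0 ?cmod0 ?mulr_ge0 ?cmod_ge0 ?(ltW e0)//.
    by rewrite -subr_eq0 addrC addKr.
  by rewrite addrC addKr.
by case: df => _ <- [_ <-].
Qed.

End Meromorphic.

(** * Uniqueness and gluing of continuations *)

Section Gluing.
Variable R : realType.
Local Notation C := R[i].
Local Notation Re := (@complex.Re R).
Local Notation Im := (@complex.Im R).
Local Open Scope complex_scope.
Implicit Types (f g Z : C -> C) (a z w : C).

(** From [a] one moves to the right along a horizontal line up to an abscissa at least 2, where both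
    functions coincide; [3 / 2] is half the dimension. *)
Lemma mero_agree Z1 Z2 a :
  (forall t : R, Re a <= t -> mero Z1 (t +i* Im a)) ->
  (forall t : R, Re a <= t -> mero Z2 (t +i* Im a)) ->
  (forall s, 3 / 2 < Re s -> Z1 s = Z2 s) ->
  exists2 r : R, 0 < r & forall z, z != a -> cmod (z - a) < r -> Z1 z = Z2 z.
Proof.
move=> m1 m2 eq12; pose x1 := Num.max (Re a) 2.
have ax1 : Re a <= x1 by rewrite le_max lexx.
have x12 : 2 <= x1 by rewrite le_max lexx orbT.
have [||//||r r0 h] := @mero_identity R (fun z => Z1 z + -1 * Z2 z) (Re a) x1 (Im a) _ _ _ (Re a).
- by [].
- by move=> t /andP[at' _]; apply: meroD; [exact: m1|apply: meroZ; exact: m2].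
- exists (1 / 2); first by rewrite divr_gt0.
  move=> z _ hz; rewrite eq12 ?mulN1r ?subrr//.
  by have := Re_le_cmod (z - (x1 +i* Im a)); rewrite !cReIm/= ler_norml; lra.
- by rewrite lexx ax1.
exists r => // z za zr; apply/eqP; rewrite -subr_eq0 -mulN1r; apply/eqP.
by apply: h; case: a za zr {m1 m2 ax1 x1 x12} => ? ?.
Qed.

(** The difference vanishes on a punctured disc around 0, so its derivative at 0, when it exists, is
    0. *)
Lemma zeta_unique Z1 Z2 d1 d2 :
  (forall t : R, 0 <= t -> mero Z1 t%:C) -> (forall t : R, 0 <= t -> mero Z2 t%:C) ->
  (forall s, 3 / 2 < Re s -> Z1 s = Z2 s) ->
  is_derive (0 : C) (1 : C) Z1 d1 -> is_derive (0 : C) (1 : C) Z2 d2 ->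
  d1 = d2.
Proof.
move=> m1 m2 eq12 D1 D2.
have [||r r0 h] := @mero_agree Z1 Z2 0 _ _ eq12; [exact: m1|exact: m2|].
have D := cderB D1 D2.
apply/eqP; rewrite -subr_eq0; apply/eqP.
apply: zero_near_derive D; exists r => // z z0 zr.
by rewrite h// subrr.
Qed.

(** Each [Zs N] continues [f] to a half-plane, and any two of them agree near each common point,
    except perhaps at that point. The index is chosen pointwise and takes at most two values near a
    given point, so meromorphy is inherited. At 0 the value is that of [Z0], which is holomorphic
    there. *)
Lemma glue_zeta (Zs : nat -> C -> C) (Z0 f : C -> C) :
  (forall N a, - N%:R < Re a -> mero (Zs N) a) ->
  (forall N s, 3 / 2 < Re s -> Zs N s = f s) ->
  (forall t : R, 0 <= t -> mero Z0 t%:C) -> holomorphic_at Z0 0 ->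
  (forall s, 3 / 2 < Re s -> Z0 s = f s) ->
  exists Z, [/\ forall s, 3 / 2 < Re s -> Z s = f s,
    forall a, meromorphic_at Z a, holomorphic_at Z 0
    & exists2 r : R, 0 < r & forall z, cmod z < r -> Z z = Z0 z].
Proof.
move=> mZs Zsf mZ0 hZ0 Z0f.
(* Already [N z - 1] is large enough for [z], so near a point [a] the only values that occur, [N a]
   and [N a - 1], are both admissible at [a]. *)
pose N z := (Num.truncn (- Re z)).+2.
have NP z : - (N z).-1%:R < Re z.
  by rewrite /N/= ltrNl truncnS_gt.
pose Z z := if z == 0 then Z0 0 else Zs (N z) z.
have agree M K a : - M%:R < Re a -> - K%:R < Re a ->
    exists2 r : R, 0 < r & forall z, z != a -> cmod (z - a) < r -> Zs M z = Zs K z.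
  move=> hM hK; apply: mero_agree.
  - by move=> t ht; apply: mZs => /=; lra.
  - by move=> t ht; apply: mZs => /=; lra.
  - by move=> s hs; rewrite !Zsf.
have Zloc a : exists2 r : R, 0 < r & forall z, z != a -> z != 0 -> cmod (z - a) < r -> Zs (N a) z = Z z.
  pose m := Num.truncn (- Re a).
  have Na : N a = m.+2 by [].
  have am : - m.+1%:R < Re a by have := NP a.
  have [r1 r10 h1] : exists2 r : R, 0 < r & forall z, z != a -> cmod (z - a) < r -> Zs m.+1 z = Zs (N a) z.
    by apply: agree => //; rewrite Na -natr1; have := am; lra.
  have am2 : - m.+2%:R < Re a by rewrite -natr1; lra.
  pose r2 := Re a + m.+1%:R; have r20 : 0 < r2 by rewrite /r2; lra.
  exists (Num.min r1 (Num.min r2 (1 / 2))); first by rewrite !lt_min r10 r20 divr_gt0.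
  move=> z za z0; rewrite !lt_min => /andP[zr1 /andP[zr2 zr3]].
  rewrite /Z (negPf z0).
  have := Re_le_cmod (z - a); rewrite !cReIm ler_norml => /andP[l1 l2].
  have Nz : N z = m.+2 \/ N z = m.+1.
    have h3 : (Num.truncn (- Re z) <= m)%N by rewrite truncn_le_nat; rewrite /r2 in zr2; lra.
    have h4 : (m <= (Num.truncn (- Re z)).+1)%N.
      case em : m => [//|[//|k]]; rewrite !ltnS truncn_gt_nat.
      have : (k.+1 < m)%N by rewrite em.
      rewrite /m truncn_gt_nat -natr1; lra.
    by move: h3 h4; rewrite /N; move: (Num.truncn (- Re z)) (m) => p q; clear; lia.
  by case: Nz => E; rewrite E; [rewrite Na|rewrite h1].
have Znear : exists2 r : R, 0 < r & forall z, cmod z < r -> Z z = Z0 z.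
  have [r1 r10 h1] := Zloc 0.
  have [|||r2 r20 h2] := @mero_agree (Zs (N 0)) Z0 0.
  - by move=> t /= t0; apply: mZs; apply: lt_le_trans t0; rewrite oppr_lt0 ltr0n.
  - by move=> t /= t0; exact: mZ0.
  - by move=> s hs; rewrite Zsf// Z0f.
  exists (Num.min r1 r2); first by rewrite lt_min r10.
  move=> z; rewrite lt_min => /andP[z1 z2].
  have [->|z0] := eqVneq z 0; first by rewrite /Z eqxx.
  by rewrite -h1 ?subr0// h2 ?subr0.
exists Z; split; last exact: Znear.
- move=> s hs; rewrite /Z; case: eqVneq => [s0|_]; last exact: Zsf.
  exfalso; have : (3 / 2 : R) < 0 by [move: hs; rewrite s0].
  clear s0; lra.
- move=> a; apply/meroP; have [r r0 h] := Zloc a.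
  apply: mero_ext (mZs (N a) a _); last by have := NP a; rewrite -[N a]prednK// -natr1; lra.
  have [a0|a0] := eqVneq a 0.
    by exists r => // z za zr; apply: h => //; rewrite -a0.
  have ca : 0 < cmod a by rewrite cmod_gt0.
  exists (Num.min r (cmod a)); first by rewrite lt_min r0.
  move=> z za; rewrite lt_min => /andP[zr zca]; apply: h => //.
  by apply: contraTneq zca => ->; rewrite sub0r cmodN ltxx.
- have [r r0 h] := Znear; have [s s0 hs] := (holP _ _).1 hZ0.
  apply/holP; exists (Num.min s r); first by rewrite lt_min s0.
  move=> z; rewrite lt_min subr0 => /andP[zs zr].
  apply: (@derivable_near _ Z0); last by apply: hs; rewrite subr0.
  exists (r - cmod z); first by rewrite subr_gt0.
  move=> w wz; rewrite h// (_ : w = (w - z) + z); last by ring.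
  by apply: le_lt_trans (cmodD _ _) _; lra.
Qed.

End Gluing.

(** * The Riemann zeta function *)

Section Powers.
Variable R : realType.
Local Notation C := R[i].
Local Notation Re := (@complex.Re R).
Local Notation Im := (@complex.Im R).
Local Open Scope complex_scope.
Implicit Types (s z : C) (x y : R) (u v : R -> C).

Lemma fset_nat_bound (A : {fset nat}) : exists n, forall i, i \in A -> (i < n)%N.
Proof.
exists (\sum_(i <- A) i.+1)%N => i iA.
by rewrite (big_fsetD1 i iA)/= leq_addr.
Qed.

Lemma sum_fset_nat_le (F : nat -> R) (M : R) : (forall i, 0 <= F i) ->
  (forall n, \sum_(i < n) F i <= M) -> forall A : {fset nat}, \sum_(i <- A) F i <= M.
Proof.
move=> F0 hM A; have [n hn] := fset_nat_bound A.
apply: le_trans (hM n); rewrite -(big_mkord xpredT).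
pose B := seq_fset tt (index_iota 0 n).
have AB : (A `<=` B)%fset.
  by apply/fsubsetP => i /hn; rewrite /B seq_fsetE mem_index_iota.
apply: le_trans (ler_sum_fsub F0 AB) _.
rewrite le_eqVlt; apply/orP; left; apply/eqP.
apply: perm_big; apply: uniq_perm; rewrite ?fset_uniq ?iota_uniq//.
by move=> i; rewrite /B seq_fsetE.
Qed.

Lemma summ_nat (F : nat -> R) (M : R) : (forall n, \sum_(i < n) `|F i| <= M) -> summ F.
Proof. by move=> hM; exists M; apply: sum_fset_nat_le. Qed.

(** Each term is compared with a difference of [x^(1 - p)] by the mean value theorem, and the
    differences telescope. *)
Lemma summ_pseries p : 1 < p -> summ (fun n : nat => n.+1%:R `^ (- p) : R).
Proof.
move=> p1; apply: (@summ_nat _ (1 + (p - 1)^-1)) => n.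
have key (k : nat) : k.+2%:R `^ (- p) <= (p - 1)^-1 * (k.+1%:R `^ (1 - p) - k.+2%:R `^ (1 - p)) :> R.
  have k1 : (0 : R) < k.+1%:R by [].
  have k12 : k.+1%:R <= k.+2%:R :> R by rewrite ler_nat.
  have [|c /andP[c1 c2]] := @mvt_local R (fun x => x `^ (1 - p)) (fun x => (1 - p) * x `^ (1 - p - 1)) _ _ k12.
    by move=> x /andP[x1 _]; apply: is_derive1_powR; exact: lt_le_trans x1.
  rewrite (_ : k.+2%:R - k.+1%:R = 1 :> R); last by rewrite -[k.+2%:R]natr1; ring.
  rewrite mulr1 (_ : 1 - p - 1 = - p); last by ring.
  move=> E; rewrite -[X in _ * X]opprB E -mulNr opprB mulrA mulVf ?mul1r; last first.
    by rewrite gt_eqF// subr_gt0.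
  rewrite !powRN lef_pV2 ?posrE ?powR_gt0//; last exact: lt_le_trans c1.
  by apply: ge0_ler_powR => //; rewrite ?nnegrE; lra.
have p0 : 0 < (p - 1)^-1 by rewrite invr_gt0 subr_gt0.
suff h m : \sum_(i < m.+1) `|i.+1%:R `^ (- p)| <= 1 + (p - 1)^-1 * (1 - m.+1%:R `^ (1 - p)) :> R.
  case: n => [|n]; first by rewrite big_ord0 addr_ge0// ltW.
  apply: le_trans (h n) _; rewrite lerD2l ler_piMr ?(ltW p0)//; rewrite ?lerBlDr ?lerDl ?powR_ge0.
elim: m => [|m IH].
  by rewrite big_ord1/= !powR1 normr1 subrr mulr0 addr0.
rewrite big_ord_recr/= ger0_norm ?powR_ge0//; have := key m; lra.
Qed.

Lemma cpowE x s : cpow x s = cexp (s * (ln x)%:C). Proof. by []. Qed.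

Lemma cmod_cpow x s : 0 < x -> cmod (cpow x s) = x `^ Re s.
Proof. by move=> x0; rewrite cpowE cmod_cexp cReM/= mulr0 subr0 /powR gt_eqF. Qed.

Lemma cpowD x s (t : C) : cpow x (s + t) = cpow x s * cpow x t.
Proof. by rewrite !cpowE mulrDl cexpD. Qed.

Lemma cpow0 x : cpow x 0 = 1.
Proof. by rewrite cpowE mul0r cexp0. Qed.

Lemma cpow1 x : 0 < x -> cpow x 1 = x%:C.
Proof.
move=> x0; rewrite cpowE mul1r.
by apply: complex_eqP; rewrite /= ?cos0 ?sin0 ?mulr1 ?mulr0// lnK.
Qed.

Lemma cpowMl x y s : 0 < x -> 0 < y -> cpow (x * y) s = cpow x s * cpow y s.
Proof. by move=> x0 y0; rewrite !cpowE lnM ?posrE// rmorphD/= mulrDr cexpD. Qed.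

Lemma cpow_neq0 x s : cpow x s != 0.
Proof. exact: cexp_neq0. Qed.

Lemma cpowN x s : cpow x (- s) = (cpow x s)^-1.
Proof. by rewrite !cpowE mulNr cexpN. Qed.

Lemma cder_cpow x (p q : C) s :
  is_derive s (1 : C) (fun s => cpow x (p * s + q)) (cpow x (p * s + q) * (p * (ln x)%:C)).
Proof.
have := @cder_comp _ (@cexp R) (fun s => (p * s + q) * (ln x)%:C) s _ _ (cder_cexp ((p * s + q) * (ln x)%:C))
  (cderM (cderD (cderZ p (cder_id s)) (cder_cst s q)) (cder_cst s (ln x)%:C)).
by move=> h; apply: cder_eq h _; rewrite cpowE; ring.
Qed.

Definition rder (u : R -> C) x (d : C) :=
  is_derive x 1 (fun t => Re (u t)) (Re d) /\ is_derive x 1 (fun t => Im (u t)) (Im d).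

Lemma rder_eq u x (d e : C) : rder u x d -> d = e -> rder u x e.
Proof. by move=> ? <-. Qed.

Lemma rder_ext u v x (d : C) : u =1 v -> rder u x d -> rder v x d.
Proof. by move=> /funext ->. Qed.

Lemma rderD u v x (d e : C) : rder u x d -> rder v x e -> rder (fun t => u t + v t) x (d + e).
Proof.
move=> [h1 h2] [k1 k2]; split.
  apply: is_derive_ext (drv_eq (drvD h1 k1) _) => [t|]; by rewrite cReD.
apply: is_derive_ext (drv_eq (drvD h2 k2) _) => [t|]; by rewrite cImD.
Qed.

Lemma rderM u v x (d e : C) : rder u x d -> rder v x e ->
  rder (fun t => u t * v t) x (d * v x + u x * e).
Proof.
move=> [h1 h2] [k1 k2]; split.
  apply: is_derive_ext (drv_eq (drvB (drvM h1 k1) (drvM h2 k2)) _) => [t|].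
    by rewrite cReM.
  by rewrite !cReIm; ring.
apply: is_derive_ext (drv_eq (drvD (drvM h1 k2) (drvM h2 k1)) _) => [t|].
  by rewrite cImM.
by rewrite !cReIm; ring.
Qed.

Lemma rder_cst (c : C) x : rder (fun=> c) x 0.
Proof. by split; exact: drv_cst. Qed.

Lemma rderZ (c : C) u x (d : C) : rder u x d -> rder (fun t => c * u t) x (c * d).
Proof. by move=> h; apply: rder_eq (rderM (rder_cst c x) h) _; rewrite mul0r add0r. Qed.

Lemma rderN u x (d : C) : rder u x d -> rder (fun t => - u t) x (- d).
Proof.
move=> h; apply: rder_ext (rder_eq (rderZ (-1) h) _) => [t|]; by rewrite mulN1r.
Qed.

Lemma rderB u v x (d e : C) : rder u x d -> rder v x e -> rder (fun t => u t - v t) x (d - e).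
Proof. by move=> hu hv; exact: rderD hu (rderN hv). Qed.

Lemma rder_real (f : R -> R) x d : is_derive x 1 f d -> rder (fun t => (f t)%:C) x d%:C.
Proof. by move=> h; split=> //=; exact: drv_cst. Qed.

Lemma rder_shift u c x (d : C) : rder u (x + c) d -> rder (fun t => u (t + c)) x d.
Proof.
by move=> [h1 h2]; split; [exact: (@drv_shift R (fun t => Re (u t)))|
  exact: (@drv_shift R (fun t => Im (u t)))].
Qed.

Lemma rder_cpow (th : R -> R) x d s : 0 < th x -> is_derive x 1 th d ->
  rder (fun t => cpow (th t) s) x (s * (d / th x)%:C * cpow (th x) s).
Proof.
move=> t0 hd; have hl := drv_comp (is_derive1_ln t0) hd.
case: s => a b.
have E t : cpow (th t) (a +i* b) = (expR (a * ln (th t)) * cos (b * ln (th t))) +i*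
   (expR (a * ln (th t)) * sin (b * ln (th t))).
  by rewrite cpowE /cexp/= !mulr0 subr0 add0r; congr (_ +i* _); rewrite /= ?addr0.
have he := @drv_comp R (@expR R) (fun t => a * ln (th t)) x _ _ (is_derive_expR (a * ln (th x))) (drvZ a hl).
have hc := @drv_comp R (@cos R) (fun t => b * ln (th t)) x _ _ (is_derive_cos (b * ln (th x))) (drvZ b hl).
have hs := @drv_comp R (@sin R) (fun t => b * ln (th t)) x _ _ (is_derive_sin (b * ln (th x))) (drvZ b hl).
split.
  apply: is_derive_ext (drv_eq (drvM he hc) _) => [t|]; first by rewrite E.
  by rewrite E !cReIm/=; ring.
apply: is_derive_ext (drv_eq (drvM he hs) _) => [t|]; first by rewrite E.
by rewrite E !cReIm/=; ring.
Qed.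

Lemma rmvt u (du : R -> C) a b (M : R) : a <= b -> (forall x, a <= x <= b -> rder u x (du x)) ->
  (forall x, a <= x <= b -> cmod (du x) <= M) -> cmod (u b - u a) <= 2 * M * (b - a).
Proof.
move=> ab hd hM.
have h1 := ler_mvt ab (fun x hx => (hd x hx).1) (fun x hx => le_trans (Re_le_cmod _) (hM x hx)).
have h2 := ler_mvt ab (fun x hx => (hd x hx).2) (fun x hx => le_trans (Im_le_cmod _) (hM x hx)).
apply: le_trans (cmod_le_ReIm _) _; rewrite !cReIm; lra.
Qed.

(** The inner difference is taken first, so that inductions generalise over [u]; [fdiffS] is the
    other unfolding. *)
Fixpoint fdiff (n : nat) (u : R -> C) : R -> C :=
  if n is m.+1 then fdiff m (fun x => u (x + 1) - u x) else u.

Lemma fdiffS n u x : fdiff n.+1 u x = fdiff n u (x + 1) - fdiff n u x.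
Proof.
elim: n u x => [//|n IH] u x.
by rewrite [LHS]IH.
Qed.

(** [G] is a chain of successive derivatives: each difference is a mean value of the next one, at
    the cost of the factor 2 of [rmvt]. *)
Lemma fdiff_bound n (G : nat -> R -> C) x (M : R) :
  (forall k y, x <= y -> rder (G k) y (G k.+1 y)) ->
  (forall y, x <= y <= x + n%:R -> cmod (G n y) <= M) ->
  cmod (fdiff n (G 0%N) x) <= 2 ^+ n * M.
Proof.
elim: n G x M => [|n IH] G x M hd hM.
  by rewrite expr0 mul1r hM// lexx/= addr0.
rewrite /= exprSr -mulrA; apply: (IH (fun k y => G k (y + 1) - G k y)).
  move=> k y xy; apply: rderB; last exact: hd.
  by apply: rder_shift; apply: hd; lra.
move=> y /andP[xy yn].
have := @rmvt (G n) (G n.+1) y (y + 1) M.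
rewrite lerDl ler01 => /(_ erefl); rewrite (addrC y) addrK mulr1; apply.
  by move=> z /andP[yz _]; apply: hd; lra.
by move=> z /andP[yz zy]; apply: hM; move: yn; rewrite -natr1; lra.
Qed.

End Powers.

(** * The alternating zeta function and Euler's transformation *)

Section Eta.
Variable R : realType.
Local Notation C := R[i].
Local Notation Re := (@complex.Re R).
Local Notation Im := (@complex.Im R).
Local Open Scope complex_scope.
Implicit Types (s z : C) (x y : R).

Lemma csum_shift (I J : choiceType) (h : I -> J) (F : J -> C) : bijective h -> csumm F ->
  csumm (F \o h) /\ csum (F \o h) = csum F.
Proof.
move=> hb hF; split; last exact: csum_bij.
by apply: (@summ_inj _ _ _ h (fun i => cmod (F i))) => //; exact: bij_inj.
Qed.

Lemma csum_parity (F : nat -> C) : csumm F ->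
  csum F = csum (fun i => F i.*2) + csum (fun i => F i.*2.+1).
Proof.
move=> hF.
pose h (k : nat + nat) := match k with inl i => i.*2 | inr i => i.*2.+1 end.
pose g n := if odd n then inr n./2 else inl n./2 : nat + nat.
have hb : bijective h.
  exists g => [[i|i]|n]; rewrite /h /g.
  - by rewrite odd_double doubleK.
  - by rewrite /= odd_double/= uphalf_double.
  - by case: ifP => on; have := odd_double_half n; rewrite on.
have [h1 <-] := csum_shift hb hF.
by rewrite csum_sumtype.
Qed.

Lemma csumN (I : choiceType) (F : I -> C) : csumm F -> csum (fun i => - F i) = - csum F.
Proof.
move=> hF; rewrite -mulN1r -csumZ//; apply: eq_csum => i; by rewrite mulN1r.
Qed.

Lemma csum_recl (F : nat -> C) : csumm F -> csum F = F 0%N + csum (fun i => F i.+1).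
Proof.
move=> hF.
pose F0 i := if i == 0%N then F i else 0; pose F1 i := if i == 0%N then 0 else F i.
have h0 : csumm F0.
  by apply: csumm_le hF => i; rewrite /F0; case: ifP => // _; rewrite cmod0 cmod_ge0.
have h1 : csumm F1.
  by apply: csumm_le hF => i; rewrite /F1; case: ifP => // _; rewrite cmod0 cmod_ge0.
rewrite (@eq_csum _ _ F (fun i => F0 i + F1 i)); last first.
  by move=> i; rewrite /F0 /F1; case: ifP; rewrite ?addr0 ?add0r.
rewrite csumD//; congr (_ + _).
  rewrite (@csum_fin _ _ _ [fset 0%N]%fset) ?big_seq_fset1// => i.
  by rewrite inE /F0 => /negPf ->.
rewrite -(@csum_inj _ _ _ succn F1) => //; first by move=> ? ? [].
by case=> [|i _]; [rewrite /F1/= eqxx|exists i].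
Qed.

(** The falling factorial of [- s]: the derivative of order [n] of [x^(- s)] is [pc n s] times
    [x^(- s - n)]. *)
Definition pc (n : nat) s : C := \prod_(i < n) (- s - i%:R).

Lemma pcS n s : pc n.+1 s = pc n s * (- s - n%:R).
Proof. by rewrite /pc big_ord_recr. Qed.

Lemma cmod_pc n s (A : R) : cmod s <= A -> cmod (pc n s) <= (A + n%:R) ^+ n.
Proof.
move=> sA; have A0 : 0 <= A by apply: le_trans sA; exact: cmod_ge0.
suff H m : (m <= n)%N -> cmod (pc m s) <= (A + n%:R) ^+ m by exact: H.
elim: m => [|m IH] mn; first by rewrite /pc big_ord0 cmod1 expr0.
rewrite pcS cmodM exprSr ler_pM ?cmod_ge0//; first by apply: IH; exact: ltnW.
apply: le_trans (cmodB _ _) _; rewrite cmodN cmod_nat lerD// ler_nat; exact: ltnW.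
Qed.

Lemma rder_pw n s x : 0 < x ->
  rder (fun x => pc n s * cpow x (- s - n%:R)) x (pc n.+1 s * cpow x (- s - n.+1%:R)).
Proof.
move=> x0; apply: rder_eq (rderZ (pc n s) (@rder_cpow R (fun x => x) x 1 (- s - n%:R) x0 (drv_id x))) _.
rewrite pcS (_ : cpow x (- s - n.+1%:R) = cpow x (- s - n%:R) / x%:C).
  by rewrite div1r fmorphV; ring.
by rewrite -(cpow1 x0) -cpowN -cpowD; congr cpow; rewrite -natr1; ring.
Qed.

Definition Pw s x : C := cpow x (- s).

Lemma ler_powR_decr x y (a : R) : 0 < x -> x <= y -> a <= 0 -> y `^ a <= x `^ a.
Proof.
move=> x0 xy a0; have y0 : 0 < y by exact: lt_le_trans xy.
rewrite -(opprK a) (powRN y) (powRN x) lef_pV2 ?posrE ?powR_gt0//.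
by apply: ge0_ler_powR => //; rewrite ?nnegrE; lra.
Qed.

(** A difference of order [N] gains [N] powers of [x], with a constant locally uniform in [s]. This
    gain is what makes the transformed series converge, and differentiable in [s], for
    [Re s + N > 1]. *)
Lemma fdiff_Pw_bound N s x (A : R) : 0 < x -> cmod s <= A -> 0 <= Re s + N%:R ->
  cmod (fdiff N (Pw s) x) <= 2 ^+ N * (A + N%:R) ^+ N * x `^ (- (Re s + N%:R)).
Proof.
move=> x0 sA sN.
pose G n y : C := pc n s * cpow y (- s - n%:R).
have G0 : Pw s = G 0%N.
  by apply/funext => y; rewrite /G /Pw /pc big_ord0 mul1r subr0.
rewrite G0 -mulrA; apply: fdiff_bound.
  by move=> k y xy; apply: rder_pw; exact: lt_le_trans xy.
move=> y /andP[xy _]; have y0 : 0 < y by exact: lt_le_trans xy.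
rewrite /G cmodM ler_pM ?cmod_ge0//; first exact: cmod_pc.
rewrite cmod_cpow// !cReIm -(rmorph_nat (@real_complex R))/= -opprD.
by apply: ler_powR_decr => //; rewrite oppr_le0.
Qed.

Lemma fdiff_cder n (u : C -> R -> C) (du : R -> C) s x :
  (forall y, x <= y -> is_derive s (1 : C) (u ^~ y) (du y)) ->
  is_derive s (1 : C) (fun s => fdiff n (u s) x) (fdiff n du x).
Proof.
elim: n u du => [|n IH] u du hd /=; first by apply: hd.
apply: (IH (fun s y => u s (y + 1) - u s y) (fun y => du (y + 1) - du y)) => y xy.
by apply: cderB; apply: hd => //; rewrite (le_trans xy)// lerDl.
Qed.

Definition dPw s x : C := cpow x (- s) * - (ln x)%:C.

Lemma cder_Pw s x : is_derive s (1 : C) (fun s => Pw s x) (dPw s x).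
Proof.
have := @cder_cpow R x (-1) 0 s.
rewrite (_ : (fun s => cpow x (-1 * s + 0)) = (fun s => Pw s x)); last first.
  by apply/funext => t; rewrite addr0 mulN1r.
by rewrite addr0 !mulN1r.
Qed.

(** The factor of one Euler step: an alternating sum of [u n] is [u 0 / 2] plus [mh] times the
    alternating sum of [u n.+1 - u n]. *)
Definition mh : C := - 2^-1.

(* [N] steps of Euler's transformation of the alternating series: [eta N s] makes
   sense for [Re s > - N] and does not depend on [N] there. *)
Definition eta (N : nat) s : C :=
  \sum_(r < N) mh ^+ r / 2 * fdiff r (Pw s) 1 +
  mh ^+ N * csum (fun n : nat => (-1) ^+ n * fdiff N (Pw s) n.+1%:R).

Definition deta (N : nat) s : C :=
  \sum_(r < N) mh ^+ r / 2 * fdiff r (dPw s) 1 +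
  mh ^+ N * csum (fun n : nat => (-1) ^+ n * fdiff N (dPw s) n.+1%:R).

Lemma cmod_sign n : cmod ((-1 : C) ^+ n) = 1.
Proof. by rewrite cmodX cmodN cmod1 expr1n. Qed.

Lemma eta_summ N s : 1 < Re s + N%:R -> csumm (fun n : nat => (-1) ^+ n * fdiff N (Pw s) n.+1%:R).
Proof.
move=> h; apply: csumm_le (summZ (2 ^+ N * (cmod s + N%:R) ^+ N) (summ_pseries h)) => n.
by rewrite cmodM cmod_sign mul1r; apply: fdiff_Pw_bound => //; lra.
Qed.

Lemma cder_sum (I : Type) (l : seq I) (F : I -> C -> C) (dF : I -> C) s :
  (forall i, is_derive s (1 : C) (F i) (dF i)) ->
  is_derive s (1 : C) (fun z => \sum_(i <- l) F i z) (\sum_(i <- l) dF i).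
Proof.
move=> h; elim: l => [|i l IH].
  rewrite big_nil (_ : (fun z => _) = (fun=> 0)); first exact: cder_cst.
  by apply/funext => z; rewrite big_nil.
rewrite big_cons (_ : (fun z => _) = (fun z => F i z + \sum_(j <- l) F j z)).
  exact: cderD.
by apply/funext => z; rewrite big_cons.
Qed.

Lemma eta_derive N s : 1 < Re s + N%:R -> is_derive s (1 : C) (eta N) (deta N s).
Proof.
move=> h; pose r := (Re s + N%:R - 1) / 2; have r0 : 0 < r by rewrite /r; lra.
apply: cderD.
  by apply: cder_sum => i; apply: cderZ; apply: fdiff_cder => y _; exact: cder_Pw.
apply: cderZ.
have p1 : 1 < Re s - r + N%:R by rewrite /r; lra.
apply: (@csum_derive _ _ (fun n z => (-1) ^+ n * fdiff N (Pw z) n.+1%:R)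
  (fun n z => (-1) ^+ n * fdiff N (dPw z) n.+1%:R) s r
  (fun n => 2 ^+ N * (cmod s + r + N%:R) ^+ N * n.+1%:R `^ (- (Re s - r + N%:R)))) => //.
- by move=> n z _; apply: cderZ; apply: fdiff_cder => y _; exact: cder_Pw.
- move=> n z zr; rewrite cmodM cmod_sign mul1r.
  have := Re_le_cmod (z - s); rewrite !cReIm ler_norml => /andP[z1 z2].
  have zA : cmod z <= cmod s + r.
    rewrite (_ : z = s + (z - s)); last by ring.
    by apply: le_trans (cmodD _ _) _; rewrite lerD2l ltW.
  have zN : 0 <= Re z + N%:R by lra.
  apply: le_trans (fdiff_Pw_bound (ltr0Sn _ n) zA zN) _.
  apply: ler_wpM2l.
    by rewrite mulr_ge0// exprn_ge0// !addr_ge0// ?cmod_ge0// ltW.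
  by apply: ler_powR; [rewrite ler1n|lra].
- exact: summZ (summ_pseries p1).
Qed.

Definition zetaS s : C := csum (fun n : nat => Pw s n.+1%:R).
(** The alternating zeta function divided by [1 - 2^(1 - s)]. At a zero of the denominator the
    quotient is 0 by convention, and meromorphy does not see the value at one point. *)
Definition zetaN N s : C := eta N s / (1 - cpow 2 (1 - s)).

Lemma zetaS_summ s : 1 < Re s -> csumm (fun n : nat => Pw s n.+1%:R).
Proof.
move=> h; apply: csumm_le (summ_pseries h) => n.
by rewrite cmod_cpow// cReN.
Qed.

Lemma altsum_step (u : nat -> C) : csumm (fun n => (-1) ^+ n * u n) ->
  csum (fun n : nat => (-1) ^+ n * u n) =
  2^-1 * u 0%N + mh * csum (fun n => (-1) ^+ n * (u n.+1 - u n)).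
Proof.
move=> hu; set S := csum _.
have hs : csumm (fun n => (-1) ^+ n * u n.+1).
  have := @summ_inj R _ _ succn (fun n => cmod ((-1) ^+ n * u n)) succn_inj hu.
  by apply: csumm_le => n /=; rewrite !cmodM !cmod_sign.
have E1 : csum (fun n => (-1) ^+ n * u n.+1) = u 0%N - S.
  rewrite /S (csum_recl hu) expr0 mul1r opprD addrA subrr sub0r.
  have E n : (-1) ^+ n.+1 * u n.+1 = - ((-1) ^+ n * u n.+1) by rewrite exprS; ring.
  rewrite (eq_csum E) csumN// opprK//.
have -> : csum (fun n => (-1) ^+ n * (u n.+1 - u n)) = u 0%N - S - S.
  by rewrite -E1 -csumB//; apply: eq_csum => n; rewrite mulrBr.
by rewrite /mh; field.
Qed.

Lemma etaS N s : 1 < Re s + N%:R -> eta N.+1 s = eta N s.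
Proof.
move=> h; rewrite /eta big_ord_recr/= -addrA; congr (_ + _).
rewrite [in RHS](@altsum_step (fun n => fdiff N (Pw s) n.+1%:R)); last exact: eta_summ.
rewrite (mulrDr (mh ^+ N)); congr (_ + _); first by rewrite mulrA.
rewrite exprSr -mulrA; congr (_ * (_ * _)).
by apply: eq_csum => n; rewrite -[n.+2%:R]natr1 -fdiffS.
Qed.

Lemma eta0E N s : 1 < Re s -> eta N s = eta 0 s.
Proof.
move=> h; elim: N => [//|N IH]; rewrite etaS// (lt_le_trans h)// lerDl.
by [].
Qed.

Lemma two_pow_neq1 s : 1 < Re s -> 1 - cpow 2 (1 - s) != 0.
Proof.
move=> h; rewrite subr_eq0; apply: contraTneq (h) => E.
have : cmod (cpow (2 : R) (1 - s)) < 1.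
  rewrite cmod_cpow// /powR gt_eqF// expR_lt1 pmulr_llt0 ?ln_gt0 ?ltr1n//.
  by rewrite !cReIm/=; lra.
by rewrite -E cmod1 ltxx.
Qed.

(** The even-numbered terms sum to [2^(- s)] times the zeta function, and the alternating series is
    the full one minus twice these. *)
Lemma zetaS_zetaN N s : 1 < Re s -> zetaN N s = zetaS s.
Proof.
move=> h; rewrite /zetaN eta0E//.
rewrite -[RHS](mulfK (two_pow_neq1 h)); congr (_ / _).
have hZ := zetaS_summ h.
have hE : csumm (fun n : nat => (-1) ^+ n * Pw s n.+1%:R).
  by apply: csumm_le hZ => n; rewrite cmodM cmod_sign mul1r.
have hev : csumm (fun i : nat => Pw s i.*2.+1%:R).
  by apply: (@summ_inj _ _ _ double _ double_inj hZ).
have hod : csumm (fun i : nat => Pw s i.*2.+2%:R).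
  apply: (@summ_inj _ _ _ (fun i => i.*2.+1) _ _ hZ).
  by move=> i j [/double_inj].
rewrite /eta big_ord0 add0r expr0 mul1r /zetaS (csum_parity hZ) (csum_parity hE)/=.
have -> : csum (fun i => (-1) ^+ i.*2 * Pw s i.*2.+1%:R) = csum (fun i => Pw s i.*2.+1%:R).
  by apply: eq_csum => i; rewrite -signr_odd odd_double mul1r.
have -> : csum (fun i => (-1) ^+ i.*2.+1 * Pw s i.*2.+2%:R) = - csum (fun i => Pw s i.*2.+2%:R).
  rewrite -csumN//; apply: eq_csum => i.
  by rewrite -signr_odd/= odd_double mulN1r.
have E : csum (fun i => Pw s i.*2.+2%:R) = cpow 2 (- s) * zetaS s.
  rewrite /zetaS -csumZ//; apply: eq_csum => i.
  by rewrite /Pw -cpowMl// -natrM mul2n doubleS.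
have E' := csum_parity hZ; rewrite -/(zetaS s) E in E'.
rewrite -(csum_parity hZ) -/(zetaS s) E cpowD cpow1//.
have -> : csum (fun i => Pw s i.*2.+1%:R) = zetaS s - cpow 2 (- s) * zetaS s.
  by rewrite [X in X - _]E'; ring.
by rewrite (rmorph_nat (@real_complex R) 2); ring.
Qed.

Lemma zeta_den_derive (s : C) : is_derive s (1 : C) (fun s => 1 - cpow (2 : R) (1 - s))
  (cpow 2 (1 - s) * (ln 2)%:C).
Proof.
have := cderB (cder_cst s 1) (@cder_cpow R 2 (-1) 1 s).
rewrite (_ : (fun t => 1 - cpow 2 (-1 * t + 1)) = (fun s => 1 - cpow (2 : R) (1 - s))).
  by move=> h; apply: cder_eq h _; rewrite (_ : -1 * s + 1 = 1 - s); ring.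
by apply/funext => t; congr (1 - cpow _ _); ring.
Qed.

(** The derivative [2^(1 - s) ln 2] of the denominator has no zero, so the zeros of the denominator
    are simple and [mero_inv] applies. *)
Lemma mero_zetaN N (a : C) : 1 < Re a + N%:R -> mero (zetaN N) a.
Proof.
move=> h; apply: meroM.
  apply: mero_hol; exists (Re a + N%:R - 1); first by lra.
  move=> z hz; have := Re_le_cmod (z - a); rewrite !cReIm ler_norml => /andP[z1 z2].
  by have [] : is_derive z (1 : C) (eta N) (deta N z) by apply: eta_derive; lra.
apply: (mero_inv _ (zeta_den_derive a)).
  by exists 1 => // z _; have [] := zeta_den_derive z.
right; rewrite mulf_neq0 ?cpow_neq0//.
by rewrite -cmod_gt0 cmodR normr_gt0 gt_eqF// ln_gt0// ltr1n.
Qed.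

End Eta.

(** * Value and derivative of the zeta function at -2 *)

Section ZetaMinusTwo.
Variable R : realType.
Local Notation C := R[i].
Local Notation Re := (@complex.Re R).
Local Notation Im := (@complex.Im R).
Local Open Scope complex_scope.
Implicit Types (s z : C) (x y : R).

Lemma fdiff_ext n (u v : R -> C) x : (forall y, x <= y -> u y = v y) -> fdiff n u x = fdiff n v x.
Proof.
elim: n u v => [|n IH] u v h /=; first exact: h.
by apply: IH => y xy; rewrite !h// (le_trans xy)// lerDl.
Qed.

Fixpoint rdiff (n : nat) (f : R -> R) : R -> R :=
  if n is m.+1 then rdiff m (fun x => f (x + 1) - f x) else f.

Lemma fdiff_real n (f : R -> R) x : fdiff n (fun y => (f y)%:C) x = (rdiff n f x)%:C.
Proof.
elim: n f => [//|n IH] f /=; rewrite -IH; apply: fdiff_ext => y _.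
by rewrite rmorphB.
Qed.

Lemma rdiffS n (f : R -> R) x : rdiff n.+1 f x = rdiff n f (x + 1) - rdiff n f x.
Proof. by elim: n f x => [//|n IH] f x; rewrite [LHS]IH. Qed.

Lemma rdiffN n (f : R -> R) x : rdiff n (fun y => - f y) x = - rdiff n f x.
Proof.
elim: n f => [//|n IH] f /=; rewrite -IH; congr (rdiff n _ x).
by apply/funext => y; ring.
Qed.

Lemma rdiff_ge0 n (G : nat -> R -> R) x :
  (forall k y, x <= y -> is_derive y 1 (G k) (G k.+1 y)) ->
  (forall y, x <= y -> 0 <= G n y) -> 0 <= rdiff n (G 0%N) x.
Proof.
elim: n G => [|n IH] G hd hG /=; first exact: hG.
apply: (IH (fun k y => G k (y + 1) - G k y)) => [k y xy|y xy].
  by apply: drvB; [apply: drv_shift; apply: hd; lra|exact: hd].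
have yy : y <= y + 1 by rewrite lerDl.
have [|c /andP[yc _] ->] := @mvt_local R (G n) (G n.+1) _ _ yy.
  by move=> z /andP[yz _]; apply: hd; lra.
by rewrite (addrC y) addrK mulr1 hG//; lra.
Qed.

Lemma csum_real (I : choiceType) (F : I -> R) : csum (fun i => (F i)%:C) = (rsum F)%:C.
Proof. by apply: complex_eqP; rewrite /= ?rsum0. Qed.

Definition ylny x : R := x ^+ 2 * ln x.

Lemma drv_pow k x : 0 < x -> is_derive x 1 (fun t : R => t `^ (- k%:R)) (- k%:R * x `^ (- k.+1%:R)).
Proof.
move=> x0; apply: drv_eq (is_derive1_powR (- k%:R) x0) _.
by congr (_ * _ `^ _); rewrite -natr1; ring.
Qed.

(* The third and higher derivatives of [x ^ 2 * ln x]: the derivative of order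
   [k + 3] is [2 (-1)^k k! x^(-k-1)]. *)
Definition ylny_der (k : nat) x : R :=
  match k with
  | 0 => ylny x
  | 1 => 2 * (x * ln x) + x
  | 2 => 2 * ln x + 3
  | k.+3 => 2 * ((-1) ^+ k * k`!%:R) * x `^ (- k.+1%:R)
  end.

Lemma ylny_derP k x : 0 < x -> is_derive x 1 (ylny_der k) (ylny_der k.+1 x).
Proof.
move=> x0; have hl := is_derive1_ln x0; have hi := drv_id x.
have xn : x != 0 by rewrite gt_eqF.
case: k => [|[|[|k]]] /=.
- apply: (@is_derive_ext _ (fun t : R => (t * t) * ln t)) => [t|]; first by rewrite /ylny_der /ylny expr2.
  by apply: drv_eq (drvM (drvM hi hi) hl) _; rewrite /ylny_der; field.
- by apply: drv_eq (drvD (drvZ 2 (drvM hi hl)) hi) _; field.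
- apply: drv_eq (drvD (drvZ 2 hl) (drv_cst x 3)) _.
  by rewrite expr0 fact0 !mulr1 addr0 powR_inv1 ?ltW.
apply: drv_eq (drvZ _ (drv_pow k.+1 x0)) _.
rewrite factS natrM exprS; ring.
Qed.

(** The derivatives of odd order at least 3 are positive, and a difference of order [n] inherits the
    sign of the derivative of order [n]. *)
Lemma rdiff_ylny k x : 0 < x -> 0 <= rdiff (3 + k.*2) ylny x.
Proof.
move=> x0; apply: (@rdiff_ge0 _ ylny_der) => [j y xy|y xy].
  by apply: ylny_derP; exact: lt_le_trans xy.
rewrite /= -signr_odd odd_double mul1r !mulr_ge0// powR_ge0//.
Qed.

(** [3^9 = 19683] and [2^16 = 65536]. The sign of the derivative of zeta at -2 comes down to this
    inequality. *)
Lemma ln3_ln2 : 9 * ln 3 < 16 * ln (2 : R).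
Proof.
have -> : 9 * ln (3 : R) = ln (3 ^+ 9) by rewrite lnXn// mulr_natl.
have -> : 16 * ln (2 : R) = ln (2 ^+ 16) by rewrite lnXn// mulr_natl.
by rewrite ltr_ln ?posrE// ?exprn_gt0// -!natrX ltr_nat.
Qed.

Lemma Pw_m2 y : 0 < y -> Pw (-2) y = (y ^+ 2)%:C.
Proof.
move=> y0; rewrite /Pw opprK (_ : (2 : C) = 1 + 1); last by ring.
by rewrite cpowD cpow1// -rmorphM expr2.
Qed.

Lemma dPw_m2 y : 0 < y -> dPw (-2) y = (- ylny y)%:C.
Proof.
move=> y0; rewrite /dPw -[cpow _ _]/(Pw (-2) y) Pw_m2//.
by apply: complex_eqP; rewrite /ylny !cReIm/=; ring.
Qed.

Lemma fdiff_Pw_m2 n x : 0 < x -> fdiff n (Pw (-2)) x = (rdiff n (fun y => y ^+ 2) x)%:C.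
Proof.
move=> x0; rewrite -fdiff_real; apply: fdiff_ext => y xy.
by rewrite Pw_m2// (lt_le_trans x0).
Qed.

Lemma fdiff_dPw_m2 n x : 0 < x -> fdiff n (dPw (-2)) x = (- rdiff n ylny x)%:C.
Proof.
move=> x0; rewrite -rdiffN -fdiff_real; apply: fdiff_ext => y xy.
by rewrite dPw_m2// (lt_le_trans x0).
Qed.

Lemma mhE : mh R = (- 2^-1)%:C.
Proof. by rewrite /mh rmorphN fmorphV/= (rmorph_nat (@real_complex R) 2). Qed.

Lemma sum_ord4 (V : nmodType) (F : nat -> V) :
  \sum_(r < 4) F r = F 0%N + F 1%N + F 2%N + F 3%N.
Proof. by do 4 rewrite big_ord_recr/=; rewrite big_ord0 add0r. Qed.

(** The series is that of the squares, whose differences of order at least 3 vanish; the remaining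
    terms are [1/2 - 3/4 + 1/4]. *)
Lemma eta4_m2 : eta 4 (-2 : C) = 0.
Proof.
rewrite /eta (eq_csum (G := fun=> 0)); last first.
  move=> n; rewrite fdiff_Pw_m2//= (_ : _ - _ - _ = 0) ?mulr0//; by ring.
rewrite csum0 mulr0 addr0 (sum_ord4 (fun r => mh R ^+ r / 2 * fdiff r (Pw (-2)) 1)).
rewrite !fdiff_Pw_m2// mhE.
have -> : (2 : C) = 2%:C by rewrite (rmorph_nat (@real_complex R) 2).
rewrite -fmorphV -!rmorphXn -!rmorphM -!rmorphD.
by congr (_%:C); rewrite /=; field.
Qed.

(** Here the terms are [- x^2 ln x]. The transformed tail alternates, with terms [a n] that are
    nonnegative and decreasing by the signs of the fourth and fifth derivatives, so it is
    nonnegative; so is the contribution of order 3. The other terms add up to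
    [2 ln 2 - (9 / 8) ln 3], positive by [ln3_ln2]. *)
Lemma deta4_m2 : 0 < Re (deta 4 (-2 : C)).
Proof.
have h : 1 < Re (-2 : C) + 4%:R :> R by rewrite !cReIm/=; lra.
pose a n := - rdiff 4 ylny n.+1%:R.
have a0 n : 0 <= a n.
  rewrite /a -rdiffN; apply: (@rdiff_ge0 4 (fun k y => - ylny_der k y)) => [j y xy|y xy].
    by apply: drvN; apply: ylny_derP; apply: lt_le_trans xy.
  rewrite /= -mulNr -mulrN mulr_ge0 ?powR_ge0//.
  by rewrite expr1 mulN1r opprK mulr_ge0.
have ad n : a n.+1 <= a n.
  rewrite /a lerN2 -subr_ge0 -(natr1 n.+1) -rdiffS; exact: (@rdiff_ylny 1).
have sa : csumm (fun n : nat => (-1) ^+ n * (a n)%:C).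
  apply: (@csumm_le _ _ _ a) => [n|].
    by rewrite cmodM cmod_sign mul1r cmodR ger0_norm.
  apply: (@summ_nat _ _ (rdiff 3 ylny 1)) => n.
  rewrite (eq_bigr (fun i : 'I_n => rdiff 3 ylny i.+1%:R - rdiff 3 ylny i.+2%:R)).
    rewrite -(big_mkord xpredT (fun i => rdiff 3 ylny i.+1%:R - rdiff 3 ylny i.+2%:R)).
    have E := telescope_sumr (fun i => - rdiff 3 ylny i.+1%:R) (leq0n n).
    rewrite (eq_bigr (fun i => - rdiff 3 ylny i.+2%:R - - rdiff 3 ylny i.+1%:R)).
      rewrite E opprK.
      have : 0 <= rdiff 3 ylny n.+1%:R by apply: (@rdiff_ylny 0).
      by move=> ?; rewrite -[X in _ <= X]add0r lerD2r oppr_le0.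
    by move=> i _; rewrite opprK addrC.
  by move=> i _; rewrite ger0_norm// /a rdiffS opprB natr1.
rewrite /deta (eq_csum (G := fun n => (-1) ^+ n * (a n)%:C)); last first.
  by move=> n; rewrite fdiff_dPw_m2.
have A0 : 0 <= Re (csum (fun n : nat => (-1) ^+ n * (a n)%:C)).
  have inj2 (g : nat -> nat) : injective g -> summ (fun i => a (g i)).
    move=> hi; apply: (@summ_inj _ _ _ g a) => //.
    by apply: summ_le sa => i; rewrite cmodM cmod_sign mul1r cmodR.
  rewrite csum_parity// (eq_csum (G := fun i => (a i.*2)%:C)); last first.
    by move=> i; rewrite -signr_odd odd_double expr0 mul1r.
  rewrite (eq_csum (F := fun i => _ ^+ i.*2.+1 * _) (G := fun i => (- a i.*2.+1)%:C)); last first.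
    by move=> i /=; rewrite exprS -signr_odd odd_double expr0 mulr1 mulN1r; apply: complex_eqP; rewrite !cReIm/= ?oppr0.
  rewrite !csum_real -rmorphD/=.
  have s1 : summ (fun i => a i.*2) by apply: inj2 => i j /double_inj.
  have s2 : summ (fun i => a i.*2.+1) by apply: inj2 => i j [/double_inj].
  by rewrite (rsumN s2) subr_ge0; apply: ler_rsum.
rewrite mhE (sum_ord4 (fun r => (- 2^-1)%:C ^+ r / 2 * fdiff r (dPw (-2)) 1)) !fdiff_dPw_m2//.
have -> : (2 : C) = 2%:C by rewrite (rmorph_nat (@real_complex R) 2).
rewrite -fmorphV -!rmorphXn -!rmorphM -!rmorphD.
rewrite cReD cReM; rewrite [Re (_%:C)]/= [X in X * _]/= [Im (_%:C)]/= mul0r subr0.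
have d3 : 0 <= rdiff 3 ylny 1 by exact: (@rdiff_ylny 0).
have l2 : ln (1 + 1) = ln 2 :> R by [].
have e0 : ylny 1 = 0 by rewrite /ylny ln1 mulr0.
have e1 : ylny (1 + 1) = 4 * ln 2 by rewrite /ylny l2; ring.
have e2 : ylny (1 + 1 + 1) = 9 * ln 3.
  by rewrite (_ : 1 + 1 + 1 = 3 :> R) /ylny; [|]; ring.
move: A0; set Y := Re (csum _); clearbody Y; move: d3; rewrite /= e0 e1 e2; set Z := ylny _.
move=> d3 A0; have := ln3_ln2.
have q2 : (- (2 : R)^-1) ^+ 2 = 4^-1 by field.
have q3 : (- (2 : R)^-1) ^+ 3 = - 8^-1 by field.
have q4 : (- (2 : R)^-1) ^+ 4 = 16^-1 by field.
rewrite q2 q3 q4 expr0 expr1; lra.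
Qed.

(** The denominator at -2 is [1 - 2^3 = - 7], and since [eta 4] vanishes there only one term of the
    quotient rule survives. *)
Lemma zeta_m2 : zetaN 4 (-2 : C) = 0 /\ is_derive (-2 : C) (1 : C) (zetaN 4) (- deta 4 (-2 : C) / 7).
Proof.
split; first by rewrite /zetaN eta4_m2 mul0r.
have h : 1 < Re (-2 : C) + 4%:R :> R by rewrite !cReIm/=; lra.
have E : 1 - cpow (2 : R) (1 - -2) = - 7 :> C.
  rewrite (_ : 1 - -2 = 1 + 1 + 1 :> C); last by ring.
  by rewrite !cpowD !cpow1// (rmorph_nat (@real_complex R) 2); ring.
have n0 : 1 - cpow (2 : R) (1 - -2) != 0 :> C.
  by rewrite E oppr_eq0 pnatr_eq0.
have d1 := eta_derive h; have d2 := @cderV _ (fun s => 1 - cpow 2 (1 - s)) _ _ n0 (zeta_den_derive (-2 : C)).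
apply: cder_eq (cderM d1 d2) _.
by rewrite eta4_m2 mul0r addr0 E; field.
Qed.

End ZetaMinusTwo.

(** * The spectral zeta function of the oscillators *)

Section EulerMaclaurin.
Variable R : realType.
Local Notation C := R[i].
Local Notation Re := (@complex.Re R).
Local Notation Im := (@complex.Im R).
Local Open Scope complex_scope.
Implicit Types (s z : C) (x y : R).

Lemma rder_sum (I : Type) (l : seq I) (F : I -> R -> C) (dF : I -> C) x :
  (forall i, rder (F i) x (dF i)) ->
  rder (fun t => \sum_(i <- l) F i t) x (\sum_(i <- l) dF i).
Proof.
move=> h; elim: l => [|i l IH].
  by rewrite big_nil; apply: rder_ext (rder_cst 0 x) => t; rewrite big_nil.
rewrite big_cons; apply: rder_ext (rderD (h i) IH) => t; by rewrite big_cons.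
Qed.

Lemma drvX (n : nat) x : is_derive x 1 (fun t : R => t ^+ n) (n%:R * x ^+ n.-1).
Proof.
elim: n => [|n IH]; first by rewrite mul0r; apply: is_derive_ext (drv_cst x 1) => t.
apply: (@is_derive_ext _ (fun t : R => t * t ^+ n)) => [t|]; first by rewrite exprS.
apply: drv_eq (drvM (drv_id x) IH) _; rewrite /= mul1r.
case: n {IH} => [|n] /=; first by rewrite mul0r mulr0 expr0; ring.
by rewrite -[in RHS](natr1 n.+1) exprS; ring.
Qed.

(** As a function of [h] the remainder vanishes at 0, and its derivative is the remainder of order
    one less for the shifted chain; each step costs the factor 2 of [rmvt]. *)
Lemma taylor_bound (M : nat) (G : nat -> R -> C) x h (S : R) :
  (forall k y, x <= y -> rder (G k) y (G k.+1 y)) -> 0 <= h <= 1 ->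
  (forall y, x <= y <= x + 1 -> cmod (G M.+1 y) <= S) ->
  cmod (G 0%N (x + h) - \sum_(n < M.+1) (h ^+ n / n`!%:R)%:C * G n x) <= 2 ^+ M.+1 * S.
Proof.
elim: M G h => [|M IH] G h hd h01 hS.
  rewrite big_ord1 expr0 fact0 divr1 mul1r expr1.
  have := @rmvt R (G 0%N) (G 1%N) x (x + h) S.
  rewrite lerDl (addrC x) addrK; case/andP: h01 => h0 h1 => /(_ h0).
  have S0 : 0 <= S by apply: le_trans (hS x _); rewrite ?cmod_ge0//; lra.
  move=> H; apply: le_trans (H _ _) _.
  - by move=> y /andP[xy _]; exact: hd.
  - by move=> y xy; apply: hS; lra.
  by rewrite ler_piMr// mulr_ge0.
pose u t := G 0%N (x + t) - \sum_(n < M.+2) (t ^+ n / n`!%:R)%:C * G n x.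
pose du t := G 1%N (x + t) - \sum_(n < M.+1) (t ^+ n / n`!%:R)%:C * G n.+1 x.
have u0 : u 0 = 0.
  rewrite /u addr0 big_ord_recl expr0 fact0 divr1 mul1r big1 ?addr0 ?subrr// => i _.
  by rewrite expr0n/= mul0r mul0r.
have du_u t : 0 <= t <= 1 -> rder u t (du t).
  move=> t01; apply: rderB.
    apply: rder_ext (rder_shift (_ : rder (G 0%N) (t + x) _)) => [y|]; first by rewrite addrC.
    by rewrite addrC; apply: hd; lra.
  rewrite /du (_ : \sum_(n < M.+1) _ = \sum_(n < M.+2) (n%:R * t ^+ n.-1 / n`!%:R)%:C * G n x).
    apply: rder_sum => n; have dn : is_derive t 1 (fun t : R => t ^+ n / n`!%:R) (n%:R * t ^+ n.-1 / n`!%:R).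
      apply: (@is_derive_ext _ (fun y : R => (n`!%:R)^-1 * y ^+ n)) => [y|]; first by rewrite mulrC.
      by apply: drv_eq (drvZ _ (drvX n t)) _; ring.
    apply: rder_eq (rderM (rder_real dn) (rder_cst (G n x) t)) _.
    by rewrite mulr0 addr0.
  rewrite [RHS]big_ord_recl mul0r mul0r mul0r add0r; apply: eq_bigr => i _.
  congr (_%:C * _); rewrite lift0 factS natrM.
  have f0 : (i`!%:R : R) != 0 by rewrite pnatr_eq0 -lt0n fact_gt0.
  have i0 : (i.+1%:R : R) != 0 by rewrite pnatr_eq0.
  by move: (i`!%:R : R) (i.+1%:R : R) f0 i0 => a b a0 b0; field; apply/andP; split.
have B t : 0 <= t <= 1 -> cmod (du t) <= 2 ^+ M.+1 * S.
  by move=> t01; apply: (IH (fun k => G k.+1)) => // k y xy; exact: hd.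
have S0 : 0 <= S by apply: le_trans (hS x _); rewrite ?cmod_ge0//; lra.
case/andP: h01 => h0 h1.
have := @rmvt R u du 0 h (2 ^+ M.+1 * S) h0.
rewrite u0 !subr0 => H; apply: le_trans (H _ _) _.
- by move=> t ht; apply: du_u; lra.
- by move=> t ht; apply: B; lra.
by rewrite (exprS 2 M.+1) -(mulrA 2 (2 ^+ M.+1) S) ler_piMr// !mulr_ge0// exprn_ge0.
Qed.

(** Course-of-values recursion through the list of the earlier coefficients: each new one is solved
    from the identity [embE]. *)
Fixpoint midpoint_coefs (n : nat) : seq R :=
  if n is m.+1 then
    rcons (midpoint_coefs m) (2^-1 ^+ m / m`!%:R - \sum_(r < m) nth 0 (midpoint_coefs m) r / (m.+1 - r)`!%:R)
  else [::].

(* The coefficients of [D e^(D/2) / (e^D - 1)], the midpoint Euler-Maclaurin formula. *)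
Definition midpoint_coef (n : nat) : R := nth 0 (midpoint_coefs n.+1) n.

Lemma size_midpoint_coefs n : size (midpoint_coefs n) = n.
Proof. by elim: n => [//|n IH]; rewrite /= size_rcons IH. Qed.

Lemma nth_midpoint_coefs m r : (r < m)%N -> nth 0 (midpoint_coefs m) r = midpoint_coef r.
Proof.
elim: m => [//|m IH]; rewrite ltnS leq_eqVlt => /orP[/eqP ->//|rm].
by rewrite /= nth_rcons size_midpoint_coefs rm IH.
Qed.

(** This is the coefficient of [D^(n + 1)] in the identity between [e^D - 1] times the generating
    series of [midpoint_coef] and [D e^(D/2)]. *)
Lemma embE n : \sum_(r < n.+1) midpoint_coef r / (n.+1 - r)`!%:R = 2^-1 ^+ n / n`!%:R.
Proof.
rewrite big_ord_recr/= subSnn [1`!]/= divr1 [X in _ + X]/midpoint_coef/= nth_rcons size_midpoint_coefs ltnn eqxx.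
rewrite (eq_bigr (fun r : 'I_n => nth 0 (midpoint_coefs n) r / (n.+1 - r)`!%:R)); first by ring.
by move=> r _; rewrite nth_midpoint_coefs.
Qed.

Lemma emb0 : midpoint_coef 0 = 1.
Proof. by have := embE 0; rewrite big_ord1 !fact0 expr0 !divr1. Qed.

Lemma emb1 : midpoint_coef 1 = 0.
Proof.
have := embE 1; rewrite !big_ord_recr big_ord0 !subSS !subn0 !factS fact0 [widen_ord _ _]/=.
by rewrite /= emb0 expr1; lra.
Qed.

Lemma emb2 : midpoint_coef 2 = - 24^-1.
Proof.
have := embE 2; rewrite !big_ord_recr big_ord0/= emb0 emb1 !subSS !subn0 !factS fact0.
by rewrite !muln1 expr2; lra.
Qed.

Lemma emb3 : midpoint_coef 3 = 0.
Proof.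
have := embE 3; rewrite !big_ord_recr big_ord0/= emb0 emb1 emb2 !subSS !subn0 !factS fact0.
by rewrite !muln1 exprS expr2; lra.
Qed.

Definition midpoint_bound (N : nat) : R := 2 ^+ N + \sum_(r < N) `|midpoint_coef r| * 2 ^+ (N - r).+1.

Lemma midpoint_bound_ge0 N : 0 <= midpoint_bound N.
Proof.
rewrite addr_ge0 ?exprn_ge0// sumr_ge0// => r _; by rewrite mulr_ge0// exprn_ge0.
Qed.

Lemma cmod_sum (I : Type) (l : seq I) (F : I -> C) :
  cmod (\sum_(i <- l) F i) <= \sum_(i <- l) cmod (F i).
Proof.
elim: l => [|i l IH]; first by rewrite !big_nil cmod0.
by rewrite !big_cons (le_trans (cmodD _ _))// lerD2l.
Qed.

Lemma filter_geq_iota r n : (r <= n)%N ->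
  [seq i <- index_iota 0 n | (r <= i)%N] = index_iota r n.
Proof.
move=> rn; rewrite /index_iota subn0 -[in LHS](subnKC rn) iotaD filter_cat add0n.
rewrite [X in X ++ _](_ : _ = [::]) ?cat0s.
  apply/all_filterP/allP => i; by rewrite mem_iota => /andP[].
apply/eqP; rewrite -[_ == _]negbK -has_filter; apply/hasPn => i.
by rewrite mem_iota add0n -ltnNge.
Qed.

(** Everything is expanded by Taylor's formula at [x]: the coefficients of [G 1], ..., [G N] cancel
    by [embE], and the remainders, all governed by [G N.+1], add up to [midpoint_bound]. *)
Lemma em_bound N (G : nat -> R -> C) x (S : R) : (0 < N)%N ->
  (forall k y, x <= y -> rder (G k) y (G k.+1 y)) ->
  (forall y, x <= y <= x + 1 -> cmod (G N.+1 y) <= S) ->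
  cmod (G 1%N (x + 2^-1) - \sum_(r < N) (midpoint_coef r)%:C * (G r (x + 1) - G r x)) <= midpoint_bound N * S.
Proof.
case: N => [//|N] _ hd hS; set N' := N.+1.
pose T0 := \sum_(n < N') (2^-1 ^+ n / n`!%:R)%:C * G n.+1 x.
pose T r := \sum_(n < (N' - r).+1) (1 ^+ n / n`!%:R)%:C * G (r + n)%N x.
have E0 : cmod (G 1%N (x + 2^-1) - T0) <= 2 ^+ N' * S.
  apply: (@taylor_bound N (fun k => G k.+1)) => //; first by move=> k y; exact: hd.
  by rewrite invr_ge0 invf_le1//; apply/andP; split => //; rewrite ler1n.
have E1 (r : 'I_N') : cmod (G r (x + 1) - T r) <= 2 ^+ (N' - r).+1 * S.
  have := @taylor_bound (N' - r) (fun k => G (r + k)%N) x 1 S.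
  rewrite addn0; apply.
  - by move=> k y xy; rewrite addnS; exact: hd.
  - by rewrite ler01 lexx.
  - by move=> y hy; rewrite addnS subnKC ?hS// ltnW.
have main : T0 = \sum_(r < N') (midpoint_coef r)%:C * (T r - G r x).
  have TE r : (r <= N')%N -> T r - G r x = \sum_(0 <= i < N' | (r <= i)%N) ((i.+1 - r)`!%:R^-1)%:C * G i.+1 x.
    move=> rN; rewrite /T big_ord_recl expr0 fact0 divr1 mul1r addn0 addrC addKr.
    rewrite -[RHS]big_filter.
    have -> : [seq i <- index_iota 0 N' | (r <= i)%N] = index_iota r N'.
      by exact: filter_geq_iota.
    rewrite -[X in index_iota X _](add0n r) big_addn big_mkord; apply: eq_bigr => i _.
    by rewrite lift0 expr1n div1r -addSn addnK addnC.
  rewrite (eq_bigr (fun r : 'I_N' => \sum_(i < N' | (r <= i)%N)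
     ((midpoint_coef r / (i.+1 - r)`!%:R)%:C * G i.+1 x))); last first.
    move=> r _; rewrite TE ?(ltnW (ltn_ord r))// big_mkord mulr_sumr.
    by apply: eq_bigr => i _; rewrite mulrA -rmorphM.
  rewrite (exchange_big_dep xpredT)//= /T0; apply: eq_bigr => i _.
  rewrite -embE rmorph_sum/= mulr_suml.
  rewrite (big_ord_widen N' (fun r => (midpoint_coef r / (i.+1 - r)`!%:R)%:C * G i.+1 x)) ?ltn_ord//.
rewrite (_ : _ - _ = (G 1%N (x + 2^-1) - T0) -
    \sum_(r < N') (midpoint_coef r)%:C * (G r (x + 1) - T r)); last first.
  rewrite main -addrA -opprD -big_split/=; congr (_ - _).
  by apply: eq_bigr => r _; ring.
apply: le_trans (cmodB _ _) _; rewrite /midpoint_bound mulrDl lerD//.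
apply: le_trans (cmod_sum _ _) _; rewrite mulr_suml; apply: ler_sum => r _.
by rewrite cmodM cmodR -mulrA ler_wpM2l.
Qed.

Lemma csum_telescope (h : nat -> C) : csumm (fun j => h j.+1 - h j) ->
  (forall e : R, 0 < e -> exists n0, forall n, (n0 <= n)%N -> cmod (h n) <= e) ->
  csum (fun j => h j.+1 - h j) = - h 0%N.
Proof.
move=> sh h0.
have key (f : nat -> R) : summ (fun j => f j.+1 - f j) ->
    (forall e : R, 0 < e -> exists n0, forall n, (n0 <= n)%N -> `|f n| <= e) ->
    rsum (fun j => f j.+1 - f j) = - f 0%N.
  move=> sf f0; apply/eqP; rewrite -subr_eq0 -normr_le0; apply/ler_addgt0Pl => e e0.
  rewrite addr0; have e2 : 0 < e / 2 by rewrite divr_gt0.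
  have [A hA] := summ_is_sum sf e2; have [n0 hn0] := f0 _ e2.
  have [n1 hn1] := fset_nat_bound A.
  pose n := maxn n0 n1.
  pose B := seq_fset tt (index_iota 0 n).
  have AB : (A `<=` B)%fset.
    apply/fsubsetP => i /hn1 ?; rewrite /B seq_fsetE mem_index_iota/=.
    by rewrite (leq_trans _ (leq_maxr _ _)).
  have := hA _ AB.
  have -> : \sum_(i <- B) (f i.+1 - f i) = f n - f 0%N.
    rewrite -(telescope_sumr f (leq0n n)); apply: perm_big.
    apply: uniq_perm; rewrite ?fset_uniq ?iota_uniq//.
    by move=> i; rewrite /B seq_fsetE.
  have := hn0 n (leq_maxl _ _); set X := rsum _.
  rewrite !ler_norml; lra.
apply: complex_eqP; rewrite !cReIm/=.
  rewrite -(key (fun n => Re (h n))).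
  - by congr rsum; apply/funext => j; rewrite !cReIm.
  - have := csummRe sh; by congr summ; apply/funext => j; rewrite !cReIm.
  - move=> e /h0[n0 hn]; exists n0 => n /hn; exact: le_trans (Re_le_cmod _).
rewrite -(key (fun n => Im (h n))).
- by congr rsum; apply/funext => j; rewrite !cReIm.
- have := csummIm sh; by congr summ; apply/funext => j; rewrite !cReIm.
- move=> e /h0[n0 hn]; exists n0 => n /hn; exact: le_trans (Im_le_cmod _).
Qed.

End EulerMaclaurin.

(** * The oscillator double sum: continuation and derivative at 0 *)

Section HeisenbergZeta.
Variable R : realType.
Local Notation C := R[i].
Local Notation Re := (@complex.Re R).
Local Notation Im := (@complex.Im R).
Local Open Scope complex_scope.
Implicit Types (s z a : C) (x y : R) (k j : nat).

Lemma powR_add x (p q : R) : 0 < x -> x `^ (p + q) = x `^ p * x `^ q.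
Proof. by move=> x0; rewrite powRD// (gt_eqF x0) implybT. Qed.

Lemma cReIm_nat n : (Re (n%:R : C) = n%:R) * (Im (n%:R : C) = 0).
Proof. by rewrite -(rmorph_nat (@real_complex R)). Qed.

(** The existential form lets the rules of differentiation compose without naming the
    derivatives. *)
Definition dv (f : C -> C) z := exists d, is_derive z (1 : C) f d.

Lemma dvP (f : C -> C) z : dv f z <-> derivable f z (1 : C).
Proof. by split=> [[d []]//|h]; exists ('D_1 f z); exact: DeriveDef. Qed.

Lemma dv_ext (f g : C -> C) z : f =1 g -> dv f z -> dv g z.
Proof. by move=> /funext ->. Qed.

Lemma dvM (f g : C -> C) z : dv f z -> dv g z -> dv (fun t => f t * g t) z.
Proof. by move=> [d hf] [e hg]; eexists; exact: cderM hf hg. Qed.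

Lemma dvD (f g : C -> C) z : dv f z -> dv g z -> dv (fun t => f t + g t) z.
Proof. by move=> [d hf] [e hg]; eexists; exact: cderD hf hg. Qed.

Lemma dvB (f g : C -> C) z : dv f z -> dv g z -> dv (fun t => f t - g t) z.
Proof. by move=> [d hf] [e hg]; eexists; exact: cderB hf hg. Qed.

Lemma dv_cst (c z : C) : dv (fun _ => c) z.
Proof. by eexists; exact: cder_cst z c. Qed.

Lemma dv_id z : dv (fun t : C => t) z.
Proof. by eexists; exact: cder_id z. Qed.

Lemma dvN (f : C -> C) z : dv f z -> dv (fun t => - f t) z.
Proof. by move=> [d hf]; eexists; exact: cderN hf. Qed.

Lemma dvV (f : C -> C) z : f z != 0 -> dv f z -> dv (fun t => (f t)^-1) z.
Proof. by move=> f0 [d hf]; eexists; exact: cderV f0 hf. Qed.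

Lemma dv_sum (I : Type) (l : seq I) (F : I -> C -> C) z :
  (forall i, dv (F i) z) -> dv (fun t => \sum_(i <- l) F i t) z.
Proof.
move=> h; elim: l => [|i l IH].
  by apply: dv_ext (dv_cst 0 z) => t; rewrite big_nil.
by apply: dv_ext (dvD (h i) IH) => t; rewrite big_cons.
Qed.

Lemma dv_cpow x (p q : C) z : dv (fun t => cpow x (p * t + q)) z.
Proof. by eexists; exact: cder_cpow x p q z. Qed.

Lemma dv_comp (f : C -> C) (p q : C) z : dv f (p * z + q) -> dv (fun t => f (p * t + q)) z.
Proof.
move=> [d hf]; have h : is_derive z (1 : C) (fun t => p * t + q) (p * 1 + 0).
  exact: cderD (cderZ p (cder_id z)) (cder_cst z q).
by eexists; exact: (@cder_comp _ f (fun t => p * t + q) z _ _ hf h).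
Qed.

Lemma mero_dv (f : C -> C) a (r : R) : 0 < r ->
  (forall z, cmod (z - a) < r -> dv f z) -> mero f a.
Proof. by move=> r0 h; apply: mero_hol; exists r => // z /h /dvP. Qed.

Lemma dv_pc n z : dv (fun s => pc n (s - 1)) z.
Proof.
elim: n => [|n IH]; first by apply: dv_ext (dv_cst 1 z) => t; rewrite /pc big_ord0.
have h : dv (fun t => - (t - 1) - n%:R) z.
  exact: dvB (dvN (dvB (dv_id z) (dv_cst 1 z))) (dv_cst n%:R z).
by apply: dv_ext (dvM IH h) => t; rewrite pcS.
Qed.

Lemma csum_bigsum (I : choiceType) (T : Type) (l : seq T) (F : T -> I -> C) :
  (forall t, csumm (F t)) ->
  csumm (fun i => \sum_(t <- l) F t i) /\
  csum (fun i => \sum_(t <- l) F t i) = \sum_(t <- l) csum (F t).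
Proof.
move=> hF; elim: l => [|t l [IH1 IH2]].
  rewrite big_nil; under eq_fun do rewrite big_nil.
  split; last exact: csum0.
  by apply: (@csumm_le _ _ _ (fun _ => 0)) => [i|]; rewrite ?cmod0//; exact: (@summ_fin _ _ _ fset0).
rewrite big_cons; under eq_fun do rewrite big_cons.
by split; [exact: csummD|rewrite csumD// IH2].
Qed.

(** The successive derivatives of [x^(1 - s)]. As [Gw 1] is [(1 - s) x^(- s)], summation produces
    the double sum multiplied by [1 - s], which is why [hzeta] divides by it. *)
Definition Gw (n : nat) s x : C := pc n (s - 1) * cpow x (- (s - 1) - n%:R).

Lemma Gw_rder n s x : 0 < x -> rder (Gw n s) x (Gw n.+1 s x).
Proof. exact: rder_pw. Qed.

Lemma cmod_Gw n s x : 0 < x -> cmod (Gw n.+1 s x) = cmod (pc n.+1 (s - 1)) * x `^ (- (Re s + n%:R)).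
Proof.
move=> x0; rewrite cmodM cmod_cpow//; congr (_ * _ `^ _).
by rewrite !cReIm !cReIm_nat /= -natr1; ring.
Qed.

Definition midpoint_defect (N : nat) s x : C :=
  Gw 1 s (x + 2^-1) - \sum_(r < N) (midpoint_coef R r)%:C * (Gw r s (x + 1) - Gw r s x).

Lemma cmod_midpoint_defect N s x : (0 < N)%N -> 0 < x -> 0 <= Re s + N%:R ->
  cmod (midpoint_defect N s x) <= midpoint_bound R N * cmod (pc N.+1 (s - 1)) * x `^ (- (Re s + N%:R)).
Proof.
move=> N0 x0 h; rewrite -mulrA; apply: (@em_bound _ N (fun k => Gw k s)) => //.
  by move=> k y xy; apply: Gw_rder; lra.
move=> y /andP[xy _]; rewrite cmod_Gw; last by lra.
by rewrite ler_wpM2l ?cmod_ge0// ler_powR_decr// oppr_le0.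
Qed.

Lemma cmod_Gw_diff n s x : 0 < x -> 0 <= Re s + n%:R ->
  cmod (Gw n s (x + 1) - Gw n s x) <= 2 * cmod (pc n.+1 (s - 1)) * x `^ (- (Re s + n%:R)).
Proof.
move=> x0 h; have x1 : x <= x + 1 by rewrite lerDl.
have := @rmvt _ (Gw n s) (Gw n.+1 s) x (x + 1) (cmod (pc n.+1 (s - 1)) * x `^ (- (Re s + n%:R))) x1.
rewrite addrAC subrr add0r mulr1 mulrA; apply.
  by move=> y /andP[xy _]; apply: Gw_rder; lra.
move=> y /andP[xy _]; rewrite cmod_Gw; last by lra.
by rewrite ler_wpM2l ?cmod_ge0// ler_powR_decr// oppr_le0.
Qed.

Section Weights.
Variable c : R.
Hypothesis c1 : 1 <= c.

Let c0 : 0 < c. Proof. exact: lt_le_trans c1. Qed.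

(** The index [k] stands for the frequency [k + 1]. *)
Definition hx k : R := c * k.+1%:R.

Lemma hx_gt0 k : 0 < hx k. Proof. by rewrite mulr_gt0. Qed.

Lemma hx_ge k : k.+1%:R <= hx k. Proof. by rewrite ler_peMl. Qed.

Lemma hx_ge1 k : 1 <= hx k.
Proof. by apply: le_trans (hx_ge k); rewrite ler1n. Qed.

Lemma hxj_gt0 k j : 0 < hx k + j%:R.
Proof. by rewrite ltr_wpDr// hx_gt0. Qed.

(* The exponent of [hx k + j] is shared between [k] and [j] so that both
   resulting series converge. *)
Definition hW (N : nat) (sg : R) (p : nat * nat) : R :=
  p.1.+1%:R * (4 * hx p.1) `^ (- sg) * (hx p.1 + p.2%:R) `^ (- (sg + N%:R)).

Definition hWS (N : nat) (sg : R) : R :=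
  rsum (fun p : nat * nat => p.1.+1%:R `^ (- (sg + (N%:R + 1) / 2 - 1)) *
    p.2.+1%:R `^ (- (sg + (N%:R - 1) / 2)) : R).

(** The exponent [sg + N] splits as [A + B]: [hx k + j] is bounded below by [hx k] in the power [A]
    and by [j + 1] in the power [B]. The series in [k] and in [j] then have the same exponent
    [sg + (N - 1) / 2], which exceeds 1 exactly when [3 < 2 sg + N]. *)
Lemma hW_le N sg p : 3 < 2 * sg + N%:R -> hW N sg p <=
  4 `^ (- sg) * c `^ (- (sg + (N%:R + 1) / 2)) *
  (p.1.+1%:R `^ (- (sg + (N%:R + 1) / 2 - 1)) * p.2.+1%:R `^ (- (sg + (N%:R - 1) / 2))).
Proof.
move=> h; case: p => k j /=; rewrite /hW/=.
have hk := hx_gt0 k; have hj := hxj_gt0 k j; have N0 : 0 <= N%:R :> R by [].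
set A := (N%:R + 1) / 2; set B := sg + (N%:R - 1) / 2.
have -> : sg + N%:R = A + B by rewrite /A /B; field.
have B0 : 0 <= B by rewrite /B; lra.
have A0 : 0 <= A by rewrite /A; lra.
have k1 : 0 < k.+1%:R :> R by [].
have h1 : (hx k + j%:R) `^ (- A) <= hx k `^ (- A).
  by apply: ler_powR_decr; rewrite ?oppr_le0// lerDl.
have h2 : (hx k + j%:R) `^ (- B) <= j.+1%:R `^ (- B).
  apply: ler_powR_decr; rewrite ?oppr_le0// -natr1 addrC lerD2r; exact: hx_ge1.
rewrite (opprD A B) (powR_add _ _ hj).
have -> : k.+1%:R * (4 * hx k) `^ (- sg) * ((hx k + j%:R) `^ (- A) * (hx k + j%:R) `^ (- B)) =
  (k.+1%:R * (4 * hx k) `^ (- sg)) * (hx k + j%:R) `^ (- A) * (hx k + j%:R) `^ (- B) by ring.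
rewrite [leRHS](_ : _ = (k.+1%:R * (4 * hx k) `^ (- sg)) * hx k `^ (- A) * j.+1%:R `^ (- B)).
  apply: ler_pM => //; rewrite ?mulr_ge0 ?powR_ge0//.
  by apply: ler_wpM2l => //; rewrite mulr_ge0 ?powR_ge0.
rewrite /hx (powRM (- sg)) ?mulr_ge0 ?ltW// !(powRM _ (ltW c0) (ltW k1)).
rewrite (_ : - (sg + A) = - sg - A); last by ring.
rewrite (_ : - (sg + A - 1) = 1 - sg - A); last by ring.
by rewrite !(powR_add _ _ k1) !(powR_add _ _ c0) (powRr1 (ltW k1)); ring.
Qed.

Lemma hWS_summ N sg : 3 < 2 * sg + N%:R ->
  summ (fun p : nat * nat => p.1.+1%:R `^ (- (sg + (N%:R + 1) / 2 - 1)) *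
    p.2.+1%:R `^ (- (sg + (N%:R - 1) / 2)) : R).
Proof.
move=> h; apply: (@summ_mul _ _ _ (fun k : nat => k.+1%:R `^ _) (fun j : nat => j.+1%:R `^ _));
  apply: summ_pseries; lra.
Qed.

Lemma hW_ge0 N sg p : 0 <= hW N sg p.
Proof. by rewrite !mulr_ge0 ?powR_ge0. Qed.

Lemma hW_summ N sg : 3 < 2 * sg + N%:R -> summ (hW N sg).
Proof.
move=> h; apply: summ_le (summZ _ (hWS_summ h)) => p.
by rewrite ger0_norm ?hW_ge0//; exact: hW_le.
Qed.

Lemma hW_rsum N sg : 3 < 2 * sg + N%:R ->
  rsum (hW N sg) <= 4 `^ (- sg) * c `^ (- (sg + (N%:R + 1) / 2)) * hWS N sg.
Proof.
move=> h; rewrite -rsumZ; last exact: hWS_summ.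
apply: ler_rsum; [exact: hW_summ|exact: summZ (hWS_summ h)|].
by move=> p; exact: hW_le.
Qed.

Lemma hW_decr N (s t : R) p : s <= t -> hW N t p <= hW N s p.
Proof.
move=> st; case: p => k j; rewrite /hW/=.
have hk := hx_ge1 k; have h4 : 1 <= 4 * hx k by lra.
have j0 : 0 <= j%:R :> R by [].
apply: ler_pM; rewrite ?mulr_ge0 ?powR_ge0//.
  by rewrite ler_wpM2l// ler_powR// lerN2.
by apply: ler_powR; lra.
Qed.

Definition hw s k : C := k.+1%:R%:C * cpow (4 * hx k) (- s).

Lemma cmod_hw s k : cmod (hw s k) = k.+1%:R * (4 * hx k) `^ (- Re s).
Proof.
by rewrite cmodM cmodR ger0_norm// cmod_cpow ?cReN// mulr_gt0// hx_gt0.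
Qed.

Definition hterm N s (p : nat * nat) : C := hw s p.1 * midpoint_defect N s (hx p.1 + p.2%:R).

Lemma cmod_hterm N s p : (0 < N)%N -> 3 < 2 * Re s + N%:R ->
  cmod (hterm N s p) <= midpoint_bound R N * cmod (pc N.+1 (s - 1)) * hW N (Re s) p.
Proof.
move=> N0 h; have NN : 1 <= N%:R :> R by rewrite ler1n.
rewrite cmodM cmod_hw.
have := @cmod_midpoint_defect N s (hx p.1 + p.2%:R) N0 (hxj_gt0 _ _).
move=> H; apply: le_trans (ler_wpM2l _ (H _)) _; rewrite ?mulr_ge0 ?powR_ge0//; first by lra.
rewrite [leLHS](_ : _ = midpoint_bound R N * cmod (pc N.+1 (s - 1)) * hW N (Re s) p)// /hW; ring.
Qed.

Definition hrem N s : C := csum (hterm N s).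

Lemma dv_hterm N s p : dv (fun s => hterm N s p) s.
Proof.
have dw : dv (fun s => hw s p.1) s.
  apply: dv_ext (dvM (dv_cst p.1.+1%:R%:C s) (dv_cpow (4 * hx p.1) (-1) 0 s)) => t.
  by rewrite /hw mulN1r addr0.
have dG n x : dv (fun s => Gw n s x) s.
  apply: dv_ext (dvM (dv_pc n s) (dv_cpow x (-1) (1 - n%:R) s)) => t.
  by rewrite /Gw; congr (_ * cpow _ _); ring.
apply: (dvM dw); apply: (dvB (dG _ _)).
apply: dv_sum => r; exact: dvM (dv_cst (midpoint_coef R r)%:C s) (dvB (dG _ _) (dG _ _)).
Qed.

Lemma cmod_hterm_near N a (r : R) s p : (0 < N)%N -> 3 < 2 * (Re a - r) + N%:R ->
  cmod (s - a) < r ->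
  cmod (hterm N s p) <= midpoint_bound R N * (cmod a + r + 1 + N.+1%:R) ^+ N.+1 * hW N (Re a - r) p.
Proof.
move=> N0 h sa; have := Re_le_cmod (s - a); rewrite !cReIm ler_norml => /andP[s1 s2].
apply: le_trans (cmod_hterm p N0 _) _; first by lra.
have -> : midpoint_bound R N * (cmod a + r + 1 + N.+1%:R) ^+ N.+1 * hW N (Re a - r) p =
  midpoint_bound R N * ((cmod a + r + 1 + N.+1%:R) ^+ N.+1 * hW N (Re a - r) p) by ring.
rewrite -mulrA ler_wpM2l ?midpoint_bound_ge0// ler_pM ?cmod_ge0 ?hW_ge0//; last by apply: hW_decr; lra.
apply: cmod_pc; apply: le_trans (cmodB _ _) _; rewrite cmod1.
rewrite (_ : s = (s - a) + a); last by rewrite subrK.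
by have := cmodD (s - a) a; lra.
Qed.

Lemma hrem_derivable N s : (0 < N)%N -> 3 < 2 * Re s + N%:R -> dv (hrem N) s.
Proof.
move=> N0 h; pose r := (2 * Re s + N%:R - 3) / 4; have r0 : 0 < r by rewrite /r; lra.
have hr : 3 < 2 * (Re s - r) + N%:R by rewrite /r; lra.
have := @csum_derive _ _ (fun p s => hterm N s p) (fun p z => 'D_1 (fun s => hterm N s p) z) s r
  (fun p => midpoint_bound R N * (cmod s + r + 1 + N.+1%:R) ^+ N.+1 * hW N (Re s - r) p) r0.
move=> H; eexists; apply: H.
- by move=> p z _; apply: DeriveDef => //; apply/dvP; exact: dv_hterm.
- by move=> p z hz; exact: cmod_hterm_near.
- by apply: summZ; exact: hW_summ.
Qed.

(** For [N = 4] and [sg = - 1/8] the power in [hW_rsum] is [c^(- 19/8)], at most [1/c] since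
    [1 <= c]; the fifth power bounds [pc 5 (s - 1)] on the disc of radius [1/8]. *)
Lemma hrem_bound s : cmod s < 8^-1 ->
  cmod (hrem 4 s) <= 2 * (midpoint_bound R 4 * (8^-1 + 1 + 5) ^+ 5 * (4 `^ (8^-1) * hWS 4 (- 8^-1))) * c^-1.
Proof.
move=> hs; have h : 3 < 2 * (- 8^-1) + 4%:R :> R by lra.
have sW := hW_summ h.
have B p : cmod (hterm 4 s p) <= midpoint_bound R 4 * (8^-1 + 1 + 5) ^+ 5 * hW 4 (- 8^-1) p.
  have := @cmod_hterm_near 4 0 8^-1 s p isT.
  by rewrite subr0 cmod0 /= sub0r add0r => H; apply: H.
apply: le_trans (csum_norm B (summZ _ sW)) _; rewrite rsumZ//.
have P0 : 0 <= (8^-1 + 1 + 5 : R) ^+ 5 by rewrite exprn_ge0.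
move: (_ ^+ 5) P0 => P P0; rewrite -!mulrA ler_wpM2l//.
rewrite ler_wpM2l ?midpoint_bound_ge0// ler_wpM2l//.
apply: le_trans (hW_rsum h) _; rewrite opprK -mulrA ler_wpM2l ?powR_ge0// mulrC ler_wpM2l//.
  by apply: rsum_ge0 => [p|]; [rewrite mulr_ge0 ?powR_ge0|exact: hWS_summ].
rewrite -(powR_inv1 (ltW c0)); apply: ler_powR; first exact: c1.
by rewrite -subr_ge0 (_ : _ - _ = 11 / 8)//; field.
Qed.

(** The relation [sum_hterm] solved for the double sum, with the continued [zetaN] in place of the
    series. *)
Definition hzeta N s : C := (1 - s)^-1 * (hrem N s - \sum_(r < N) (midpoint_coef R r)%:C *
  (pc r (s - 1) * (cpow 4 (- s) * (cpow c (1 - 2 * s - r%:R) * zetaN N (2 * s + (r%:R - 2)))))).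

Lemma hzeta_mero N a : (0 < N)%N -> 3 < 2 * Re a + N%:R -> mero (hzeta N) a.
Proof.
move=> N0 h; apply: meroM.
  apply: (@mero_inv _ _ _ (-1)).
  - by exists 1 => // z _; apply/dvP; exact: dvB (dv_cst _ _) (dv_id _).
  - by have := cderB (cder_cst a 1) (cder_id a); rewrite sub0r.
  - by right; rewrite oppr_eq0 oner_eq0.
apply: meroD.
  apply: (@mero_dv _ _ ((2 * Re a + N%:R - 3) / 4)); first by lra.
  move=> z hz; have := Re_le_cmod (z - a); rewrite !cReIm ler_norml => /andP[s1 s2].
  by apply: hrem_derivable => //; lra.
have -> : (fun z => - \sum_(r < N) (midpoint_coef R r)%:C *
  (pc r (z - 1) * (cpow 4 (- z) * (cpow c (1 - 2 * z - r%:R) * zetaN N (2 * z + (r%:R - 2)))))) =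
  fun z => -1 * \sum_(r < N) (midpoint_coef R r)%:C *
  (pc r (z - 1) * (cpow 4 (- z) * (cpow c (1 - 2 * z - r%:R) * zetaN N (2 * z + (r%:R - 2))))).
  by apply/funext => z; rewrite mulN1r.
apply: meroZ; apply: mero_sum => r; apply: meroZ.
apply: meroM; first by apply: (@mero_dv _ _ 1) => // z _; exact: dv_pc.
apply: meroM.
  apply: (@mero_dv _ _ 1) => // z _; apply: dv_ext (dv_cpow 4 (-1) 0 z) => t.
  by rewrite mulN1r addr0.
apply: meroM.
  apply: (@mero_dv _ _ 1) => // z _; apply: dv_ext (dv_cpow c (-2) (1 - r%:R) z) => t.
  by congr cpow; ring.
apply: mero_comp_affine; first by rewrite pnatr_eq0.
apply: mero_zetaN; rewrite !cReIm; have : (0 <= r%:R :> R) by [].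
rewrite !cReIm_nat /=; lra.
Qed.

Lemma powR_decay x (q e : R) : 0 < x -> 0 < q -> 0 < e ->
  exists n0, forall n, (n0 <= n)%N -> (x + n%:R) `^ (- q) <= e.
Proof.
move=> x0 q0 e0; have M0 : 0 < e `^ (- q^-1) by rewrite powR_gt0.
exists (Num.truncn (e `^ (- q^-1))).+1 => n hn.
have -> : e = (e `^ (- q^-1)) `^ (- q).
  by rewrite -powRrM mulrNN mulVf ?gt_eqF// powRr1// ltW.
apply: ler_powR_decr => //; last by rewrite oppr_le0 ltW.
have h1 := truncnS_gt (e `^ (- q^-1)).
have h2 : (Num.truncn (e `^ (- q^-1))).+1%:R <= n%:R :> R by rewrite ler_nat.
by apply: le_trans (ltW h1) _; apply: le_trans h2 _; rewrite lerDr ltW.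
Qed.

Lemma hw_cpow r s k : hw s k * cpow (hx k) (1 - s - r%:R) =
  cpow 4 (- s) * (cpow c (1 - 2 * s - r%:R) * Pw (2 * s + (r%:R - 2)) k.+1%:R).
Proof.
have k0 : 0 < k.+1%:R :> R by [].
rewrite /hw /Pw /hx !cpowMl ?mulr_gt0// -[X in X * _ * _](cpow1 k0).
rewrite (_ : - (2 * s + (r%:R - 2)) = 1 + (- s) + (1 - s - r%:R)); last by ring.
rewrite (_ : 1 - 2 * s - r%:R = (- s) + (1 - s - r%:R)); last by ring.
rewrite !(cpowD k.+1%:R) !(cpowD c (- s)); ring.
Qed.

(** For fixed [k] the differences of [Gw r] telescope over [j] and leave [- Gw r s (hx k)]; by
    homogeneity in [c] and [k + 1] the sum over [k] is a zeta value at [2 s + r - 2]. *)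
Lemma sum_hterm N s : (0 < N)%N -> 3 / 2 < Re s ->
  hrem N s = (1 - s) * csum (fun p : nat * nat => p.1.+1%:R%:C *
      cpow (4 * hx p.1 * (hx p.1 + p.2%:R + 2^-1)) (- s)) +
    \sum_(r < N) (midpoint_coef R r)%:C * (pc r (s - 1) *
      (cpow 4 (- s) * (cpow c (1 - 2 * s - r%:R) * zetaS (2 * s + (r%:R - 2))))).
Proof.
move=> N0 hs.
have hW0 (r : nat) : summ (hW r (Re s)).
  by apply: hW_summ; have : (0 <= r%:R :> R) by []; lra.
pose P (p : nat * nat) := hw s p.1 * cpow (hx p.1 + p.2%:R + 2^-1) (- s).
pose Q (r : nat) (p : nat * nat) := hw s p.1 * (Gw r s (hx p.1 + p.2%:R + 1) - Gw r s (hx p.1 + p.2%:R)).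
have sP : csumm P.
  apply: csumm_le (hW0 0%N) => -[k j]; rewrite /P /= cmodM cmod_hw cmod_cpow; last first.
    by rewrite ltr_wpDr// hxj_gt0.
  rewrite /hW/= ler_wpM2l ?mulr_ge0 ?powR_ge0// cReN addr0.
  apply: ler_powR_decr; rewrite ?hxj_gt0//; last by lra.
  by rewrite lerDl.
have sQ r : csumm (Q r).
  apply: csumm_le (summZ (2 * cmod (pc r.+1 (s - 1))) (hW0 r)) => -[k j].
  rewrite /Q/= cmodM cmod_hw.
  have r0 : 0 <= r%:R :> R by [].
  have := @cmod_Gw_diff r s (hx k + j%:R) (hxj_gt0 _ _).
  move=> H; apply: le_trans (ler_wpM2l _ (H _)) _; rewrite ?mulr_ge0 ?powR_ge0//; first by lra.
  rewrite [leLHS](_ : _ = 2 * cmod (pc r.+1 (s - 1)) * hW r (Re s) (k, j))// /hW/=; ring.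
have cQ r : csum (Q r) = - (pc r (s - 1) *
    (cpow 4 (- s) * (cpow c (1 - 2 * s - r%:R) * zetaS (2 * s + (r%:R - 2))))).
  have E k : csum (fun j : nat => Q r (k, j)) = - pc r (s - 1) * (hw s k * cpow (hx k) (1 - s - r%:R)).
    have h0 : hw s k != 0.
      by rewrite -cmod_gt0 cmod_hw mulr_gt0// powR_gt0// mulr_gt0// hx_gt0.
    have sj := csumm_pair k (sQ r).
    have := csummZ (hw s k)^-1 sj.
    rewrite (_ : (fun j => (hw s k)^-1 * Q r (k, j)) = (fun j => (fun j => Gw r s (hx k + j%:R)) j.+1 - (fun j => Gw r s (hx k + j%:R)) j)); last first.
      apply/funext => j; rewrite /Q/= mulKf//; congr (Gw _ _ _ - _); by rewrite -natr1 addrA.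
    move=> sT.
    rewrite (eq_csum (G := fun j => hw s k * ((fun j => Gw r s (hx k + j%:R)) j.+1 - (fun j => Gw r s (hx k + j%:R)) j))); last first.
      by move=> j; rewrite /Q/= -natr1 (addrA (hx k)).
    rewrite (csumZ _ sT) (csum_telescope sT); last first.
      move=> e e0; have q0 : 0 < Re s + r%:R - 1.
        by have : (0 <= r%:R :> R) by []; lra.
      pose B := cmod (pc r (s - 1)) + 1.
      have B0 : 0 < B by rewrite ltr_wpDl ?cmod_ge0.
      have [n0 hn] := powR_decay (hx_gt0 k) q0 (divr_gt0 e0 B0).
      exists n0 => n /hn H; rewrite cmodM cmod_cpow ?hxj_gt0//.
      rewrite (_ : Re (- (s - 1) - r%:R) = - (Re s + r%:R - 1)); last first.
        by rewrite !cReIm !cReIm_nat /=; ring.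
      apply: le_trans (ler_pM (cmod_ge0 _) (powR_ge0 _ _) (_ : _ <= B) H) _.
        by rewrite lerDl.
      by rewrite mulrCA divff ?mulr1// gt_eqF.
    rewrite addr0 /Gw (_ : - (s - 1) = 1 - s); last by ring.
    ring.
  have h1 : 1 < Re (2 * s + (r%:R - 2)).
    by rewrite !cReIm !cReIm_nat /=; have : (0 <= r%:R :> R) by []; lra.
  rewrite csum_pair// (eq_csum E) -mulNr /zetaS -!csumZ.
  - by apply: eq_csum => k; rewrite hw_cpow.
  - by do 2 apply: csummZ; exact: zetaS_summ.
  - by apply: csummZ; exact: zetaS_summ.
  - exact: zetaS_summ.
have sQe r : csumm (fun p => (midpoint_coef R r)%:C * Q r p) by exact: csummZ.
have [sS cS] := @csum_bigsum _ _ (index_enum 'I_N) (fun r p => (midpoint_coef R (val r))%:C * Q r p) (fun r => sQe r).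
rewrite /hrem (eq_csum (G := fun p => (1 - s) * P p - \sum_(r < N) (midpoint_coef R r)%:C * Q r p)); last first.
  move=> [k j]; rewrite /hterm /midpoint_defect /P /Q/= mulrBr; congr (_ - _).
    rewrite /Gw /pc big_ord1 subr0 mulrCA; congr (_ * (_ * cpow _ _)); first by ring.
    by rewrite mulr1n; ring.
  by rewrite mulr_sumr; apply: eq_bigr => r _; rewrite mulrCA.
rewrite (csumB (csummZ _ sP) sS) (csumZ _ sP) cS -sumrN; congr (_ * _ + _).
  apply: eq_csum => -[k j]; have h4 : 0 < 4 * hx k by rewrite mulr_gt0// hx_gt0.
  have h5 : 0 < hx k + j%:R + 2^-1 by rewrite ltr_wpDr// hxj_gt0.
  by rewrite /P /hw/= (cpowMl _ h4 h5) mulrA.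
by apply: eq_bigr => r _; rewrite (csumZ _ (sQ r)) cQ mulrN opprK.
Qed.

Lemma hzeta_sum N s : (0 < N)%N -> 3 / 2 < Re s ->
  hzeta N s = csum (fun p : nat * nat => p.1.+1%:R%:C *
      cpow (4 * hx p.1 * (hx p.1 + p.2%:R + 2^-1)) (- s)).
Proof.
move=> N0 hs; rewrite /hzeta (sum_hterm N0 hs).
have -> : \sum_(r < N) (midpoint_coef R r)%:C * (pc r (s - 1) *
      (cpow 4 (- s) * (cpow c (1 - 2 * s - r%:R) * zetaN N (2 * s + (r%:R - 2))))) =
    \sum_(r < N) (midpoint_coef R r)%:C * (pc r (s - 1) *
      (cpow 4 (- s) * (cpow c (1 - 2 * s - r%:R) * zetaS (2 * s + (r%:R - 2))))).
  apply: eq_bigr => r _; rewrite zetaS_zetaN// !cReIm !cReIm_nat /=.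
  by have : (0 <= r%:R :> R) by []; lra.
rewrite addrK mulKf// subr_eq0; apply/eqP => e.
by move: (hs); rewrite -e /= => h1; clear e; lra.
Qed.

(** For [Re w < 1] the modulus of [2^(1 - w)] exceeds 1, so the denominator does not vanish. *)
Lemma dv_zetaN N (w : C) : 1 < Re w + N%:R -> Re w < 1 -> dv (zetaN N) w.
Proof.
move=> h w1; apply: dvM; first by eexists; exact: eta_derive.
apply: dvV; last by eexists; exact: zeta_den_derive.
rewrite subr_eq0 eq_sym; apply/eqP => e.
have := cmod_cpow (1 - w) (ltr0n R 2 : 0 < 2); rewrite e cmod1 => /eqP.
rewrite eq_sym powR_eq1 !cReIm /= => /or3P[/eqP|h2|/eqP]; lra.
Qed.

Lemma Re_near0 s (r : R) : cmod s < r -> - r < Re s < r.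
Proof. by move=> h; rewrite -ltr_norml; exact: le_lt_trans (Re_le_cmod _) h. Qed.

(** The coefficients of orders 1 and 3 vanish, so order 4 leaves the zeta values at [2 s - 2] and
    [2 s], the second with a factor [s]. *)
Lemma hzeta4E s : hzeta 4 s = (1 - s)^-1 * (hrem 4 s -
  (cpow 4 (- s) * (cpow c (1 - 2 * s) * zetaN 4 (2 * s - 2)) +
   (- 24^-1)%:C * (s * (s - 1) * (cpow 4 (- s) * (cpow c (- 1 - 2 * s) * zetaN 4 (2 * s)))))).
Proof.
rewrite /hzeta (sum_ord4 (fun r : nat => (midpoint_coef R r)%:C *
  (pc r (s - 1) * (cpow 4 (- s) * (cpow c (1 - 2 * s - r%:R) * zetaN 4 (2 * s + (r%:R - 2))))))).
rewrite emb0 emb1 emb2 emb3 !mul0r !addr0 [1%:C]/= mul1r subr0 sub0r addrN addr0.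
congr (_ * (_ - (_ + _ * (_ * (_ * (cpow _ _ * _))))));
  rewrite /pc ?big_ord0 ?mul1r//; last by ring.
by rewrite !big_ord_recr big_ord0 /=; ring.
Qed.

Lemma dv_hzeta4 s : cmod s < 4^-1 -> dv (hzeta 4) s.
Proof.
move=> /Re_near0/andP[s1 s2].
have -> : hzeta 4 = fun s => (1 - s)^-1 * (hrem 4 s -
  (cpow 4 (- s) * (cpow c (1 - 2 * s) * zetaN 4 (2 * s - 2)) +
   (- 24^-1)%:C * (s * (s - 1) * (cpow 4 (- s) * (cpow c (- 1 - 2 * s) * zetaN 4 (2 * s)))))).
  by apply/funext => t; exact: hzeta4E.
have n1 : 1 - s != 0.
  by rewrite subr_eq0; apply/eqP => e; move: (s2); rewrite -e /= => h1; clear e; lra.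
have d4 : dv (fun t => cpow 4 (- t)) s.
  by apply: dv_ext (dv_cpow 4 (-1) 0 s) => t; rewrite mulN1r addr0.
have dc (q : C) : dv (fun t => cpow c (q - 2 * t)) s.
  by apply: dv_ext (dv_cpow c (-2) q s) => t; congr cpow; ring.
have dz (q : C) : Re q <= 0 -> -2 <= Re q -> dv (fun t => zetaN 4 (2 * t + q)) s.
  move=> q0 q2; apply: (@dv_comp (zetaN 4) 2 q); apply: dv_zetaN; rewrite !cReIm /=; lra.
have z2 := dz (-2); have z0 : dv (fun t => zetaN 4 (2 * t)) s.
  by apply: dv_ext (dz 0 _ _) => [t||]; rewrite ?addr0//= ; lra.
apply: dvM; first exact: (@dvV (fun t => 1 - t) s n1 (dvB (dv_cst 1 s) (dv_id s))).
apply: dvB; first by apply: hrem_derivable => //; lra.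
apply: dvD.
  apply: dvM => //; apply: dvM; first exact: dc.
  by apply: z2; rewrite !cReIm /=; lra.
apply: dvM; first exact: dv_cst.
apply: dvM; first exact: dvM (dv_id s) (dvB (dv_id s) (dv_cst 1 s)).
by apply: dvM => //; apply: dvM => //; exact: dc.
Qed.

End Weights.

(** With [B / c] the bound of [hrem_bound], 256 is [16 * 2 / (1/8)]: the Cauchy estimate on the disc
    of radius [1/8], where [(1 - s)^-1] has modulus at most 2. The other summand controls the term
    with the zeta value at 0. *)
Definition hzeta_cst : R :=
  Num.max 0 (256 * (2 * (midpoint_bound R 4 * (8^-1 + 1 + 5) ^+ 5 * (4 `^ (8^-1) * hWS 4 (- 8^-1)))) +
    cmod (zetaN 4 (0 : C))).

Lemma hzeta4_arith (i B m Z H D R1 m1 c : R) : m1 <= 256 * B * i -> - m1 <= R1 ->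
  i * (256 * B + m) <= i * H -> i * Z <= i * m -> 0 <= i * m ->
  c * (2 / 7 * D) - H * i <= R1 + c * (2 / 7) * D - 24^-1 * i * Z.
Proof. by move=> h1 h2 h3 h4 h5; lra. Qed.

(** The remainder [A1] has derivative at most [256 B / c]. In the leading term the vanishing of zeta
    at -2 leaves only its derivative there, which contributes [(2 / 7) c] times [deta 4 (-2)]. The
    last term contains the factor [s], so only the value [A3 0], which is minus the zeta value at 0
    divided by [c], enters. *)
Lemma hzeta4_deriv c d : 1 <= c -> is_derive (0 : C) (1 : C) (hzeta c 4) d ->
  c * (2 / 7 * Re (deta 4 (-2 : C))) - hzeta_cst / c <= Re d.
Proof.
move=> c1 hd; have c0 : 0 < c by exact: lt_le_trans c1.
set B := 2 * (midpoint_bound R 4 * (8^-1 + 1 + 5) ^+ 5 * (4 `^ (8^-1) * hWS 4 (- 8^-1))).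
have z0 : Re (0 : C) = 0 by [].
pose A1 s := (1 - s)^-1 * hrem c 4 s.
have dvA s : cmod s < 8^-1 -> dv A1 s.
  move=> hs; have /andP[s1 s2] := Re_near0 hs.
  apply: dvM; last by apply: hrem_derivable => //; lra.
  apply: dvV (dvB (dv_cst 1 s) (dv_id s)).
  by rewrite subr_eq0; apply/eqP => e; move: (s2); rewrite -e /= => h1; clear e; lra.
have [d1 hd1] : dv A1 0 by apply: dvA; rewrite cmod0.
have b1 : cmod d1 <= 256 * B / c.
  have := @cauchy_est _ A1 0 8^-1 (2 * (B / c)) d1.
  have -> : 16 * (2 * (B / c)) / 8^-1 = 256 * B / c by field; rewrite gt_eqF.
  apply=> //.
  - by move=> z; rewrite subr0 => /dvA/dvP.
  - move=> z; rewrite subr0 => hz; rewrite cmodM cmodV.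
    apply: ler_pM; rewrite ?invr_ge0 ?cmod_ge0//; last exact: hrem_bound.
    have := cmodD (1 - z) z; rewrite subrK cmod1 => h1.
    have h2 : 2^-1 <= cmod (1 - z) by lra.
    by rewrite invf_ple ?posrE//; lra.
pose A2 s := (1 - s)^-1 * (cpow 4 (- s) * cpow c (1 - 2 * s)).
have [e2 he2] : dv A2 0.
  apply: dvM.
    by apply: dvV (dvB (dv_cst 1 _) (dv_id _)); rewrite subr0 oner_eq0.
  apply: dvM; first by apply: dv_ext (dv_cpow 4 (-1) 0 0) => t; rewrite mulN1r addr0.
  by apply: dv_ext (dv_cpow c (-2) 1 0) => t; congr cpow; ring.
have [zz hz] := zeta_m2 R.
have hz2 : is_derive (0 : C) (1 : C) (fun s => zetaN 4 (2 * s - 2)) (- deta 4 (-2) / 7 * (2 * 1 - 0)).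
  have q1 : is_derive (2 * 0 - 2 : C) (1 : C) (zetaN 4) (- deta 4 (-2) / 7) by rewrite mulr0 sub0r.
  have q2 : is_derive (0 : C) (1 : C) (fun s : C => 2 * s - 2) (2 * 1 - 0).
    exact: cderB (cderZ 2 (cder_id 0)) (cder_cst 0 2).
  exact: (@cder_comp _ (zetaN 4) (fun s => 2 * s - 2) 0 _ _ q1 q2).
have hA2 := cderM he2 hz2.
pose A3 s := (1 - s)^-1 * ((s - 1) * (cpow 4 (- s) * (cpow c (- 1 - 2 * s) * zetaN 4 (2 * s)))).
have [e3 he3] : dv A3 0.
  apply: dvM.
    by apply: dvV (dvB (dv_cst 1 _) (dv_id _)); rewrite subr0 oner_eq0.
  apply: dvM; first exact: dvB (dv_id 0) (dv_cst 1 0).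
  apply: dvM; first by apply: dv_ext (dv_cpow 4 (-1) 0 0) => t; rewrite mulN1r addr0.
  apply: dvM; first by apply: dv_ext (dv_cpow c (-2) (-1) 0) => t; congr cpow; ring.
  have : dv (zetaN 4) (2 * 0 + 0) by rewrite mulr0 addr0; apply: dv_zetaN => /=; lra.
  by move=> /dv_comp; apply: dv_ext => t; rewrite addr0.
have hA3 := cderM (cder_id 0) he3.
have hall := cderB hd1 (cderD hA2 (cderZ (- 24^-1)%:C hA3)).
have E : hzeta c 4 = fun s => A1 s - (A2 s * zetaN 4 (2 * s - 2) + (- 24^-1)%:C * (s * A3 s)).
  by apply/funext => s; rewrite hzeta4E /A1 /A2 /A3; ring.
rewrite -E in hall.
have -> : d = d1 - (e2 * zetaN 4 (2 * 0 - 2) + A2 0 * (- deta 4 (-2) / 7 * (2 * 1 - 0)) +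
   (- 24^-1)%:C * (1 * A3 0 + 0 * e3)).
  by case: hd => _ <-; case: hall => _ <-.
have A20 : A2 0 = c%:C by rewrite /A2 !subr0 invr1 oppr0 cpow0 !mul1r mulr0 subr0 cpow1.
have A30 : A3 0 = - (c^-1%:C * zetaN 4 0).
  by rewrite /A3 !subr0 invr1 oppr0 cpow0 !mul1r !mulr0 subr0 cpowN cpow1// fmorphV/= sub0r mulN1r.
rewrite A20 A30 mulr0 sub0r zz mulr0 add0r mul0r addr0 mul1r subr0.
have key (D Z : C) : d1 - (c%:C * (- D / 7 * (2 * 1)) + (- 24^-1)%:C * - (c^-1%:C * Z)) =
  d1 + (c * (2 / 7))%:C * D - (24^-1 * c^-1)%:C * Z.
  have -> : (2 : C) = 2%:C by rewrite (rmorph_nat (@real_complex R) 2).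
  have -> : (7 : C) = 7%:C by rewrite (rmorph_nat (@real_complex R) 7).
  rewrite -fmorphV; case: d1 D Z {hd1 b1 hall} => [a1 b1] [a2 b2] [a3 b3].
  by apply: complex_eqP; rewrite !cReIm /=; ring.
have keyR (D Z : C) : Re (d1 + (c * (2 / 7))%:C * D - (24^-1 * c^-1)%:C * Z) =
    Re d1 + c * (2 / 7) * Re D - 24^-1 * c^-1 * Re Z.
  by case: D Z => [a2 b2] [a3 b3]; rewrite !cReIm /=; ring.
rewrite key keyR.
have h1 := Re_le_cmod d1; have h2 := Re_le_cmod (zetaN 4 (0 : C)).
have h3 : 256 * B + cmod (zetaN 4 (0 : C)) <= hzeta_cst by rewrite le_max lexx orbT.
move: h1 h2; rewrite !ler_norml => /andP[h1 _] /andP[_ h2].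
have ci : 0 < c^-1 by rewrite invr_gt0.
have h4 : c^-1 * (256 * B + cmod (zetaN 4 (0 : C))) <= c^-1 * hzeta_cst by rewrite ler_pM2l.
have h5 : c^-1 * Re (zetaN 4 0) <= c^-1 * cmod (zetaN 4 (0 : C)) by rewrite ler_pM2l.
have h6 : 0 <= c^-1 * cmod (zetaN 4 (0 : C)) by rewrite mulr_ge0 ?cmod_ge0// ltW.
exact: hzeta4_arith b1 h1 h4 h5 h6.
Qed.

End HeisenbergZeta.

(** * The zeta function of the flat torus *)

Section TorusZeta.
Variable R : realType.
Local Notation C := R[i].
Local Notation Re := (@complex.Re R).
Local Notation Im := (@complex.Im R).
Local Open Scope complex_scope.
Implicit Types (s z a : C) (x y : R) (k n : nat) (m : int).

Definition Tw n x : R := x ^+ 2 + n%:R ^+ 2.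
Definition tphi n s x : C := cpow (Tw n x) (- s).

Lemma Tw_gt0 n x : 0 < Tw n.+1 x.
Proof. by rewrite ltr_wpDl ?sqr_ge0// exprn_gt0. Qed.

(* The derivatives of [u = w ^ (- s)], [w = x ^ 2 + n ^ 2], obey the recursion
   found by differentiating [w u' = - 2 s x u]. *)
Fixpoint tder n s k x : C * C :=
  if k is j.+1 then
    let p := tder n s j x in
    (p.2, - ((Tw n x)^-1%:C * (2 * (s + j%:R) * (x%:C * p.2) +
      (2 * s + j%:R - 1) * (j%:R * p.1))))
  else (0, tphi n s x).

Lemma drv_Tw n x : is_derive x 1 (Tw n) (2 * x).
Proof.
have -> : Tw n = fun t => t * t + n%:R ^+ 2 by apply/funext => t; rewrite /Tw expr2.
apply: drv_eq (drvD (drvM (drv_id x) (drv_id x)) (drv_cst x _)) _; ring.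
Qed.

Lemma rder_tder n s k x : rder (fun x => (tder n.+1 s k x).2) x (tder n.+1 s k.+1 x).2.
Proof.
(* At order 0 the first component is the placeholder 0 instead of a primitive; the factor [k] in the
   second claim absorbs this. *)
suff [] : rder (fun x => (tder n.+1 s k x).2) x (tder n.+1 s k.+1 x).2 /\
  exists2 d, rder (fun x => (tder n.+1 s k x).1) x d & k%:R * d = k%:R * (tder n.+1 s k x).2 by [].
have w0 := Tw_gt0 n x; have wn : Tw n.+1 x != 0 by rewrite gt_eqF.
have hw := drv_Tw n.+1 x.
elim: k => [|k [IH1 [d IH2 kd]]].
  split; last by exists 0; [exact: rder_cst|rewrite !mul0r].
  apply: rder_eq (@rder_cpow _ (Tw n.+1) x _ (- s) w0 hw) _.
  have -> : (2 * x / Tw n.+1 x)%:C = 2 * x%:C * (Tw n.+1 x)^-1%:C.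
    by rewrite !rmorphM /= (rmorph_nat (@real_complex R) 2).
  by rewrite /= mulr0n /tphi; ring.
split; last by exists (tder n.+1 s k.+1 x).2.
have hW : is_derive x 1 (fun x => (Tw n.+1 x)^-1) (- (2 * x) / Tw n.+1 x ^+ 2).
  apply: drv_eq (is_deriveV wn hw) _; rewrite /GRing.scale/=; field.
  by rewrite wn.
have hx := rder_real (drv_id x).
have := rderN (rderM (rder_real hW) (rderD (rderZ (2 * (s + k%:R)) (rderM hx IH1))
   (rderZ (2 * s + k%:R - 1) (rderZ k%:R IH2)))).
move=> H; apply: rder_eq H _; rewrite kd.
have -> : (- (2 * x) / Tw n.+1 x ^+ 2)%:C = - 2 * x%:C * (Tw n.+1 x)^-1%:C ^+ 2.
  by rewrite -exprVn rmorphM rmorphXn rmorphN rmorphM /= (rmorph_nat (@real_complex R) 2) mulNr.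
have E1 : (tder n.+1 s k.+1 x).2 = - ((Tw n.+1 x)^-1%:C * (2 * (s + k%:R) * (x%:C * (tder n.+1 s k x).2) +
      (2 * s + k%:R - 1) * (k%:R * (tder n.+1 s k x).1))) by [].
have E2 : (tder n.+1 s k.+2 x).2 = - ((Tw n.+1 x)^-1%:C * (2 * (s + k.+1%:R) * (x%:C * (tder n.+1 s k.+1 x).2) +
      (2 * s + k.+1%:R - 1) * (k.+1%:R * (tder n.+1 s k x).2))) by [].
rewrite E2 E1 -!(natr1 k); ring.
Qed.

(** The recursion of [tder] with every coefficient replaced by its bound for [cmod s <= A], the
    powers of [w] being accounted for separately. *)
Fixpoint tK (A : R) k : R * R :=
  if k is j.+1 then
    let p := tK A j in (p.2, 2 * (A + j%:R) * p.2 + (2 * A + j%:R + 1) * (j%:R * p.1))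
  else (0, 1).

Lemma tK_ge0 A k : 0 <= A -> 0 <= (tK A k).1 /\ 0 <= (tK A k).2.
Proof.
move=> A0; elim: k => [|k [h1 h2]] /=; first by rewrite lexx ler01.
by split=> //; rewrite addr_ge0 ?mulr_ge0 ?addr_ge0 ?mulr_ge0.
Qed.

(** Since [|x| <= w^(1/2)], both terms of the recursion gain half a power of [w] per derivative. *)
Lemma cmod_tder n s k x A : cmod s <= A ->
  cmod (tder n.+1 s k x).2 <= (tK A k).2 * Tw n.+1 x `^ (- (Re s + k%:R / 2)).
Proof.
move=> sA; have A0 : 0 <= A by exact: le_trans (cmod_ge0 s) sA.
have w0 := Tw_gt0 n x.
suff [] : cmod (tder n.+1 s k x).1 <= (tK A k).1 * Tw n.+1 x `^ (- (Re s + (k%:R - 1) / 2)) /\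
  cmod (tder n.+1 s k x).2 <= (tK A k).2 * Tw n.+1 x `^ (- (Re s + k%:R / 2)) by [].
elim: k => [|k [IH1 IH2]].
  by rewrite /= cmod0 mul0r lexx mul1r mul0r addr0 cmod_cpow// cReN lexx.
split; first by rewrite -natr1 addrK.
have [K1 K2] := tK_ge0 k A0.
have xw : `|x| <= Tw n.+1 x `^ 2^-1.
  by rewrite (powR12_sqrt (ltW w0)) -sqrtr_sqr; apply: ler_wsqrtr; rewrite lerDl sqr_ge0.
have wi : 0 <= (Tw n.+1 x)^-1 by rewrite invr_ge0 ltW.
rewrite [(tder _ _ _ _).2]/= cmodN cmodM cmodR (ger0_norm wi).
set w := Tw _ _ in w0 xw IH1 IH2 wi *.
have E1 : w^-1 * (w `^ 2^-1 * w `^ (- (Re s + k%:R / 2))) = w `^ (- (Re s + k.+1%:R / 2)).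
  rewrite -(powR_inv1 (ltW w0)) -!powR_add//; congr (_ `^ _); rewrite -natr1; by field.
have E2 : w^-1 * w `^ (- (Re s + (k%:R - 1) / 2)) = w `^ (- (Re s + k.+1%:R / 2)).
  rewrite -(powR_inv1 (ltW w0)) -!powR_add//; congr (_ `^ _); rewrite -natr1; by field.
have P0 (q : R) : 0 <= w `^ q by exact: powR_ge0.
have c2 (t : C) : cmod (2 * t) = 2 * cmod t by rewrite cmodM cmod_nat.
have B1 : cmod (2 * (s + k%:R) * (x%:C * (tder n.+1 s k x).2)) <=
    2 * (A + k%:R) * (w `^ 2^-1 * ((tK A k).2 * w `^ (- (Re s + k%:R / 2)))).
  rewrite !cmodM !cmod_nat cmodR; apply: ler_pM; rewrite ?mulr_ge0 ?cmod_ge0//.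
    by rewrite ler_wpM2l// (le_trans (cmodD _ _))// cmod_nat lerD2r.
  by apply: ler_pM; rewrite ?cmod_ge0.
have B2 : cmod ((2 * s + k%:R - 1) * (k%:R * (tder n.+1 s k x).1)) <=
    (2 * A + k%:R + 1) * (k%:R * ((tK A k).1 * w `^ (- (Re s + (k%:R - 1) / 2)))).
  rewrite !cmodM cmod_nat; apply: ler_pM; rewrite ?mulr_ge0 ?cmod_ge0//.
    apply: le_trans (cmodB _ _) _; rewrite cmod1 lerD2r.
    by apply: le_trans (cmodD _ _) _; rewrite cmod_nat lerD2r c2 ler_wpM2l.
  by rewrite ler_wpM2l.
apply: le_trans (ler_wpM2l wi (le_trans (cmodD _ _) (lerD B1 B2))) _.
rewrite [leLHS](_ : _ = 2 * (A + k%:R) * (tK A k).2 * (w^-1 * (w `^ 2^-1 * w `^ (- (Re s + k%:R / 2)))) +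
   (2 * A + k%:R + 1) * (k%:R * (tK A k).1) * (w^-1 * w `^ (- (Re s + (k%:R - 1) / 2)))); last by ring.
by rewrite E1 E2 -mulrDl.
Qed.

(** This separates the variables: negative powers of [Tw] are dominated by products of powers in [x]
    and [n], which form a summable double family. *)
Lemma Tw_ge n x : (1 + `|x|) * (1 + n.+1%:R) <= 5 * Tw n.+1 x.
Proof.
rewrite /Tw -(real_normK (num_real x)); have := normr_ge0 x; move: `|x| => y y0.
have : 1 <= n.+1%:R :> R by rewrite ler1n.
move: (n.+1%:R : R) => u u1.
have := sqr_ge0 (y - u); have := sqr_ge0 (y - 1); have := sqr_ge0 (u - 1).
rewrite !sqrrB !expr1n !mulr1; nra.
Qed.

(** The 5 comes from [Tw_ge]; the factor [N + 1] pays for the points [y] of [[m, m + N]], where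
    [1 + |m|] is at most [N + 1] times [1 + |y|]. *)
Definition tW (N : nat) (p : R) (q : nat * int) : R :=
  (5 * N.+1%:R) `^ p * ((1 + `|q.2%:~R|) `^ (- p) * (1 + q.1.+1%:R) `^ (- p)).

Lemma fdiff_tphi N n s m A : cmod s <= A -> 0 <= Re s + N%:R / 2 ->
  cmod (fdiff N (tphi n.+1 s) m%:~R) <= 2 ^+ N * ((tK A N).2 * tW N (Re s + N%:R / 2) (n, m)).
Proof.
move=> sA sN; have A0 : 0 <= A by exact: le_trans (cmod_ge0 s) sA.
apply: (@fdiff_bound _ N (fun k x => (tder n.+1 s k x).2)).
  by move=> k y _; exact: rder_tder.
move=> y /andP[y1 y2]; apply: le_trans (cmod_tder n N y sA) _.
have [_ K2] := tK_ge0 N A0; rewrite ler_wpM2l// /tW/=.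
set p := Re s + _ in sN *.
have u0 : 0 < 1 + `|m%:~R| :> R by rewrite ltr_pwDl.
have v0 : 0 < 1 + n.+1%:R :> R by rewrite ltr_wpDr.
have N5 : 0 < 5 * N.+1%:R :> R by rewrite mulr_gt0.
have -> : (5 * N.+1%:R) `^ p * ((1 + `|m%:~R|) `^ (- p) * (1 + n.+1%:R) `^ (- p)) =
   ((5 * N.+1%:R)^-1 * ((1 + `|m%:~R|) * (1 + n.+1%:R))) `^ (- p).
  have h1 : 0 <= (5 * N.+1%:R : R)^-1 by rewrite invr_ge0 ltW.
  rewrite (powRM (- p) h1 (mulr_ge0 (ltW u0) (ltW v0))) (powRM (- p) (ltW u0) (ltW v0)).
  by rewrite -(powR_inv1 (ltW N5)) -powRrM mulrNN mul1r.
apply: ler_powR_decr; rewrite ?oppr_le0// ?mulr_gt0 ?invr_gt0 ?mulr_gt0//.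
rewrite ler_pdivrMl//; have := Tw_ge n y.
have hm : 1 + `|m%:~R| <= N.+1%:R * (1 + `|y|).
  have N0 : 0 <= N%:R :> R by [].
  have : `|m%:~R| <= `|y| + N%:R.
    have := ler_norm y; have : - y <= `|y| by rewrite -normrN ler_norm.
    by rewrite ler_norml => ? ?; apply/andP; split; lra.
  rewrite -natr1; have := normr_ge0 y; nra.
move=> h; apply: le_trans (ler_wpM2r (ltW v0) hm) _.
rewrite -mulrA (mulrC 5) -mulrA ler_wpM2l//.
Qed.

Lemma summ_int (F : int -> R) : summ (fun n : nat => F n) -> summ (fun n : nat => F (Negz n)) -> summ F.
Proof.
move=> h1 h2; pose h (i : nat + nat) := match i with inl n => Posz n | inr n => Negz n end.
apply: (@summ_bij _ _ _ h); last exact: summ_sumtype.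
by exists (fun i : int => match i with Posz n => inl n | Negz n => inr n end) => [[]|[]].
Qed.

Lemma csum_int (F : int -> C) : csumm F ->
  csum F = csum (fun n : nat => F n) + csum (fun n : nat => F (Negz n)).
Proof.
move=> hF; pose h (i : nat + nat) := match i with inl n => Posz n | inr n => Negz n end.
have hb : bijective h.
  by exists (fun i : int => match i with Posz n => inl n | Negz n => inr n end) => [[]|[]].
have [sh <-] := csum_shift hb hF; exact: csum_sumtype.
Qed.

Lemma summ_int_powR (p : R) : 1 < p -> summ (fun m : int => (1 + `|m%:~R|) `^ (- p) : R).
Proof.
move=> p1; have h := summ_pseries p1; apply: summ_int.
  by apply: summ_le h => n; rewrite ger0_norm ?powR_ge0// ger0_norm// addrC natr1.
apply: summ_le h => n; rewrite ger0_norm ?powR_ge0// NegzE mulrNz normrN ger0_norm//.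
by apply: ler_powR_decr => //; [rewrite lerDr|lra].
Qed.

Lemma tW_summ N p : 1 < p -> summ (tW N p).
Proof.
move=> p1; apply: summZ.
have h2 : summ (fun k : nat => (1 + k.+1%:R) `^ (- p) : R).
  apply: summ_le (summ_pseries p1) => k; rewrite ger0_norm ?powR_ge0//.
  by apply: ler_powR_decr => //; [rewrite lerDr|lra].
apply: (@summ_le _ _ _ (fun q : nat * int => (1 + q.1.+1%:R) `^ (- p) * (1 + `|q.2%:~R|) `^ (- p))).
  by move=> q; rewrite ger0_norm ?mulr_ge0 ?powR_ge0// mulrC.
exact: (@summ_mul _ _ _ (fun k : nat => (1 + k.+1%:R) `^ (- p)) _ h2 (summ_int_powR p1)).
Qed.

(** The index [k] stands for the row [n = k + 1]. *)
Definition tsgn k m : C := (2 + (-1) ^+ k.+1) * (-1) ^+ `|m|%N.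

Lemma cmod_tsgn k m : cmod (tsgn k m) <= 3.
Proof.
rewrite cmodM cmod_sign mulr1; apply: le_trans (cmodD _ _) _.
by rewrite cmod_sign cmod_nat; lra.
Qed.

Definition tterm N s (q : nat * int) : C := tsgn q.1 q.2 * fdiff N (tphi q.1.+1 s) q.2%:~R.
Definition trem N s : C := csum (tterm N s).

Lemma cmod_tterm N s q A : cmod s <= A -> 0 <= Re s + N%:R / 2 ->
  cmod (tterm N s q) <= 3 * (2 ^+ N * ((tK A N).2 * tW N (Re s + N%:R / 2) q)).
Proof.
move=> sA sN; rewrite cmodM; apply: ler_pM; rewrite ?cmod_ge0//; first exact: cmod_tsgn.
by case: q => n m; exact: fdiff_tphi.
Qed.

Lemma tterm_summ N s : 1 < Re s + N%:R / 2 -> csumm (tterm N s).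
Proof.
move=> h; apply: csumm_le (summZ _ (summZ _ (summZ _ (tW_summ N h)))) => q.
by apply: (@cmod_tterm _ _ _ (cmod s)) => //; lra.
Qed.

Lemma tW_decr N (p p' : R) q : p <= p' -> tW N p' q <= (5 * N.+1%:R) `^ (p' - p) * tW N p q.
Proof.
move=> pp; have N5 : 0 < 5 * N.+1%:R :> R by rewrite mulr_gt0.
rewrite /tW [leRHS]mulrA -(powR_add _ _ N5) subrK ler_wpM2l ?powR_ge0//.
by apply: ler_pM; rewrite ?powR_ge0//; apply: ler_powR; rewrite ?lerN2// lerDl.
Qed.

Lemma dv_trem N s : 1 < Re s + N%:R / 2 -> dv (trem N) s.
Proof.
move=> h; pose r := (Re s + N%:R / 2 - 1) / 2; have r0 : 0 < r by rewrite /r; lra.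
pose p := Re s - r + N%:R / 2; have p1 : 1 < p by rewrite /p /r; lra.
pose A := cmod s + r.
eexists; apply: (@csum_derive _ _ (fun q z => tterm N z q)
  (fun q z => tsgn q.1 q.2 * fdiff N (fun x => cpow (Tw q.1.+1 x) (-1 * z + 0) * (-1 * (ln (Tw q.1.+1 x))%:C)) q.2%:~R) s r
  (fun q => 3 * (2 ^+ N * ((tK A N).2 * ((5 * N.+1%:R) `^ (2 * r) * tW N p q))))) => //.
- move=> q z _; apply: cderZ; apply: fdiff_cder => y _.
  have := @cder_cpow R (Tw q.1.+1 y) (-1) 0 z.
  by rewrite (_ : (fun s => cpow _ (-1 * s + 0)) = (tphi q.1.+1)^~ y)//; apply/funext => t; rewrite mulN1r addr0.
- move=> q z zr; have := Re_le_cmod (z - s); rewrite !cReIm ler_norml => /andP[z1 z2].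
  have zA : cmod z <= A.
    rewrite (_ : z = s + (z - s)); last by ring.
    by apply: le_trans (cmodD _ _) _; rewrite lerD2l ltW.
  have A0 : 0 <= A by exact: le_trans (cmod_ge0 z) zA.
  have [_ K2] := tK_ge0 N A0.
  have hz1 : Re s - r <= Re z by lra.
  have hz0 : 0 <= Re z + N%:R / 2 by apply: le_trans (_ : p <= _); [lra|rewrite /p lerD2r].
  apply: le_trans (cmod_tterm q zA _) _; first exact: hz0.
  rewrite !ler_wpM2l ?exprn_ge0//.
  apply: le_trans (tW_decr N q (_ : p <= _)) _; first by rewrite /p; lra.
  apply: ler_wpM2r; first by rewrite !mulr_ge0 ?powR_ge0.
  apply: ler_powR; last by rewrite /p; lra.
  by have : 1 <= N.+1%:R :> R; [rewrite ler1n|lra].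
- by do 4 apply: summZ; exact: tW_summ.
Qed.

(* [(1 - 4^(1-s)) T(s)] is the sum of [- (-1)^m (2 + (-1)^n) (m^2 + n^2)^(-s)], to whose
   rows Euler's transformation applies. *)
Definition torus N s : C :=
  (6 * eta N (2 * s) - 2 * (mh R ^+ N * trem N s)) / (1 - cpow 4 (1 - s)).

Lemma four_pow_derive (s : C) : is_derive s (1 : C) (fun s => 1 - cpow (4 : R) (1 - s))
  (cpow 4 (1 - s) * (ln 4)%:C).
Proof.
have := cderB (cder_cst s 1) (@cder_cpow R 4 (-1) 1 s).
rewrite (_ : (fun t => 1 - cpow 4 (-1 * t + 1)) = (fun s => 1 - cpow (4 : R) (1 - s))).
  move=> h; apply: cder_eq h _; rewrite (_ : -1 * s + 1 = 1 - s); last by ring.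
  ring.
by apply/funext => t; congr (1 - cpow 4 _); ring.
Qed.

Lemma dv_torus_num N s : 1 < Re s + N%:R / 2 -> dv (fun s => 6 * eta N (2 * s) - 2 * (mh R ^+ N * trem N s)) s.
Proof.
move=> h; apply: dvB.
  apply: dvM; first exact: dv_cst.
  have : dv (fun t => eta N (2 * t + 0)) s.
    apply: dv_comp; eexists; apply: eta_derive; rewrite !cReIm /=; lra.
  by apply: dv_ext => t; rewrite addr0.
by apply: dvM (dv_cst _ _) (dvM (dv_cst _ _) _); exact: dv_trem.
Qed.

Lemma mero_torus N a : 1 < Re a + N%:R / 2 -> mero (torus N) a.
Proof.
move=> h; apply: meroM.
  apply: (@mero_dv _ _ _ (Re a + N%:R / 2 - 1)); first by lra.
  move=> z hz; have := Re_le_cmod (z - a); rewrite !cReIm ler_norml => /andP[z1 z2].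
  by apply: dv_torus_num; lra.
apply: (mero_inv _ (four_pow_derive a)).
  by exists 1 => // z _; have [] := four_pow_derive z.
right; rewrite mulf_neq0 ?cpow_neq0//.
by apply/eqP => /(congr1 Re)/= /eqP; rewrite gt_eqF// ln_gt0// ltr1n.
Qed.

Lemma dv_torus N s : 1 < Re s + N%:R / 2 -> Re s < 1 -> dv (torus N) s.
Proof.
move=> h s1; apply: dvM; first exact: dv_torus_num.
apply: dvV; last by eexists; exact: four_pow_derive.
rewrite subr_eq0 eq_sym; apply/eqP => e.
have := cmod_cpow (1 - s) (ltr0n R 4 : 0 < 4); rewrite e cmod1 => /eqP.
rewrite eq_sym powR_eq1 !cReIm /= => /or3P[/eqP|h2|/eqP]; lra.
Qed.

End TorusZeta.

(** * The lattice sum over the torus *)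

Section TorusSum.
Variable R : realType.
Local Notation C := R[i].
Local Notation Re := (@complex.Re R).
Local Notation Im := (@complex.Im R).
Local Open Scope complex_scope.
Implicit Types (s z a : C) (x y : R) (k n : nat) (m : int).

Definition isg m : C := (-1) ^+ `|m|%N.

Lemma isgS m : isg (m + 1) = - isg m.
Proof.
rewrite /isg; case: m => [n|[|n]].
- by rewrite -PoszD /= addn1 exprS mulN1r.
- by rewrite /= expr1 opprK.
- have -> : Negz n.+1 + 1 = Negz n by rewrite !NegzE; lia.
  by rewrite /= [in RHS]exprS mulN1r opprK.
Qed.

Lemma isgM2 m : isg (2 * m) = 1.
Proof. by rewrite /isg abszM mul2n -signr_odd odd_double. Qed.

Lemma isgM21 m : isg (2 * m + 1) = - 1.
Proof. by rewrite isgS isgM2. Qed.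

Lemma isgN m : isg (- m) = isg m.
Proof. by rewrite /isg abszN. Qed.

Lemma addz1_bij : bijective (fun m : int => m + 1).
Proof. by exists (fun m => m - 1) => m; rewrite ?addrK ?subrK. Qed.

(** Over all integers the shift [m -> m + 1] is a bijection, so Euler's step has no boundary
    term. *)
Lemma euler_int (u : int -> C) : csumm (fun m => isg m * u m) ->
  csumm (fun m => isg m * (u (m + 1) - u m)) /\
  csum (fun m => isg m * u m) = mh R * csum (fun m => isg m * (u (m + 1) - u m)).
Proof.
move=> su; have [s1 e1] := csum_shift addz1_bij su.
have E : (fun m => isg m * (u (m + 1) - u m)) =
   fun m => (-2) * (isg m * u m) + - ((isg (m + 1) * u (m + 1)) - (isg m * u m)).
  by apply/funext => m; rewrite isgS; ring.
have s2 : csumm (fun m => - ((isg (m + 1) * u (m + 1)) - (isg m * u m))).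
  have := csummZ (-1) (csummD s1 (csummZ (-1) su)); congr csumm.
  by apply/funext => m /=; ring.
have s3 := csummZ (-2) su.
rewrite E; split; first exact: csummD.
rewrite (csumD s3 s2) (csumZ _ su).
have -> : csum (fun m => - ((isg (m + 1) * u (m + 1)) - (isg m * u m))) = 0.
  rewrite (eq_csum (G := fun m => -1 * (isg (m + 1) * u (m + 1) - isg m * u m))); last first.
    by move=> m; rewrite mulN1r.
  have h := csumB s1 su; rewrite csumZ; last first.
    have := csummD s1 (csummZ (-1) su); congr csumm.
    by apply/funext => m /=; ring.
  by rewrite -[X in _ * X]/(csum (fun m => ((fun m => isg m * u m) \o (fun m => m + 1)) m - isg m * u m)) h e1 subrr mulr0.
rewrite addr0 /mh mulrA mulNr mulrN opprK mulVf ?mul1r//.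
Qed.

Lemma euler_intN N (u : R -> C) : csumm (fun m : int => isg m * u m%:~R) ->
  csumm (fun m : int => isg m * fdiff N u m%:~R) /\
  csum (fun m : int => isg m * u m%:~R) = mh R ^+ N * csum (fun m : int => isg m * fdiff N u m%:~R).
Proof.
move=> su; elim: N => [|N [IH1 IH2]]; first by rewrite expr0 mul1r.
have [h1 h2] := @euler_int (fun m => fdiff N u m%:~R) IH1.
have E : (fun m : int => isg m * fdiff N.+1 u m%:~R) =
   fun m => isg m * (fdiff N u (m + 1)%:~R - fdiff N u m%:~R).
  by apply/funext => m; rewrite fdiffS intrD.
by rewrite E; split=> //; rewrite IH2 h2 exprSr mulrA.
Qed.

Lemma csum_int_even (F : int -> C) : csumm F -> (forall m, F (- m) = F m) ->
  csum F = F 0 + 2 * csum (fun n : nat => F n.+1).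
Proof.
move=> hF Fe; rewrite csum_int// csum_recl; last first.
  by apply: (@summ_inj _ _ _ Posz (fun i => cmod (F i))) => // i j [].
rewrite (_ : (fun n : nat => F (Negz n)) = fun n : nat => F n.+1); last first.
  by apply/funext => n; rewrite NegzE Fe.
by rewrite -addrA; congr (_ + _); ring.
Qed.

Lemma csum_par1 (F : int * int -> C) : csumm F ->
  [/\ csumm (fun p => F (2 * p.1, p.2)), csumm (fun p => F (2 * p.1 + 1, p.2)) &
    csum F = csum (fun p => F (2 * p.1, p.2)) + csum (fun p => F (2 * p.1 + 1, p.2))].
Proof.
move=> hF.
pose h (i : (int * int) + (int * int)) := match i with
  inl p => (2 * p.1, p.2) | inr p => (2 * p.1 + 1, p.2) end.
have hb : bijective h.
  exists (fun p : int * int => if (p.1 %% 2)%Z == 0 then inl ((p.1 %/ 2)%Z, p.2)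
    else inr ((p.1 %/ 2)%Z, p.2)).
    move=> [[m n]|[m n]] /=.
      have -> : ((2 * m)%R %% 2)%Z = 0 by lia.
      by congr (inl (_, _)); lia.
    have -> : ((2 * m + 1)%R %% 2)%Z = 1 by lia.
    by congr (inr (_, _)); lia.
  move=> [m n] /=; case: ifP => /= e; congr (_, _); lia.
have [s1 e1] := csum_shift hb hF; split.
- by apply: (@summ_inj _ _ _ (fun p : int * int => (2 * p.1, p.2)) (fun i => cmod (F i))) => // -[a b] [c d] /= [? ->]; congr (_, _); lia.
- by apply: (@summ_inj _ _ _ (fun p : int * int => (2 * p.1 + 1, p.2)) (fun i => cmod (F i))) => // -[a b] [c d] /= [? ->]; congr (_, _); lia.
- by rewrite -e1 csum_sumtype.
Qed.

Lemma swap_bij (T : Type) : bijective (fun p : T * T => (p.2, p.1)).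
Proof. by exists (fun p : T * T => (p.2, p.1)) => -[]. Qed.

Lemma csum_par2 (F : int * int -> C) : csumm F ->
  [/\ csumm (fun p => F (p.1, 2 * p.2)), csumm (fun p => F (p.1, 2 * p.2 + 1)) &
    csum F = csum (fun p => F (p.1, 2 * p.2)) + csum (fun p => F (p.1, 2 * p.2 + 1))].
Proof.
move=> hF; have [s1 e1] := csum_shift (swap_bij int) hF.
have [h1 h2 h3] := csum_par1 s1.
have [s2 e2] := csum_shift (swap_bij int) h1; have [s3 e3] := csum_shift (swap_bij int) h2.
by split=> //; rewrite -e1 h3 -e2 -e3.
Qed.

(** On the parity classes even-even, even-odd, odd-even, odd-odd the weight is 3, 1, -3, -1. By
    symmetry the two mixed classes may be given the weight -1 each, which leaves minus the full sum
    plus 4 times the even-even part. *)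
Lemma csum_parity2 (f : int * int -> C) : csumm f -> (forall m n : int, f (m, n) = f (n, m)) ->
  csum (fun p => (2 + isg p.2) * isg p.1 * f p) =
  4 * csum (fun p => f (2 * p.1, 2 * p.2)) - csum f.
Proof.
move=> hf fs.
have hG : csumm (fun p => (2 + isg p.2) * isg p.1 * f p).
  apply: csumm_le (summZ 3 hf) => p; rewrite cmodM ler_wpM2r ?cmod_ge0// cmodM cmod_sign mulr1.
  by apply: le_trans (cmodD _ _) _; rewrite cmod_sign cmod_nat; lra.
have [a1 a2 ->] := csum_par1 hG.
have [b1 b2 ->] := csum_par2 a1; have [c1 c2 ->] := csum_par2 a2.
have [d1 d2 ->] := csum_par1 hf.
have [e1 e2 ->] := csum_par2 d1; have [g1 g2 ->] := csum_par2 d2.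
have B1 : csum (fun p => (2 + isg (2 * p.2)) * isg (2 * p.1) * f (2 * p.1, 2 * p.2)) =
    3 * csum (fun p => f (2 * p.1, 2 * p.2)).
  by rewrite -csumZ//; apply: eq_csum => p; rewrite !isgM2; ring.
have B2 : csum (fun p => (2 + isg (2 * p.2 + 1)) * isg (2 * p.1) * f (2 * p.1, 2 * p.2 + 1)) =
    csum (fun p => f (2 * p.1, 2 * p.2 + 1)).
  by apply: eq_csum => p; rewrite isgM2 isgM21; ring.
have B3 : csum (fun p => (2 + isg (2 * p.2)) * isg (2 * p.1 + 1) * f (2 * p.1 + 1, 2 * p.2)) =
    -3 * csum (fun p => f (2 * p.1 + 1, 2 * p.2)).
  by rewrite -csumZ//; apply: eq_csum => p; rewrite isgM2 isgM21; ring.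
have B4 : csum (fun p => (2 + isg (2 * p.2 + 1)) * isg (2 * p.1 + 1) * f (2 * p.1 + 1, 2 * p.2 + 1)) =
    - 1 * csum (fun p => f (2 * p.1 + 1, 2 * p.2 + 1)).
  by rewrite -csumZ//; apply: eq_csum => p; rewrite !isgM21; ring.
have E : csum (fun p => f (2 * p.1 + 1, 2 * p.2)) = csum (fun p => f (2 * p.1, 2 * p.2 + 1)).
  have [_ <-] := csum_shift (swap_bij int) e2; apply: eq_csum => p /=; exact: fs.
rewrite /= B1 B2 B3 B4 E; ring.
Qed.

Definition latw (p : int * int) : R := p.1%:~R ^+ 2 + p.2%:~R ^+ 2.
Definition latf s (p : int * int) : C := if p == (0, 0) then 0 else cpow (latw p) (- s).

Lemma norm_int_ge1 m : m != 0 -> 1 <= `|m%:~R| :> R.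
Proof. by move=> m0; rewrite -intr_norm ler1z; lia. Qed.

Lemma latw_ge p : p != (0, 0) -> (1 + `|p.1%:~R|) * (1 + `|p.2%:~R|) <= 5 * latw p.
Proof.
case: p => m n; rewrite /latw xpair_eqE negb_and /= -(real_normK (num_real m%:~R)) -(real_normK (num_real n%:~R)).
have hm := @norm_int_ge1 m; have hn := @norm_int_ge1 n.
have := normr_ge0 (m%:~R : R); have := normr_ge0 (n%:~R : R).
move: (`|m%:~R| : R) (`|n%:~R| : R) hm hn => u v hm hn v0 u0.
have := sqr_ge0 (u - v); have := sqr_ge0 (u - 1); have := sqr_ge0 (v - 1); rewrite !sqrrB !expr1n !mulr1.
by move=> h1 h2 h3 /orP[/hm h4|/hn h4]; nra.
Qed.

Lemma latw_gt0 p : p != (0, 0) -> 0 < latw p.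
Proof.
move=> /latw_ge h; rewrite -(pmulr_rgt0 _ (ltr0n R 5 : 0 < 5)); apply: lt_le_trans h.
by rewrite mulr_gt0// ltr_pwDl.
Qed.

Lemma latf_summ s : 1 < Re s -> csumm (latf s).
Proof.
move=> h; have s1 := summ_int_powR h.
apply: csumm_le (summZ (5 `^ Re s) (summ_mul s1 s1)) => p; rewrite /latf.
case: ifPn => p0; first by rewrite cmod0 !mulr_ge0 ?powR_ge0.
have w0 := latw_gt0 p0; rewrite cmod_cpow// cReN.
have u0 : 0 < 1 + `|p.1%:~R| :> R by rewrite ltr_pwDl.
have v0 : 0 < 1 + `|p.2%:~R| :> R by rewrite ltr_pwDl.
have h5 : 0 <= (5^-1 : R) by rewrite invr_ge0.
have -> : 5 `^ Re s = (5^-1) `^ (- Re s) :> R.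
  by rewrite -(powR_inv1 (ltW (ltr0n R 5))) -powRrM mulrNN mul1r.
rewrite -(powRM _ (ltW u0) (ltW v0)) -(powRM _ h5 (mulr_ge0 (ltW u0) (ltW v0))); apply: ler_powR_decr.
- by rewrite mulr_gt0 ?invr_gt0// mulr_gt0.
- by rewrite ler_pdivrMl// latw_ge.
- by lra.
Qed.

Lemma latf2 s p : latf s (2 * p.1, 2 * p.2) = cpow 4 (- s) * latf s p.
Proof.
case: p => m n; rewrite /latf !xpair_eqE !mulf_eq0 /=.
case: ifPn => [_|p0]; first by rewrite mulr0.
have w0 : 0 < latw (m, n) by apply: latw_gt0; rewrite xpair_eqE.
by rewrite -cpowMl//; congr cpow; rewrite /latw /= !intrM; ring.
Qed.

Lemma four_pow_neq1 s : 1 < Re s -> 1 - cpow (4 : R) (1 - s) != 0.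
Proof.
move=> h; rewrite subr_eq0 eq_sym; apply/eqP => e.
have := cmod_cpow (1 - s) (ltr0n R 4 : 0 < 4); rewrite e cmod1 => /eqP.
rewrite eq_sym powR_eq1 !cReIm /= => /or3P[/eqP|h2|/eqP]; lra.
Qed.

(** By [csum_parity2] and homogeneity the signed sum is [4^(1 - s) - 1] times the lattice sum. Its
    row [n = 0] is [- 6 eta N (2 s)]; the other rows pair up under [n -> - n] and go through [N]
    Euler steps. *)
Lemma torus_sum N s : 1 < Re s -> torus N s = csum (latf s).
Proof.
move=> h; have sf := latf_summ h.
have h2 : 1 < Re (2 * s) by rewrite !cReIm /=; lra.
have := @csum_parity2 (latf s) sf.
rewrite (eq_csum (fun p => latf2 s p)) (csumZ _ sf) => /(_ _)/wrap[].
  move=> m n; rewrite /latf !xpair_eqE andbC; congr (if _ then _ else cpow _ _).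
  by rewrite /latw/= addrC.
have hG : csumm (fun p => (2 + isg p.2) * isg p.1 * latf s p).
  apply: csumm_le (summZ 3 sf) => p; rewrite cmodM ler_wpM2r ?cmod_ge0// cmodM cmod_sign mulr1.
  by apply: le_trans (cmodD _ _) _; rewrite cmod_sign cmod_nat; lra.
have [hG' eG] := csum_shift (swap_bij int) hG.
rewrite -eG (csum_pair hG') csum_int_even; last 2 first.
- exact: csumm_csum_pair hG'.
- move=> n; apply: eq_csum => m /=; rewrite isgN; congr (_ * _).
  by rewrite /latf !xpair_eqE oppr_eq0 /latw /= rmorphN/= sqrrN.
rewrite /=.
have -> : csum (fun m => (2 + isg 0) * isg m * latf s (m, 0)) = - (6 * eta N (2 * s)).
  rewrite csum_int_even; last 2 first.
  - exact: csumm_pair hG'.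
  - by move=> m; rewrite isgN /latf !xpair_eqE oppr_eq0 /latw /= rmorphN/= sqrrN.
  rewrite {1}/latf eqxx mulr0 add0r eta0E// /eta big_ord0 add0r expr0 mul1r.
  have sE : csumm (fun n : nat => (-1) ^+ n * Pw (2 * s) n.+1%:R).
    by apply: csumm_le (zetaS_summ h2) => n; rewrite cmodM cmod_sign mul1r.
  rewrite (eq_csum (G := fun n : nat => -3 * ((-1) ^+ n * Pw (2 * s) n.+1%:R))); last first.
    move=> n; have n0 : 0 < n.+1%:R :> R by [].
    rewrite /latf xpair_eqE /= /isg /= expr0 exprS mulN1r /latw /= expr0n /= addr0.
    rewrite expr2 cpowMl// /Pw (_ : - (2 * s) = - s + - s); last by ring.
    by rewrite cpowD; ring.
  by rewrite csumZ// -[X in _ = - (6 * X)]/(csum (fun n : nat => (-1) ^+ n * Pw (2 * s) n.+1%:R)); ring.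
have -> : csum (fun n : nat => csum (fun m => (2 + isg n.+1) * isg m * latf s (m, Posz n.+1))) =
    mh R ^+ N * trem N s.
  have sT : csumm (tterm N s) by apply: tterm_summ; have : (0 <= N%:R :> R) by []; lra.
  have sP := csumm_csum_pair sT.
  rewrite /trem (csum_pair sT) -csumZ//; apply: eq_csum => n.
  have n2 : 2 + (-1) ^+ n.+1 != 0 :> C.
    rewrite -signr_odd; case: (odd _); rewrite ?expr1 ?expr0.
      by rewrite (_ : 2 - 1 = 1) ?oner_eq0//; ring.
    by rewrite natr1 pnatr_eq0.
  have E m : (2 + isg n.+1) * isg m * latf s (m, Posz n.+1) = (2 + (-1) ^+ n.+1) * (isg m * tphi n.+1 s m%:~R).
    by rewrite -mulrA; congr (_ * (_ * _)); rewrite /latf xpair_eqE andbF.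
  have sR : csumm (fun m : int => isg m * tphi n.+1 s m%:~R).
    have := csummZ (2 + (-1) ^+ n.+1)^-1 (csumm_pair (Posz n.+1) hG'); congr csumm.
    by apply/funext => m; rewrite /= E mulKf.
  have [s1 e1] := euler_intN N sR.
  rewrite (eq_csum E) (csumZ _ sR) e1 mulrCA -(csumZ _ s1); congr (_ * _).
  by apply: eq_csum => m; rewrite /tterm /tsgn mulrA.
move=> e; rewrite /torus; apply: (canLR (mulfK (four_pow_neq1 h))).
rewrite cpowD cpow1//.
have -> : (4 : R)%:C = 4 :> C by rewrite (rmorph_nat (@real_complex R) 4).
move: e; set S := csum _; set a := 6 * _; set b := _ * trem _ _; set d := cpow _ _ => e.
have -> : a - 2 * b = - (- a + 2 * b) by ring.
by rewrite e; ring.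
Qed.

End TorusSum.

(** * The Heisenberg Laplacian in coordinates *)

Section Coordinates.
Variable R : realType.
Implicit Types (f g : 'rV[R]_3 -> R) (x y z t : R) (p q : 'rV[R]_3).

Definition pt3 x y z : 'rV[R]_3 := \row_j [:: x; y; z]`_j.

Lemma pt3E x y z : (pt3 x y z 0 0 = x) * (pt3 x y z 0 1 = y) * (pt3 x y z 0 2 = z).
Proof. by rewrite !mxE. Qed.

Lemma pt3_eta p : p = pt3 (p 0 0) (p 0 1) (p 0 2).
Proof.
apply/rowP => j; rewrite mxE.
case: j => [[|[|[|j]]] jlt]//=; congr (p 0 _); exact: val_inj.
Qed.

Lemma is_derive_path (c : R -> 'rV[R]_3) v f x d : (forall h, c (h + x) = h *: v + c x) ->
  is_derive (c x) v f d <-> is_derive x 1 (fun t => f (c t)) d.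
Proof.
move=> hc.
have E : (fun h => h^-1 *: ((f \o shift (c x)) (h *: v) - f (c x))) =
   (fun h => h^-1 *: (((fun t => f (c t)) \o shift x) (h *: 1) - f (c x))).
  by apply/funext => h /=; rewrite [h%:A]mulr1 hc.
by split=> -[h1 h2]; split; move: h1 h2; rewrite /derivable /derive E.
Qed.

Lemma pt3_shift x y z h : (pt3 (h + x) y z = h *: delta_mx 0 0 + pt3 x y z) *
  (pt3 x (h + y) z = h *: delta_mx 0 1 + pt3 x y z) * (pt3 x y (h + z) = h *: delta_mx 0 2 + pt3 x y z).
Proof.
split; [split|]; apply/rowP => j; rewrite !mxE; case: j => [[|[|[|j]]] jlt]//=;
  by rewrite ?mulr1 ?mulr0 ?add0r.
Qed.

Lemma is_derive_x f x y z d :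
  is_derive (pt3 x y z) (delta_mx 0 0) f d <-> is_derive x 1 (fun t => f (pt3 t y z)) d.
Proof. by apply: (@is_derive_path (fun t => pt3 t y z)) => h; rewrite pt3_shift. Qed.

Lemma is_derive_y f x y z d :
  is_derive (pt3 x y z) (delta_mx 0 1) f d <-> is_derive y 1 (fun t => f (pt3 x t z)) d.
Proof. by apply: (@is_derive_path (fun t => pt3 x t z)) => h; rewrite pt3_shift. Qed.

Lemma is_derive_z f x y z d :
  is_derive (pt3 x y z) (delta_mx 0 2) f d <-> is_derive z 1 (fun t => f (pt3 x y t)) d.
Proof. by apply: (@is_derive_path (fun t => pt3 x y t)) => h; rewrite pt3_shift. Qed.

Lemma continuous_pt3 (T : topologicalType) (u v w : T -> R) : continuous u -> continuous v ->
  continuous w -> continuous (fun t : T => pt3 (u t) (v t) (w t)).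
Proof.
move=> cu cv cw t; apply/cvg_ballP => e e0.
have /cvg_ballP/(_ e e0) h1 := cu t; have /cvg_ballP/(_ e e0) h2 := cv t.
have /cvg_ballP/(_ e e0) h3 := cw t.
near=> s; have b1 : ball (u t) e (u s) by near: s. have b2 : ball (v t) e (v s) by near: s.
have b3 : ball (w t) e (w s) by near: s.
by split=> // i j; rewrite !mxE; case: j => [[|[|[|j]]] jlt].
Unshelve. all: by end_near. Qed.

Lemma coord_cont (j : 'I_3) : continuous (fun p : 'rV[R]_3 => p 0 j).
Proof. by move=> p; exact: coord_continuous. Qed.

Lemma partialE i f p d : is_derive p (delta_mx 0 i) f d -> partial i f p = d.
Proof. by case. Qed.

Lemma smooth_partial f i : smooth f -> smooth (partial i f).
Proof.
move=> h s p; have -> : foldr (@partial R 2) (partial i f) s = foldr (@partial R 2) f (rcons s i).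
  by rewrite foldr_rcons.
exact: h.
Qed.

Lemma smooth_cont f : smooth f -> continuous f.
Proof. by move=> h p; have [] := h [::] p. Qed.

Lemma smooth_derive f i p : smooth f -> is_derive p (delta_mx 0 i) f (partial i f p).
Proof. by move=> h; apply: DeriveDef => //; have [_] := h [::] p; apply. Qed.

Lemma smooth_dx f x y z : smooth f -> is_derive x 1 (fun t => f (pt3 t y z)) (partial 0 f (pt3 x y z)).
Proof. by move=> h; apply/is_derive_x; exact: smooth_derive. Qed.

Lemma smooth_dy f x y z : smooth f -> is_derive y 1 (fun t => f (pt3 x t z)) (partial 1 f (pt3 x y z)).
Proof. by move=> h; apply/is_derive_y; exact: smooth_derive. Qed.

Lemma smooth_dz f x y z : smooth f -> is_derive z 1 (fun t => f (pt3 x y t)) (partial 2 f (pt3 x y z)).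
Proof. by move=> h; apply/is_derive_z; exact: smooth_derive. Qed.

(** Smoothness constrains all iterated partials; a class stable under [partial] is the invariant of
    the induction over the list of indices. *)
Lemma smooth_class (K : set ('rV[R]_3 -> R)) :
  (forall f, K f -> continuous f /\ forall i, K (partial i f) /\ forall p, derivable f p (delta_mx 0 i)) ->
  forall f, K f -> smooth f.
Proof.
move=> hK f Kf s p; have : K (foldr (@partial R 2) f s).
  by elim: s => [//|i s IH] /=; have [_ /(_ i)[]] := hK _ IH.
by move=> /hK[cf df]; split=> [|i]; [exact: cf|have [_] := df i; apply].
Qed.

Lemma ord3_ind (P : 'I_3 -> Prop) : P 0 -> P 1 -> P 2 -> forall i, P i.
Proof.
move=> h0 h1 h2 [[|[|[|i]]] ilt]//.
- by rewrite (_ : Ordinal ilt = 0)//; exact: val_inj.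
- by rewrite (_ : Ordinal ilt = 1)//; exact: val_inj.
- by rewrite (_ : Ordinal ilt = 2)//; exact: val_inj.
Qed.

Lemma sum3 (V : nmodType) (F : 'I_3 -> V) : \sum_i F i = F 0 + F 1 + F 2.
Proof.
rewrite !big_ord_recl big_ord0 addr0 addrA; congr (_ + F _ + F _); exact: val_inj.
Qed.

(** The rows are the left invariant fields [d/dx], [d/dy + x d/dz], [d/dz]. *)
Definition frame_mx x : 'M[R]_3 := mx3 [:: [:: 1; 0; 0]; [:: 0; 1; x]; [:: 0; 0; 1]].

Lemma heis_frameE p : heis_frame p = frame_mx (p 0 0).
Proof.
apply/matrixP; apply: ord3_ind => //; apply: ord3_ind;
  by rewrite !mxE /= ?mxE ?sum3 ?mxE /=; ring.
Qed.

Definition coframe_mx x : 'M[R]_3 := frame_mx (- x).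

Lemma frame_mxK x : frame_mx x *m coframe_mx x = 1%:M.
Proof.
apply/matrixP; apply: ord3_ind => //; apply: ord3_ind;
  by rewrite !mxE !sum3 !mxE /=; ring.
Qed.

Lemma invmx_frame x : invmx (frame_mx x) = coframe_mx x.
Proof.
have h := frame_mxK x; have /mulmx1_unit[u _] := h.
by rewrite -[RHS](mulKmx u) h mulmx1.
Qed.

Lemma heis_metricE p : heis_metric p = coframe_mx (p 0 0) *m (coframe_mx (p 0 0))^T.
Proof. by rewrite /heis_metric heis_frameE invmx_frame. Qed.

Lemma coframe_mxK x : coframe_mx x *m frame_mx x = 1%:M.
Proof. by have /mulmx1C := frame_mxK x. Qed.

Lemma invmx_metric p : invmx (heis_metric p) = (frame_mx (p 0 0))^T *m frame_mx (p 0 0).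
Proof.
rewrite heis_metricE; set A := coframe_mx _; set F := frame_mx _.
have h : (A *m A^T) *m (F^T *m F) = 1%:M.
  rewrite mulmxA -(mulmxA A) -trmx_mul (_ : F *m A = 1%:M); last exact: frame_mxK.
  by rewrite trmx1 mulmx1 coframe_mxK.
have /mulmx1_unit[u _] := h.
by rewrite -[RHS](mulKmx u) h mulmx1.
Qed.

Lemma det_frame x : \det (frame_mx x) = 1.
Proof.
have E : is_trig_mx (frame_mx x)^T.
  apply/is_trig_mxP; apply: ord3_ind => //; apply: ord3_ind => //; by rewrite !mxE.
rewrite -det_tr (det_trig E) (big_ord_recl 2) !big_ord_recl big_ord0 !mxE /=; ring.
Qed.

Lemma det_metric p : \det (heis_metric p) = 1.
Proof. by rewrite heis_metricE det_mulmx det_tr det_frame mulr1. Qed.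

(** Minus the sum of the squares of the three frame fields: the volume density is 1 and the
    coefficients depend on [x] only, so they commute with the outer [d/dy] and [d/dz]. The mixed
    partials appear in both orders, as the squares produce them. *)
Lemma laplacianE f x y z : smooth f -> laplacian (@heis_metric R) f (pt3 x y z) =
  - (partial 0 (partial 0 f) (pt3 x y z) + partial 1 (partial 1 f) (pt3 x y z) +
     x * partial 1 (partial 2 f) (pt3 x y z) + x * partial 2 (partial 1 f) (pt3 x y z) +
     (1 + x ^+ 2) * partial 2 (partial 2 f) (pt3 x y z)).
Proof.
move=> sf; rewrite /laplacian det_metric sqrtr1 invr1 mulN1r; congr (- _).
have E i : (fun q => Num.sqrt (\det (heis_metric q)) * (\sum_j invmx (heis_metric q) i j * partial j f q)) =
    fun q => ((frame_mx (q 0 0))^T *m frame_mx (q 0 0)) i 0 * partial 0 f q +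
      ((frame_mx (q 0 0))^T *m frame_mx (q 0 0)) i 1 * partial 1 f q +
      ((frame_mx (q 0 0))^T *m frame_mx (q 0 0)) i 2 * partial 2 f q.
  by apply/funext => q; rewrite det_metric sqrtr1 mul1r sum3 invmx_metric.
rewrite sum3 !E.
have s1 := smooth_partial 1 sf; have s2 := smooth_partial 2 sf.
have -> : (fun q => ((frame_mx (q 0 0))^T *m frame_mx (q 0 0)) 0 0 * partial 0 f q +
      ((frame_mx (q 0 0))^T *m frame_mx (q 0 0)) 0 1 * partial 1 f q +
      ((frame_mx (q 0 0))^T *m frame_mx (q 0 0)) 0 2 * partial 2 f q) = partial 0 f.
  by apply/funext => q; rewrite !mxE !sum3 !mxE /=; ring.
have -> : partial 1 (fun q => ((frame_mx (q 0 0))^T *m frame_mx (q 0 0)) 1 0 * partial 0 f q +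
      ((frame_mx (q 0 0))^T *m frame_mx (q 0 0)) 1 1 * partial 1 f q +
      ((frame_mx (q 0 0))^T *m frame_mx (q 0 0)) 1 2 * partial 2 f q) (pt3 x y z) =
    partial 1 (partial 1 f) (pt3 x y z) + x * partial 1 (partial 2 f) (pt3 x y z).
  apply: partialE; apply/is_derive_y.
  apply: is_derive_ext (drvD (smooth_dy x y z s1) (drvZ x (smooth_dy x y z s2))) => t.
  by rewrite !mxE !sum3 !mxE /=; ring.
have -> : partial 2 (fun q => ((frame_mx (q 0 0))^T *m frame_mx (q 0 0)) 2 0 * partial 0 f q +
      ((frame_mx (q 0 0))^T *m frame_mx (q 0 0)) 2 1 * partial 1 f q +
      ((frame_mx (q 0 0))^T *m frame_mx (q 0 0)) 2 2 * partial 2 f q) (pt3 x y z) =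
    x * partial 2 (partial 1 f) (pt3 x y z) + (1 + x ^+ 2) * partial 2 (partial 2 f) (pt3 x y z).
  apply: partialE; apply/is_derive_z.
  apply: is_derive_ext (drvD (drvZ x (smooth_dz x y z s1)) (drvZ (1 + x ^+ 2) (smooth_dz x y z s2))) => t.
  by rewrite !mxE !sum3 !mxE /=; ring.
by rewrite !addrA.
Qed.

Lemma lattice_act (l : nat) f :
  (forall A p q, heis_lattice l A -> heis_pt q = A *m heis_pt p -> f q = f p) <->
  (forall (m n k : int) x y z, f (pt3 (m%:~R + x) (n%:~R + y) (k%:~R / (2 * l%:R) + (z + m%:~R * y))) =
     f (pt3 x y z)).
Proof.
have E (a b c x y z : R) : heis a b c *m heis x y z = heis (a + x) (b + y) (c + (z + a * y)).
  apply/matrixP; apply: ord3_ind => //; apply: ord3_ind;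
    by rewrite !mxE !sum3 !mxE /=; ring.
split=> [h m n k x y z|h A p q [m [n [k ->]]]].
  apply: (h (heis m%:~R n%:~R (k%:~R / (2 * l%:R)))); first by exists m, n, k.
  by rewrite /heis_pt !pt3E E.
rewrite /heis_pt E => /matrixP e.
have := e 0 1; have := e 1 2; have := e 0 2; rewrite !mxE /= => e1 e2 e3.
by rewrite (pt3_eta q) e1 e2 e3 h -pt3_eta.
Qed.

End Coordinates.

(** * Fourier analysis of eigenfunctions *)

Section DoubleFourier.
Variable R : realType.
Implicit Types (G H : R * R -> R) (s t p : R) (m n k : int) (q : R * R).

Lemma cont_fst (S T : topologicalType) : continuous (@fst S T).
Proof. by move=> x; exact: cvg_fst. Qed.

Lemma cont_snd (S T : topologicalType) : continuous (@snd S T).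
Proof. by move=> x; exact: cvg_snd. Qed.

Lemma continuous_comp' (S T U : topologicalType) (g : T -> U) (f : S -> T) :
  continuous f -> continuous g -> continuous (fun x => g (f x)).
Proof. by move=> cf cg x; apply: (@continuous_comp _ _ _ f g); [exact: cf|exact: cg]. Qed.

Lemma continuous_pair (S T U : topologicalType) (f : S -> T) (g : S -> U) :
  continuous f -> continuous g -> continuous (fun x => (f x, g x)).
Proof. by move=> cf cg x; apply: cvg_pair; [exact: cf|exact: cg]. Qed.

Definition integ2 G : R := integ (fun s => integ (fun t => G (s, t)) 0 1) 0 1.

Lemma cont_integ2 G : continuous G -> continuous (fun s => integ (fun t => G (s, t)) 0 1).
Proof. by move=> cG; exact: continuous_integ. Qed.

Lemma eq_integ2 G H : G =1 H -> integ2 G = integ2 H.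
Proof. by move=> /funext ->. Qed.

Lemma integ2D G H : continuous G -> continuous H -> integ2 (fun q => G q + H q) = integ2 G + integ2 H.
Proof.
move=> cG cH; rewrite /integ2 -integD; [|exact: cont_integ2|exact: cont_integ2].
by apply: eq_integ => s; rewrite integD//; exact: continuous_slice.
Qed.

Lemma integ2Z c G : continuous G -> integ2 (fun q => c * G q) = c * integ2 G.
Proof.
move=> cG; rewrite /integ2 -integZ; last exact: cont_integ2.
by apply: eq_integ => s; rewrite integZ//; exact: continuous_slice.
Qed.

Lemma integ2_norm G M : continuous G -> (forall s t, 0 <= s <= 1 -> 0 <= t <= 1 -> `|G (s, t)| <= M) ->
  `|integ2 G| <= M.
Proof.
move=> cG hM; have := @integ_norm R (fun s => integ (fun t => G (s, t)) 0 1) 0 1 M ler01.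
rewrite subr0 mulr1; apply; first exact: cont_integ2.
move=> s hs; have := @integ_norm R (fun t => G (s, t)) 0 1 M ler01.
rewrite subr0 mulr1; apply; first exact: continuous_slice.
by move=> t ht; exact: hM.
Qed.

(** The free phase makes one real family stable under differentiation: a derivative replaces [p] by
    [p - pi / 2], and two of them change the sign. *)
Definition wave m n p q : R := cos (2 * pi * (m%:~R * q.1 + n%:~R * q.2) + p).

Lemma wave_cont m n p : continuous (wave m n p).
Proof.
apply: cont_comp; first exact: continuous_cos.
apply: contD; last exact: cont_cst.
by apply: contZ; apply: contD; apply: contZ; [exact: cont_fst|exact: cont_snd].
Qed.

Lemma wave_pi m n p q : wave m n (p - pi / 2 - pi / 2) q = - wave m n p q.
Proof.
rewrite /wave -[RHS]cosDpi -[in RHS](cos_int (-1)); congr cos.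
by rewrite mulrN1z; field.
Qed.

Lemma wave_shift1 m n p s t : wave m n p (s + 1, t) = wave m n p (s, t).
Proof. by rewrite /wave/= -[RHS](cos_int m); congr cos; ring. Qed.

Lemma wave_shift2 m n p s t : wave m n p (s, t + 1) = wave m n p (s, t).
Proof. by rewrite /wave/= -[RHS](cos_int n); congr cos; ring. Qed.

Lemma cosBpihalf (x : R) : cos (x - pi / 2) = sin x.
Proof. by rewrite cosB cos_pihalf sin_pihalf mulr0 add0r mulr1. Qed.

Lemma drv_cos_lin (a b x : R) : is_derive x 1 (fun t => cos (a * t + b)) (- a * cos (a * x + (b - pi / 2))).
Proof.
have := @drv_comp R cos (fun t => a * t + b) x _ _ (is_derive_cos _) (drvD (drvZ a (drv_id x)) (drv_cst x b)).
by move=> h; apply: drv_eq h _; rewrite addrA cosBpihalf; ring.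
Qed.

Lemma wave_d1 m n p s t : is_derive s 1 (fun s => wave m n p (s, t)) (- (2 * pi * m%:~R) * wave m n (p - pi / 2) (s, t)).
Proof.
have := drv_cos_lin (2 * pi * m%:~R) (2 * pi * n%:~R * t + p) s.
rewrite (_ : (fun s => _) = fun s => wave m n p (s, t)); last by apply/funext => x; rewrite /wave/=; congr cos; ring.
by move=> h; apply: drv_eq h _; rewrite /wave/=; congr (_ * cos _); ring.
Qed.

Lemma wave_d2 m n p s t : is_derive t 1 (fun t => wave m n p (s, t)) (- (2 * pi * n%:~R) * wave m n (p - pi / 2) (s, t)).
Proof.
have := drv_cos_lin (2 * pi * n%:~R) (2 * pi * m%:~R * s + p) t.
rewrite (_ : (fun t => _) = fun t => wave m n p (s, t)); last by apply/funext => x; rewrite /wave/=; congr cos; ring.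
by move=> h; apply: drv_eq h _; rewrite /wave/=; congr (_ * cos _); ring.
Qed.

Definition coef m n p G : R := integ2 (fun q => G q * wave m n p q).

Lemma coef_cont m n p G : continuous G -> continuous (fun q => G q * wave m n p q).
Proof. by move=> cG; apply: contM => //; exact: wave_cont. Qed.

Lemma eq_coef m n p G H : G =1 H -> coef m n p G = coef m n p H.
Proof. by move=> /funext ->. Qed.

Lemma wcoefD m n p G H : continuous G -> continuous H ->
  coef m n p (fun q => G q + H q) = coef m n p G + coef m n p H.
Proof.
move=> cG cH; rewrite /coef -integ2D; [|exact: coef_cont|exact: coef_cont].
by apply: eq_integ2 => q; rewrite mulrDl.
Qed.

Lemma wcoefZ m n p c G : continuous G -> coef m n p (fun q => c * G q) = c * coef m n p G.
Proof.
move=> cG; rewrite /coef -integ2Z; last exact: coef_cont.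
by apply: eq_integ2 => q; rewrite mulrA.
Qed.

Lemma coef_pi m n p G : continuous G -> coef m n (p - pi / 2 - pi / 2) G = - coef m n p G.
Proof.
move=> cG; rewrite -[RHS]mulN1r /coef -integ2Z; last exact: coef_cont.
by apply: eq_integ2 => q; rewrite wave_pi; ring.
Qed.

(** Integration by parts; periodicity cancels the boundary terms. *)
Lemma coef_parts1 m n p G G1 : continuous G -> continuous G1 ->
  (forall s t, is_derive s 1 (fun s => G (s, t)) (G1 (s, t))) ->
  (forall s t, G (s + 1, t) = G (s, t)) ->
  coef m n p G1 = 2 * pi * m%:~R * coef m n (p - pi / 2) G.
Proof.
move=> cG cG1 hd hp; pose c := 2 * pi * m%:~R : R.
pose H s := integ (fun t => G (s, t) * wave m n p (s, t)) 0 1.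
pose D q := G1 q * wave m n p q + (- c) * (G q * wave m n (p - pi / 2) q).
have cD : continuous D by apply: contD; [exact: coef_cont|apply: contZ; exact: coef_cont].
have hH s : is_derive s 1 H (integ (fun t => D (s, t)) 0 1).
  apply: (@is_derive_integ _ (fun q => G q * wave m n p q) D) => //; last exact: coef_cont.
  move=> x t; apply: drv_eq (drvM (hd x t) (wave_d1 m n p x t)) _.
  by rewrite /D /c; ring.
have : integ2 D = 0.
  rewrite /integ2 (integ_eq _ _ hH) -[1]add0r /H.
  rewrite (@eq_integ _ (fun t => G (0 + 1, t) * wave m n p (0 + 1, t)) (fun t => G (0, t) * wave m n p (0, t))) ?subrr//.
  by move=> t; rewrite hp wave_shift1.
rewrite /D integ2D ?integ2Z; [|exact: coef_cont|exact: coef_cont|by apply: contZ; exact: coef_cont].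
by rewrite -/(coef m n p G1) -/(coef m n (p - pi / 2) G) mulNr => /subr0_eq.
Qed.

Lemma coef_parts2 m n p G G1 : continuous G -> continuous G1 ->
  (forall s t, is_derive t 1 (fun t => G (s, t)) (G1 (s, t))) ->
  (forall s t, G (s, t + 1) = G (s, t)) ->
  coef m n p G1 = 2 * pi * n%:~R * coef m n (p - pi / 2) G.
Proof.
move=> cG cG1 hd hp; pose c := 2 * pi * n%:~R : R.
pose D q := G1 q * wave m n p q + (- c) * (G q * wave m n (p - pi / 2) q).
have cD : continuous D by apply: contD; [exact: coef_cont|apply: contZ; exact: coef_cont].
have : integ2 D = 0.
  rewrite /integ2 (@eq_integ _ _ (fun _ => 0)).
    by rewrite (integ_eq 0 1 (fun x => drv_cst x 0)) subrr.
  move=> s; have hH t : is_derive t 1 (fun t => G (s, t) * wave m n p (s, t)) (D (s, t)).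
    apply: drv_eq (drvM (hd s t) (wave_d2 m n p s t)) _.
    by rewrite /D /c; ring.
  by rewrite (integ_eq 0 1 hH) -[1]add0r hp wave_shift2 subrr.
rewrite /D integ2D ?integ2Z; [|exact: coef_cont|exact: coef_cont|by apply: contZ; exact: coef_cont].
by rewrite -/(coef m n p G1) -/(coef m n (p - pi / 2) G) mulNr => /subr0_eq.
Qed.

(** A cosine of any phase is a combination of the waves of phase [- pi / 4] at [(m, n)] and
    [(- m, - n)], which are multiples of [cos + sin] and [cos - sin]. *)
Lemma coef_all G : continuous G -> (forall m n, coef m n (- (pi / 4)) G = 0) ->
  forall m n p, coef m n p G = 0.
Proof.
move=> cG h m n p.
pose c := cos (pi / 4) : R.
have sc : sin (pi / 4) = c.
  by rewrite -cosBpihalf -cosN; congr cos; field.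
have c2 : 2 * (c * c) = 1.
  by have := cos2Dsin2 (pi / 4 : R); rewrite sc !expr2 -/c; lra.
have W q : wave m n p q = ((cos p - sin p) * c) * wave m n (- (pi / 4)) q +
    ((cos p + sin p) * c) * wave (- m) (- n) (- (pi / 4)) q.
  rewrite /wave !mulrNz; set x := 2 * pi * (m%:~R * q.1 + n%:~R * q.2).
  have -> : 2 * pi * (- m%:~R * q.1 + - n%:~R * q.2) = - x by rewrite /x; ring.
  rewrite !cosD (cosN (pi / 4)) (sinN (pi / 4)) sc cosN sinN -/c.
  rewrite [RHS](_ : _ = 2 * (c * c) * (cos x * cos p - sin x * sin p)); last by ring.
  by rewrite c2 mul1r.
rewrite /coef (eq_integ2 (H := fun q => ((cos p - sin p) * c) * (G q * wave m n (- (pi / 4)) q) +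
   ((cos p + sin p) * c) * (G q * wave (- m) (- n) (- (pi / 4)) q))); last first.
  by move=> q; rewrite W; ring.
rewrite integ2D ?integ2Z; try by [exact: coef_cont|apply: contZ; exact: coef_cont].
by rewrite -!/(coef _ _ _ G) !h !mulr0 addr0.
Qed.

(** One-dimensional uniqueness is used in [t] and then in [s]; a product of two cosines is a half
    sum of two waves. *)
Lemma fourier2 G : continuous G -> (forall s t, G (s + 1, t) = G (s, t)) ->
  (forall s t, G (s, t + 1) = G (s, t)) ->
  (forall m n, coef m n (- (pi / 4)) G = 0) -> forall q, G q = 0.
Proof.
move=> cG p1 p2 /(coef_all cG) h [s t].
have c1 s' : continuous (fun t => G (s', t)) by exact: continuous_slice.
apply: (@fourier_unique _ (fun t => G (s, t))) => // n p.
pose K q := G q * cos (2 * pi * n%:~R * q.2 + p).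
have cK : continuous K.
  apply: contM => //; apply: cont_comp; first exact: continuous_cos.
  by apply: contD; [apply: contZ; exact: cont_snd|exact: cont_cst].
apply: (@fourier_unique _ (fun s => integ (fun t => K (s, t)) 0 1)); first exact: cont_integ2.
  by move=> s'; apply: eq_integ => t'; rewrite /K/= p1.
move=> m p'.
rewrite -[LHS]/(integ _ 0 1) (@eq_integ _ _ (fun s => integ (fun t => K (s, t) * cos (2 * pi * m%:~R * s + p')) 0 1)); last first.
  move=> s'; rewrite mulrC -integZ; last exact: (@continuous_slice R R K s' cK).
  by apply: eq_integ => t'; rewrite mulrC.
rewrite -[LHS]/(integ2 (fun q => K q * cos (2 * pi * m%:~R * q.1 + p'))).
rewrite (eq_integ2 (H := fun q => 2^-1 * (G q * wave m n (p + p') q) + 2^-1 * (G q * wave m (- n) (p' - p) q))).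
  rewrite integ2D ?integ2Z; try by [exact: coef_cont|apply: contZ; exact: coef_cont].
  by rewrite -!/(coef _ _ _ G) !h !mulr0 addr0.
move=> q; rewrite /K /wave mulrNz.
have -> : 2 * pi * (m%:~R * q.1 + n%:~R * q.2) + (p + p') =
  (2 * pi * m%:~R * q.1 + p') + (2 * pi * n%:~R * q.2 + p) by ring.
have -> : 2 * pi * (m%:~R * q.1 + - n%:~R * q.2) + (p' - p) =
  (2 * pi * m%:~R * q.1 + p') - (2 * pi * n%:~R * q.2 + p) by ring.
move: (2 * pi * m%:~R * q.1 + p') (2 * pi * n%:~R * q.2 + p) => A B.
by rewrite (cosD A B) cosB; field.
Qed.

(* The phase [- pi / 4] makes [wave] a multiple of [cos + sin], so that these
   real waves are orthogonal, the frequencies [(m, n)] and [(- m, - n)] included. *)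
Lemma wave_ortho m n m' n' : integ2 (fun q => wave m n (- (pi / 4)) q * wave m' n' (- (pi / 4)) q) =
  if (m == m') && (n == n') then 2^-1 else 0.
Proof.
have I0 m0 n0 p : (m0, n0) != (0, 0) -> integ2 (wave m0 n0 p) = 0.
  rewrite xpair_eqE negb_and => h.
  have c1 : continuous (fun _ : R * R => 1 : R) by exact: cont_cst.
  have c0 : continuous (fun _ : R * R => 0 : R) by exact: cont_cst.
  have E : coef m0 n0 (p + pi / 2 - pi / 2) (fun=> 1) = integ2 (wave m0 n0 p).
    by rewrite addrK; apply: eq_integ2 => q; rewrite mul1r.
  have Z0 : coef m0 n0 (p + pi / 2) (fun=> 0) = 0.
    by have := @wcoefZ m0 n0 (p + pi / 2) 0 (fun=> 1) c1; rewrite !mul0r.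
  have pi2 : 2 * pi != 0 :> R by rewrite mulf_neq0// gt_eqF// pi_gt0.
  case/orP: h => h.
    have := @coef_parts1 m0 n0 (p + pi / 2) (fun=> 1) (fun=> 0) c1 c0 (fun s t => drv_cst s 1) (fun _ _ => erefl).
    rewrite Z0 E => /esym/eqP; rewrite mulf_eq0 (negbTE (mulf_neq0 pi2 _)) ?intr_eq0//=.
    by move/eqP.
  have := @coef_parts2 m0 n0 (p + pi / 2) (fun=> 1) (fun=> 0) c1 c0 (fun s t => drv_cst t 1) (fun _ _ => erefl).
  rewrite Z0 E => /esym/eqP; rewrite mulf_eq0 (negbTE (mulf_neq0 pi2 _)) ?intr_eq0//=.
  by move/eqP.
have Ic c : integ2 (fun=> c) = c.
  rewrite /integ2 (@eq_integ _ _ (fun=> c)).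
    by rewrite (integ_eq 0 1 (fun x => drv_eq (drvZ c (drv_id x)) (mulr1 c))) mulr0 mulr1 subr0.
  by move=> s; rewrite (integ_eq 0 1 (fun x => drv_eq (drvZ c (drv_id x)) (mulr1 c))) mulr0 mulr1 subr0.
rewrite (eq_integ2 (H := fun q => 2^-1 * wave (m + m') (n + n') (- (pi / 2)) q + 2^-1 * wave (m - m') (n - n') 0 q)); last first.
  move=> q; rewrite /wave !intrD !mulrNz.
  set x := 2 * pi * (m%:~R * q.1 + n%:~R * q.2) + - (pi / 4).
  set y := 2 * pi * (m'%:~R * q.1 + n'%:~R * q.2) + - (pi / 4).
  have -> : 2 * pi * ((m%:~R + m'%:~R) * q.1 + (n%:~R + n'%:~R) * q.2) + - (pi / 2) = x + y.
    by rewrite /x /y; field.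
  have -> : 2 * pi * ((m%:~R - m'%:~R) * q.1 + (n%:~R - n'%:~R) * q.2) + 0 = x - y.
    by rewrite /x /y; ring.
  by rewrite (cosD x y) (cosB x y); field.
rewrite integ2D ?integ2Z; try by [exact: wave_cont|apply: contZ; exact: wave_cont].
have -> : integ2 (wave (m + m') (n + n') (- (pi / 2))) = 0.
  have [e|/I0->//] := eqVneq (m + m', n + n') (0, 0).
  case: e => -> ->; rewrite (eq_integ2 (H := fun=> 0)) ?Ic// => q.
  by rewrite /wave !mul0r addr0 mulr0 add0r cosN cos_pihalf.
case: ifPn => [/andP[/eqP-> /eqP->]|h].
  rewrite !subrr (eq_integ2 (G := wave 0 0 0) (H := fun=> 1)) ?Ic ?mulr0 ?add0r ?mulr1// => q.
  by rewrite /wave !mul0r !addr0 mulr0 cos0.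
rewrite I0 ?mulr0 ?addr0//; by rewrite xpair_eqE !subr_eq0.
Qed.

End DoubleFourier.

(** * Hermite functions and the oscillator equation *)

Section Oscillator.
Variables (R : realType) (a : R).
Hypothesis a0 : 0 < a.
Implicit Types (u v q : R -> R) (t x mu c e : R) (P : {poly R}).

(** The unnormalised Hermite polynomials of the weight [exp(- a t^2)]: [(- 1)^j exp(a t^2)] times
    the derivative of order [j] of [exp(- a t^2)]. *)
Fixpoint hermite (j : nat) : {poly R} :=
  if j is i.+1 then (2 * a) *: ('X * hermite i) - (hermite i)^`() else 1.

Lemma hermite_deriv j : (hermite j.+1)^`() = (2 * a * j.+1%:R) *: hermite j.
Proof.
elim: j => [|j IH].
  by rewrite /= mulr1 derivC subr0 derivZ derivX mulr1.
have -> : hermite j.+2 = (2 * a) *: ('X * hermite j.+1) - (hermite j.+1)^`() by [].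
rewrite derivB derivZ derivM derivX mul1r IH derivZ [hermite j.+1 in RHS]/=.
have -> : hermite j.+1 = (2 * a) *: ('X * hermite j) - (hermite j)^`() by [].
rewrite -(natr1 j.+1) mulrDr -!mul_polyC !polyCM polyCD; ring.
Qed.

Lemma hermite_ode j : (hermite j)^`()^`() - (2 * a) *: ('X * (hermite j)^`()) = - (2 * a * j%:R) *: hermite j.
Proof.
case: j => [|j]; first by rewrite /= derivC linear0 !mulr0 scaler0 subr0 oppr0 scale0r.
rewrite hermite_deriv derivZ; have -> : hermite j.+1 = (2 * a) *: ('X * hermite j) - (hermite j)^`() by [].
rewrite -!mul_polyC !(polyCM, polyCN); ring.
Qed.

Definition gauss t : R := expR (- (a / 2) * (t * t)).

Lemma gauss_gt0 t : 0 < gauss t. Proof. exact: expR_gt0. Qed.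

Lemma drv_gauss t : is_derive t 1 gauss (- (a * t) * gauss t).
Proof.
have h := drvZ (- (a / 2)) (drvM (drv_id t) (drv_id t)).
apply: drv_eq (@drv_comp R expR _ t _ _ (is_derive_expR _) h) _.
by rewrite /gauss; field.
Qed.

(** Differentiation of [P] times the Gaussian, transported to the polynomial. *)
Definition gstep P : {poly R} := P^`() - a *: ('X * P).

Lemma drv_pgauss P t : is_derive t 1 (fun t => P.[t] * gauss t) ((gstep P).[t] * gauss t).
Proof.
apply: drv_eq (drvM (is_derive_poly P t) (drv_gauss t)) _.
by rewrite /gstep hornerD hornerN hornerZ hornerM hornerX; ring.
Qed.

Definition hermite_fun j t : R := (hermite j).[t] * gauss t.

Lemma gstep2_hermite j : gstep (gstep (hermite j)) = a ^+ 2 *: ('X * ('X * hermite j)) - (a * (2 * j%:R + 1)) *: hermite j.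
Proof.
have := hermite_ode j; rewrite /gstep derivB derivZ derivM derivX mul1r => h.
have -> : (hermite j)^`()^`() = - (2 * a * j%:R) *: hermite j + (2 * a) *: ('X * (hermite j)^`()).
  by rewrite -h subrK.
rewrite -!mul_polyC !(polyCM, polyCN, polyCD, polyC_exp); ring.
Qed.

Lemma hermite_fun_ode j t : is_derive t 1 (hermite_fun j) ((gstep (hermite j)).[t] * gauss t) /\
  is_derive t 1 (fun t => (gstep (hermite j)).[t] * gauss t) ((a ^+ 2 * t ^+ 2 - a * (2 * j%:R + 1)) * hermite_fun j t).
Proof.
split; first exact: drv_pgauss.
apply: drv_eq (drv_pgauss _ t) _; rewrite gstep2_hermite /hermite_fun !hornerE /=; ring.
Qed.

Lemma hermite_fun_lower j t : (gstep (hermite j.+1)).[t] * gauss t + a * t * hermite_fun j.+1 t = 2 * a * j.+1%:R * hermite_fun j t.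
Proof.
have h : (hermite j.+1)^`().[t] = 2 * a * j.+1%:R * (hermite j).[t] by rewrite hermite_deriv hornerZ.
by rewrite /gstep hornerD h /hermite_fun hornerN hornerZ hornerM hornerX; ring.
Qed.

Lemma hermite_fun_neq0 j : exists t, hermite_fun j t != 0.
Proof.
suff [t ht] : exists t, (hermite j).[t] != 0 by exists t; rewrite mulf_neq0// gt_eqF// gauss_gt0.
elim: j => [|j [t ht]]; first by exists 0; rewrite hornerC oner_eq0.
apply: contrapT => h; have h0 x : (hermite j.+1).[x] = 0.
  by apply: contrapT => /eqP hx; apply: h; exists x.
have d0 : is_derive t 1 (fun x => (hermite j.+1).[x]) 0.
  by apply: is_derive_ext (drv_cst t 0) => x; rewrite h0.
have [_ e1] := is_derive_poly (hermite j.+1) t; have [_ e2] := d0.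
move: ht; apply/negP; rewrite negbK.
have : (hermite j.+1)^`().[t] = 0 by rewrite -e1 -e2.
rewrite hermite_deriv hornerZ => /eqP; rewrite !mulf_eq0 !pnatr_eq0 (gt_eqF a0) //.
Qed.

(** The functions to be classified are bounded, but the ladder operator multiplies by [t];
    polynomial growth is preserved by it on solutions of the equation. *)
Definition poly_growth u := exists C K, 0 <= C /\ forall t, `|u t| <= C * (1 + `|t|) ^+ K.

Lemma pow_le (t : R) K L : (K <= L)%N -> (1 + `|t|) ^+ K <= (1 + `|t|) ^+ L.
Proof. by move=> KL; apply: ler_weXn2l => //; rewrite lerDl. Qed.

Lemma poly_growthD u v : poly_growth u -> poly_growth v -> poly_growth (fun t => u t + v t).
Proof.
move=> [C [K [C0 h]]] [D [L [D0 k]]]; exists (C + D), (K + L)%N; split=> [|t]; first exact: addr_ge0.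
apply: le_trans (ler_normD _ _) _; rewrite mulrDl lerD//.
  by apply: le_trans (h t) _; rewrite ler_wpM2l// pow_le// leq_addr.
by apply: le_trans (k t) _; rewrite ler_wpM2l// pow_le// leq_addl.
Qed.

Lemma poly_growthM u v : poly_growth u -> poly_growth v -> poly_growth (fun t => u t * v t).
Proof.
move=> [C [K [C0 h]]] [D [L [D0 k]]]; exists (C * D), (K + L)%N; split=> [|t]; first exact: mulr_ge0.
by rewrite normrM exprD mulrACA ler_pM.
Qed.

Lemma poly_growth_cst c : poly_growth (fun=> c).
Proof. by exists `|c|, 0%N; split=> // t; rewrite expr0 mulr1. Qed.

Lemma poly_growth_id : poly_growth id.
Proof. by exists 1, 1%N; split=> // t; rewrite expr1 mul1r lerDr. Qed.

Lemma poly_growth_opp u : poly_growth u -> poly_growth (fun t => u (- t)).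
Proof. by move=> [C [K [C0 h]]]; exists C, K; split=> // t; rewrite -(normrN t). Qed.

Lemma poly_growth_near u : poly_growth u -> exists C K, 0 <= C /\ forall t d, `|d| <= `|t| + 1 -> `|u d| <= C * (1 + `|t|) ^+ K.
Proof.
move=> [C [K [C0 h]]]; exists (C * 2 ^+ K), K; split=> [|t d dt]; first by rewrite mulr_ge0// exprn_ge0.
apply: le_trans (h d) _; rewrite -mulrA ler_wpM2l// -exprMn lerXn2r ?nnegrE ?mulr_ge0 ?addr_ge0//.
by have := normr_ge0 t; lra.
Qed.

(** The mean value theorem on [[t, t + 1]], used twice, writes [u1 t] as [u (t + 1) - u t] minus a
    nearby value of [w] times a number of [[0, 1]]. *)
Lemma poly_growth_deriv u u1 w : (forall t, is_derive t 1 u (u1 t)) -> (forall t, is_derive t 1 u1 (w t)) ->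
  poly_growth u -> poly_growth w -> poly_growth u1.
Proof.
move=> h1 h2 /poly_growth_near[C [K [C0 hu]]] /poly_growth_near[D [L [D0 hw]]].
exists (C + C + D), (K + L)%N; split=> [|t]; first by rewrite !addr_ge0.
have tt : t <= t + 1 by rewrite lerDl.
have [c /andP[c1 c2] e1] := mvt tt h1; have [d /andP[d1 d2] e2] := mvt c1 h2.
have nb x : t <= x -> x <= t + 1 -> `|x| <= `|t| + 1.
  move=> x1 x2; have := ler_norm t; have := ler_norm (- t); rewrite normrN => t1 t2.
  by rewrite ler_norml; apply/andP; split; lra.
have b1 := hu t (t + 1) (nb _ tt (lexx _)).
have b2 := hu t t (nb _ (lexx _) tt).
have b3 := hw t d (nb _ d1 (le_trans d2 c2)).
have b4 : `|w d * (c - t)| <= D * (1 + `|t|) ^+ L.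
  apply: le_trans b3; rewrite normrM ler_piMr// ger0_norm; lra.
have p1 : C * (1 + `|t|) ^+ K <= C * (1 + `|t|) ^+ (K + L) by rewrite ler_wpM2l// pow_le// leq_addr.
have p2 : D * (1 + `|t|) ^+ L <= D * (1 + `|t|) ^+ (K + L) by rewrite ler_wpM2l// pow_le// leq_addl.
have -> : u1 t = u (t + 1) - u t - w d * (c - t) by rewrite e1 -e2; ring.
apply: le_trans (ler_normB _ _) _; have := ler_normB (u (t + 1)) (u t).
rewrite !mulrDl; lra.
Qed.

(** [q t exp(- e t)] is nondecreasing, so a positive value of [q] would force exponential growth;
    the term of degree [K + 1] of the exponential series already beats the polynomial bound of
    degree [K]. *)
Lemma exp_growth q dq e : 0 < e -> (forall t, is_derive t 1 q (dq t)) -> (forall t, e * q t <= dq t) ->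
  poly_growth q -> forall t, q t <= 0.
Proof.
move=> e0 hd hq [C [K [C0 hC]]] t0; rewrite leNgt; apply/negP => q0.
pose r t := q t * expR (- e * t).
have hr t : is_derive t 1 r ((dq t - e * q t) * expR (- e * t)).
  have := drvM (hd t) (@drv_comp R expR _ t _ _ (is_derive_expR (- e * t)) (drvZ (- e) (drv_id t))).
  by move=> h; apply: drv_eq h _; ring.
have key x : 0 <= x -> q t0 * (1 + x ^+ K.+1 / K.+1`!%:R) <= q (t0 + x / e).
  move=> x0; have tx : t0 <= t0 + x / e by rewrite lerDl divr_ge0// ltW.
  have [c _] := mvt tx hr; rewrite /r => h.
  have : 0 <= (dq c - e * q c) * expR (- e * c) * (t0 + x / e - t0).
    by rewrite mulr_ge0 ?mulr_ge0 ?expR_ge0 ?subr_ge0.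
  rewrite -h subr_ge0 (_ : - e * (t0 + x / e) = - e * t0 + - x); last by field; rewrite gt_eqF.
  rewrite expRD mulrA (mulrAC _ _ (expR (- x))) ler_pM2r ?expR_gt0// expRN.
  rewrite ler_pdivlMr ?expR_gt0//; apply: le_trans.
  by rewrite ler_wpM2l ?(ltW q0)//; exact: expR_ge1Dxn.
pose B := 1 + `|t0| + e^-1.
have ei : 0 < e^-1 by rewrite invr_gt0.
have B0 : 0 < B by rewrite /B; have := normr_ge0 t0; lra.
pose M := C * B ^+ K * K.+1`!%:R / q t0.
have M0 : 0 <= M by rewrite /M !mulr_ge0 ?invr_ge0 ?exprn_ge0// ltW.
pose x := M + 1; have x1 : 1 <= x by rewrite lerDr.
have x0 : 0 < x by exact: lt_le_trans x1.
have := le_trans (key x (ltW x0)) (le_trans (ler_norm _) (hC _)); apply/negP; rewrite -ltNge.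
have xB : 1 + `|t0 + x / e| <= B * x.
  have h1 : `|t0 + x / e| <= `|t0| + x / e.
    by apply: le_trans (ler_normD _ _) _; rewrite (ger0_norm (divr_ge0 (ltW x0) (ltW e0))).
  have h2 : `|t0| <= `|t0| * x by rewrite ler_peMr.
  have -> : B * x = x + (`|t0| * x + x / e) by rewrite /B; ring.
  by apply: lerD x1 (le_trans h1 (lerD h2 (lexx _))).
apply: le_lt_trans (_ : C * (B * x) ^+ K < _).
  apply: ler_wpM2l => //; apply: lerXn2r => //; rewrite nnegrE ?addr_ge0//.
  by rewrite mulr_ge0// ltW.
have f0 : 0 < K.+1`!%:R :> R by rewrite ltr0n fact_gt0.
apply: lt_le_trans (_ : q t0 * (x ^+ K.+1 / K.+1`!%:R) <= _); last by rewrite ler_wpM2l ?(ltW q0)// lerDr.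
rewrite mulrA ltr_pdivlMr// exprMn exprS.
have -> : C * (B ^+ K * x ^+ K) * K.+1`!%:R = (C * B ^+ K * K.+1`!%:R) * x ^+ K by ring.
rewrite mulrA ltr_pM2r ?exprn_gt0// -ltr_pdivrMl// mulrC.
by rewrite -/M ltrDl.
Qed.

(** With [v = u^2] and [e^2 = - 2 mu], [v'' >= e^2 v], so the derivative of [v' + e v] is at least
    [e] times itself and [exp_growth] gives [v' + e v <= 0]. The reflection [t -> - t] gives
    [- v' + e v <= 0], and the sum forces [v <= 0]. *)
Lemma oscillator_eq0_base u u1 mu : (forall t, is_derive t 1 u (u1 t)) ->
  (forall t, is_derive t 1 u1 ((a ^+ 2 * t ^+ 2 - mu) * u t)) -> poly_growth u -> mu < 0 ->
  forall t, u t = 0.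
Proof.
move=> h1 h2 pu mu0.
have pw : poly_growth (fun t => (a ^+ 2 * t ^+ 2 - mu) * u t).
  apply: poly_growthM => //; apply: poly_growthD; last exact: poly_growth_cst.
  by apply: poly_growthM; [exact: poly_growth_cst|apply: poly_growthM; exact: poly_growth_id].
have pu1 := poly_growth_deriv h1 h2 pu pw.
pose e := Num.sqrt (- 2 * mu); have e0 : 0 < e by rewrite sqrtr_gt0; lra.
have e2 : e * e = - 2 * mu by rewrite -expr2 sqr_sqrtr//; lra.
pose v t := u t * u t; pose v1 t := 2 * (u t * u1 t).
have dv1 t : is_derive t 1 v (v1 t) by apply: drv_eq (drvM (h1 t) (h1 t)) _; rewrite /v1; ring.
pose v2 t := 2 * (u1 t * u1 t + u t * ((a ^+ 2 * t ^+ 2 - mu) * u t)).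
have dv2 t : is_derive t 1 v1 (v2 t) by apply: drv_eq (drvZ 2 (drvM (h1 t) (h2 t))) _.
have vv t : - 2 * mu * v t <= v2 t.
  rewrite /v2 /v; have := sqr_ge0 (u1 t); have := sqr_ge0 (a * t * u t).
  by rewrite !expr2; lra.
have pv : poly_growth v by exact: poly_growthM. 
have pv1 : poly_growth v1 by apply: poly_growthM; [exact: poly_growth_cst|exact: poly_growthM].
have A := @exp_growth (fun t => v1 t + e * v t) (fun t => v2 t + e * v1 t) e e0.
have A1 : forall t, v1 t + e * v t <= 0.
  apply: (A (fun t => drvD (dv2 t) (drvZ e (dv1 t)))).
  - by move=> t; have := vv t; rewrite -e2; lra.
  - by apply: poly_growthD => //; apply: poly_growthM => //; exact: poly_growth_cst.
have dN (f : R -> R) t d : is_derive (- t) 1 f d -> is_derive t 1 (fun t => f (- t)) (- d).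
  move=> h; have := @drv_comp R f (fun t => - t) t _ _ h (drvN (drv_id t)).
  by move=> k; apply: drv_eq k _; ring.
have B1 : forall t, - v1 (- t) + e * v (- t) <= 0.
  apply: (@exp_growth (fun t => - v1 (- t) + e * v (- t)) (fun t => v2 (- t) + e * - v1 (- t)) e) => // [t|t|].
  - apply: drv_eq (drvD (drvN (dN _ _ _ (dv2 (- t)))) (drvZ e (dN _ _ _ (dv1 (- t))))) _.
    by rewrite opprK.
  - by have := vv (- t); rewrite -e2; lra.
  - apply: poly_growthD; last by apply: poly_growthM; [exact: poly_growth_cst|exact: poly_growth_opp].
    have := poly_growthM (poly_growth_cst (-1)) (poly_growth_opp pv1); congr poly_growth; apply/funext => t; exact: mulN1r.
move=> t; have := A1 t; have := B1 (- t); rewrite opprK => b1 a1.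
have v0 : 0 <= v t by rewrite /v -expr2 sqr_ge0.
have : v t <= 0 by rewrite -(pmulr_rle0 _ e0); lra.
move=> vt; apply/eqP; rewrite -sqrf_eq0 expr2 -/(v t) eq_le vt//.
Qed.

(* The ladder operator [u' + a t u] lowers [mu] by [2 a]; below [0] the function [u ^ 2]
   is convex and grows exponentially unless it vanishes. *)
Lemma oscillator_eq0 N u u1 mu : (forall t, is_derive t 1 u (u1 t)) ->
  (forall t, is_derive t 1 u1 ((a ^+ 2 * t ^+ 2 - mu) * u t)) -> poly_growth u -> mu < 2 * a * N%:R ->
  (forall t, u t = 0) \/ exists j c, mu = a * (2 * j%:R + 1) /\ forall t, u t = c * hermite_fun j t.
Proof.
elim: N u u1 mu => [|N IH] u u1 mu h1 h2 pu muN.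
  by left; apply: oscillator_eq0_base h1 h2 pu _; rewrite mulr0 in muN.
(* What the lowering operator annihilates is a multiple of the Gaussian, and the equation at [t = 0]
   forces [mu = a] unless the multiple is 0. *)
have kill (v v1 : R -> R) : (forall t, is_derive t 1 v (v1 t)) ->
    (forall t, is_derive t 1 v1 ((a ^+ 2 * t ^+ 2 - mu) * v t)) ->
    (forall t, v1 t + a * t * v t = 0) -> exists c, (forall t, v t = c * gauss t) /\ (mu - a) * c = 0.
  move=> d1 d2 z; exists (v 0).
  have g0 : gauss 0 = 1 by rewrite /gauss !mulr0 expR0.
  have E t : v t = v 0 * gauss t.
    have hG x : is_derive x 1 (fun x => v x / gauss x) 0.
      have gn : gauss x != 0 by rewrite gt_eqF// gauss_gt0.
      apply: drv_eq (drvM (d1 x) (is_deriveV gn (drv_gauss x))) _.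
      have -> : v1 x = - (a * x * v x) by have := z x; lra.
      by rewrite /GRing.scale/=; field.
    have := eq_derive_sub 0 t hG (fun x => drv_cst x 0); rewrite subrr => /subr0_eq.
    by rewrite g0 divr1 => <-; rewrite divfK// gt_eqF// gauss_gt0.
  split=> //; have k : is_derive (0 : R) 1 v1 (- a * v 0).
    apply: (@is_derive_ext _ (fun t => - a * (t * v t))) => [t|]; first by have := z t; lra.
    by apply: drv_eq (drvZ (- a) (drvM (drv_id 0) (d1 0))) _; ring.
  have [_ e1] := k; have [_ e2] := d2 0.
  by move: e2; rewrite e1 expr0n /= mulr0 sub0r => e2; lra.
pose w t := u1 t + a * t * u t.
pose w1 t := (a ^+ 2 * t ^+ 2 - mu) * u t + a * u t + a * t * u1 t.
have dw t : is_derive t 1 w (w1 t).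
  apply: (@is_derive_ext _ (fun t => u1 t + a * (t * u t))) => [x|]; first by rewrite /w mulrA.
  by apply: drv_eq (drvD (h2 t) (drvZ a (drvM (drv_id t) (h1 t)))) _; rewrite /w1; ring.
have dw1 t : is_derive t 1 w1 ((a ^+ 2 * t ^+ 2 - (mu - 2 * a)) * w t).
  apply: (@is_derive_ext _ (fun t => (a ^+ 2 * (t * t) - mu) * u t + a * u t + a * (t * u1 t))) => [x|].
    by rewrite /w1 expr2; ring.
  apply: drv_eq (drvD (drvD (drvM (drvB (drvZ (a ^+ 2) (drvM (drv_id t) (drv_id t))) (drv_cst t mu)) (h1 t))
    (drvZ a (h1 t))) (drvZ a (drvM (drv_id t) (h2 t)))) _.
  by rewrite /w; ring.
have pw : poly_growth (fun t => (a ^+ 2 * t ^+ 2 - mu) * u t).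
  apply: poly_growthM => //; apply: poly_growthD; last exact: poly_growth_cst.
  by apply: poly_growthM; [exact: poly_growth_cst|apply: poly_growthM; exact: poly_growth_id].
have pww : poly_growth w.
  apply: poly_growthD; first exact: poly_growth_deriv h1 h2 pu pw.
  by apply: poly_growthM => //; apply: poly_growthM; [exact: poly_growth_cst|exact: poly_growth_id].
have muN' : mu - 2 * a < 2 * a * N%:R by move: muN; rewrite -natr1; lra.
have [w0|[j [c [ej hj]]]] := IH w w1 (mu - 2 * a) dw dw1 pww muN'.
  have [c [E /eqP]] := kill u u1 h1 h2 w0; rewrite mulf_eq0 => /orP[/eqP ma|/eqP c0].
    by right; exists 0%N, c; split; [lra|move=> t; rewrite E /hermite_fun hornerC mul1r].
  by left=> t; rewrite E c0 mul0r.
have j2 : 2 * a * j.+1%:R != 0 by rewrite !mulf_neq0 ?pnatr_eq0 ?(gt_eqF a0).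
(* By [hermite_fun_lower] this coefficient makes the lowering operator annihilate [u] minus [d]
   times the Hermite function of level [j + 1]. *)
pose d := c / (2 * a * j.+1%:R).
have muj : mu = a * (2 * j.+1%:R + 1) by move: ej; rewrite -natr1; lra.
pose v t := u t - d * hermite_fun j.+1 t.
pose v1 t := u1 t - d * ((gstep (hermite j.+1)).[t] * gauss t).
have [e [E /eqP]] : exists e, (forall t, v t = e * gauss t) /\ (mu - a) * e = 0.
  apply: (kill v v1) => t.
  - by apply: drvB (h1 t) (drvZ d _); have [] := hermite_fun_ode j.+1 t.
  - have [_ k] := hermite_fun_ode j.+1 t; apply: drv_eq (drvB (h2 t) (drvZ d k)) _.
    by rewrite /v muj; ring.
  - have := hermite_fun_lower j t; have := hj t; rewrite /w /v1 /v => k1 k2.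
    have -> : u1 t - d * ((gstep (hermite j.+1)).[t] * gauss t) + a * t * (u t - d * hermite_fun j.+1 t) =
      (u1 t + a * t * u t) - d * ((gstep (hermite j.+1)).[t] * gauss t + a * t * hermite_fun j.+1 t) by ring.
    by rewrite k1 k2 /d mulrA divfK// subrr.
rewrite mulf_eq0 => /orP[/eqP ma|/eqP e0].
  have j0 : 0 < j.+1%:R :> R by []. 
  have : 0 < a * j.+1%:R by rewrite mulr_gt0.
  by move: ma; rewrite muj; lra.
right; exists j.+1, d; split=> // t.
by have := E t; rewrite e0 mul0r /v => /subr0_eq.
Qed.

End Oscillator.

(** * Fourier coefficients of an eigenfunction *)

Section Eigenfunctions.
Variables (R : realType) (l : nat).
Hypothesis l0 : (0 < l)%N.
Implicit Types (f g : 'rV[R]_3 -> R) (x y z s t p lam : R) (m n k : int).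

Definition ka : R := 2 * l%:R.

Lemma ka_gt0 : 0 < ka.
Proof. by rewrite mulr_gt0// ltr0n. Qed.

Let kan : ka != 0. Proof. by rewrite gt_eqF// ka_gt0. Qed.

(** At fixed [x] an invariant function has period 1 in [y] and [1 / ka] in [z]; the rescaling of [z]
    makes both periods 1. *)
Definition xslice g x (q : R * R) : R := g (pt3 x q.1 (q.2 / ka)).

Lemma xslice_cont g x : continuous g -> continuous (xslice g x).
Proof.
move=> cg; apply: (@continuous_comp' _ _ _ g (fun q : R * R => pt3 x q.1 (q.2 / ka))) => //.
apply: continuous_pt3; [exact: cont_cst|exact: cont_fst|].
by apply: contM; [exact: cont_snd|exact: cont_cst].
Qed.

Definition per g := (forall x y z, g (pt3 x (y + 1) z) = g (pt3 x y z)) /\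
  (forall x y z, g (pt3 x y (z + ka^-1)) = g (pt3 x y z)).

Lemma derive_translate g w v (a : 'rV[R]_3) : (forall b, g (b + w) = g b) -> 'D_v g (a + w) = 'D_v g a.
Proof.
move=> h; have E : (fun e : R => e^-1 *: ((g \o shift (a + w)) (e *: v) - g (a + w))) =
    (fun e : R => e^-1 *: ((g \o shift a) (e *: v) - g a)).
  by apply/funext => e /=; rewrite addrA !h.
by rewrite /derive E.
Qed.

Lemma per_partial g i : per g -> per (partial i g).
Proof.
move=> [h1 h2]; split=> x y z.
  have E (a b c : R) : pt3 a (b + 1) c = pt3 a b c + delta_mx 0 1.
    by rewrite [RHS]addrC (addrC b) (pt3_shift a b c 1).1.2 scale1r.
  by rewrite E; apply: derive_translate => b; rewrite (pt3_eta b) -E h1.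
have E (a b c : R) : pt3 a b (c + ka^-1) = pt3 a b c + ka^-1 *: delta_mx 0 2.
  by rewrite [RHS]addrC (addrC c) (pt3_shift a b c ka^-1).2.
by rewrite E; apply: derive_translate => b; rewrite (pt3_eta b) -E h2.
Qed.

Lemma xslice_per1 g x s t : per g -> xslice g x (s + 1, t) = xslice g x (s, t).
Proof. by move=> [h _]; rewrite /xslice/= h. Qed.

Lemma xslice_per2 g x s t : per g -> xslice g x (s, t + 1) = xslice g x (s, t).
Proof. by move=> [_ h]; rewrite /xslice/= mulrDl mul1r h. Qed.

Lemma coef_dx g n k p x : smooth g ->
  is_derive x 1 (fun x => coef n k p (xslice g x)) (coef n k p (xslice (partial 0 g) x)).
Proof.
move=> sg.
have cK g' : smooth g' -> continuous (fun q : (R * R) * R => xslice g' q.1.1 (q.1.2, q.2) * wave n k p (q.1.2, q.2)).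
  move=> /smooth_cont cg; have c1 : continuous (fun q : (R * R) * R => q.1.1).
    by apply: (@continuous_comp' _ _ _ fst fst); exact: cont_fst.
  have c2 : continuous (fun q : (R * R) * R => q.1.2).
    by apply: (@continuous_comp' _ _ _ snd fst); [exact: cont_fst|exact: cont_snd].
  apply: contM.
    apply: (@continuous_comp' _ _ _ g' (fun q : (R * R) * R => pt3 q.1.1 q.1.2 (q.2 / ka))) => //.
    by apply: continuous_pt3 => //; apply: contM; [exact: cont_snd|exact: cont_cst].
  apply: (@continuous_comp' _ _ _ (wave n k p) (fun q : (R * R) * R => (q.1.2, q.2))).
    by apply: continuous_pair => //; exact: cont_snd.
  exact: wave_cont.
pose H g' (q : R * R) := integ (fun t => xslice g' q.1 (q.2, t) * wave n k p (q.2, t)) 0 1.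
have cH g' : smooth g' -> continuous (H g').
  by move=> /cK c; exact: (@continuous_integ _ _ (fun q : (R * R) * R => xslice g' q.1.1 (q.1.2, q.2) * wave n k p (q.1.2, q.2)) 0 1 ler01 c).
have s0 := smooth_partial 0 sg.
apply: (@is_derive_integ _ (H g) (H (partial 0 g))) => //; [|exact: cH|exact: cH].
move=> x' s.
have cc g' : smooth g' -> continuous (fun q : R * R => xslice g' q.1 (s, q.2) * wave n k p (s, q.2)).
  move=> /cK c; apply: (@continuous_comp' _ _ _ _ (fun q : R * R => ((q.1, s), q.2)) _ c).
  apply: continuous_pair; last exact: cont_snd.
  by apply: continuous_pair; [exact: cont_fst|exact: cont_cst].
apply: (@is_derive_integ _ (fun q : R * R => xslice g q.1 (s, q.2) * wave n k p (s, q.2))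
   (fun q : R * R => xslice (partial 0 g) q.1 (s, q.2) * wave n k p (s, q.2))) => //; [|exact: cc|exact: cc].
move=> y t; apply: drv_eq (drvM (smooth_dx y s (t / ka) sg) (drv_cst y (wave n k p (s, t)))) _.
by rewrite mulr0 addr0.
Qed.

Lemma coef_dy g n k p x : smooth g -> per g ->
  coef n k p (xslice (partial 1 g) x) = 2 * pi * n%:~R * coef n k (p - pi / 2) (xslice g x).
Proof.
move=> sg pg; have s1 := smooth_partial 1 sg; apply: coef_parts1.
- exact: xslice_cont (smooth_cont sg).
- exact: xslice_cont (smooth_cont s1).
- by move=> s t; exact: (smooth_dy x s (t / ka) sg).
- by move=> s t; exact: xslice_per1.
Qed.

Lemma drv_xslice g x s t : smooth g -> is_derive t 1 (fun t => g (pt3 x s (t / ka))) (ka^-1 * partial 2 g (pt3 x s (t / ka))).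
Proof.
move=> sg; have h := drvM (drv_id t) (drv_cst t ka^-1).
have := @drv_comp R (fun z => g (pt3 x s z)) (fun t => t / ka) t _ _ (smooth_dz x s (t / ka) sg) h.
by move=> k; apply: drv_eq k _; ring.
Qed.

Lemma coef_dz g n k p x : smooth g -> per g ->
  coef n k p (xslice (partial 2 g) x) = 2 * pi * k%:~R * ka * coef n k (p - pi / 2) (xslice g x).
Proof.
move=> sg pg; have s2 := smooth_partial 2 sg; have c2 := @xslice_cont _ x (smooth_cont s2).
have c0 := @xslice_cont _ x (smooth_cont sg).
have c2' : continuous (fun q => ka^-1 * xslice (partial 2 g) x q) by exact: contZ.
have := @coef_parts2 _ n k p (xslice g x) (fun q => ka^-1 * xslice (partial 2 g) x q) c0 c2'
  (fun s t => drv_xslice x s t sg) (fun s t => xslice_per2 x s t pg).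
by rewrite wcoefZ// => h; rewrite [RHS]mulrAC -h mulrAC mulVf ?mul1r.
Qed.

Lemma coef_dyy g n k p x : smooth g -> per g ->
  coef n k p (xslice (partial 1 (partial 1 g)) x) = - (2 * pi * n%:~R) ^+ 2 * coef n k p (xslice g x).
Proof.
move=> sg pg; rewrite (coef_dy n k p x (smooth_partial 1 sg) (per_partial 1 pg)) (coef_dy n k _ x sg pg).
by rewrite coef_pi; [ring|exact: xslice_cont (smooth_cont sg)].
Qed.

Lemma coef_dyz g n k p x : smooth g -> per g ->
  coef n k p (xslice (partial 1 (partial 2 g)) x) = - (2 * pi * n%:~R * (2 * pi * k%:~R * ka)) * coef n k p (xslice g x).
Proof.
move=> sg pg; rewrite (coef_dy n k p x (smooth_partial 2 sg) (per_partial 2 pg)) (coef_dz n k _ x sg pg).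
by rewrite coef_pi; [ring|exact: xslice_cont (smooth_cont sg)].
Qed.

Lemma coef_dzy g n k p x : smooth g -> per g ->
  coef n k p (xslice (partial 2 (partial 1 g)) x) = - (2 * pi * n%:~R * (2 * pi * k%:~R * ka)) * coef n k p (xslice g x).
Proof.
move=> sg pg; rewrite (coef_dz n k p x (smooth_partial 1 sg) (per_partial 1 pg)) (coef_dy n k _ x sg pg).
by rewrite coef_pi; [ring|exact: xslice_cont (smooth_cont sg)].
Qed.

Lemma coef_dzz g n k p x : smooth g -> per g ->
  coef n k p (xslice (partial 2 (partial 2 g)) x) = - (2 * pi * k%:~R * ka) ^+ 2 * coef n k p (xslice g x).
Proof.
move=> sg pg; rewrite (coef_dz n k p x (smooth_partial 2 sg) (per_partial 2 pg)) (coef_dz n k _ x sg pg).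
by rewrite coef_pi; [ring|exact: xslice_cont (smooth_cont sg)].
Qed.

Lemma coef_lin2 m n p (c1 c2 : R) (A F1 F2 : R * R -> R) : continuous F1 -> continuous F2 ->
  (forall q, A q = c1 * F1 q + c2 * F2 q) -> coef m n p A = c1 * coef m n p F1 + c2 * coef m n p F2.
Proof.
move=> h1 h2 /funext ->.
by rewrite wcoefD ?wcoefZ//; exact: contZ.
Qed.

Lemma coef_lin5 m n p (c1 c2 c3 c4 c5 : R) (A F1 F2 F3 F4 F5 : R * R -> R) :
  continuous F1 -> continuous F2 -> continuous F3 -> continuous F4 -> continuous F5 ->
  (forall q, A q = c1 * F1 q + (c2 * F2 q + (c3 * F3 q + (c4 * F4 q + c5 * F5 q)))) ->
  coef m n p A = c1 * coef m n p F1 + (c2 * coef m n p F2 + (c3 * coef m n p F3 +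
    (c4 * coef m n p F4 + c5 * coef m n p F5))).
Proof.
move=> h1 h2 h3 h4 h5 /funext ->.
have k1 : continuous (fun q => c1 * F1 q) by exact: contZ.
have k2 : continuous (fun q => c2 * F2 q) by exact: contZ.
have k3 : continuous (fun q => c3 * F3 q) by exact: contZ.
have k4 : continuous (fun q => c4 * F4 q) by exact: contZ.
have k5 : continuous (fun q => c5 * F5 q) by exact: contZ.
have k45 := contD k4 k5; have k345 := contD k3 k45; have k2345 := contD k2 k345.
by rewrite (wcoefD _ _ _ k1 k2345) (wcoefD _ _ _ k2 k345) (wcoefD _ _ _ k3 k45) (wcoefD _ _ _ k4 k5) !wcoefZ.
Qed.

Lemma integ_lin5 (c1 c2 c3 c4 c5 : R) (A F1 F2 F3 F4 F5 : R -> R) :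
  continuous F1 -> continuous F2 -> continuous F3 -> continuous F4 -> continuous F5 ->
  (forall q, A q = c1 * F1 q + (c2 * F2 q + (c3 * F3 q + (c4 * F4 q + c5 * F5 q)))) ->
  integ A 0 1 = c1 * integ F1 0 1 + (c2 * integ F2 0 1 + (c3 * integ F3 0 1 + (c4 * integ F4 0 1 + c5 * integ F5 0 1))).
Proof.
move=> h1 h2 h3 h4 h5 /funext ->.
have k1 : continuous (fun q => c1 * F1 q) by exact: contZ.
have k2 : continuous (fun q => c2 * F2 q) by exact: contZ.
have k3 : continuous (fun q => c3 * F3 q) by exact: contZ.
have k4 : continuous (fun q => c4 * F4 q) by exact: contZ.
have k5 : continuous (fun q => c5 * F5 q) by exact: contZ.
have k45 := contD k4 k5; have k345 := contD k3 k45; have k2345 := contD k2 k345.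
by rewrite (integD _ _ k1 k2345) (integD _ _ k2 k345) (integD _ _ k3 k45) (integD _ _ k4 k5) !integZ.
Qed.

Lemma lin5_subst (c1 c2 c3 c4 c5 A F1 F2 F3 F4 F5 E2 E3 E4 E5 Z : R) :
  A = c1 * F1 + (c2 * F2 + (c3 * F3 + (c4 * F4 + c5 * F5))) ->
  F2 = E2 -> F3 = E3 -> F4 = E4 -> F5 = E5 ->
  c1 * F1 + (c2 * E2 + (c3 * E3 + (c4 * E4 + c5 * E5))) = Z -> A = Z.
Proof. by move=> -> -> -> -> ->. Qed.

(** The component of central frequency 0, which for an invariant function lives on the torus of the
    coordinates [(x, y)]. *)
Definition zmean g (q : R * R) : R := integ (fun t => g (pt3 q.1 q.2 (t / ka))) 0 1.

Lemma zmean_joint g : continuous g -> continuous (fun q : (R * R) * R => g (pt3 q.1.1 q.1.2 (q.2 / ka))).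
Proof.
move=> cg; apply: (@continuous_comp' _ _ _ g (fun q : (R * R) * R => pt3 q.1.1 q.1.2 (q.2 / ka))) => //.
apply: continuous_pt3.
- by apply: (@continuous_comp' _ _ _ fst fst); exact: cont_fst.
- by apply: (@continuous_comp' _ _ _ snd fst); [exact: cont_fst|exact: cont_snd].
- by apply: contM; [exact: cont_snd|exact: cont_cst].
Qed.

Lemma zmean_cont g : continuous g -> continuous (zmean g).
Proof. by move=> /zmean_joint c; exact: (@continuous_integ _ _ _ 0 1 ler01 c). Qed.

Lemma zmean_slice g x y : continuous g -> continuous (fun t => g (pt3 x y (t / ka))).
Proof. by move=> /zmean_joint c; exact: (@continuous_slice _ _ _ (x, y) c). Qed.

Lemma zmean_dx g x y : smooth g -> is_derive x 1 (fun x => zmean g (x, y)) (zmean (partial 0 g) (x, y)).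
Proof.
move=> sg; have s0 := smooth_partial 0 sg.
have cc g' : smooth g' -> continuous (fun q : R * R => g' (pt3 q.1 y (q.2 / ka))).
  move=> /smooth_cont/zmean_joint c; apply: (@continuous_comp' _ _ _ _ (fun q : R * R => ((q.1, y), q.2)) _ c).
  apply: continuous_pair; last exact: cont_snd.
  by apply: continuous_pair; [exact: cont_fst|exact: cont_cst].
apply: (@is_derive_integ _ (fun q : R * R => g (pt3 q.1 y (q.2 / ka))) (fun q : R * R => partial 0 g (pt3 q.1 y (q.2 / ka)))) => //; [|exact: cc|exact: cc].
by move=> x' t; exact: (smooth_dx x' y (t / ka) sg).
Qed.

Lemma zmean_dy g x y : smooth g -> is_derive y 1 (fun y => zmean g (x, y)) (zmean (partial 1 g) (x, y)).
Proof.
move=> sg; have s0 := smooth_partial 1 sg.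
have cc g' : smooth g' -> continuous (fun q : R * R => g' (pt3 x q.1 (q.2 / ka))).
  move=> /smooth_cont/zmean_joint c; apply: (@continuous_comp' _ _ _ _ (fun q : R * R => ((x, q.1), q.2)) _ c).
  apply: continuous_pair; last exact: cont_snd.
  by apply: continuous_pair; [exact: cont_cst|exact: cont_fst].
apply: (@is_derive_integ _ (fun q : R * R => g (pt3 x q.1 (q.2 / ka))) (fun q : R * R => partial 1 g (pt3 x q.1 (q.2 / ka)))) => //; [|exact: cc|exact: cc].
by move=> x' t; exact: (smooth_dy x x' (t / ka) sg).
Qed.

Lemma zmean_dz g q : smooth g -> per g -> zmean (partial 2 g) q = 0.
Proof.
move=> sg [_ pg]; have s2 := smooth_partial 2 sg.
have := integ_eq 0 1 (fun t => drv_xslice q.1 q.2 t sg); rewrite integZ; last exact: zmean_slice (smooth_cont s2).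
rewrite mul0r -[1 / ka]add0r mul1r pg subrr => /eqP.
by rewrite mulf_eq0 invr_eq0 (negbTE kan) /= => /eqP.
Qed.

Lemma coef_zmean g n p x : continuous g -> coef n 0 p (xslice g x) = integ (fun s => zmean g (x, s) * cos (2 * pi * (n%:~R * s) + p)) 0 1.
Proof.
move=> cg; apply: eq_integ => s; rewrite mulrC -integZ; last exact: zmean_slice.
by apply: eq_integ => t; rewrite /wave mul0r addr0 mulrC.
Qed.

Section Eigen.
Variables (f : 'rV[R]_3 -> R) (lam : R).
Hypothesis sf : smooth f.
Hypothesis invf : forall m n k x y z,
  f (pt3 (m%:~R + x) (n%:~R + y) (k%:~R / ka + (z + m%:~R * y))) = f (pt3 x y z).
Hypothesis eigf : forall a, laplacian (@heis_metric R) f a = lam * f a.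

Lemma perf : per f.
Proof.
split=> x y z.
  by have := invf 0 1 0 x y z; rewrite !mul0r !add0r addr0 addrC.
by have := invf 0 0 1 x y z; rewrite !mul0r !add0r addr0 mul1r addrC.
Qed.

Lemma pde x y z : partial 0 (partial 0 f) (pt3 x y z) =
  - lam * f (pt3 x y z) + (- 1 * partial 1 (partial 1 f) (pt3 x y z) +
     (- x * partial 1 (partial 2 f) (pt3 x y z) + (- x * partial 2 (partial 1 f) (pt3 x y z) +
     - (1 + x ^+ 2) * partial 2 (partial 2 f) (pt3 x y z)))).
Proof.
have := eigf (pt3 x y z); rewrite laplacianE//.
move: (partial 0 _ _) (partial 1 (partial 1 f) _) (partial 1 (partial 2 f) _) (partial 2 (partial 1 f) _) (partial 2 (partial 2 f) _) (f _) => A B D E F G h.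
have -> : A = - (- (A + B + x * D + x * E + (1 + x ^+ 2) * F)) - B - x * D - x * E - (1 + x ^+ 2) * F by ring.
by rewrite h; ring.
Qed.

Let s0 := smooth_partial 0 sf.
Let s1 := smooth_partial 1 sf.
Let s2 := smooth_partial 2 sf.
Let p1 := per_partial 1 perf.
Let p2 := per_partial 2 perf.

(** At frequency [(n, k)] the field [d/dy + x d/dz] acts as [i (2 pi n + tau x)] with
    [tau = 2 pi k ka]. For [k <> 0] this is an oscillator of strength [|tau|] centred at
    [- n / (k ka)]. *)
Lemma coef_ode n k p x : coef n k p (xslice (partial 0 (partial 0 f)) x) =
  ((2 * pi * n%:~R + 2 * pi * k%:~R * ka * x) ^+ 2 + (2 * pi * k%:~R * ka) ^+ 2 - lam) *
  coef n k p (xslice f x).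
Proof.
have cs g : smooth g -> continuous (xslice g x) by move=> /smooth_cont; exact: xslice_cont.
have H := @coef_lin5 n k p _ _ _ _ _ _ _ _ _ _ _ (cs _ sf) (cs _ (smooth_partial 1 s1)) (cs _ (smooth_partial 1 s2))
  (cs _ (smooth_partial 2 s1)) (cs _ (smooth_partial 2 s2)) (fun q => pde x q.1 (q.2 / ka)).
apply: (lin5_subst H (coef_dyy n k p x sf perf) (coef_dyz n k p x sf perf) (coef_dzy n k p x sf perf)
  (coef_dzz n k p x sf perf)).
ring.
Qed.

(** The lattice element that translates [x] by 1 shears [z] by [y]; transferred to the wave of
    central frequency [k], the shear raises the frequency in [y] by [k ka = 2 l k]. Hence only the
    residues of [n] modulo [2 l |k|] are independent, which is the multiplicity. *)
Lemma coef_shift n k p x : coef n k p (xslice f (x + 1)) = coef (n + 2 * (l%:Z * k)) k p (xslice f x).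
Proof.
apply: eq_integ => y.
pose phi (t : R) := xslice f x (y, t) * wave (n + 2 * (l%:Z * k)) k p (y, t).
have cphi : continuous phi.
  have cp : continuous (fun q => xslice f x q * wave (n + 2 * (l%:Z * k)) k p q).
    by apply: coef_cont; exact: xslice_cont (smooth_cont sf).
  exact: (@continuous_slice _ _ _ y cp).
have pphi t : phi (t + 1) = phi t.
  by rewrite /phi wave_shift2 xslice_per2//; exact: perf.
rewrite (@eq_integ _ _ (fun t => phi (t + - (ka * y)))).
  by rewrite integ_shift// add0r addrC integ_period.
move=> t; rewrite /phi /xslice/=; congr (_ * _).
  have := invf 1 0 0 x y ((t - ka * y) / ka); rewrite !mul0r mulr1z !mul1r !add0r (addrC 1 x) => <-.
  congr (f (pt3 _ _ _)).
  by rewrite mulrBl (mulrC ka) mulfK// subrK.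
by rewrite /wave/=; congr cos; rewrite intrD !intrM /ka; ring.
Qed.

Lemma coef_shiftz n k p x (q : int) :
  coef n k p (xslice f (x + q%:~R)) = coef (n + q * (2 * (l%:Z * k))) k p (xslice f x).
Proof.
move: (2 * (l%:Z * k)) (fun n => coef_shift n k p) => D hD.
have P (j : nat) n' y : coef n' k p (xslice f (y + j%:~R)) = coef (n' + j%:Z * D) k p (xslice f y).
  elim: j n' y => [|j IH] n' y; first by rewrite mul0r !addr0.
  rewrite -addn1 PoszD intrD addrA hD IH.
  have -> // : n' + D + j%:Z * D = n' + (j%:Z + 1%Z) * D.
  by rewrite (mulrDl (j%:Z) 1) mul1r (addrC (j%:Z * D)) addrA.
case: q => j; first exact: P.
have := P j.+1 (n - j.+1%:Z * D) (x - j.+1%:~R); rewrite !subrK => h.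
by rewrite NegzE mulrNz -h mulNr.
Qed.

Lemma bounded01 : exists M, forall x y z, 0 <= x <= 1 -> 0 <= y <= 1 -> 0 <= z <= 1 ->
  `|xslice f x (y, z)| <= M.
Proof.
have cK := zmean_joint (smooth_cont sf).
have K01 := @segment_compact R 0 1.
have := continuous_compact (continuous_subspaceT cK) (compact_setX (compact_setX K01 K01) K01).
move=> /compact_bounded[M [Mr hM]]; exists (M + 1) => x y z hx hy hz.
by apply: (hM (M + 1)); [rewrite ltrDl|exists ((x, y), z) => //=; rewrite !in_itv/= hx hy hz].
Qed.

(** [x] is brought back to [[0, 1]] at the price of another [n], and the bound on the slices there
    does not depend on [n]. *)
Lemma coef_bounded n k p : exists M, forall x, `|coef n k p (xslice f x)| <= M.
Proof.
have [M hM] := bounded01; exists M => x.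
have -> : x = (x - (Num.floor x)%:~R) + (Num.floor x)%:~R by rewrite subrK.
rewrite coef_shiftz; set y := x - _.
have hy : 0 <= y <= 1.
  have := floor_le_tmp x; have := floorD1_gt x; rewrite /y intrD; lra.
apply: integ2_norm; first by apply: coef_cont; exact: xslice_cont (smooth_cont sf).
move=> s t hs ht; rewrite normrM; have := hM y s t hy hs ht; apply: le_trans.
by rewrite ler_piMr// cos_max.
Qed.

(** Recentred by [nu], the coefficient is a bounded solution of the oscillator equation with
    [a = |tau|] and [mu = lam - tau^2], so [oscillator_eq0] applies. *)
Lemma coef_alt n k p : k != 0 -> (forall x, coef n k p (xslice f x) = 0) \/
  exists j c, lam = (2 * pi * k%:~R * ka) ^+ 2 + `|2 * pi * k%:~R * ka| * (2 * j%:R + 1) /\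
   forall x, coef n k p (xslice f x) = c * hermite_fun `|2 * pi * k%:~R * ka| j (x + n%:~R / (k%:~R * ka)).
Proof.
move=> k0; set tau := 2 * pi * k%:~R * ka.
have kr : k%:~R != 0 :> R by rewrite intr_eq0.
have pin : pi != 0 :> R by rewrite gt_eqF// pi_gt0.
have n2 : 2 != 0 :> R by rewrite pnatr_eq0.
have tau0 : tau != 0 by exact: mulf_neq0 (mulf_neq0 (mulf_neq0 n2 pin) kr) kan.
have a0 : 0 < `|tau| by rewrite normr_gt0.
pose nu := n%:~R / (k%:~R * ka) : R.
pose v t := coef n k p (xslice f (t - nu)); pose v1 t := coef n k p (xslice (partial 0 f) (t - nu)).
have d1 t : is_derive t 1 v (v1 t).
  by apply: (@drv_shift R (fun x => coef n k p (xslice f x))); exact: coef_dx.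
have d2 t : is_derive t 1 v1 ((`|tau| ^+ 2 * t ^+ 2 - (lam - tau ^+ 2)) * v t).
  apply: (@drv_shift R (fun x => coef n k p (xslice (partial 0 f) x))).
  apply: drv_eq (coef_dx n k p (t - nu) s0) _; rewrite coef_ode; congr (_ * _).
  rewrite real_normK ?num_real// (_ : 2 * pi * n%:~R + 2 * pi * k%:~R * ka * (t - nu) = tau * t).
    by rewrite -/tau; ring.
  by rewrite /nu /tau; field; rewrite kr kan.
have pv : poly_growth v.
  have [M hM] := coef_bounded n k p; exists `|M|, 0%N; split=> // t.
  by rewrite expr0 mulr1; apply: le_trans (hM _) (ler_norm _).
have [N hN] : exists N : nat, lam - tau ^+ 2 < 2 * `|tau| * N%:R.
  exists (Num.truncn ((lam - tau ^+ 2) / (2 * `|tau|))).+1.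
  by rewrite -ltr_pdivrMl ?mulr_gt0// mulrC truncnS_gt.
have vx x : coef n k p (xslice f x) = v (x + nu) by rewrite /v addrK.
have [z|[j [c [e h]]]] := oscillator_eq0 a0 d1 d2 pv hN; first by left=> x; rewrite vx.
right; exists j, c; split; last by move=> x; rewrite vx h.
by rewrite -e; ring.
Qed.

Lemma zmean_per1 x y : zmean f (x + 1, y) = zmean f (x, y).
Proof.
pose phi t := f (pt3 x y (t / ka)).
have cphi : continuous phi by exact: zmean_slice (smooth_cont sf).
have pphi t : phi (t + 1) = phi t by have [_ h] := perf; rewrite /phi mulrDl mul1r h.
rewrite /zmean/= (@eq_integ _ _ (fun t => phi (t + - (ka * y)))).
  by rewrite integ_shift// add0r addrC integ_period.
move=> t; rewrite /phi; have := invf 1 0 0 x y ((t - ka * y) / ka).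
rewrite !mul0r mulr1z !mul1r !add0r (addrC 1 x) => <-.
congr (f (pt3 _ _ _)).
by rewrite mulrBl (mulrC ka) mulfK// subrK.
Qed.

Lemma zmean_per2 x y g : per g -> zmean g (x, y + 1) = zmean g (x, y).
Proof. by move=> [h _]; apply: eq_integ => t /=; rewrite h. Qed.

Lemma zmean0_per1 x y : zmean (partial 0 f) (x + 1, y) = zmean (partial 0 f) (x, y).
Proof.
have [_ <-] := zmean_dx (x + 1) y sf; have [_ <-] := zmean_dx x y sf.
have h := @drv_shift R (fun x => zmean f (x, y)) _ 1 x (zmean_dx (x + 1) y sf).
have [_ e1] := zmean_dx (x + 1) y sf; rewrite e1.
have e : (fun t => zmean f (t + 1, y)) = fun t => zmean f (t, y) by apply/funext => t; rewrite zmean_per1.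
by move: h; rewrite e => -[_ <-].
Qed.

Lemma torus_coef m n p : lam != 4 * pi ^+ 2 * (m%:~R ^+ 2 + n%:~R ^+ 2) -> coef m n p (zmean f) = 0.
Proof.
move=> hl; have ca g : smooth g -> continuous (zmean g) by move=> /smooth_cont; exact: zmean_cont.
have E q : zmean (partial 0 (partial 0 f)) q = - lam * zmean f q + (- 1) * zmean (partial 1 (partial 1 f)) q.
  have sc g : smooth g -> continuous (fun t => g (pt3 q.1 q.2 (t / ka))) by move=> /smooth_cont; exact: zmean_slice.
  have z12 : zmean (partial 1 (partial 2 f)) q = 0.
    case: q {sc} => x y; have [_ <-] := zmean_dy x y s2.
    rewrite (_ : (fun y => zmean (partial 2 f) (x, y)) = fun=> 0); first by have [_ ->] := drv_cst y (0 : R).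
    by apply/funext => t; exact: zmean_dz sf perf.
  have H := @integ_lin5 _ _ _ _ _ _ _ _ _ _ _ (sc _ sf) (sc _ (smooth_partial 1 s1)) (sc _ (smooth_partial 1 s2))
    (sc _ (smooth_partial 2 s1)) (sc _ (smooth_partial 2 s2)) (fun t => pde q.1 q.2 (t / ka)).
  apply: (lin5_subst H erefl z12 (zmean_dz q s1 p1) (zmean_dz q s2 p2)).
  by rewrite !mulr0 !addr0.
have e0 : coef m n p (zmean (partial 0 (partial 0 f))) = - (2 * pi * m%:~R) ^+ 2 * coef m n p (zmean f).
  apply: etrans (@coef_parts1 _ m n p (zmean (partial 0 f)) (zmean (partial 0 (partial 0 f))) (ca _ s0)
    (ca _ (smooth_partial 0 s0)) (fun s t => zmean_dx s t s0) zmean0_per1) _.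
  apply: etrans (congr1 _ (@coef_parts1 _ m n (p - pi / 2) (zmean f) (zmean (partial 0 f)) (ca _ sf) (ca _ s0)
    (fun s t => zmean_dx s t sf) zmean_per1)) _.
  by rewrite coef_pi; [ring|exact: ca].
have e1 : coef m n p (zmean (partial 1 (partial 1 f))) = - (2 * pi * n%:~R) ^+ 2 * coef m n p (zmean f).
  apply: etrans (@coef_parts2 _ m n p (zmean (partial 1 f)) (zmean (partial 1 (partial 1 f))) (ca _ s1)
    (ca _ (smooth_partial 1 s1)) (fun s t => zmean_dy s t s1) (fun s t => zmean_per2 s t p1)) _.
  apply: etrans (congr1 _ (@coef_parts2 _ m n (p - pi / 2) (zmean f) (zmean (partial 1 f)) (ca _ sf) (ca _ s1)
    (fun s t => zmean_dy s t sf) (fun s t => zmean_per2 s t perf))) _.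
  by rewrite coef_pi; [ring|exact: ca].
have h := esym (etrans (esym e0) (@coef_lin2 m n p _ _ _ _ _ (ca _ sf) (ca _ (smooth_partial 1 s1)) E)).
have h' := etrans (congr1 (fun t => - lam * coef m n p (zmean f) + -1 * t) (esym e1)) h.
have : (lam - 4 * pi ^+ 2 * (m%:~R ^+ 2 + n%:~R ^+ 2)) * coef m n p (zmean f) = 0.
  move: (coef m n p (zmean f)) h' => X h'.
  rewrite (_ : _ * X = - ((- lam * X + -1 * (- (2 * pi * n%:~R) ^+ 2 * X)) - (- (2 * pi * m%:~R) ^+ 2 * X))).
    by rewrite h' subrr oppr0.
  ring.
by move/eqP; rewrite mulf_eq0 subr_eq0 (negbTE hl) => /eqP.
Qed.

(** For [k <> 0] a coefficient is a multiple of one Hermite function, so a single point [pt k j]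
    where that function is nonzero decides whether it vanishes. By [coef_shiftz] one representative
    [n] of each residue modulo [2 l |k|] is tested; for [k = 0] the function [zmean f] is tested
    instead. *)
Lemma eigen_eq0 (pt : int -> nat -> R) :
  (forall k j, k != 0 -> hermite_fun `|2 * pi * k%:~R * ka| j (pt k j) != 0) ->
  (forall m n, lam = 4 * pi ^+ 2 * (m%:~R ^+ 2 + n%:~R ^+ 2) -> coef m n (- (pi / 4)) (zmean f) = 0) ->
  (forall k j (n : nat), k != 0 -> (n < 2 * l * `|k|)%N ->
    lam = (2 * pi * k%:~R * ka) ^+ 2 + `|2 * pi * k%:~R * ka| * (2 * j%:R + 1) ->
    coef n%:Z k (- (pi / 4)) (xslice f (pt k j - n%:~R / (k%:~R * ka))) = 0) ->
  forall a, f a = 0.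
Proof.
move=> hpt hT hK a.
have av0 q : zmean f q = 0.
  apply: fourier2 => //; [exact: zmean_cont (smooth_cont sf)|exact: zmean_per1|by move=> s t; apply: zmean_per2; exact: perf|].
  move=> m n; have [e|e] := eqVneq lam (4 * pi ^+ 2 * (m%:~R ^+ 2 + n%:~R ^+ 2)); first exact: hT.
  exact: torus_coef.
suff h x q : xslice f x q = 0.
  rewrite (pt3_eta a); have := h (a 0 0) (a 0 1, a 0 2 * ka).
  by rewrite /xslice/= mulfK.
apply: fourier2 => //; [exact: xslice_cont (smooth_cont sf)|by move=> s t; apply: xslice_per1; exact: perf|
  by move=> s t; apply: xslice_per2; exact: perf|].
move=> n k; have [->|k0] := eqVneq k 0.
  rewrite coef_zmean; last exact: smooth_cont.
  rewrite (@eq_integ _ _ (fun=> 0)); last by move=> s; rewrite av0 mul0r.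
  by rewrite (integ_eq 0 1 (fun x => drv_cst x 0)) subrr.
pose d := 2 * (l%:Z * k).
have d0 : d != 0 by rewrite !mulf_neq0//; lia.
(* The quotient of [n] by [2 l k] becomes a translation of [x], leaving the residue as the frequency
   in [y]. *)
have -> : n = (n %% d)%Z + (n %/ d)%Z * d by rewrite addrC -divz_eq.
rewrite -coef_shiftz.
have [n0 [en0 hn0]] : exists n0 : nat, (n %% d)%Z = n0%:Z /\ (n0 < 2 * l * `|k|)%N.
  exists `|(n %% d)%Z|%N; have h1 := modz_ge0 n d0; have h2 := ltz_mod n d0.
  split; first by lia.
  have : `|d| = (2 * l * `|k|)%N%:Z by rewrite /d !normrM; lia.
  by lia.
rewrite en0; have [->//|[j [c [e h]]]] := coef_alt n0%:Z (- (pi / 4)) k0.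
have := hK k j n0 k0 hn0 e; rewrite h subrK => /eqP.
by rewrite mulf_eq0 (negbTE (hpt _ _ k0)) orbF h => /eqP ->; rewrite mul0r.
Qed.

End Eigen.
End Eigenfunctions.

(** * Theta functions *)

Section Theta.
Variables (R : realType) (l : nat) (k n : int).
Hypotheses (l0 : (0 < l)%N) (k0 : k != 0).
Implicit Types (P : {poly R}) (x y z s t p : R) (q : int) (v : 'rV[R]_3).

Local Notation ka := (ka R l).

Definition tau : R := 2 * pi * k%:~R * ka.
Local Notation a := `|tau|.

Let kan : ka != 0. Proof. by rewrite gt_eqF// ka_gt0. Qed.
Let kr : k%:~R != 0 :> R. Proof. by rewrite intr_eq0. Qed.

Lemma tau_neq0 : tau != 0.
Proof.
have n2 : 2 != 0 :> R by rewrite pnatr_eq0.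
have pin : pi != 0 :> R by rewrite gt_eqF// pi_gt0.
exact: mulf_neq0 (mulf_neq0 (mulf_neq0 n2 pin) kr) kan.
Qed.

Lemma norm_tau_gt0 : 0 < a. Proof. by rewrite normr_gt0 tau_neq0. Qed.

Lemma poly_growth_horner P : poly_growth (fun t => P.[t]).
Proof.
elim/poly_ind: P => [|P c IH].
  by have := poly_growth_cst (0 : R); congr poly_growth; apply/funext => t; rewrite horner0.
have := poly_growthD (poly_growthM IH (@poly_growth_id R)) (poly_growth_cst c); congr poly_growth.
by apply/funext => t; rewrite !hornerE.
Qed.

Lemma gauss_dec K : exists C, forall t, (1 + `|t|) ^+ K * gauss a t <= C.
Proof.
have a0 := norm_tau_gt0; have a4 : 0 < a / 4 by rewrite divr_gt0.
have f0 : 0 < K.+1`!%:R :> R by rewrite ltr0n fact_gt0.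
exists (expR (a / 2) * (K.+1`!%:R / (a / 4) ^+ K.+1)) => t.
set x := 1 + `|t|; have x1 : 1 <= x by rewrite lerDl.
have x0 : 0 < x by exact: lt_le_trans x1.
have h1 : gauss a t <= expR (a / 2) * expR (- (a / 4 * x ^+ 2)).
  have hx : x ^+ 2 <= 2 * (t * t) + 2.
    rewrite /x -expr2 -(real_normK (num_real t)) sqrrD.
    by have := sqr_ge0 (`|t| - 1); rewrite sqrrB; lra.
  have h : a / 4 * x ^+ 2 <= a / 4 * (2 * (t * t) + 2) by rewrite ler_pM2l.
  by rewrite /gauss -expRD ler_expR; lra.
apply: le_trans (ler_wpM2l _ h1) _; first by rewrite exprn_ge0// ltW.
rewrite mulrCA ler_pM2l ?expR_gt0// expRN ler_pdivrMr ?expR_gt0//.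
have h2 : (a / 4 * x ^+ 2) ^+ K.+1 / K.+1`!%:R <= expR (a / 4 * x ^+ 2).
  apply: le_trans (expR_ge1Dxn K _); first by rewrite lerDr.
  by rewrite mulr_ge0 ?sqr_ge0// ltW.
apply: le_trans (ler_wpM2l _ h2); last by rewrite divr_ge0 ?exprn_ge0// ltW.
have A0 : (a / 4) ^+ K.+1 != 0 by rewrite expf_neq0// gt_eqF.
have F0 : K.+1`!%:R != 0 :> R by rewrite gt_eqF.
rewrite [leRHS](_ : _ = (x ^+ 2) ^+ K.+1); last first.
  rewrite (exprMn K.+1 (a / 4) (x ^+ 2)); move: A0 F0; move: ((a / 4) ^+ K.+1) (K.+1`!%:R : R) => A F A0 F0.
  by field; rewrite ?A0 ?F0.
by rewrite -exprM; apply: ler_weXn2l => //; clear; lia.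
Qed.

Lemma pgauss_dec P : exists2 C, 0 <= C & forall t, `|P.[t]| * gauss a t * (1 + t ^+ 2) <= C.
Proof.
have [D [K [D0 hD]]] := poly_growthM (poly_growth_horner P) (poly_growthD (poly_growth_cst (1 : R)) (poly_growthM (@poly_growth_id R) (@poly_growth_id R))).
have [C hC] := gauss_dec K; exists (D * `|C|) => [|t]; first exact: mulr_ge0.
have s0 : 0 <= 1 + t * t by rewrite addr_ge0// -expr2 sqr_ge0.
have := hD t; rewrite normrM (ger0_norm s0) -expr2 => h.
rewrite mulrAC; apply: le_trans (ler_wpM2r _ h) _; first exact: ltW (gauss_gt0 _ _).
by rewrite -mulrA ler_wpM2l// (le_trans (hC t))// ler_norm.
Qed.

Definition nu : R := n%:~R / (k%:~R * ka).
Definition wq q : R := q%:~R + nu.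
Definition theta_weight q : R := (1 + `|q%:~R|) `^ (- 2).

Lemma theta_weight_summ : summ theta_weight.
Proof. by apply: summ_int_powR; rewrite ltr1n. Qed.

Lemma term_dec P (B : R) : exists C, 0 <= C /\ forall q x, `|x| <= B ->
  `|P.[x + wq q] * gauss a (x + wq q)| <= C * theta_weight q.
Proof.
have [C C0 hC] := pgauss_dec P; pose D := 2 * (1 + `|B| + `|nu|) ^+ 2.
exists (C * D); split=> [|q x xB]; first by rewrite mulr_ge0// mulr_ge0// sqr_ge0.
have g0 := ltW (gauss_gt0 a (x + wq q)); rewrite normrM (ger0_norm g0).
have q0 : 0 < 1 + `|q%:~R| :> R by rewrite ltr_pwDl.
have -> : theta_weight q = ((1 + `|q%:~R|) ^+ 2)^-1 by rewrite /theta_weight powRN powR_mulrn// ltW.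
rewrite ler_pdivlMr ?exprn_gt0//; set t := x + wq q.
have h : (1 + `|q%:~R|) ^+ 2 <= D * (1 + t ^+ 2).
  have h1 : `|q%:~R| <= `|t| + (`|B| + `|nu|).
    have -> : q%:~R = t - x - nu by rewrite /t /wq; ring.
    have := ler_normB (t - x) nu; have := ler_normB t x; have := ler_norm B; lra.
  have h2 : 1 + `|q%:~R| <= (1 + `|B| + `|nu|) * (1 + `|t|).
    have : 0 <= (`|B| + `|nu|) * `|t| by rewrite mulr_ge0// addr_ge0.
    lra.
  have h3 : (1 + `|t|) ^+ 2 <= 2 * (1 + t ^+ 2).
    by rewrite -(real_normK (num_real t)); have := sqr_ge0 (`|t| - 1); rewrite sqrrB sqrrD; lra.
  apply: le_trans (_ : ((1 + `|B| + `|nu|) * (1 + `|t|)) ^+ 2 <= _).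
    by apply: lerXn2r => //; rewrite nnegrE ?mulr_ge0 ?addr_ge0.
  rewrite exprMn; apply: le_trans (ler_wpM2l (sqr_ge0 _) h3) _.
  by rewrite /D mulrA (mulrC _ 2).
apply: le_trans (ler_wpM2l _ h) _; first by rewrite mulr_ge0// ltW// gauss_gt0.
by rewrite mulrCA mulrC ler_wpM2r// mulr_ge0// sqr_ge0.
Qed.

(** A Gaussian times a polynomial, centred at [- wq q], times a wave of frequency [n + 2 l k q] in
    [y] and [k] in the rescaled [z]; the sum over [q] restores the invariance in [x]. [P] is
    arbitrary because differentiation leaves the Hermite polynomials. *)
Definition theta_term P p q x y z : R := P.[x + wq q] * gauss a (x + wq q) * cos (tau * (wq q * y + z) + p).
Definition theta P p x y z : R := rsum (fun q => theta_term P p q x y z).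
Definition theta_fun P p v : R := theta P p (v 0 0) (v 0 1) (v 0 2).

Lemma theta_fun_pt3 P p x y z : theta_fun P p (pt3 x y z) = theta P p x y z.
Proof. by rewrite /theta_fun !pt3E. Qed.

Lemma theta_term_dec P p (B : R) : exists C, 0 <= C /\ forall q x y z, `|x| <= B ->
  `|theta_term P p q x y z| <= C * theta_weight q.
Proof.
have [C [C0 h]] := term_dec P B; exists C; split=> // q x y z xB; apply: le_trans (h q x xB).
by rewrite normrM ler_piMr// cos_max.
Qed.

Lemma theta_term_summ P p x y z : summ (fun q => theta_term P p q x y z).
Proof.
have [C [C0 h]] := theta_term_dec P p `|x|.
by apply: summ_le (summZ C theta_weight_summ) => q; exact: h.
Qed.

Lemma thetaD P Q p x y z : theta (P + Q) p x y z = theta P p x y z + theta Q p x y z.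
Proof.
rewrite /theta -rsumD; [|exact: theta_term_summ|exact: theta_term_summ]; congr rsum; apply/funext => q.
by rewrite /theta_term hornerD; ring.
Qed.

Lemma thetaZ c P p x y z : theta (c *: P) p x y z = c * theta P p x y z.
Proof.
rewrite /theta -rsumZ; last exact: theta_term_summ; congr rsum; apply/funext => q.
by rewrite /theta_term hornerZ; ring.
Qed.

Lemma thetaN P p x y z : theta (- P) p x y z = - theta P p x y z.
Proof. by rewrite -scaleN1r thetaZ mulN1r. Qed.

Lemma theta_pi P p x y z : theta P (p - pi / 2 - pi / 2) x y z = - theta P p x y z.
Proof.
rewrite -[RHS]mulN1r /theta -rsumZ; last exact: theta_term_summ; congr rsum; apply/funext => q.
rewrite /theta_term [RHS]mulN1r -[RHS]mulrN -[in RHS]cosDpi -[in RHS](cos_int (-1)); congr (_ * cos _).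
by rewrite mulrN1z; field.
Qed.

Lemma near_norm x y (r : R) : `|y - x| <= r -> `|y| <= `|x| + r.
Proof.
move=> h; rewrite -(subrK x y); apply: le_trans (ler_normD _ _) _.
by rewrite addrC lerD2l.
Qed.

Lemma theta_dx P p x y z : is_derive x 1 (fun x => theta P p x y z) (theta (gstep a P) p x y z).
Proof.
have [C [C0 h]] := theta_term_dec (gstep a P) p (`|x| + 1).
apply: (@rsum_is_derive _ _ (fun q x => theta_term P p q x y z) (fun q x => theta_term (gstep a P) p q x y z)
  (fun q => C * theta_weight q) x 1) => //.
- move=> q t _; apply: drv_eq (drvM (drv_shift (drv_pgauss a P (t + wq q))) (drv_cst t _)) _.
  by rewrite mulr0 addr0.
- by move=> t _; exact: theta_term_summ.
- exact: summZ theta_weight_summ.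
- by move=> q t /near_norm; exact: h.
Qed.

Lemma theta_dz P p x y z : is_derive z 1 (fun z => theta P p x y z) (- tau * theta P (p - pi / 2) x y z).
Proof.
have [C [C0 h]] := theta_term_dec P (p - pi / 2) `|x|.
rewrite /theta -rsumZ; last exact: theta_term_summ.
apply: (@rsum_is_derive _ _ (fun q z => theta_term P p q x y z) (fun q z => - tau * theta_term P (p - pi / 2) q x y z)
   (fun q => a * (C * theta_weight q)) z 1) => //.
- move=> q t _; have := drv_cos_lin tau (tau * (wq q * y) + p) t.
  move=> hc; apply: (@is_derive_ext _ (fun t => P.[x + wq q] * gauss a (x + wq q) * cos (tau * t + (tau * (wq q * y) + p)))).
    by move=> t'; rewrite /theta_term; congr (_ * cos _); ring.
  apply: drv_eq (drvZ _ hc) _; rewrite /theta_term.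
  rewrite (_ : tau * t + (tau * (wq q * y) + p - pi / 2) = tau * (wq q * y + t) + (p - pi / 2)); last by ring.
  by ring.
- by move=> t _; exact: theta_term_summ.
- by apply: summZ; exact: summZ theta_weight_summ.
- by move=> q t _; rewrite normrM normrN ler_wpM2l// h.
Qed.

(** A derivative in [y] brings down [wq q], written as [(x + wq q) - x]: the first part multiplies
    [P] by ['X], the second is the explicit factor [x]. *)
Lemma theta_dy P p x y z : is_derive y 1 (fun y => theta P p x y z)
  (- tau * (theta ('X * P) (p - pi / 2) x y z - x * theta P (p - pi / 2) x y z)).
Proof.
have [C [C0 h]] := theta_term_dec ('X * P) (p - pi / 2) `|x|.
have [D [D0 h']] := theta_term_dec P (p - pi / 2) `|x|.
rewrite /theta -rsumZ; last exact: theta_term_summ.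
rewrite -rsumB; [|exact: theta_term_summ|by apply: summZ; exact: theta_term_summ].
rewrite -rsumZ; last by apply: summB; [exact: theta_term_summ|by apply: summZ; exact: theta_term_summ].
apply: (@rsum_is_derive _ _ (fun q y => theta_term P p q x y z)
   (fun q y => - tau * (theta_term ('X * P) (p - pi / 2) q x y z - x * theta_term P (p - pi / 2) q x y z))
   (fun q => a * (C * theta_weight q + `|x| * (D * theta_weight q))) y 1) => //.
- move=> q t _; have := drv_cos_lin (tau * wq q) (tau * z + p) t.
  move=> hc; apply: (@is_derive_ext _ (fun t => P.[x + wq q] * gauss a (x + wq q) * cos (tau * wq q * t + (tau * z + p)))).
    by move=> t'; rewrite /theta_term; congr (_ * cos _); ring.
  apply: drv_eq (drvZ _ hc) _; rewrite /theta_term hornerM hornerX.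
  rewrite (_ : tau * wq q * t + (tau * z + p - pi / 2) = tau * (wq q * t + z) + (p - pi / 2)); last by ring.
  by ring.
- by move=> t _; exact: theta_term_summ.
- apply: summZ; apply: summD; first exact: summZ theta_weight_summ.
  by apply: summZ; exact: summZ theta_weight_summ.
- move=> q t _; rewrite normrM normrN ler_wpM2l//.
  apply: le_trans (ler_normB _ _) _; apply: lerD; first exact: h.
  by rewrite normrM ler_wpM2l// h'.
Qed.

Lemma theta_fun_cont P p : continuous (theta_fun P p).
Proof.
move=> v; have [C [C0 h]] := theta_term_dec P p (`|v 0 0| + 1).
apply: (@rsum_continuous _ _ _ (fun q (v : 'rV[R]_3) => theta_term P p q (v 0 0) (v 0 1) (v 0 2)) (fun q => C * theta_weight q)).
- move=> q; suff : continuous (fun v : 'rV[R]_3 => theta_term P p q (v 0 0) (v 0 1) (v 0 2)) by apply.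
  have cx : continuous (fun v : 'rV[R]_3 => v 0 0 + wq q) by apply: contD; [exact: coord_cont|exact: cont_cst].
  apply: contM.
    apply: contM.
      by apply: (@cont_comp _ _ (fun t => P.[t])) cx; apply: is_derive_continuous => t; exact: is_derive_poly.
    by apply: cont_comp cx; apply: is_derive_continuous => t; exact: drv_gauss.
  apply: cont_comp; first exact: continuous_cos.
  apply: contD; last exact: cont_cst.
  by apply: contZ; apply: contD; [apply: contZ|]; exact: coord_cont.
- exact: summZ theta_weight_summ.
- have /cvgrPdist_le/(_ 1 ltr01) := @coord_cont R 0 v; apply: filterS => u hu q.
  by apply: h; apply: near_norm; rewrite distrC.
Qed.

Lemma is_derive_line (f : 'rV[R]_3 -> R) v e d :
  is_derive v e f d <-> is_derive (0 : R) 1 (fun t => f (t *: e + v)) d.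
Proof.
have E : v = (0 : R) *: e + v by rewrite scale0r add0r.
rewrite {1}E; apply: (@is_derive_path _ (fun t => t *: e + v)) => h.
by rewrite scale0r add0r addr0.
Qed.

(** The closure that makes [smooth_class] applicable: the generator for multiplication by the
    coordinate [x] accounts for the explicit [x] in [theta_dy]. *)
Inductive theta_class : ('rV[R]_3 -> R) -> Prop :=
| theta_class_base P p : theta_class (theta_fun P p)
| theta_class_add f g : theta_class f -> theta_class g -> theta_class (fun v => f v + g v)
| theta_class_scale (c : R) f : theta_class f -> theta_class (fun v => c * f v)
| theta_class_mulx f : theta_class f -> theta_class (fun v => v 0 0 * f v).

Lemma theta_class_derive f : theta_class f -> continuous f /\
  forall i, exists2 g, theta_class g & forall v, is_derive v (delta_mx 0 i) f (g v).
Proof.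
elim=> {f} [P p|f g tf [cf df] tg [cg dg]|c f tf [cf df]|f tf [cf df]].
- split; first exact: theta_fun_cont.
  apply: ord3_ind.
  + exists (theta_fun (gstep a P) p) => [|v]; first exact: theta_class_base.
    rewrite (pt3_eta v) theta_fun_pt3; apply/is_derive_x.
    by apply: is_derive_ext (theta_dx P p _ _ _) => t; rewrite theta_fun_pt3.
  + exists (fun v => - tau * (theta_fun ('X * P) (p - pi / 2) v + -1 * (v 0 0 * theta_fun P (p - pi / 2) v))).
      by apply: theta_class_scale; apply: theta_class_add; [exact: theta_class_base|apply: theta_class_scale; apply: theta_class_mulx; exact: theta_class_base].
    move=> v; rewrite (pt3_eta v) !theta_fun_pt3 mulN1r pt3E; apply/is_derive_y.
    by apply: is_derive_ext (theta_dy P p _ _ _) => t; rewrite theta_fun_pt3.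
  + exists (fun v => - tau * theta_fun P (p - pi / 2) v) => [|v]; first by apply: theta_class_scale; exact: theta_class_base.
    rewrite (pt3_eta v) theta_fun_pt3; apply/is_derive_z.
    by apply: is_derive_ext (theta_dz P p _ _ _) => t; rewrite theta_fun_pt3.
- split=> [|i]; first exact: contD.
  have [f' tf' hf] := df i; have [g' tg' hg] := dg i.
  exists (fun v => f' v + g' v) => [|v]; first exact: theta_class_add.
  have /is_derive_line h1 := hf v; have /is_derive_line h2 := hg v.
  by apply/is_derive_line; exact: drvD h1 h2.
- split=> [|i]; first exact: contZ.
  have [f' tf' hf] := df i; exists (fun v => c * f' v) => [|v]; first exact: theta_class_scale.
  by have /is_derive_line h1 := hf v; apply/is_derive_line; exact: drvZ h1.
- split=> [|i]; first by apply: contM => //; exact: coord_cont.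
  have [f' tf' hf] := df i; exists (fun v => (delta_mx 0 i : 'rV[R]_3) 0 0 * f v + v 0 0 * f' v) => [|v].
    by apply: theta_class_add; [exact: theta_class_scale|exact: theta_class_mulx].
  have h1 : is_derive (0 : R) 1 (fun t : R => (t *: (delta_mx 0 i : 'rV[R]_3) + v) 0 0) ((delta_mx 0 i : 'rV[R]_3) 0 0).
    apply: (@is_derive_ext _ (fun t => t * (delta_mx 0 i : 'rV[R]_3) 0 0 + v 0 0)) => [t|]; first by rewrite !mxE.
    by apply: drv_eq (drvD (drvM (drv_id 0) (drv_cst 0 _)) (drv_cst 0 _)) _; ring.
  have /is_derive_line h2 := hf v.
  apply/is_derive_line; apply: drv_eq (drvM h1 h2) _.
  by rewrite scale0r add0r.
Qed.

Lemma theta_fun_smooth P p : smooth (theta_fun P p).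
Proof.
apply: (@smooth_class R [set f | theta_class f]); last exact: theta_class_base.
move=> f /= /theta_class_derive[cf df]; split=> // i; have [g tg hg] := df i; split.
  by rewrite (_ : partial i f = g)//; apply/funext => v; exact: partialE.
by move=> v; have [] := hg v.
Qed.

Lemma theta_fun_partial0 P p : partial 0 (theta_fun P p) = theta_fun (gstep a P) p.
Proof.
apply/funext => v; rewrite (pt3_eta v) theta_fun_pt3; apply: partialE; apply/is_derive_x.
by apply: is_derive_ext (theta_dx P p _ _ _) => t; rewrite theta_fun_pt3.
Qed.

Lemma theta_fun_partial1 P p : partial 1 (theta_fun P p) =
  fun v => - tau * (theta_fun ('X * P) (p - pi / 2) v - v 0 0 * theta_fun P (p - pi / 2) v).
Proof.
apply/funext => v; rewrite (pt3_eta v) !theta_fun_pt3 pt3E; apply: partialE; apply/is_derive_y.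
by apply: is_derive_ext (theta_dy P p _ _ _) => t; rewrite theta_fun_pt3.
Qed.

Lemma theta_fun_partial2 P p : partial 2 (theta_fun P p) = fun v => - tau * theta_fun P (p - pi / 2) v.
Proof.
apply/funext => v; rewrite (pt3_eta v) !theta_fun_pt3; apply: partialE; apply/is_derive_z.
by apply: is_derive_ext (theta_dz P p _ _ _) => t; rewrite theta_fun_pt3.
Qed.

(** The explicit factors [x] cancel between the derivatives in [y] and [z], leaving [- tau^2] times
    the theta function of ['X^2 P] and of [P]. The first cancels the term [a^2 'X^2 P] of
    [gstep2_hermite], as [a = |tau|]. *)
Lemma theta_fun_eigen j p v : laplacian (@heis_metric R) (theta_fun (hermite a j) p) v =
  (tau ^+ 2 + a * (2 * j%:R + 1)) * theta_fun (hermite a j) p v.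
Proof.
rewrite (pt3_eta v); move: (v 0 0) (v 0 1) (v 0 2) => x y z {v}.
rewrite (laplacianE _ _ _ (theta_fun_smooth _ _)) !theta_fun_partial0 theta_fun_partial1 theta_fun_partial2.
set P := hermite a j; set p1 := p - pi / 2.
have e11 : partial 1 (fun v => - tau * (theta_fun ('X * P) p1 v - v 0 0 * theta_fun P p1 v)) (pt3 x y z) =
   - tau ^+ 2 * (theta ('X * ('X * P)) p x y z - 2 * x * theta ('X * P) p x y z + x ^+ 2 * theta P p x y z).
  apply: partialE; apply/is_derive_y.
  apply: (@is_derive_ext _ (fun t => - tau * (theta ('X * P) p1 x t z - x * theta P p1 x t z))) => [t|].
    by rewrite !theta_fun_pt3 pt3E.
  apply: drv_eq (drvZ (- tau) (drvB (theta_dy ('X * P) p1 x y z) (drvZ x (theta_dy P p1 x y z)))) _.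
  by rewrite !theta_pi; ring.
have e12 : partial 1 (fun v => - tau * theta_fun P p1 v) (pt3 x y z) =
   - tau ^+ 2 * (theta ('X * P) p x y z - x * theta P p x y z).
  apply: partialE; apply/is_derive_y.
  apply: (@is_derive_ext _ (fun t => - tau * theta P p1 x t z)) => [t|]; first by rewrite theta_fun_pt3.
  apply: drv_eq (drvZ (- tau) (theta_dy P p1 x y z)) _.
  by rewrite !theta_pi; ring.
have e21 : partial 2 (fun v => - tau * (theta_fun ('X * P) p1 v - v 0 0 * theta_fun P p1 v)) (pt3 x y z) =
   - tau ^+ 2 * (theta ('X * P) p x y z - x * theta P p x y z).
  apply: partialE; apply/is_derive_z.
  apply: (@is_derive_ext _ (fun t => - tau * (theta ('X * P) p1 x y t - x * theta P p1 x y t))) => [t|].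
    by rewrite !theta_fun_pt3 pt3E.
  apply: drv_eq (drvZ (- tau) (drvB (theta_dz ('X * P) p1 x y z) (drvZ x (theta_dz P p1 x y z)))) _.
  by rewrite !theta_pi; ring.
have e22 : partial 2 (fun v => - tau * theta_fun P p1 v) (pt3 x y z) = - tau ^+ 2 * theta P p x y z.
  apply: partialE; apply/is_derive_z.
  apply: (@is_derive_ext _ (fun t => - tau * theta P p1 x y t)) => [t|]; first by rewrite theta_fun_pt3.
  apply: drv_eq (drvZ (- tau) (theta_dz P p1 x y z)) _.
  by rewrite !theta_pi; ring.
rewrite e11 e12 e21 e22 !theta_fun_pt3 gstep2_hermite thetaD thetaN !thetaZ.
rewrite real_normK ?num_real//; ring.
Qed.

(** A translation of [x] by [m] is absorbed by the reindexing [q -> q + m]; the remaining change of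
    phase is an integer multiple of [2 pi]. *)
Lemma theta_fun_inv P p (m n' k' : int) x y z :
  theta_fun P p (pt3 (m%:~R + x) (n'%:~R + y) (k'%:~R / ka + (z + m%:~R * y))) = theta_fun P p (pt3 x y z).
Proof.
rewrite !theta_fun_pt3 /theta.
have hb : bijective (fun q : int => q + m) by exists (fun q => q - m) => q; rewrite ?addrK ?subrK.
rewrite -(rsum_bij hb (theta_term_summ P p x y z)); congr rsum; apply/funext => q /=.
have ew : wq (q + m) = wq q + m%:~R by rewrite /wq intrD; ring.
rewrite /theta_term (_ : m%:~R + x + wq q = x + wq (q + m)); last by rewrite ew; ring.
congr (_ * _); rewrite -[RHS](cos_int (2 * (l%:Z * k) * q * n' + n * n' + k * k')); congr cos.
rewrite ew !(intrD, intrM) /wq /nu /tau /ka; field.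
by rewrite kr andbT pnatr_eq0 -lt0n.
Qed.

Lemma xslice_theta_fun P p x (u : R * R) : xslice l (theta_fun P p) x u =
  rsum (fun q => P.[x + wq q] * gauss a (x + wq q) * wave (n + q * (2 * (l%:Z * k))) k p u).
Proof.
rewrite /xslice theta_fun_pt3; congr rsum; apply/funext => q; rewrite /theta_term /wave; congr (_ * cos _).
rewrite !(intrD, intrM) /wq /nu /tau /ka; field.
by rewrite kr andbT pnatr_eq0 -lt0n.
Qed.

Lemma coef_rsum m n' p (F : int -> R * R -> R) (M : int -> R) : (forall q, continuous (F q)) ->
  summ M -> (forall q u, `|F q u| <= M q) ->
  coef m n' p (fun u => rsum (F^~ u)) = rsum (fun q => coef m n' p (F q)).
Proof.
move=> cF sM hM; have cw q := @coef_cont R m n' p _ (cF q).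
have hMw q u : `|F q u * wave m n' p u| <= M q.
  by apply: le_trans (hM q u); rewrite normrM ler_piMr// cos_max.
rewrite /coef /integ2 -(@integ_rsum _ _ _ M 0 1); last 3 first.
- by move=> q; exact: (@cont_integ2 R _ (cw q)).
- exact: sM.
- move=> q s; have := @integ_norm R (fun t => F q (s, t) * wave m n' p (s, t)) 0 1 (M q) ler01.
  rewrite subr0 mulr1; apply; last by move=> t _; exact: hMw.
  exact: (@continuous_slice R R _ s (cw q)).
apply: eq_integ => s; rewrite -(@integ_rsum _ _ _ M 0 1).
- apply: eq_integ => t; rewrite mulrC -rsumZ; last by apply: summ_le sM => q; exact: hM.
  by congr rsum; apply/funext => q; rewrite mulrC.
- by move=> q; exact: (@continuous_slice R R _ s (cw q)).
- exact: sM.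
- by move=> q t; exact: hMw.
Qed.

Lemma coef_theta_fun P x n' k' : coef n' k' (- (pi / 4)) (xslice l (theta_fun P (- (pi / 4))) x) =
  rsum (fun q => P.[x + wq q] * gauss a (x + wq q) *
    (if (n + q * (2 * (l%:Z * k)) == n') && (k == k') then 2^-1 else 0)).
Proof.
have [C [C0 h]] := term_dec P `|x|.
rewrite (eq_coef _ _ _ (xslice_theta_fun P (- (pi / 4)) x)) (@coef_rsum _ _ _ _ (fun q => C * theta_weight q)).
- congr rsum; apply/funext => q; rewrite wcoefZ; last exact: wave_cont.
  by rewrite /coef wave_ortho.
- by move=> q; apply: contZ; exact: wave_cont.
- exact: summZ theta_weight_summ.
- by move=> q u; apply: le_trans (h q x (lexx _)); rewrite normrM ler_piMr// cos_max.
Qed.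

Lemma integ_wave m k' p y : k' != 0 -> integ (fun t => wave m k' p (y, t)) 0 1 = 0.
Proof.
move=> k'0; have pin : 2 * pi * k'%:~R != 0 :> R.
  have n2 : 2 != 0 :> R by rewrite pnatr_eq0.
  have pi0 : pi != 0 :> R by rewrite gt_eqF// pi_gt0.
  by apply: mulf_neq0 (mulf_neq0 n2 pi0) _; rewrite intr_eq0.
have h t : is_derive t 1 (fun t => - (2 * pi * k'%:~R)^-1 * wave m k' (p + pi / 2) (y, t)) (wave m k' p (y, t)).
  apply: drv_eq (drvZ _ (wave_d2 m k' (p + pi / 2) y t)) _.
  by rewrite addrK mulrA mulrNN mulVf// mul1r.
by rewrite (integ_eq 0 1 h) -[1]add0r wave_shift2 subrr.
Qed.

Lemma zmean_theta_fun P p u : zmean l (theta_fun P p) u = 0.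
Proof.
have [C [C0 h]] := term_dec P `|u.1|.
rewrite /zmean (@eq_integ _ _ (fun t => rsum (fun q => P.[u.1 + wq q] * gauss a (u.1 + wq q) *
   wave (n + q * (2 * (l%:Z * k))) k p (u.2, t)))); last first.
  by move=> t; have := xslice_theta_fun P p u.1 (u.2, t); rewrite /xslice.
have cw q : continuous (fun t => wave (n + q * (2 * (l%:Z * k))) k p (u.2, t)).
  exact: (@continuous_slice R R _ u.2 (@wave_cont R _ _ _)).
rewrite (@integ_rsum _ _ (fun q t => P.[u.1 + wq q] * gauss a (u.1 + wq q) *
   wave (n + q * (2 * (l%:Z * k))) k p (u.2, t)) (fun q => C * theta_weight q)).
- rewrite (_ : (fun q => _) = fun=> 0) ?rsum0//.
  by apply/funext => q; rewrite integZ// integ_wave// mulr0.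
- by move=> q; exact: contZ.
- exact: summZ theta_weight_summ.
- by move=> q t; apply: le_trans (h q _ (lexx _)); rewrite normrM ler_piMr// cos_max.
Qed.

End Theta.

(** * Waves on the torus as functions on the group *)

Section TorusFunctions.
Variables (R : realType) (l : nat).
Hypothesis l0 : (0 < l)%N.
Implicit Types (m n k : int) (p x y z : R) (v : 'rV[R]_3).

Definition psi m n p v : R := wave m n p (v 0 0, v 0 1).

Lemma psi_d0 m n p x y z : is_derive x 1 (fun t => psi m n p (pt3 t y z)) (- (2 * pi * m%:~R) * psi m n (p - pi / 2) (pt3 x y z)).
Proof.
rewrite /psi !pt3E; apply: is_derive_ext (wave_d1 m n p x y) => t; by rewrite !pt3E.
Qed.

Lemma psi_d1 m n p x y z : is_derive y 1 (fun t => psi m n p (pt3 x t z)) (- (2 * pi * n%:~R) * psi m n (p - pi / 2) (pt3 x y z)).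
Proof.
rewrite /psi !pt3E; apply: is_derive_ext (wave_d2 m n p x y) => t; by rewrite !pt3E.
Qed.

Lemma psi_d2 m n p x y z : is_derive z 1 (fun t => psi m n p (pt3 x y t)) 0.
Proof.
by apply: is_derive_ext (drv_cst z (wave m n p (x, y))) => t; rewrite /psi !pt3E.
Qed.

Definition psi_freq m n (i : 'I_3) : R := nth 0 [:: - (2 * pi * m%:~R); - (2 * pi * n%:~R); 0] i.

Lemma psi_derive m n p i v : is_derive v (delta_mx 0 i) (psi m n p) (psi_freq m n i * psi m n (p - pi / 2) v).
Proof.
rewrite (pt3_eta v); move: i; apply: ord3_ind.
- by apply/is_derive_x; exact: psi_d0.
- by apply/is_derive_y; exact: psi_d1.
- by apply/is_derive_z; rewrite mul0r; exact: psi_d2.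
Qed.

Lemma psi_smooth m n p : smooth (psi m n p).
Proof.
apply: (@smooth_class R [set f | exists c p, f = fun v => c * psi m n p v]); last first.
  by exists 1, p; apply/funext => v; rewrite mul1r.
move=> f /= [c [p' ->]]; have d i v : is_derive v (delta_mx 0 i) (fun v => c * psi m n p' v)
    (c * (psi_freq m n i * psi m n (p' - pi / 2) v)).
  by apply/is_derive_line; apply: drvZ; apply/is_derive_line; exact: psi_derive.
split.
  apply: contZ; apply: (@continuous_comp' _ _ _ (wave m n p') (fun v : 'rV[R]_3 => (v 0 0, v 0 1))).
    by apply: continuous_pair; exact: coord_cont.
  exact: wave_cont.
move=> i; split; last by move=> v; have [] := d i v.
exists (c * psi_freq m n i), (p' - pi / 2); apply/funext => v; apply: partialE.
by rewrite -mulrA; exact: d.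
Qed.

Lemma psi_partial m n p i : partial i (psi m n p) = fun v => psi_freq m n i * psi m n (p - pi / 2) v.
Proof. by apply/funext => v; apply: partialE; exact: psi_derive. Qed.

Lemma psi_partial2 m n p i i' v : partial i' (partial i (psi m n p)) v =
  - (psi_freq m n i * psi_freq m n i') * psi m n p v.
Proof.
rewrite psi_partial; apply: partialE.
have h : is_derive v (delta_mx 0 i') (fun v => psi_freq m n i * psi m n (p - pi / 2) v)
    (psi_freq m n i * (psi_freq m n i' * psi m n (p - pi / 2 - pi / 2) v)).
  by apply/is_derive_line; apply: drvZ; apply/is_derive_line; exact: psi_derive.
have [h1 h2] := h; split=> //; rewrite h2 /psi wave_pi; ring.
Qed.

Lemma psi_eigen m n p v : laplacian (@heis_metric R) (psi m n p) v =
  4 * pi ^+ 2 * (m%:~R ^+ 2 + n%:~R ^+ 2) * psi m n p v.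
Proof.
rewrite (pt3_eta v); move: (v 0 0) (v 0 1) (v 0 2) => x y z.
apply: etrans (laplacianE x y z (psi_smooth m n p)) _.
rewrite !psi_partial2 /psi_freq /=; move: (psi m n p _) => t; ring.
Qed.

Lemma psi_inv m n p (m' n' k' : int) x y z :
  psi m n p (pt3 (m'%:~R + x) (n'%:~R + y) (k'%:~R / ka R l + (z + m'%:~R * y))) = psi m n p (pt3 x y z).
Proof.
rewrite /psi !pt3E /wave/= -[RHS](cos_int (m * m' + n * n')); congr cos.
by rewrite !(intrD, intrM); ring.
Qed.

Lemma zmean_psi m n p : zmean l (psi m n p) = wave m n p.
Proof.
apply/funext => -[x y]; rewrite /zmean (@eq_integ _ _ (fun=> wave m n p (x, y))).
  by rewrite (integ_eq 0 1 (fun t => drv_eq (drvZ (wave m n p (x, y)) (drv_id t)) (mulr1 _))) mulr0 mulr1 subr0.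
by move=> t; rewrite /psi !pt3E.
Qed.

Lemma coef_psi m n p n' k p' x : k != 0 -> coef n' k p' (xslice l (psi m n p) x) = 0.
Proof.
move=> k0; rewrite /coef /integ2 (@eq_integ _ _ (fun=> 0)).
  by rewrite (integ_eq 0 1 (fun x => drv_cst x 0)) subrr.
move=> s; rewrite (@eq_integ _ _ (fun t => wave m n p (x, s) * wave n' k p' (s, t))).
  rewrite integZ; first by rewrite integ_wave// mulr0.
  exact: (@continuous_slice R R _ s (@wave_cont R _ _ _)).
by move=> t; rewrite /xslice /psi !pt3E.
Qed.

End TorusFunctions.

(** * The spectrum with multiplicities *)

Section Dimension.
Variables (R : realType) (V : lmodType R).
Implicit Types (E : set V).

(** The two change of basis matrices have the identity of size [m] as product through size [n]. *)
Lemma has_dim_le E m n : has_dim E m -> has_dim E n -> (m <= n)%N.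
Proof.
move=> [b [fb eb]] [d [fd ed]].
have bd i : exists c : 'I_n -> R, b i = \sum_j c j *: d j.
  have : E (b i).
    rewrite eb; exists (fun j => (j == i)%:R); rewrite (bigD1 i)//= eqxx scale1r.
    by rewrite big1 ?addr0// => j /negbTE ->; rewrite scale0r.
  by rewrite ed.
have db i : exists c : 'I_m -> R, d i = \sum_j c j *: b j.
  have : E (d i).
    rewrite ed; exists (fun j => (j == i)%:R); rewrite (bigD1 i)//= eqxx scale1r.
    by rewrite big1 ?addr0// => j /negbTE ->; rewrite scale0r.
  by rewrite eb.
have [B hB] := choice bd; have [D hD] := choice db.
have : (\matrix_(i, j) B i j) *m (\matrix_(i, j) D i j) = 1%:M.
  apply/matrixP => i k; apply/eqP; rewrite -subr_eq0; apply/eqP.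
  apply: (fb (fun k => ((\matrix_(i, j) B i j) *m (\matrix_(i, j) D i j)) i k - (1%:M : 'M[R]_m) i k)).
  under eq_bigr do rewrite scalerBl.
  rewrite sumrB; apply/eqP; rewrite subr_eq0; apply/eqP.
  rewrite [RHS](bigD1 i)//= mxE eqxx scale1r [X in _ + X]big1 ?addr0; last first.
    by move=> j ji; rewrite mxE eq_sym (negbTE ji) scale0r.
  rewrite [RHS]hB; under [RHS]eq_bigr do rewrite hD scaler_sumr.
  rewrite exchange_big/=; apply: eq_bigr => j _; rewrite mxE scaler_suml.
  by apply: eq_bigr => p _; rewrite !mxE scalerA.
exact: mulmx1_min.
Qed.

Lemma has_dim_dimE E m : has_dim E m -> Defs.dim E = m.
Proof.
move=> h; have h' : has_dim E (Defs.dim E) by apply: xgetPex; exists m.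
by apply/eqP; rewrite eqn_leq (has_dim_le h h') (has_dim_le h' h).
Qed.

(** Functionals biorthogonal to [e] give independence. For spanning, [v] minus its expansion with
    coefficients [phi i v / c i] is annihilated by all of them, hence is 0. *)
Lemma has_dim_dual (J : eqType) (s : seq J) E (e : J -> V) (phi : J -> V -> R) (c : J -> R) :
  uniq s -> E 0 -> (forall a u v, E u -> E v -> E (a *: u + v)) ->
  (forall i a u v, E u -> E v -> phi i (a *: u + v) = a * phi i u + phi i v) ->
  (forall i, i \in s -> E (e i)) ->
  (forall i j, i \in s -> j \in s -> phi i (e j) = if i == j then c i else 0) ->
  (forall i, i \in s -> c i != 0) ->
  (forall v, E v -> (forall i, i \in s -> phi i v = 0) -> v = 0) ->
  has_dim E (size s).
Proof.
move=> us E0 El pl Ee pe c0 sep.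
have Esum (r : seq 'I_(size s)) (k : 'I_(size s) -> R) :
    E (\sum_(i <- r) k i *: e (tnth (in_tuple s) i)).
  elim: r => [|i r IH]; first by rewrite big_nil.
  by rewrite big_cons; apply: El => //; apply: Ee; exact: mem_tnth.
have p0 i : phi i 0 = 0.
  by have := pl i (-1) 0 0 E0 E0; rewrite scaler0 addr0 mulN1r addNr.
have psum j (r : seq 'I_(size s)) (k : 'I_(size s) -> R) :
    phi j (\sum_(i <- r) k i *: e (tnth (in_tuple s) i)) = \sum_(i <- r) k i * phi j (e (tnth (in_tuple s) i)).
  elim: r => [|i r IH]; first by rewrite !big_nil.
  by rewrite !big_cons pl ?IH//; apply: Ee; exact: mem_tnth.
have pt (i j : 'I_(size s)) : phi (tnth (in_tuple s) i) (e (tnth (in_tuple s) j)) =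
    if i == j then c (tnth (in_tuple s) i) else 0.
  rewrite pe ?mem_tnth//; congr (if _ then _ else _).
  by apply/eqP/eqP => [|-> //]; apply: (tuple_uniqP (in_tuple s)).
have pdiag (i : 'I_(size s)) (k : 'I_(size s) -> R) :
    phi (tnth (in_tuple s) i) (\sum_j k j *: e (tnth (in_tuple s) j)) = k i * c (tnth (in_tuple s) i).
  rewrite psum (bigD1 i)//= pt eqxx big1 ?addr0// => j ji.
  by rewrite pt eq_sym (negbTE ji) mulr0.
exists (fun i => e (tnth (in_tuple s) i)); split=> [k k0 i|].
  have := pdiag i k; rewrite k0 p0 => /esym/eqP.
  by rewrite mulf_eq0 (negbTE (c0 _ _)) ?mem_tnth// orbF => /eqP.
apply/seteqP; split=> [v Ev|_ [k ->]]; last exact: Esum.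
pose k (i : 'I_(size s)) := phi (tnth (in_tuple s) i) v / c (tnth (in_tuple s) i).
exists k; apply/esym/eqP; rewrite -subr_eq0; apply/eqP.
have -> : \sum_i k i *: e (tnth (in_tuple s) i) - v = (-1) *: v + \sum_i k i *: e (tnth (in_tuple s) i).
  by rewrite scaleN1r addrC.
apply: sep; first by apply: El => //; exact: Esum.
move=> j js; have /tnthP[i ->] : j \in in_tuple s by [].
by rewrite (pl _ _ _ _ Ev (Esum _ k)) pdiag /k divfK ?mulN1r ?addNr// c0// mem_tnth.
Qed.

End Dimension.

(** * Explicit eigenfunctions, dual functionals and multiplicities *)

Section Spectrum.
Variables (R : realType) (l : nat).
Hypothesis l0 : (0 < l)%N.
Implicit Types (f g : 'rV[R]_3 -> R) (v : 'rV[R]_3) (lam : R).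

Lemma smooth_lin (a : R) f g : smooth f -> smooth g -> smooth (fun v => a * f v + g v).
Proof.
move=> sf sg; apply: (@smooth_class R [set h | exists f g, smooth f /\ smooth g /\ h = fun v => a * f v + g v]).
  move=> _ [f' [g' [sf' [sg' ->]]]]; split.
    have cf := smooth_cont sf'; have cg := smooth_cont sg'.
    have caf : continuous (fun v => a * f' v) by exact: contZ.
    exact: contD.
  move=> i; have D p : is_derive p (delta_mx 0 i) (fun v => a * f' v + g' v) (a * partial i f' p + partial i g' p).
      exact: is_deriveD (is_deriveZ a (smooth_derive i p sf')) (smooth_derive i p sg').
  split; last by move=> p; have [] := D p.
  exists (partial i f'), (partial i g'); split; first exact: smooth_partial.
  by split; [exact: smooth_partial|apply/funext => p; exact: partialE].
by exists f, g.
Qed.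

Lemma partial_lin (a : R) f g i v : smooth f -> smooth g ->
  partial i (fun v => a * f v + g v) v = a * partial i f v + partial i g v.
Proof.
move=> sf sg; apply: partialE.
exact: is_deriveD (is_deriveZ a (smooth_derive i v sf)) (smooth_derive i v sg).
Qed.

Lemma partial2_lin (a : R) f g i j v : smooth f -> smooth g ->
  partial i (partial j (fun v => a * f v + g v)) v = a * partial i (partial j f) v + partial i (partial j g) v.
Proof.
move=> sf sg.
have -> : partial j (fun v => a * f v + g v) = fun v => a * partial j f v + partial j g v.
  by apply/funext => p; exact: partial_lin.
by apply: partial_lin; exact: smooth_partial.
Qed.

Lemma laplacian_lin (a : R) f g v : smooth f -> smooth g ->
  laplacian (@heis_metric R) (fun v => a * f v + g v) v =
  a * laplacian (@heis_metric R) f v + laplacian (@heis_metric R) g v.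
Proof.
move=> sf sg; rewrite (pt3_eta v); move: (v 0 0) (v 0 1) (v 0 2) => x y z.
rewrite (laplacianE _ _ _ (smooth_lin a sf sg)) (laplacianE _ _ _ sf) (laplacianE _ _ _ sg).
rewrite (partial2_lin a 0 0 _ sf sg) (partial2_lin a 1 1 _ sf sg) (partial2_lin a 1 2 _ sf sg).
rewrite (partial2_lin a 2 1 _ sf sg) (partial2_lin a 2 2 _ sf sg).
move: (partial 0 (partial 0 f) _) (partial 1 (partial 1 f) _) (partial 1 (partial 2 f) _).
move: (partial 2 (partial 1 f) _) (partial 2 (partial 2 f) _).
move: (partial 0 (partial 0 g) _) (partial 1 (partial 1 g) _) (partial 1 (partial 2 g) _).
move: (partial 2 (partial 1 g) _) (partial 2 (partial 2 g) _) => *.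
ring.
Qed.

Lemma heis_eigenspace_lin lam (a : R) f g : heis_eigenspace l lam f -> heis_eigenspace l lam g ->
  heis_eigenspace l lam (a *: f + g).
Proof.
move=> [sf hf ef] [sg hg eg]; have E : a *: f + g = fun v => a * f v + g v by [].
rewrite E; split.
- exact: smooth_lin.
- by move=> A p q hA hq; rewrite (hf A p q)// (hg A p q).
- by move=> p; rewrite laplacian_lin// ef eg; ring.
Qed.

Lemma smooth0 : smooth (fun _ : 'rV[R]_3 => 0 : R).
Proof.
apply: (@smooth_class R [set h | h = fun=> 0]) => // _ ->; split; first exact: cont_cst.
move=> i; have D (p : 'rV[R]_3) : is_derive p (delta_mx 0 i) (fun _ : 'rV[R]_3 => 0 : R) 0 by exact: is_derive_cst.
by split=> [|p]; [apply/funext => p; exact: partialE|have [] := D p].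
Qed.

Lemma heis_eigenspace0 lam : heis_eigenspace l lam (0 : 'rV[R]_3 -> R).
Proof.
have E : (0 : 'rV[R]_3 -> R) = fun=> 0 by [].
rewrite E; split; [exact: smooth0|by []|move=> p].
have := laplacian_lin (-1) p smooth0 smooth0.
rewrite (_ : (fun v => -1 * 0 + 0) = fun=> 0); last by apply/funext => v; rewrite mulr0 addr0.
by rewrite mulN1r addNr mulr0.
Qed.

(* [inl (m, n)] stands for a wave on the torus, [inr (k, j, n)] for the theta function
   of central frequency [k] and oscillator level [j], [n] ranging over residues
   modulo [2 l |k|]. *)
Definition spec_index : Type := ((int * int) + ((int * nat) * nat))%type.

Definition spec_valid (i : spec_index) : bool :=
  match i with inl _ => true | inr p => (p.1.1 != 0) && (p.2 < 2 * l * `|p.1.1|)%N end.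

Definition freq (k : int) : R := 2 * pi * k%:~R * ka R l.

Definition spec_value (i : spec_index) : R :=
  match i with
  | inl p => 4 * pi ^+ 2 * (p.1%:~R ^+ 2 + p.2%:~R ^+ 2)
  | inr p => freq p.1.1 ^+ 2 + `|freq p.1.1| * (2 * p.1.2%:R + 1)
  end.

Definition spec_fun (i : spec_index) : 'rV[R]_3 -> R :=
  match i with
  | inl p => psi p.1 p.2 (- (pi / 4))
  | inr p => theta_fun l p.1.1 p.2 (hermite `|freq p.1.1| p.1.2) (- (pi / 4))
  end.

Lemma freq_neq0 k : k != 0 -> freq k != 0.
Proof. exact: tau_neq0. Qed.

Lemma spec_pt_ex (q : int * nat) : exists t, q.1 != 0 -> hermite_fun `|freq q.1| q.2 t != 0.
Proof.
have [->|k0] := eqVneq q.1 0; first by exists 0.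
have [|t ht] := @hermite_fun_neq0 R `|freq q.1| _ q.2; first by rewrite normr_gt0 freq_neq0.
by exists t.
Qed.

Definition spec_pt (q : int * nat) : R := projT1 (cid (spec_pt_ex q)).

Lemma spec_ptP k j : k != 0 -> hermite_fun `|freq k| j (spec_pt (k, j)) != 0.
Proof. by rewrite /spec_pt; case: cid => t /=. Qed.

(** For a theta function the functional is the value of a Fourier coefficient at one point, placed
    so that the Hermite function is evaluated at [spec_pt], where it is nonzero. *)
Definition spec_coef (i : spec_index) f : R :=
  match i with
  | inl p => coef p.1 p.2 (- (pi / 4)) (zmean l f)
  | inr p => coef p.2%:Z p.1.1 (- (pi / 4)) (xslice l f (spec_pt p.1 - p.2%:~R / (p.1.1%:~R * ka R l)))
  end.

Definition spec_norm (i : spec_index) : R :=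
  match i with inl _ => 2^-1 | inr p => hermite_fun `|freq p.1.1| p.1.2 (spec_pt p.1) * 2^-1 end.

Lemma spec_coef_lin i lam (a : R) f g : heis_eigenspace l lam f -> heis_eigenspace l lam g ->
  spec_coef i (a *: f + g) = a * spec_coef i f + spec_coef i g.
Proof.
move=> [/smooth_cont cf _ _] [/smooth_cont cg _ _].
case: i => [[m n]|[[k j] n]]/=.
  rewrite -wcoefZ; last exact: zmean_cont.
  have c1 : continuous (fun q => a * zmean l f q) by apply: contZ; exact: zmean_cont.
  rewrite -wcoefD//; last exact: zmean_cont.
  apply: eq_coef => q; rewrite /zmean -integZ; last exact: zmean_slice.
  have c2 : continuous (fun t : R => a * f (pt3 q.1 q.2 (t / ka R l))) by apply: contZ; exact: zmean_slice.
  by rewrite -integD//; exact: zmean_slice.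
rewrite -wcoefZ; last exact: xslice_cont.
have c1 x : continuous (fun q => a * xslice l f x q) by apply: contZ; exact: xslice_cont.
by rewrite -wcoefD//; exact: xslice_cont.
Qed.

Lemma spec_fun_eigen i : spec_valid i -> heis_eigenspace l (spec_value i) (spec_fun i).
Proof.
case: i => [[m n] _|[[k j] n] /andP[/= k0 _]]; split.
- exact: psi_smooth.
- by apply/lattice_act => *; exact: psi_inv.
- by move=> v; exact: psi_eigen.
- exact: theta_fun_smooth.
- by apply/lattice_act => *; exact: theta_fun_inv.
- by move=> v; exact: theta_fun_eigen.
Qed.

Lemma spec_norm_neq0 i : spec_valid i -> spec_norm i != 0.
Proof.
have h2 : 2^-1 != 0 :> R by rewrite invr_eq0 pnatr_eq0.
by case: i => [//|[[k j] n] /andP[/= k0 _]]; exact: mulf_neq0 (spec_ptP j k0) h2.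
Qed.

Lemma spec_value_inj k j j' n n' : k != 0 -> spec_value (inr (k, j, n)) = spec_value (inr (k, j', n')) -> j = j'.
Proof.
move=> k0 /=; have a0 : `|freq k| != 0 by rewrite normr_eq0 freq_neq0.
move=> /addrI/(mulfI a0)/addIr; have n2 : 2 != 0 :> R by rewrite pnatr_eq0.
by move=> /(mulfI n2)/eqP; rewrite eqr_nat => /eqP.
Qed.

(** A coefficient at a fixed frequency does not separate the levels [j], so biorthogonality holds
    only inside one eigenspace: there, for given [k], the eigenvalue determines [j]. *)
Lemma spec_coef_spec_fun i i' : spec_valid i -> spec_valid i' -> spec_value i = spec_value i' ->
  spec_coef i (spec_fun i') = if i == i' then spec_norm i else 0.
Proof.
case: i => [[m n]|[[k j] n]]; case: i' => [[m' n']|[[k' j'] n']] => vi vi'.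
- move=> _; rewrite /= zmean_psi.
  have := @wave_ortho R m' n' m n.
  rewrite /coef => ->; rewrite (eq_sym m') (eq_sym n').
  by rewrite (_ : (inl (m, n) == inl (m', n') :> spec_index) = ((m == m') && (n == n'))).
- move=> _; have /andP[/= k0 _] := vi'.
  rewrite (_ : zmean l _ = fun=> 0); last by apply/funext => u; exact: zmean_theta_fun.
  rewrite (@eq_coef _ m n _ _ (fun q => 0 * 0)); last by move=> q; rewrite mulr0.
  by rewrite wcoefZ ?mul0r//; exact: cont_cst.
- by move=> _; have /andP[/= k0 _] := vi; exact: coef_psi.
- have /andP[/= k0 nk] := vi; have /andP[/= k0' nk'] := vi' => e.
  rewrite coef_theta_fun//; set F := fun q : int => _.
  (* [n] and [n'] are both below [2 l |k|], so only the term [q = 0] can have the frequency [n] in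
     [y]. *)
  rewrite (@rsum1 _ _ _ 0); last first.
    move=> q q0; rewrite /F; case: ifP => [/andP[/eqP h /eqP kk]|]; last by rewrite mulr0.
    subst k'; exfalso; move: h q0 nk nk' k0; clear; nia.
  rewrite /F mul0r addr0.
  case: ifPn => [/andP[/eqP h /eqP kk]|h]; last first.
    rewrite mulr0 ifN//; apply: contraNneq h => -[-> _ ->].
    by rewrite !eqxx.
  subst k'; have nn : n' = n by lia.
  subst n'; have jj := @spec_value_inj k j j' n n k0 e; subst j'; rewrite eqxx /spec_norm /hermite_fun/=.
  by rewrite /wq /nu/= add0r subrK.
Qed.

Lemma spec_coef_sep lam f : heis_eigenspace l lam f ->
  (forall i, spec_valid i -> spec_value i = lam -> spec_coef i f = 0) -> f = 0.
Proof.
move=> [sf hf ef] h; apply/funext => v.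
apply: (@eigen_eq0 R l l0 f lam sf _ ef (fun k j => spec_pt (k, j))).
- by move/lattice_act : hf; exact.
- by move=> k j; exact: spec_ptP.
- by move=> m n e; exact: (h (inl (m, n)) isT (esym e)).
- move=> k j n k0 nk e; apply: (h (inr (k, j, n)) _ (esym e)).
  by rewrite /spec_valid/= k0.
Qed.

Lemma dim_eigenspace lam (s : seq spec_index) : uniq s ->
  (forall i, (i \in s) = spec_valid i && (spec_value i == lam)) ->
  Defs.dim (@heis_eigenspace R l lam) = size s.
Proof.
move=> us hs; apply: has_dim_dimE; apply: (@has_dim_dual _ _ _ s _ spec_fun spec_coef spec_norm) => //.
- exact: heis_eigenspace0.
- exact: heis_eigenspace_lin.
- by move=> i a u v; exact: spec_coef_lin.
- by move=> i; rewrite hs => /andP[vi /eqP <-]; exact: spec_fun_eigen.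
- move=> i j; rewrite !hs => /andP[vi /eqP ei] /andP[vj /eqP ej].
  by apply: spec_coef_spec_fun => //; rewrite ei.
- by move=> i; rewrite hs => /andP[vi _]; exact: spec_norm_neq0.
- move=> f hf h; apply: spec_coef_sep hf _ => i vi e; apply: h.
  by rewrite hs vi e eqxx.
Qed.

Lemma spec_value_eigenvalue i : spec_valid i -> eigenvalues (@heis_eigenspace R l) (spec_value i).
Proof.
move=> vi; exists (spec_fun i); first exact: spec_fun_eigen.
move=> e; have := spec_norm_neq0 vi; have := spec_coef_spec_fun vi vi erefl; rewrite eqxx e => <-.
have z := heis_eigenspace0 (spec_value i).
have := spec_coef_lin i (-1) z z; rewrite scaler0 addr0 mulN1r addNr => ->.
by rewrite eqxx.
Qed.

End Spectrum.

(** * The spectral zeta function and the determinant *)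

Section Assembly.
Variable R : realType.
Local Notation C := R[i].
Local Notation Re := (@complex.Re R).
Local Notation Im := (@complex.Im R).
Local Notation cmod := (@cmod R).
Local Open Scope complex_scope.
Existing Instance totally_filter.

Lemma sum_fset_val (I : choiceType) (V : nmodType) (A : {fset I}) (F : I -> V) :
  \sum_(i : A) F (val i) = \sum_(i <- A) F i.
Proof. by rewrite big_seq_fsetE. Qed.

Lemma has_sumP (I : choiceType) (D : set I) (F : I -> C) :
  csumm (fun i => if i \in D then F i else 0) ->
  has_sum D F (csum (fun i => if i \in D then F i else 0)).
Proof.
set G := fun i => _; move=> hG; rewrite /has_sum; apply/cvgCP => e e0.
have e2 : 0 < e / 2 by rewrite divr_gt0.
have [A hA] := summ_is_sum (csummRe hG) e2; have [B hB] := summ_is_sum (csummIm hG) e2.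
exists (A `|` B)%fset => // K /= hK.
suff : cmod (\sum_(i <- K) G i - csum G) <= e by rewrite -(sum_fset_val K G).
have EA := hA K (fsubset_trans (fsubsetUl _ _) hK).
have EB := hB K (fsubset_trans (fsubsetUr _ _) hK).
have sRe (s : seq I) : Re (\sum_(i <- s) G i) = \sum_(i <- s) Re (G i).
  by elim: s => [|i s IH]; rewrite ?big_nil// !big_cons cReIm IH.
have sIm (s : seq I) : Im (\sum_(i <- s) G i) = \sum_(i <- s) Im (G i).
  by elim: s => [|i s IH]; rewrite ?big_nil// !big_cons cReIm IH.
apply: le_trans (cmod_le_ReIm _) _; rewrite !cReIm sRe sIm [e]splitr.
exact: lerD.
Qed.

Lemma has_sum_unique (I : choiceType) (D : set I) (F : I -> C) S T :
  has_sum D F S -> has_sum D F T -> S = T.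
Proof.
rewrite /has_sum => /cvgCP hS /cvgCP hT; apply/eqP; rewrite -subr_eq0 -cmod_eq0 eq_le cmod_ge0 andbT.
apply/ler_addgt0Pl => e e0; rewrite addr0.
have e2 : 0 < e / 2 by rewrite divr_gt0.
have [A [h1 h2]] := filter_ex (filterI (hS _ e2) (hT _ e2)).
move: h1 h2; set p := (X in cmod (X - S)); move=> h1 h2.
rewrite (_ : S - T = (p - T) - (p - S)); last by ring.
by rewrite [e]splitr; apply: le_trans (cmodB _ _) _; exact: lerD.
Qed.

Lemma summ_iter (I K : choiceType) (F : I * K -> R) (G : I -> R) :
  (forall i (B : {fset K}), \sum_(j <- B) `|F (i, j)| <= G i) -> summ G -> summ F.
Proof.
move=> hG [M hM]; exists M => A.
pose A1 := [fset k.1 | k in A]%fset; pose A2 := [fset k.2 | k in A]%fset.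
pose AB := [fset ((i, j) : I * K) | i in [fset i in A1 | xpredT i],
                      j in [fset j in A2 | xpredT j]]%fset.
have sAB : (A `<=` AB)%fset.
  apply/fsubsetP => -[i j] kC; apply/imfset2P; exists i.
    by rewrite !inE andbT; apply/imfsetP; exists (i, j).
  by exists j => //; rewrite !inE andbT; apply/imfsetP; exists (i, j).
apply: le_trans (ler_sum_fsub (F := fun k => `|F k|) _ sAB) _ => //.
rewrite (eq_bigr (fun p => `|F (p.1, p.2)|)); last by case.
have := pair_big_dep_cond (GRing.add : Monoid.com_law (0 : R)) A1 (fun=> A2) xpredT (fun=> xpredT)
  (fun i j => `|F (i, j)|).
rewrite -/AB => <-/=.
apply: le_trans (hM A1); apply: ler_sum => i _.
by apply: le_trans (hG i A2) _; exact: ler_norm.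
Qed.

Lemma rsum_lt (b : nat) (x : R) :
  summ (fun n : nat => if (n < b)%N then x else 0) /\
  rsum (fun n : nat => if (n < b)%N then x else 0) = b%:R * x.
Proof.
elim: b => [|b [IH1 IH2]].
  rewrite mul0r -[RHS](@rsum0 R nat); split; first by exists 0 => A; rewrite big1// => i _; rewrite normr0.
  by congr rsum; apply/funext => n; rewrite ltn0.
have E : (fun n : nat => if (n < b.+1)%N then x else 0) =
    fun n => (if (n < b)%N then x else 0) + (if n == b then x else 0).
  by apply/funext => n; rewrite ltnS leq_eqVlt; case: ltngtP; rewrite ?addr0 ?add0r.
have s1 : summ (fun n : nat => if n == b then x else 0).
  by apply: (@summ_fin _ _ _ [fset b]%fset) => i; rewrite inE => /negbTE ->.
rewrite E; split; first exact: summD.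
rewrite rsumD// IH2 (@rsum1 _ _ _ b) ?eqxx; first by rewrite -natr1; ring.
by move=> i /negbTE ->.
Qed.

Lemma csum_lt (b : nat) (x : C) :
  csum (fun n : nat => if (n < b)%N then x else 0) = b%:R * x.
Proof.
rewrite -(rmorph_nat (@real_complex R)); apply: complex_eqP; rewrite !cReIm /= mul0r ?subr0 ?addr0.
  rewrite -(rsum_lt b (Re x)).2; congr rsum; apply/funext => n; by case: ifP.
rewrite -(rsum_lt b (Im x)).2; congr rsum; apply/funext => n; by case: ifP.
Qed.

Section Level.
Variable l : nat.
Hypothesis l0 : (0 < l)%N.
Implicit Types s : C.

Definition heis_scale : R := 2 * pi * l%:R.

Lemma heis_scale_ge1 : 1 <= heis_scale.
Proof.
have h1 : 2 <= pi :> R by exact: pi_ge2.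
have h2 : 1 <= l%:R :> R by rewrite ler1n.
rewrite /heis_scale -[1]mulr1; apply: ler_pM => //; lra.
Qed.

Definition pairw (p : nat * nat) : R := 4 * hx heis_scale p.1 * (hx heis_scale p.1 + p.2%:R + 2^-1).
Definition pairt s (p : nat * nat) : C := p.1.+1%:R%:C * cpow (pairw p) (- s).

Lemma hx0 k : 0 < hx heis_scale k.
Proof. by rewrite mulr_gt0//; exact: lt_le_trans heis_scale_ge1. Qed.

Lemma pairw_gt0 p : 0 < pairw p.
Proof.
have h := hx0 p.1; have j0 : 0 <= p.2%:R :> R by [].
by apply: mulr_gt0; [exact: mulr_gt0|lra].
Qed.

Lemma pairt_summ s : 3 / 2 < Re s -> csumm (pairt s).
Proof.
move=> hs; apply: csumm_le (@hW_summ R heis_scale heis_scale_ge1 0%N (Re s) _); last by rewrite addr0; lra.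
case=> k j; have h := hx0 k; have j0 : 0 <= j%:R :> R by [].
have h4 : 0 < 4 * hx heis_scale k by rewrite mulr_gt0.
have h5 : 0 < hx heis_scale k + j%:R + 2^-1 by lra.
rewrite /pairt /pairw (cpowMl _ h4 h5) mulrA cmodM cmod_hw; last exact: heis_scale_ge1.
rewrite cmod_cpow//= /hW/= ler_wpM2l ?mulr_ge0 ?powR_ge0// cReN addr0.
by apply: ler_powR_decr; lra.
Qed.

Lemma freqE (k : int) : `|freq R l k| = 2 * heis_scale * `|k|%N%:R :> R.
Proof.
rewrite /freq /heis_scale /ka !normrM natr_absz intr_norm (ger0_norm (ltW (ltr0n _ 2))).
by rewrite (ger0_norm (pi_ge0 _)) (ger0_norm (ler0n _ l)); ring.
Qed.

Lemma spec_value_inr (k : int) (k' j n : nat) : `|k|%N = k'.+1 -> spec_value R l (inr (k, j, n)) = pairw (k', j).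
Proof.
move=> e; rewrite /spec_value/= -[X in X + _](real_normK (num_real _)) freqE e /pairw /hx/=.
by field.
Qed.

Lemma spec_value_inl p : spec_value R l (inl p) = 4 * pi ^+ 2 * latw R p.
Proof. by []. Qed.

Definition spec_term s (i : spec_index) : C :=
  if spec_valid l i && (spec_value R l i != 0) then cpow (spec_value R l i) (- s) else 0.

Lemma spec_term_inl s p : spec_term s (inl p) = cpow (4 * pi ^+ 2) (- s) * latf s p.
Proof.
have p4 : 0 < 4 * pi ^+ 2 :> R by rewrite mulr_gt0// exprn_gt0// pi_gt0.
rewrite /spec_term spec_value_inl /latf; have [->|p0] := eqVneq p (0, 0).
  by rewrite /latw/= !expr0n addr0 mulr0 eqxx mulr0.
have w0 := latw_gt0 R p0.
have h := mulr_gt0 p4 w0.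
by rewrite /spec_valid/= (gt_eqF h)/=; exact: cpowMl.
Qed.

(** The [2 l |k|] theta functions of frequency [k] and level [j], counted together; [pairw] numbers
    the frequencies from 0, hence the predecessor. *)
Definition kterm s (p : int * nat) : C :=
  if p.1 == 0 then 0 else (2 * l * `|p.1|)%:R * cpow (pairw (`|p.1|.-1, p.2)) (- s).

Lemma spec_term_inr s k j n : spec_term s (inr (k, j, n)) =
  if (k != 0) && (n < 2 * l * `|k|)%N then cpow (pairw (`|k|.-1, j)) (- s) else 0.
Proof.
rewrite /spec_term; have [->|k0] := eqVneq k 0; first by rewrite /spec_valid.
have e : `|k|%N = `|k|.-1.+1 by rewrite prednK// absz_gt0.
by rewrite (spec_value_inr _ _ e) (gt_eqF (pairw_gt0 _)) /spec_valid/= k0 andbT.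
Qed.

Definition kidx (q : (nat * nat) + (nat * nat)) : int * nat :=
  match q with inl p => (Posz p.1.+1, p.2) | inr p => (Negz p.1, p.2) end.

Lemma kidx_inj : injective kidx.
Proof. by case=> -[a b] [] [c d] //= [-> ->]. Qed.

Lemma kidx_surj (p : int * nat) : p.1 != 0 -> exists q, kidx q = p.
Proof.
case: p => -[[|k]|k] j //= _; first by exists (inl (k, j)).
by exists (inr (k, j)).
Qed.

Lemma kterm_kidx s q : kterm s (kidx q) = (2 * l)%:R * pairt s (match q with inl p => p | inr p => p end).
Proof.
by case: q => -[k j]; rewrite /kterm /pairt /= natrM (rmorph_nat (@real_complex R)) mulrA.
Qed.

Lemma kterm_supp s p : kterm s p != 0 -> exists q, kidx q = p.
Proof. by move=> h; apply: kidx_surj; apply: contraNneq h => e; rewrite /kterm e. Qed.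

Lemma kterm_summ s : 3 / 2 < Re s -> csumm (kterm s).
Proof.
move=> hs; apply: (summ_image kidx_inj); last first.
  by move=> p h; apply: (@kterm_supp s); rewrite -cmod_eq0.
have h := summZ (cmod (2 * l)%:R) (pairt_summ hs).
suff hq (u : nat * nat -> (nat * nat) + (nat * nat)) : (forall p, match u p with inl q => q | inr q => q end = p) ->
    summ (fun p => cmod (kterm s (kidx (u p)))) by apply: summ_sumtype; [exact: (hq inl)|exact: (hq inr)].
move=> hu; apply: summ_le h => p; rewrite kterm_kidx hu.
by rewrite cmodM ger0_norm// mulr_ge0// cmod_ge0.
Qed.

(** The frequencies [k] and [- k] have the same eigenvalues, which doubles the factor [2 l]. *)
Lemma kterm_sum s : 3 / 2 < Re s -> csum (kterm s) = (4 * l)%:R * csum (pairt s).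
Proof.
move=> hs; have hk := kterm_summ hs.
have h : csumm (kterm s \o kidx) by exact: (summ_inj kidx_inj hk).
rewrite -(csum_inj kidx_inj hk (@kterm_supp s)) (csum_sumtype h).
have E1 : csum ((kterm s \o kidx) \o inl) = (2 * l)%:R * csum (pairt s).
  by rewrite -csumZ; [apply: eq_csum => p /=; exact: (kterm_kidx s (inl p))|exact: pairt_summ].
have E2 : csum ((kterm s \o kidx) \o inr) = (2 * l)%:R * csum (pairt s).
  by rewrite -csumZ; [apply: eq_csum => p /=; exact: (kterm_kidx s (inr p))|exact: pairt_summ].
apply: etrans (congr2 _ E1 E2) _.
by rewrite -mulrDl -natrD; congr (_%:R * _); lia.
Qed.

Lemma spec_term_summ s : 3 / 2 < Re s -> csumm (spec_term s).
Proof.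
move=> hs; have p4 : 0 < 4 * pi ^+ 2 :> R by rewrite mulr_gt0// exprn_gt0// pi_gt0.
apply: summ_sumtype.
  have h := summZ (cmod (cpow (4 * pi ^+ 2) (- s))) (latf_summ (s := s) _).
  apply: summ_le (h _) => [p|]; last by lra.
  by rewrite /= spec_term_inl cmodM ger0_norm// mulr_ge0// cmod_ge0.
apply: summ_iter (kterm_summ hs) => -[k j] B /=.
rewrite /kterm/=; case: eqVneq => [k0|k0].
  by rewrite cmod0 big1// => n _; rewrite spec_term_inr k0 eqxx cmod0 normr0.
rewrite cmodM cmod_nat -(rsum_lt _ (cmod _)).2.
have sl := (rsum_lt (2 * l * `|k|) (cmod (cpow (pairw (`|k|.-1, j)) (- s)))).1.
apply: le_trans (rsum_ge B _ sl); last by move=> n; case: ifP => // _; exact: cmod_ge0.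
apply: ler_sum => n _; rewrite spec_term_inr k0 ger0_norm ?cmod_ge0//=.
by case: ifP => //; rewrite cmod0.
Qed.

Lemma spec_term_sum s : 3 / 2 < Re s ->
  csum (spec_term s) = cpow (4 * pi ^+ 2) (- s) * csum (latf s) + (4 * l)%:R * csum (pairt s).
Proof.
move=> hs; have h := spec_term_summ hs; rewrite (csum_sumtype h); congr (_ + _).
  rewrite -csumZ; last by apply: latf_summ; lra.
  by apply: eq_csum => p; exact: spec_term_inl.
have h' : csumm (spec_term s \o inr) by apply: (summ_inj _ h) => ? ? [].
rewrite -kterm_sum// (csum_pair h'); apply: eq_csum => -[k j] /=.
rewrite /kterm/=; case: eqVneq => [k0|k0].
  by rewrite -[RHS](@csum0 R nat); apply: eq_csum => n; rewrite spec_term_inr k0.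
by rewrite -csum_lt; apply: eq_csum => n; rewrite spec_term_inr k0.
Qed.

(** Infinitely many equal nonzero terms would contradict the summability at [s]. *)
Lemma fibre_finite s lam : 3 / 2 < Re s -> lam != 0 ->
  finite_set [set i : spec_index | spec_valid l i && (spec_value R l i == lam)].
Proof.
move=> hs lam0; apply: contrapT => hinf; have [M hM] := spec_term_summ hs.
have c0 : 0 < cmod (cpow lam (- s)) by rewrite cmod_gt0 cpow_neq0.
have [B sB hB] := infinite_set_fset (Num.truncn (M / cmod (cpow lam (- s)))).+1 hinf.
have := hM B; apply/negP; rewrite -ltNge.
have -> : \sum_(i <- B) `|cmod (spec_term s i)| = #|` B|%:R * cmod (cpow lam (- s)).
  rewrite big_seq (eq_bigr (fun=> cmod (cpow lam (- s)))); last first.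
    move=> i /sB/= /andP[vi /eqP ei]; rewrite /spec_term vi ei lam0/= ger0_norm//; exact: cmod_ge0.
  by rewrite -big_seq big_const_seq count_predT iter_addr addr0 mulr_natl.
rewrite -ltr_pdivrMr//; apply: lt_le_trans (truncnS_gt _) _.
by rewrite ler_nat.
Qed.

(** The sum over [spec_index] is regrouped along the fibres of [spec_value]; the valid indices in
    the fibre of a nonzero eigenvalue label a basis of the eigenspace, so their number is its
    dimension. *)
Lemma spec_term_has_sum s : 3 / 2 < Re s ->
  has_sum [set lam | eigenvalues (@heis_eigenspace R l) lam /\ lam <> 0]
    (fun lam => (Defs.dim (heis_eigenspace l lam))%:R * cpow lam (- s)) (csum (spec_term s)).
Proof.
move=> hs; have hsum := spec_term_summ hs; set D := [set lam | _ /\ _].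
have E lam : csum (fun i => if spec_value R l i == lam then spec_term s i else 0) =
    if lam \in D then (Defs.dim (heis_eigenspace l lam))%:R * cpow lam (- s) else 0.
  case: ifPn => [/set_mem[ev /eqP lam0]|hD]; last first.
    rewrite -[RHS](@csum0 R spec_index); apply: eq_csum => i; case: eqVneq => // e.
    rewrite /spec_term; case: ifP => // /andP[vi h0]; exfalso; move/negP: hD; apply.
    by apply/mem_set; split; [rewrite -e; exact: spec_value_eigenvalue|rewrite -e; exact/eqP].
  have fin := fibre_finite hs lam0; set S := fset_set [set i : spec_index | spec_valid l i && (spec_value R l i == lam)].
  have memS i : (i \in S) = spec_valid l i && (spec_value R l i == lam).
    rewrite in_fset_set//; apply/idP/idP => [/set_mem//|h]; exact/mem_set.
  rewrite (@dim_eigenspace R l l0 lam S (fset_uniq S) memS) (@csum_fin _ _ _ S); last first.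
    move=> i; rewrite memS; case: (spec_value R l i == lam) => //; rewrite andbT /spec_term => /negbTE ->.
    by [].
  rewrite big_seq (eq_bigr (fun=> cpow lam (- s))); last first.
    move=> i; rewrite memS => /andP[vi /eqP ei]; rewrite ei eqxx /spec_term vi ei lam0//.
  by rewrite -big_seq big_const_seq count_predT iter_addr addr0 mulr_natl.
rewrite (csum_fibres (spec_value R l) hsum) (eq_csum E); apply: has_sumP.
have [M hM] := hsum.
suff : csumm (fun lam => csum (fun i => if spec_value R l i == lam then spec_term s i else 0)).
  by congr csumm; apply/funext => lam; exact: E.
have := summZ 2 (summ_rsum_fibre (spec_value R l) hsum); apply: csumm_le => lam.
apply: csum_norm; last exact: summ_fibre.
by move=> i; rewrite /fibre; case: ifP => //; rewrite cmod0.
Qed.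

End Level.
End Assembly.

(** * The derivative at 0 and the limit of the determinant *)

Section Determinant.
Variable R : realType.
Local Notation C := R[i].
Local Notation Re := (@complex.Re R).
Local Notation Im := (@complex.Im R).
Local Notation cmod := (@cmod R).
Local Open Scope complex_scope.
Implicit Types (s a : C) (l N : nat).

Definition tzeta N s : C := cpow (4 * pi ^+ 2 : R) (- s) * torus N s.
(** The order [2 N + 4] reaches the half-plane [Re s > - N] for both parts, and for [N = 0] it is
    the order 4 at which the derivative of [hzeta] at 0 is estimated. *)
Definition nzeta l N s : C := tzeta (2 * N + 4) s + (4 * l)%:R * hzeta (heis_scale R l) (2 * N + 4) s.

Lemma dv_tpow s : dv (fun s : C => cpow (4 * pi ^+ 2 : R) (- s)) s.
Proof. by apply: dv_ext (dv_cpow (4 * pi ^+ 2) (-1) 0 s) => t; rewrite mulN1r addr0. Qed.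

Lemma nzeta_mero l N a : (0 < l)%N -> 1 < Re a + N%:R + 2 -> 3 < 2 * (Re a + N%:R + 2) ->
  mero (nzeta l N) a.
Proof.
move=> l0 h1 h2; have E : (2 * N + 4)%:R = 2 * N%:R + 4 :> R by rewrite natrD natrM.
apply: meroD.
  apply: meroM; first by apply: (@mero_dv _ _ _ 1) => // z _; exact: dv_tpow.
  apply: mero_torus; rewrite E; clear E h2; lra.
apply: meroZ; apply: hzeta_mero; rewrite ?E; [exact: heis_scale_ge1|by rewrite addn4|clear E h1; lra].
Qed.

Lemma nzeta_sum l N s : (0 < l)%N -> 3 / 2 < Re s -> nzeta l N s = csum (spec_term l s).
Proof.
move=> l0 hs; rewrite spec_term_sum// /nzeta /tzeta torus_sum; last by lra.
by rewrite hzeta_sum//; [exact: heis_scale_ge1|rewrite addn4].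
Qed.

Lemma nzeta_dv l s : (0 < l)%N -> cmod s < 4^-1 -> dv (nzeta l 0) s.
Proof.
move=> l0 hs; have /andP[h1 h2] := Re_near0 hs.
apply: dvD.
  apply: dvM; first exact: dv_tpow.
  apply: dv_torus; lra.
by apply: dvM; [exact: dv_cst|exact: (@dv_hzeta4 R _ (heis_scale_ge1 R l0) s hs)].
Qed.

(** [glue_zeta] supplies a continuation, so the choice in [zeta_det] does not fall on its default;
    whichever continuation is chosen, [zeta_unique] identifies its derivative at 0. *)
Lemma heis_zeta l d : (0 < l)%N -> is_derive (0 : C) (1 : C) (nzeta l 0) d ->
  heis_det R l = cexp (- d).
Proof.
move=> l0 hd.
have q0 : 0 < 4^-1 :> R by rewrite invr_gt0.
have m0 (t : R) : 0 <= t -> mero (nzeta l 0) t%:C.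
  by move=> t0; apply: nzeta_mero => //=; lra.
have h1 N a : - N%:R < Re a -> mero (nzeta l N) a.
  by move=> h; apply: nzeta_mero => //; lra.
have hol : holomorphic_at (nzeta l 0) 0.
  apply/holP; exists 4^-1; first exact: q0.
  by move=> z; rewrite subr0 => hz; apply/dvP; exact: nzeta_dv.
have [Z [Z1 Z2 Z3 _]] := glue_zeta h1 (fun N s => nzeta_sum N l0) m0 hol (fun s => nzeta_sum 0 l0).
have exd : exists d', [set d' | exists2 Z, spectral_zeta (@heis_eigenspace R l) 3 Z & d' = cexp (- derive1 Z 0)] d'.
  exists (cexp (- derive1 Z 0)), Z => //; split=> // s hs.
  by rewrite Z1//; exact: spec_term_has_sum.
have [Z' [W1 W2 W3] e] := xgetPex 1 exd.
rewrite /heis_det /zeta_det e; congr (cexp (- _)).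
have dZ' : is_derive (0 : C) (1 : C) Z' (derive1 Z' 0).
  rewrite derive1E; apply: DeriveDef => //.
  by have /holP[r' r'0 h'] := W3; apply: h'; rewrite subr0 cmod0.
apply: (@zeta_unique R Z' (nzeta l 0)) => //.
- by move=> t _; apply/meroP.
- move=> s hs; rewrite nzeta_sum//.
  exact: has_sum_unique (W1 s hs) (spec_term_has_sum l0 hs).
Qed.

Lemma det_arith (p x K H : R) : 0 < p -> 0 < x ->
  4 * x * (2 * p * x * K - H / (2 * p * x)) = 8 * p * K * (x * x) - 2 * H / p.
Proof. by move=> /lt0r_neq0 p0 /lt0r_neq0 x0; field; rewrite p0 x0. Qed.

(** With [c = 2 pi l], the bound of [hzeta4_deriv] times [4 l] is [8 pi K l^2] minus the constant
    [2 hzeta_cst / pi]; the torus adds [dT], which does not depend on [l], and [l^2] is weakened to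
    [l]. *)
Lemma heis_det_bound : exists A B : R, 0 < A /\
  forall l, (0 < l)%N -> cmod (heis_det R l) <= expR (B - A * l%:R).
Proof.
have [dT hT] : dv (tzeta 4) 0.
  apply: dvM; first exact: dv_tpow.
  by apply: dv_torus; rewrite /=; lra.
have K0 := deta4_m2 R; have pi0 := pi_gt0 R.
pose K := 2 / 7 * Re (deta 4 (-2 : C)).
have Kp : 0 < K by rewrite mulr_gt0// divr_gt0.
exists (8 * pi * K), (2 * hzeta_cst R / pi - Re dT); split; first by rewrite !mulr_gt0.
move=> l l0; have c1 := heis_scale_ge1 R l0.
have [dH hH] := @dv_hzeta4 R _ c1 0 (ltac:(by rewrite cmod0 invr_gt0)).
have hd : is_derive (0 : C) (1 : C) (nzeta l 0) (dT + (4 * l)%:R * dH).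
  exact: cderD hT (cderZ _ hH).
rewrite (heis_zeta l0 hd) cmod_cexp ler_expR.
have b := hzeta4_deriv c1 hH; rewrite -/K in b.
have l1 : 1 <= l%:R :> R by rewrite ler1n.
have lp : 0 < l%:R :> R by rewrite ltr0n.
have hm : 4 * l%:R * (heis_scale R l * K - hzeta_cst R / heis_scale R l) <= 4 * l%:R * Re dH by rewrite ler_wpM2l// mulr_ge0.
have E : 4 * l%:R * (heis_scale R l * K - hzeta_cst R / heis_scale R l) = 8 * pi * K * (l%:R * l%:R) - 2 * hzeta_cst R / pi.
  exact: det_arith.
have hl : 8 * pi * K * l%:R <= 8 * pi * K * (l%:R * l%:R).
  by rewrite ler_pM2l ?mulr_gt0// ler_peMr// ltW.
have ERe : Re (- (dT + (4 * l)%:R * dH)) = - Re dT - 4 * l%:R * Re dH.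
  by rewrite !cReIm !cReIm_nat natrM mul0r subr0 opprD.
rewrite ERe; move: hm; rewrite E; move: hl.
move: (8 * pi * K * l%:R) (8 * pi * K * _) (2 * _ / pi) (4 * _ * Re dH) (Re dT) => x1 x2 x3 x4 x5; clear; lra.
Qed.

End Determinant.

Theorem corollary2p9 (R : realType) :
  @heis_det R l.+1 @[l --> \oo] --> (0 : R[i]).
Proof.
have [A [B [A0 hAB]]] := heis_det_bound R.
apply/cvgCP => e e0.
have AE0 : 0 < A * (e * expR (- B)) by rewrite mulr_gt0// mulr_gt0// expR_gt0.
(* Beyond this index [A (l + 1) >= exp(B) / e], and [exp(A (l + 1))] is at least [A (l + 1)]. *)
exists (Num.truncn (A * (e * expR (- B)))^-1).+1 => // l /= hl.
rewrite subr0; apply: le_trans (hAB l.+1 isT) _.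
rewrite expRD expRN ler_pdivrMr ?expR_gt0// -ler_pdivrMl//.
have h1 : A * l.+1%:R <= expR (A * l.+1%:R) by apply: le_trans (expR_ge1Dx _); rewrite lerDr.
have h2 : (A * (e * expR (- B)))^-1 <= l.+1%:R.
  apply: ltW (lt_le_trans (truncnS_gt _) _); rewrite ler_nat; exact: leqW.
apply: le_trans h1; rewrite -ler_pdivrMl//.
by move: h2; rewrite !invfM expRN invrK.
Qed.
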